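(* Let $\gamma=(\gamma_n)_{n=1}^\infty$ with $0<\gamma_n<1/4$ for all $n$, and let $\epsilon_n=1/4-\gamma_n$. Then $K_1(\gamma)$ is a Parreau-Widom set if and only if $\sum_{k=1}^\infty\sqrt{\epsilon_k}<\infty$.
   Context: For $\gamma=(\gamma_n)_{n=1}^\infty$ with $0<\gamma_n<1/4$, let $f_n(z)=\frac{1}{2\gamma_n}(z^2-1)+1$, $F_0(z)=z$, $F_n=f_n\circ F_{n-1}$ for $n\in\mathbb{N}$, and $K_1(\gamma)=\bigcap_{n=1}^\infty F_n^{-1}([-1,1])$, a compact subset of $[-1,1]$. For a compact non-polar set $K\subset\mathbb{C}$, $G_{\overline{\mathbb{C}}\setminus K}$ denotes the Green function with pole at infinity of the connected component of $\overline{\mathbb{C}}\setminus K$ containing $\infty$. A compact (non-polar) set $K\subset\mathbb{R}$ which is regular with respect to the Dirichlet problem is called a Parreau-Widom set if $PW(K):=\sum_j G_{\overline{\mathbb{C}}\setminus K}(c_j)<\infty$, where $\{c_j\}$ is the (at most countable) set of critical points of $G_{\overline{\mathbb{C}}\setminus K}$. *)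

(* Defs.v *)
From HB Require Import structures.
From mathcomp Require Import all_boot all_order all_algebra.
From mathcomp Require Import all_classical all_reals all_analysis.
From mathcomp.real_closed Require Import complex.

Set Implicit Arguments.
Unset Strict Implicit.
Unset Printing Implicit Defensive.
Import Order.TTheory GRing.Theory Num.Theory.
Import numFieldNormedType.Exports.

Local Open Scope classical_set_scope.
Local Open Scope ring_scope.
Local Open Scope complex_scope.

(** The complex plane is [R * R], which carries the library's topology,
    derivatives and Borel sets; complex arithmetic is done in [R[i]].
    The norm [`|z|] of [R * R] is the sup norm (same topology), so the modulus
    is written [cmod z]. *)
Definition toC (R : realType) (z : R * R) : R[i] := z.1 +i* z.2.
Definition ofC (R : realType) (z : R[i]) : R * R := (complex.Re z, complex.Im z).
Definition cmod (R : realType) (z : R * R) : R := Num.sqrt (z.1 ^+ 2 + z.2 ^+ 2).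

(** The Riemann sphere; [None] is the point at infinity. *)
Notation sphere R := (one_point_compactification (R * R)%type).

(** Its two charts, [z |-> z] and [z |-> 1/z]. *)
Definition chart0 (R : realType) (z : R * R) : sphere R := Some z.
Definition chartoo (R : realType) (z : R * R) : sphere R :=
  if z == 0 then None else Some (ofC (toC z)^-1).

Definition boundary (T : topologicalType) (A : set T) : set T :=
  closure A `\` interior A.

Definition dirx (R : realType) : R * R := (1, 0).
Definition diry (R : realType) : R * R := (0, 1).

(** Smoothness and harmonicity on a set [U], meant for open [U]: the values of
    the functions outside of [U] are then irrelevant. *)
Definition C1_on (R : realType) (U : set (R * R)) (h : R * R -> R) : Prop :=
  forall z, U z ->
    [/\ derivable h z (dirx R), derivable h z (diry R),
        {for z, continuous (fun w => 'D_(dirx R) h w)}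
      & {for z, continuous (fun w => 'D_(diry R) h w)}].

Definition C2_on (R : realType) (U : set (R * R)) (h : R * R -> R) : Prop :=
  [/\ C1_on U h, C1_on U (fun w => 'D_(dirx R) h w)
    & C1_on U (fun w => 'D_(diry R) h w)].

Definition laplacian (R : realType) (h : R * R -> R) (z : R * R) : R :=
  'D_(dirx R) (fun w => 'D_(dirx R) h w) z + 'D_(diry R) (fun w => 'D_(diry R) h w) z.

Definition harmonic_on (R : realType) (U : set (R * R)) (h : R * R -> R) : Prop :=
  C2_on U h /\ forall z, U z -> laplacian h z = 0.

Definition sphere_harmonic_on (R : realType) (D : set (sphere R))
    (h : sphere R -> R) : Prop :=
  harmonic_on (@chart0 R @^-1` D) (h \o @chart0 R) /\
  harmonic_on (@chartoo R @^-1` D) (h \o @chartoo R).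

(** [D] is regular with respect to the Dirichlet problem: the problem is
    solvable for all continuous boundary data. *)
Definition dirichlet_regular (R : realType) (D : set (sphere R)) : Prop :=
  forall phi : sphere R -> R, {within boundary D, continuous phi} ->
    exists2 h : sphere R -> R, sphere_harmonic_on D h &
      forall zeta, boundary D zeta ->
        h x @[x --> within D (nbhs zeta)] --> phi zeta.

(** The energy is [\iint log |z - w|], with values in [-oo, +oo[ for measures of
    compact support since [lne 0 = -oo]. *)
Definition log_energy (R : realType)
    (mu : {finite_measure set (R * R)%type -> \bar R}) : \bar R :=
  (\int[mu]_z \int[mu]_w lne (cmod (z - w))%:E)%E.

Definition polar (R : realType) (E : set (R * R)) : Prop :=
  forall mu : {finite_measure set (R * R)%type -> \bar R},
    mu setT != 0%E ->
    (exists A : set (R * R), [/\ compact A, A `<=` E & mu (~` A) = 0%E]) ->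
    log_energy mu = -oo%E.

(** The component of the complement of [K] in the sphere containing infinity. *)
Definition outer_domain (R : realType) (K : set (R * R)) : set (sphere R) :=
  connected_component (~` (@chart0 R @` K)) None.

(** [g] is the Green function of [outer_domain K] with pole at infinity.  For
    compact non-polar [K] this determines the values of [g] on the finite points
    of the domain; the other values of [g] are unconstrained.  The boundary
    condition is required nearly everywhere, i.e. off a Borel polar set. *)
Definition is_green (R : realType) (K : set (R * R)) (g : R * R -> R) : Prop :=
  let Omega := @chart0 R @^-1` outer_domain K in
  [/\ harmonic_on Omega g,
      forall r : R, exists M : R,
        forall z, Omega z -> cmod z <= r -> `|g z| <= M,
      exists r M : R,
        forall z, Omega z -> r < cmod z -> `|g z - ln (cmod z)| <= M
    & exists N : set (R * R), [/\ measurable N, polar N &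
        forall zeta, boundary (outer_domain K) (chart0 zeta) -> ~ N zeta ->
          g z @[z --> within Omega (nbhs zeta)] --> (0 : R)]].

Definition critical_points (R : realType) (U : set (R * R)) (g : R * R -> R)
    : set (R * R) :=
  [set c | [/\ U c, 'D_(dirx R) g c = 0 & 'D_(diry R) g c = 0]].

Definition PW (R : realType) (K : set (R * R)) (g : R * R -> R) : \bar R :=
  (\esum_(c in critical_points (@chart0 R @^-1` outer_domain K) g) (g c)%:E)%E.

Definition parreau_widom (R : realType) (K : set (R * R)) : Prop :=
  [/\ compact K, K `<=` [set z | z.2 = 0], ~ polar K,
      dirichlet_regular (outer_domain K)
    & exists2 g : R * R -> R, is_green K g & (PW K g < +oo)%E].

(** The sequence [gamma] is indexed from [1]; [gamma 0] is not used. *)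
Definition f_gamma (R : realType) (gamma : nat -> R) (n : nat) (z : R[i]) : R[i] :=
  (1 / (2 * gamma n))%:C * (z ^+ 2 - 1) + 1.

Fixpoint F_gamma (R : realType) (gamma : nat -> R) (n : nat) (z : R[i]) : R[i] :=
  if n is m.+1 then f_gamma gamma m.+1 (F_gamma gamma m z) else z.

Definition K1 (R : realType) (gamma : nat -> R) : set (R * R) :=
  \bigcap_(n in [set n | (1 <= n)%N])
    [set z | exists2 t : R, -1 <= t <= 1 & F_gamma gamma n (toC z) = t%:C].

(* Main.v *)
(** Write [K] for [K_1(gamma)], [K'] for the set of the shifted sequence and
    [K^(n)] for the [n]-fold shift.  The Green function of the complement of [K]
    is the limit of [2^-n ln|F_n|] away from [K]; it exists exactly when the sum
    [S] of the [2^-n ln(1 / (2 gamma_n))] is finite, and it satisfies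
    [G_K = 2^-n G_{K^(n)} o F_n].

    Its critical points are the zeros of the [F_k], [2^k] of them for each [k], and
    the value there is [2^-k G_{K^(k)}(0)].  Hence [PW(K)] is the sum of the
    [G_{K^(k)}(0)], and [G_K(0) = G_{K'}(-1 - 4 epsilon_1 / (2 gamma_1)) / 2] is
    comparable to [sqrt epsilon_1], because [arccosh (1 + x)] behaves like the
    square root of [x]; the upper bound needs the product of the
    [1 / (4 gamma_k)], which converges if the [sqrt epsilon_k] are summable.

    If [S] is finite, the Dirichlet problem is first solved by Perron's method for
    data depending only on finitely many letters of the itinerary of a point under
    the [F_n], with barriers made from the Green function, and then for continuous
    data by uniform approximation.  If [S] is infinite, comparison with
    [2^-n ln|F_n|] shows that a harmonic function on the complement of [K] that is
    locally bounded and has a limit at infinity is constant, so [K] is not regular.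

    A Borel polar set is null for the equilibrium measure, which gives mass [2^-n]
    to every set of points of [K] sharing [n] letters.  Harmonic functions whose
    boundary values are [1] on few such sets and [0] elsewhere are small, and they
    dominate the difference of two Green functions on the exceptional set: this is
    the uniqueness of the Green function. *)

Require Import Defs.
From HB Require Import structures.
From mathcomp Require Import all_boot all_order all_algebra.
From mathcomp Require Import all_classical all_reals all_analysis.
From mathcomp Require Import measurable_realfun.
From mathcomp Require Import ring lra.
From mathcomp.real_closed Require Import complex.

Set Implicit Arguments.
Unset Strict Implicit.
Unset Printing Implicit Defensive.
Import Order.TTheory GRing.Theory Num.Theory.
Import numFieldNormedType.Exports.

Local Open Scope classical_set_scope.
Local Open Scope ring_scope.

(** * Harmonic functions *)

(** The potential theory rests on the maximum principle. Derivative bounds come from comparing a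
    function with its mirror image, the Dirichlet problem in a disc from explicit harmonic
    polynomials, and subharmonicity is tested by touching functions ([vsub]), a notion that survives
    the maxima and the gluing in Perron's method.

    The dynamics is measured by [ell] rather than by the modulus. Since [ell w = 1] exactly on
    [-1, 1], K is the set whose orbits keep [ell = 1]. The two-sided inequality [ell_quad], which
    uses gamma < 1/4, makes [Gn] increase and [2^-n ln ell - cap] decrease, so the Green function is
    enclosed from both sides by explicit sequences, whatever the sequence gamma.

    The inverse branches of f_n do not contract uniformly in the Euclidean distance when gamma_n
    approaches 1/4. In the angle [acos] they all contract by the factor 1/2, which the Chebyshev
    case gamma = 1/4 attains. This makes sets with a common itinerary shrink geometrically, and the
    coding by letters rests on it. *)

Section DirectionalDerivatives.
Context {R : realType} {V : normedModType R}.
Implicit Types (f u : V -> R) (z v : V).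

(** Without the quotient the estimate also holds at [h = 0], so the neighbourhood need not be
    punctured and estimates can be added and pulled back. *)
Lemma is_derive_epsP z v f (l : R) :
  is_derive z v f l <->
  (forall e : R, 0 < e -> \forall h \near (0 : R),
     `|f (h *: v + z) - f z - h * l| <= e * `|h|).
Proof.
have key (h : R) : h != 0 -> forall e : R,
    (`|l - h^-1 *: (f (h *: v + z) - f z)| <= e) =
    (`|f (h *: v + z) - f z - h * l| <= e * `|h|).
  move=> h0 e; rewrite -ler_pdivrMr ?normr_gt0 // -normf_div distrC.
  by rewrite mulrBl [h * l]mulrC mulfK // mulrC.
split.
- move=> [/cvg_ex [l' dl'] dl] e e0.
  have El : l' = l by rewrite -dl; apply/esym; apply: cvg_lim.
  move: dl'; rewrite El => /cvgrPdist_le /(_ _ e0); rewrite near_withinE /=.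
  apply: filterS => h.
  have [->|h0 /(_ isT)] := eqVneq h 0.
    by rewrite scale0r add0r subrr mul0r subr0 normr0 mulr0.
  by rewrite key.
- move=> H.
  suff dl : (fun h => h^-1 *: ((f \o shift z) (h *: v) - f z)) @ 0^' --> l.
    by split; [apply/cvg_ex; exists l | exact: cvg_lim].
  apply/cvgrPdist_le => e e0; rewrite near_withinE /=.
  by have := H _ e0; apply: filterS => h H1 h0; rewrite key.
Qed.

End DirectionalDerivatives.

Section MeanValue.
Context {R : realType} {V : normedModType R}.
Implicit Types (f u : V -> R) (z v : V).

(** Moves a directional derivative to one real variable, where the mean value theorem and the chain
    rule are available. *)
Lemma is_derive_slice z v f (s l : R) :
  is_derive (s *: v + z) v f l <-> is_derive s (1 : R) (fun t : R => f (t *: v + z)) l.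
Proof.
have E (h : R) : h *: v + (s *: v + z) = (h *: (1 : R) + s) *: v + z.
  by rewrite addrA -scalerDl /GRing.scale /= mulr1.
split=> /is_derive_epsP H; apply/is_derive_epsP => e e0; have := H _ e0;
  by apply: filterS => h; rewrite E.
Qed.

Lemma is_derive_bounded_oscillation z v f (l : R) :
  is_derive z v f l -> (fun h : R => f (h *: v + z)) @ (0 : R) --> f z.
Proof.
move=> /is_derive_epsP /(_ 1 ltr01) H.
apply/cvgrPdist_le => e e0.
have d0 : 0 < e / (`|l| + 1) by rewrite divr_gt0 // ltr_wpDl.
have Hd : \forall h \near (0 : R), `|h| < e / (`|l| + 1) by exact: nbhs0_lt.
near=> h.
have H1 : `|f (h *: v + z) - f z - h * l| <= 1 * `|h| by near: h.
have H2 : `|h| < e / (`|l| + 1).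
  by near: h.
rewrite distrC.
have -> : f (h *: v + z) - f z = (f (h *: v + z) - f z - h * l) + h * l.
  by rewrite subrK.
apply: (le_trans (ler_normD _ _)).
apply: (le_trans (lerD H1 (lexx _))).
rewrite normrM mul1r -[X in X + _]mulr1 -mulrDr [1 + _]addrC.
by rewrite -ler_pdivlMr ?ltr_wpDl // ltW.
Unshelve. all: by end_near. Qed.

Lemma mean_value_direction (u u' : V -> R) z v (t : R) :
  (forall s : R, `|s| <= `|t| -> is_derive (s *: v + z) v u (u' (s *: v + z))) ->
  exists2 s : R, `|s| <= `|t| & u (t *: v + z) - u z = t * u' (s *: v + z).
Proof.
move=> H.
have H1 (s : R) : `|s| <= `|t| ->
    is_derive s (1 : R) (fun t : R => u (t *: v + z)) (u' (s *: v + z)).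
  by move=> /H /is_derive_slice.
have cont (a b : R) : (forall s, s \in `[a, b] -> `|s| <= `|t|) ->
    {within `[a, b], continuous (fun t : R => u (t *: v + z))}.
  move=> Hab; apply: derivable_within_continuous => s /Hab /H1 ?.
  exact: ex_derive.
have [t0|t0] := leP 0 t.
- have Hi (s : R) : s \in `[0, t] -> `|s| <= `|t|.
    by rewrite in_itv /= => /andP[s0 st]; rewrite !ger0_norm.
  have [s sin E] := @MVT_segment _ (fun t : R => u (t *: v + z))
     (fun s => u' (s *: v + z)) 0 t t0
     (fun s sin => H1 s (Hi s (subset_itv_oo_cc sin))) (cont _ _ Hi).
  exists s; first exact: Hi.
  by move: E; rewrite scale0r add0r subr0 => ->; rewrite mulrC.
- have Hi (s : R) : s \in `[t, 0] -> `|s| <= `|t|.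
    rewrite in_itv /= => /andP[s0 st]; rewrite (ltr0_norm t0) (ler0_norm st).
    by rewrite lerN2.
  have [s sin E] := @MVT_segment _ (fun t : R => u (t *: v + z))
     (fun s => u' (s *: v + z)) t 0 (ltW t0)
     (fun s sin => H1 s (Hi s (subset_itv_oo_cc sin))) (cont _ _ Hi).
  exists s; first exact: Hi.
  move: E; rewrite scale0r add0r sub0r => E.
  by rewrite -[LHS]opprB E mulrN opprK mulrC.
Qed.

End MeanValue.

(** * Differentiability and the chain rule in the plane *)

Section Plane.
Context {R : realType}.
Implicit Types (u : R * R -> R) (w : R * R) (U : set (R * R)).

Lemma plane_ballP (z : R * R) w (d : R) :
  ball z d w <-> `|z.1 - w.1| < d /\ `|z.2 - w.2| < d.
Proof. by rewrite /ball /= /prod_ball /= /ball /=. Qed.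

Lemma shift_dirx (h : R) (z : R * R) : h *: dirx R + z = (h + z.1, z.2).
Proof.
rewrite /dirx; case: z => x y /=.
have -> : h *: ((1, 0) : R * R) = (h * 1, h * 0) by [].
by rewrite mulr1 mulr0; congr pair; rewrite /= ?add0r.
Qed.

Lemma shift_diry (h : R) (z : R * R) : h *: diry R + z = (z.1, h + z.2).
Proof.
rewrite /diry; case: z => x y /=.
have -> : h *: ((0, 1) : R * R) = (h * 0, h * 1) by [].
by rewrite mulr1 mulr0; congr pair; rewrite /= ?add0r.
Qed.

Lemma cvg_plane {T : Type} (F : set_system T) {FF : Filter F} (f g : T -> R) (a b : R) :
  f x @[x --> F] --> a -> g x @[x --> F] --> b ->
  (f x, g x) @[x --> F] --> ((a, b) : R * R).
Proof. by move=> fa gb A H; exact: (cvg_pair fa gb H). Qed.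

(** The way from [w] to [z] is split into a vertical and a horizontal leg meeting at [(w.1, z.2)].
    The mean value theorem turns each increment into a partial derivative at an intermediate point,
    and continuity at [w] moves that point to [w]. *)
Lemma C1_frechet (u ux uy : R * R -> R) w :
  (\forall z \near w, is_derive z (dirx R) u (ux z) /\ is_derive z (diry R) u (uy z)) ->
  {for w, continuous ux} -> {for w, continuous uy} ->
  forall e : R, 0 < e -> \forall z \near w,
    `|u z - u w - (z.1 - w.1) * ux w - (z.2 - w.2) * uy w|
      <= e * (`|z.1 - w.1| + `|z.2 - w.2|).
Proof.
move=> Hu cx cy e e0.
move/cvgrPdist_le : cx => /(_ _ e0) cx.
move/cvgrPdist_le : cy => /(_ _ e0) cy.
have /nbhs_ballP [d /= d0 Hd] : \forall z \near w,
   [/\ is_derive z (dirx R) u (ux z), is_derive z (diry R) u (uy z),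
       `|ux w - ux z| <= e & `|uy w - uy z| <= e].
  by near=> z; split; [apply: (proj1 (near Hu z _)) | apply: (proj2 (near Hu z _))
    | near: z | near: z].
apply/nbhs_ballP; exists d => // z /plane_ballP [z1 z2].
have [s1 s1l E1] : exists2 s : R, `|s| <= `|z.1 - w.1| &
   u ((z.1 - w.1) *: dirx R + (w.1, z.2)) - u (w.1, z.2)
     = (z.1 - w.1) * ux (s *: dirx R + (w.1, z.2)).
  apply: mean_value_direction => s sl.
  suff /Hd[] : ball w d (s *: dirx R + (w.1, z.2)) by [].
  rewrite shift_dirx; apply/plane_ballP => /=; split => //.
  rewrite opprD addrCA subrr addr0 normrN; apply: le_lt_trans sl _.
  by rewrite distrC.
have [s2 s2l E2] : exists2 s : R, `|s| <= `|z.2 - w.2| &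
   u ((z.2 - w.2) *: diry R + w) - u w = (z.2 - w.2) * uy (s *: diry R + w).
  apply: mean_value_direction => s sl.
  suff /Hd[] : ball w d (s *: diry R + w) by [].
  rewrite shift_diry; apply/plane_ballP => /=; split => //; first by rewrite subrr normr0.
  rewrite opprD addrCA subrr addr0 normrN; apply: le_lt_trans sl _.
  by rewrite distrC.
move: E1 E2; rewrite !shift_dirx !shift_diry /= !subrK => E1 E2.
have -> : u z - u w - (z.1 - w.1) * ux w - (z.2 - w.2) * uy w
  = (z.1 - w.1) * (ux (s1 + w.1, z.2) - ux w) + (z.2 - w.2) * (uy (w.1, s2 + w.2) - uy w).
  rewrite !mulrBr -E1 -E2 -!surjective_pairing; ring.
have [_ _ B1 _] : [/\ is_derive (s1 + w.1, z.2) (dirx R) u (ux (s1 + w.1, z.2)),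
   is_derive (s1 + w.1, z.2) (diry R) u (uy (s1 + w.1, z.2)),
       `|ux w - ux (s1 + w.1, z.2)| <= e & `|uy w - uy (s1 + w.1, z.2)| <= e].
  apply: Hd; apply/plane_ballP => /=; split => //.
  rewrite opprD addrCA subrr addr0 normrN; apply: le_lt_trans s1l _.
  by rewrite distrC.
have [_ _ _ B2] : [/\ is_derive (w.1, s2 + w.2) (dirx R) u (ux (w.1, s2 + w.2)),
   is_derive (w.1, s2 + w.2) (diry R) u (uy (w.1, s2 + w.2)),
       `|ux w - ux (w.1, s2 + w.2)| <= e & `|uy w - uy (w.1, s2 + w.2)| <= e].
  apply: Hd; apply/plane_ballP => /=; split => //; first by rewrite subrr normr0.
  rewrite opprD addrCA subrr addr0 normrN; apply: le_lt_trans s2l _.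
  by rewrite distrC.
apply: (le_trans (ler_normD _ _)); rewrite !normrM mulrDr.
by apply: lerD; rewrite mulrC ler_wpM2r // distrC.
Unshelve. all: by end_near. Qed.

Lemma C1_continuous (u ux uy : R * R -> R) w :
  (\forall z \near w, is_derive z (dirx R) u (ux z) /\ is_derive z (diry R) u (uy z)) ->
  {for w, continuous ux} -> {for w, continuous uy} -> {for w, continuous u}.
Proof.
move=> Hu cx cy; apply/cvgrPdist_le => e e0.
have := C1_frechet Hu cx cy ltr01 => /nbhs_ballP [d /= d0 Hd].
pose M := `|ux w| + `|uy w| + 2.
have M0 : 0 < M by rewrite ltr_wpDl // addr_ge0.
suff : \forall z \near w, `|u w - u z| <= e by [].
apply/nbhs_ballP; exists (Num.min d (e / M)) => /=.
  by rewrite lt_min d0 divr_gt0.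
move=> z /plane_ballP [z1 z2].
have {}Hd : `|u z - u w - (z.1 - w.1) * ux w - (z.2 - w.2) * uy w|
      <= 1 * (`|z.1 - w.1| + `|z.2 - w.2|).
  apply: Hd; apply/plane_ballP.
  by move: z1 z2; rewrite !lt_min => /andP[-> _] /andP[-> _].
have z1' : `|z.1 - w.1| <= e / M by move: z1; rewrite lt_min distrC => /andP[_ /ltW].
have z2' : `|z.2 - w.2| <= e / M by move: z2; rewrite lt_min distrC => /andP[_ /ltW].
rewrite distrC.
have -> : u z - u w = (u z - u w - (z.1 - w.1) * ux w - (z.2 - w.2) * uy w)
  + ((z.1 - w.1) * ux w + (z.2 - w.2) * uy w) by ring.
apply: le_trans (ler_normD _ _) _.
apply: (@le_trans _ _ (1 * (e / M + e / M) + (e / M * `|ux w| + e / M * `|uy w|))).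
  apply: lerD; first by apply: le_trans Hd _; rewrite !mul1r lerD.
  by apply: le_trans (ler_normD _ _) _; rewrite !normrM lerD // ler_wpM2r.
have -> : 1 * (e / M + e / M) + (e / M * `|ux w| + e / M * `|uy w|) = e / M * M.
  by rewrite /M; ring.
by rewrite divfK // gt_eqF.
Qed.

Lemma is_derive_comp2 {V : normedModType R} (u ux uy : R * R -> R) (p q : V -> R)
    (z v : V) (a b : R) : let w0 := (p z, q z) in
  (\forall w \near w0, is_derive w (dirx R) u (ux w) /\ is_derive w (diry R) u (uy w)) ->
  {for w0, continuous ux} -> {for w0, continuous uy} ->
  is_derive z v p a -> is_derive z v q b ->
  is_derive z v (fun y => u (p y, q y)) (ux w0 * a + uy w0 * b).
Proof.
move=> w Hu cx cy dp dq.
apply/is_derive_epsP => e e0.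
(* The errors add up to [e' * (M - 1) * |h|]; the bound [e' <= 1] keeps the increments of [p] and
   [q] below [(1 + |a|) |h|] and [(1 + |b|) |h|]. *)
pose M := `|a| + `|b| + 3 + `|ux w| + `|uy w|.
have M0 : 0 < M.
  by rewrite /M; have := normr_ge0 a; have := normr_ge0 b;
     have := normr_ge0 (ux w); have := normr_ge0 (uy w); lra.
have e1 : 0 < Num.min 1 (e / M) by rewrite lt_min ltr01 divr_gt0.
set e' := Num.min 1 (e / M) in e1.
have e'1 : e' <= 1 by rewrite /e' ge_min lexx.
have e'M : e' <= e / M by rewrite /e' ge_min lexx orbT.
have := C1_frechet Hu cx cy e1 => HF.
have cp := is_derive_bounded_oscillation dp.
have cq := is_derive_bounded_oscillation dq.
have cpq : (fun h : R => (p (h *: v + z), q (h *: v + z))) @ (0 : R) --> w.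
  exact: cvg_plane cp cq.
have {}HF := cpq _ HF.
move/is_derive_epsP: dp => /(_ _ e1) dp.
move/is_derive_epsP: dq => /(_ _ e1) dq.
near=> h.
have Hp : `|p (h *: v + z) - p z - h * a| <= e' * `|h| by near: h.
have Hq : `|q (h *: v + z) - q z - h * b| <= e' * `|h| by near: h.
have : `|u (p (h *: v + z), q (h *: v + z)) - u w
   - (p (h *: v + z) - p z) * ux w - (q (h *: v + z) - q z) * uy w|
      <= e' * (`|p (h *: v + z) - p z| + `|q (h *: v + z) - q z|).
  by near: h.
set P := p (h *: v + z) - p z in Hp *; set Q := q (h *: v + z) - q z in Hq *.
set X := u (p (h *: v + z), q (h *: v + z)) - u w => HX.
have -> : X - h * (ux w * a + uy w * b) = (X - P * ux w - Q * uy w)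
  + ((P - h * a) * ux w + (Q - h * b) * uy w) by ring.
have HP : `|P| <= `|h| * (1 + `|a|).
  have -> : P = (P - h * a) + h * a by rewrite subrK.
  apply: le_trans (ler_normD _ _) _; rewrite normrM mulrDr mulr1 lerD2r.
  by apply: le_trans Hp _; rewrite ler_piMl.
have HQ : `|Q| <= `|h| * (1 + `|b|).
  have -> : Q = (Q - h * b) + h * b by rewrite subrK.
  apply: le_trans (ler_normD _ _) _; rewrite normrM mulrDr mulr1 lerD2r.
  by apply: le_trans Hq _; rewrite ler_piMl.
apply: le_trans (ler_normD _ _) _.
apply: (@le_trans _ _ (e' * (`|h| * (1 + `|a|) + `|h| * (1 + `|b|))
   + (e' * `|h| * `|ux w| + e' * `|h| * `|uy w|))).
  apply: lerD.
    apply: le_trans HX _; apply: ler_wpM2l; first exact: ltW.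
    exact: lerD.
  apply: le_trans (ler_normD _ _) _; rewrite !normrM.
  by apply: lerD; apply: ler_wpM2r.
have -> : e' * (`|h| * (1 + `|a|) + `|h| * (1 + `|b|))
   + (e' * `|h| * `|ux w| + e' * `|h| * `|uy w|) = e' * (M - 1) * `|h|.
  by rewrite /M; ring.
apply: ler_wpM2r => //.
apply: (@le_trans _ _ (e / M * M)); last by rewrite divfK // gt_eqF.
apply: ler_pM => //; first exact: ltW.
  by rewrite /M; have := normr_ge0 a; have := normr_ge0 b;
     have := normr_ge0 (ux w); have := normr_ge0 (uy w); lra.
by rewrite gerBl.
Unshelve. all: by end_near. Qed.

End Plane.

(** * Harmonic functions: closure properties and conformal invariance *)

Section Harmonic.
Context {R : realType}.
Implicit Types (h u : R * R -> R) (z w : R * R) (U : set (R * R)).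

(* [hxy] is the [y]-derivative of [hx] and [hyx] the [x]-derivative of [hy]. *)
Definition C2_data U h (hx hy hxx hxy hyx hyy : R * R -> R) : Prop :=
  forall z, U z ->
    [/\ is_derive z (dirx R) h (hx z), is_derive z (diry R) h (hy z)
      & [/\ is_derive z (dirx R) hx (hxx z), is_derive z (diry R) hx (hxy z),
            is_derive z (dirx R) hy (hyx z) & is_derive z (diry R) hy (hyy z)]] /\
    [/\ {for z, continuous hxx}, {for z, continuous hxy},
        {for z, continuous hyx} & {for z, continuous hyy}].

Lemma open_nearW U (P : R * R -> Prop) z :
  open U -> U z -> (forall w, U w -> P w) -> \forall w \near z, P w.
Proof.
move=> oU Uz H; have : nbhs z U by exact: open_nbhs_nbhs.
by apply: filterS.
Qed.

Lemma near_continuous (f g : R * R -> R) z :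
  (\forall w \near z, f w = g w) -> {for z, continuous f} -> {for z, continuous g}.
Proof.
move=> fg cf; rewrite /prop_for /continuous_at -(nbhs_singleton fg).
by apply: cvg_trans cf; exact: near_eq_cvg.
Qed.

(* An opaque head: proof search on [{for z, continuous f}] unfolds filters. *)
Definition cont_at (f : R * R -> R) z : Prop := {for z, continuous f}.

Lemma cont_atD (f g : R * R -> R) z :
  cont_at f z -> cont_at g z -> cont_at (fun w => f w + g w) z.
Proof. by move=> cf cg; exact: continuousD. Qed.

Lemma cont_atM (f g : R * R -> R) z :
  cont_at f z -> cont_at g z -> cont_at (fun w => f w * g w) z.
Proof. by move=> cf cg; exact: continuousM. Qed.

Lemma is_derive_ex (f : R * R -> R) (z v : R * R) (l : R) :
  is_derive z v f l -> derivable f z v.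
Proof. by case. Qed.

Lemma is_derive_scl (f : R * R -> R) (z v : R * R) (k l : R) :
  is_derive z v f l -> is_derive z v (fun w => k * f w) (k * l).
Proof. by move=> df; exact: is_deriveZ. Qed.

Lemma is_derive_mul (f g : R * R -> R) (z v : R * R) (k l : R) :
  is_derive z v f k -> is_derive z v g l ->
  is_derive z v (fun w => f w * g w) (f z * l + g z * k).
Proof. by move=> df dg; exact: is_deriveM. Qed.

Lemma is_derive_add (f g : R * R -> R) (z v : R * R) (k l : R) :
  is_derive z v f k -> is_derive z v g l ->
  is_derive z v (fun w => f w + g w) (k + l).
Proof. by move=> df dg; exact: is_deriveD. Qed.

Lemma is_derive_val (f : R * R -> R) (z v : R * R) (l : R) :
  is_derive z v f l -> 'D_v f z = l.
Proof. by case. Qed.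

(** Differentiating ['D_v h] again requires knowing it near a point, while computations produce
    formulas valid on [U] only. Openness of [U] turns agreement on [U] into agreement near each of
    its points, which transports derivatives and continuity. *)
Lemma harmonic_onP U h : open U ->
  harmonic_on U h <->
  exists hx hy hxx hxy hyx hyy, C2_data U h hx hy hxx hxy hyx hyy /\
    (forall z, U z -> hxx z + hyy z = 0).
Proof.
move=> oU; split.
- move=> [[C1 C1x C1y] L].
  exists ('D_(dirx R) h), ('D_(diry R) h), ('D_(dirx R) ('D_(dirx R) h)),
   ('D_(diry R) ('D_(dirx R) h)), ('D_(dirx R) ('D_(diry R) h)),
   ('D_(diry R) ('D_(diry R) h)); split => // z Uz.
  have [a1 a2 _ _] := C1 z Uz; have [b1 b2 b3 b4] := C1x z Uz.
  have [c1 c2 c3 c4] := C1y z Uz.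
  split; last exact: (And4 b3 b4 c3 c4).
  split; [exact: (derivableP a1)|exact: (derivableP a2)|].
  split; [exact: (derivableP b1)|exact: (derivableP b2)|
    exact: (derivableP c1)|exact: (derivableP c2)].
- move=> [hx [hy [hxx [hxy [hyx [hyy [D L]]]]]]].
  have Ex z : U z -> 'D_(dirx R) h z = hx z by move=> /D[[[_ ?] _ _] _].
  have Ey z : U z -> 'D_(diry R) h z = hy z by move=> /D[[_ [_ ?] _] _].
  have Nx z : U z -> \near z, hx z = 'D_(dirx R) h z.
    by move=> Uz; apply: open_nearW oU Uz _ => w /Ex.
  have Ny z : U z -> \near z, hy z = 'D_(diry R) h z.
    by move=> Uz; apply: open_nearW oU Uz _ => w /Ey.
  have Dxx z : U z -> is_derive z (dirx R) ('D_(dirx R) h) (hxx z).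
    move=> Uz; apply: near_eq_is_derive (Nx z Uz) _.
    by have [[_ _ []]] := D z Uz.
  have Dxy z : U z -> is_derive z (diry R) ('D_(dirx R) h) (hxy z).
    move=> Uz; apply: near_eq_is_derive (Nx z Uz) _.
    by have [[_ _ []]] := D z Uz.
  have Dyx z : U z -> is_derive z (dirx R) ('D_(diry R) h) (hyx z).
    move=> Uz; apply: near_eq_is_derive (Ny z Uz) _.
    by have [[_ _ []]] := D z Uz.
  have Dyy z : U z -> is_derive z (diry R) ('D_(diry R) h) (hyy z).
    move=> Uz; apply: near_eq_is_derive (Ny z Uz) _.
    by have [[_ _ []]] := D z Uz.
  have nf (f g : R * R -> R) (z : R * R) : U z -> {for z, continuous g} ->
      (forall w, U w -> f w = g w) -> {for z, continuous f}.
    move=> Uz cg fg; apply: near_continuous cg.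
    by apply: open_nearW oU Uz _ => w /fg.
  have cx z : U z -> {for z, continuous hx}.
    move=> Uz; have [_ [? ? ? ?]] := D z Uz; apply: (@C1_continuous _ _ hxx hxy) => //.
    by apply: open_nearW oU Uz _ => w /D[[_ _ []]].
  have cy z : U z -> {for z, continuous hy}.
    move=> Uz; have [_ [? ? ? ?]] := D z Uz; apply: (@C1_continuous _ _ hyx hyy) => //.
    by apply: open_nearW oU Uz _ => w /D[[_ _ []]].
  split; last first.
    by move=> z Uz; rewrite /laplacian (is_derive_val (Dxx z Uz)) (is_derive_val (Dyy z Uz)) L.
  split => z Uz; have [[[a1 _] [a2 _] _] [b1 b2 b3 b4]] := D z Uz; split.
  + exact: a1.
  + exact: a2.
  + exact: nf Uz (cx z Uz) Ex.
  + exact: nf Uz (cy z Uz) Ey.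
  + exact: (is_derive_ex (Dxx z Uz)).
  + exact: (is_derive_ex (Dxy z Uz)).
  + by apply: nf Uz b1 _ => w Uw; exact: (is_derive_val (Dxx w Uw)).
  + by apply: nf Uz b2 _ => w Uw; exact: (is_derive_val (Dxy w Uw)).
  + exact: (is_derive_ex (Dyx z Uz)).
  + exact: (is_derive_ex (Dyy z Uz)).
  + by apply: nf Uz b3 _ => w Uw; exact: (is_derive_val (Dyx w Uw)).
  + by apply: nf Uz b4 _ => w Uw; exact: (is_derive_val (Dyy w Uw)).
Qed.

Lemma C2_data_continuous U h hx hy hxx hxy hyx hyy z : open U -> U z ->
  C2_data U h hx hy hxx hxy hyx hyy ->
  [/\ {for z, continuous h}, {for z, continuous hx} & {for z, continuous hy}].
Proof.
move=> oU Uz D.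
have cx w : U w -> {for w, continuous hx}.
  move=> Uw; have [_ [? ? ? ?]] := D w Uw; apply: (@C1_continuous _ _ hxx hxy) => //.
  by apply: open_nearW oU Uw _ => y /D[[_ _ []]].
have cy w : U w -> {for w, continuous hy}.
  move=> Uw; have [_ [? ? ? ?]] := D w Uw; apply: (@C1_continuous _ _ hyx hyy) => //.
  by apply: open_nearW oU Uw _ => y /D[[_ _ []]].
split; [|exact: cx|exact: cy].
apply: (C1_continuous (ux := hx) (uy := hy)); [|exact: cx|exact: cy].
by apply: open_nearW oU Uz _ => y /D[[]].
Qed.

Lemma harmonic_continuous U h z : open U -> U z -> harmonic_on U h ->
  {for z, continuous h}.
Proof.
move=> oU Uz /(harmonic_onP _ oU) [hx [hy [hxx [hxy [hyx [hyy [D _]]]]]]].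
by have [] := C2_data_continuous oU Uz D.
Qed.

Lemma harmonic_derive U h : open U -> harmonic_on U h ->
  forall z, U z -> [/\ is_derive z (dirx R) h ('D_(dirx R) h z),
    is_derive z (diry R) h ('D_(diry R) h z),
    {for z, continuous ('D_(dirx R) h)} & {for z, continuous ('D_(diry R) h)}].
Proof.
by move=> oU [[C _ _] _] z /C[a b c d]; split => //; exact: derivableP.
Qed.

Lemma harmonic_sub U U' h : U' `<=` U -> harmonic_on U h -> harmonic_on U' h.
Proof.
move=> sU [[a b c] d]; split; last by move=> z /sU /d.
by split => z /sU; [exact: a|exact: b|exact: c].
Qed.

Lemma harmonic_ext U h h' : open U -> (forall z, U z -> h z = h' z) ->
  harmonic_on U h -> harmonic_on U h'.
Proof.
move=> oU E /(harmonic_onP _ oU) [hx [hy [hxx [hxy [hyx [hyy [D L]]]]]]].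
apply/(harmonic_onP _ oU); exists hx, hy, hxx, hxy, hyx, hyy; split => // z Uz.
have [[a b c] d] := D z Uz; split => //.
have nE : \forall w \near z, h w = h' w by apply: open_nearW oU Uz _ => w /E.
by split => //; apply: near_eq_is_derive nE _.
Qed.

Lemma harmonic_local U h : open U ->
  (forall z, U z -> exists2 B, nbhs z B & exists2 h', harmonic_on B^° h' &
     forall w, B^° w -> h w = h' w) ->
  harmonic_on U h.
Proof.
move=> oU H.
have H' z : U z -> exists2 B, open_nbhs z B & harmonic_on B h.
  move=> /H [B Bz [h' hh' E]]; exists B^°.
    by split; [exact: open_interior | exact: nbhs_singleton (nbhs_interior Bz)].
  by apply: harmonic_ext hh'; [exact: open_interior | move=> w /E].
split; last by move=> z /H' [B [_ Bz] [_ L]]; exact: L.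
split => z /H' [B [_ Bz] [[a b c] _]]; [exact: a|exact: b|exact: c].
Qed.

Lemma harmonicD U h u : open U -> harmonic_on U h -> harmonic_on U u ->
  harmonic_on U (fun z => h z + u z).
Proof.
move=> oU /(harmonic_onP _ oU) [hx [hy [hxx [hxy [hyx [hyy [D L]]]]]]].
move=> /(harmonic_onP _ oU) [ux [uy [uxx [uxy [uyx [uyy [E M]]]]]]].
apply/(harmonic_onP _ oU).
exists (fun z => hx z + ux z), (fun z => hy z + uy z), (fun z => hxx z + uxx z),
 (fun z => hxy z + uxy z), (fun z => hyx z + uyx z), (fun z => hyy z + uyy z).
split; last by move=> z Uz; rewrite addrACA L // M // addr0.
move=> z Uz; have [[a b [c d e f]] [i j k l]] := D z Uz.
have [[a' b' [c' d' e' f']] [i' j' k' l']] := E z Uz.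
split; first by split; [exact: is_deriveD..|split; exact: is_deriveD].
by split; exact: continuousD.
Qed.

Lemma harmonicZ U h (k : R) : open U -> harmonic_on U h ->
  harmonic_on U (fun z => k * h z).
Proof.
move=> oU /(harmonic_onP _ oU) [hx [hy [hxx [hxy [hyx [hyy [D L]]]]]]].
apply/(harmonic_onP _ oU).
exists (fun z => k * hx z), (fun z => k * hy z), (fun z => k * hxx z),
 (fun z => k * hxy z), (fun z => k * hyx z), (fun z => k * hyy z).
split; last by move=> z Uz; rewrite -mulrDr L // mulr0.
move=> z Uz; have [[a b [c d e f]] [i j m l]] := D z Uz.
split; first by split; [exact: is_deriveZ..|split; exact: is_deriveZ].
by split; apply: continuousM => //; exact: cvg_cst.
Qed.

Lemma harmonic_cst U (k : R) : open U -> harmonic_on U (fun=> k).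
Proof.
move=> oU; apply/(harmonic_onP _ oU).
exists (cst 0), (cst 0), (cst 0), (cst 0), (cst 0), (cst 0).
split; last by move=> z _; rewrite addr0.
move=> z _; split; first by split; [exact: is_derive_cst..|split; exact: is_derive_cst].
by split; exact: cst_continuous.
Qed.

Lemma harmonicN U h : open U -> harmonic_on U h -> harmonic_on U (fun z => - h z).
Proof.
move=> oU hh; apply: harmonic_ext (harmonicZ (-1) oU hh) => // z _.
by rewrite mulN1r.
Qed.

Lemma harmonicB U h u : open U -> harmonic_on U h -> harmonic_on U u ->
  harmonic_on U (fun z => h z - u z).
Proof. by move=> oU hh hu; exact: (harmonicD oU hh (harmonicN oU hu)). Qed.

(* [p + i q] satisfies the Cauchy-Riemann equations with derivative [a + i b]
   ([s = 1]), or is the conjugate of such a function ([s = -1]). *)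
Definition cauchy_riemann (s : R) U (p q a b : R * R -> R) : Prop :=
  forall z, U z ->
    [/\ is_derive z (dirx R) p (a z), is_derive z (diry R) p (- s * b z),
        is_derive z (dirx R) q (b z) & is_derive z (diry R) q (s * a z)].

Lemma derive_comp_conformal (s : R) U W (p q a b u : R * R -> R) : open W ->
  harmonic_on W u -> cauchy_riemann s U p q a b ->
  forall z, U z -> W (p z, q z) ->
  is_derive z (dirx R) (fun w => u (p w, q w))
    ('D_(dirx R) u (p z, q z) * a z + 'D_(diry R) u (p z, q z) * b z) /\
  is_derive z (diry R) (fun w => u (p w, q w))
    ('D_(dirx R) u (p z, q z) * (- s * b z) + 'D_(diry R) u (p z, q z) * (s * a z)).
Proof.
move=> oW hu CR z Uz Wz; have [c1 c2 c3 c4] := CR z Uz.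
have [_ _ d1 d2] := harmonic_derive oW hu Wz.
have nu : \forall w \near (p z, q z), is_derive w (dirx R) u ('D_(dirx R) u w) /\
   is_derive w (diry R) u ('D_(diry R) u w).
  by apply: (open_nearW oW Wz) => w Ww; have [] := harmonic_derive oW hu Ww.
split.
  exact: (is_derive_comp2 nu d1 d2 c1 c3).
exact: (is_derive_comp2 nu d1 d2 c2 c4).
Qed.

(** [a + i b] is the x-derivative of [p + i q], and [c + i d] that of [a + i b]. The Laplacian of
    the composition is [a^2 + b^2] times the Laplacian of [u] at the image point. *)
Lemma harmonic_comp (s : R) U W (p q a b c d u : R * R -> R) : s ^+ 2 = 1 ->
  open U -> open W -> harmonic_on W u ->
  cauchy_riemann s U p q a b -> cauchy_riemann s U a b c d ->
  (forall z, U z -> {for z, continuous c} /\ {for z, continuous d}) ->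
  (forall z, U z -> W (p z, q z)) ->
  harmonic_on U (fun z => u (p z, q z)).
Proof.
move=> s2 oU oW /(harmonic_onP _ oW) [ux [uy [uxx [uxy [uyx [uyy [D L]]]]]]] CR CR' C UW.
apply/(harmonic_onP _ oU).
(* [T] is an opaque name for composition with [(p, q)], so that the sum and product rules below
   match only the visible structure. *)
have [T ET] : exists T : (R * R -> R) -> R * R -> R, T = (fun f z => f (p z, q z)).
  by eexists.
have -> : (fun z => u (p z, q z)) = T u by rewrite ET.
have TE f z : T f z = f (p z, q z) by rewrite ET.
have cpq z : U z -> {for z, continuous (fun z => (p z, q z))}.
  move=> Uz.
  have ca y : U y -> {for y, continuous a}.
    move=> Uy; apply: (@C1_continuous _ _ c (fun z => - s * d z)).
    - by apply: open_nearW oU Uy _ => w /CR' [].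
    - by have [] := C y Uy.
    - by apply: continuousM; [exact: cvg_cst|have [] := C y Uy].
  have cb y : U y -> {for y, continuous b}.
    move=> Uy; apply: (@C1_continuous _ _ d (fun z => s * c z)).
    - by apply: open_nearW oU Uy _ => w /CR' [].
    - by have [] := C y Uy.
    - by apply: continuousM; [exact: cvg_cst|have [] := C y Uy].
  have cp : {for z, continuous p}.
    apply: (@C1_continuous _ _ a (fun z => - s * b z)).
    - by apply: open_nearW oU Uz _ => w /CR [].
    - exact: ca.
    - by apply: continuousM; [exact: cvg_cst|exact: cb].
  have cq : {for z, continuous q}.
    apply: (@C1_continuous _ _ b (fun z => s * a z)).
    - by apply: open_nearW oU Uz _ => w /CR [].
    - exact: cb.
    - by apply: continuousM; [exact: cvg_cst|exact: ca].
  exact: cvg_plane cp cq.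
have cT f z : U z -> {for (p z, q z), continuous f} -> cont_at (T f) z.
  by move=> Uz cf; rewrite ET; apply: continuous_comp (cpq z Uz) cf.
have [cont_a cont_b] : (forall z, U z -> {for z, continuous a}) /\ (forall z, U z -> {for z, continuous b}).
  split => z Uz.
  - apply: (@C1_continuous _ _ c (fun z => - s * d z)).
    + by apply: open_nearW oU Uz _ => w /CR' [].
    + by have [] := C z Uz.
    + by apply: continuousM; [exact: cvg_cst|have [] := C z Uz].
  - apply: (@C1_continuous _ _ d (fun z => s * c z)).
    + by apply: open_nearW oU Uz _ => w /CR' [].
    + by have [] := C z Uz.
    + by apply: continuousM; [exact: cvg_cst|have [] := C z Uz].
have dT (f fx fy : R * R -> R) (v : R * R) (z : R * R) (l m : R) : U z ->
   (forall w, W w -> is_derive w (dirx R) f (fx w) /\ is_derive w (diry R) f (fy w)) ->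
   {for (p z, q z), continuous fx} -> {for (p z, q z), continuous fy} ->
   is_derive z v p l -> is_derive z v q m ->
   is_derive z v (T f) (T fx z * l + T fy z * m).
  move=> Uz Df c1 c2 d1 d2; rewrite ET.
  apply: (@is_derive_comp2 _ _ f fx fy p q z v l m _ c1 c2 d1 d2).
  exact: open_nearW oW (UW z Uz) Df.
exists (fun z => T ux z * a z + T uy z * b z),
 (fun z => T ux z * (- s * b z) + T uy z * (s * a z)),
 (fun z => (T ux z * c z + a z * (T uxx z * a z + T uxy z * b z)) +
   (T uy z * d z + b z * (T uyx z * a z + T uyy z * b z))),
 (fun z => (T ux z * (- s * d z) + a z * (T uxx z * (- s * b z) + T uxy z * (s * a z))) +
   (T uy z * (s * c z) + b z * (T uyx z * (- s * b z) + T uyy z * (s * a z)))),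
 (fun z => (T ux z * (- s * d z) + (- s * b z) * (T uxx z * a z + T uxy z * b z)) +
   (T uy z * (s * c z) + (s * a z) * (T uyx z * a z + T uyy z * b z))),
 (fun z => (T ux z * (- s * (s * c z)) + (- s * b z) * (T uxx z * (- s * b z) + T uxy z * (s * a z))) +
   (T uy z * (s * (- s * d z)) + (s * a z) * (T uyx z * (- s * b z) + T uyy z * (s * a z)))).
split.
- move=> z Uz; have Wz := UW z Uz.
  have [[a1 b1 [c1 d1 e1 f1]] [i1 j1 k1 l1]] := D _ Wz.
  have [p1 p2 p3 p4] := CR z Uz; have [r1 r2 r3 r4] := CR' z Uz.
  have [cc cd] := C z Uz.
  have [cu cux cuy] := C2_data_continuous oW Wz D.
  have Du w : W w -> is_derive w (dirx R) u (ux w) /\ is_derive w (diry R) u (uy w).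
    by move=> /D[[]].
  have Dux w : W w -> is_derive w (dirx R) ux (uxx w) /\ is_derive w (diry R) ux (uxy w).
    by move=> /D[[_ _ []]].
  have Duy w : W w -> is_derive w (dirx R) uy (uyx w) /\ is_derive w (diry R) uy (uyy w).
    by move=> /D[[_ _ []]].
  split; last first.
    have ca : cont_at a z := cont_a z Uz.
    have cb : cont_at b z := cont_b z Uz.
    have cc' : cont_at c z := cc.
    have cd' : cont_at d z := cd.
    have Txx := cT _ _ Uz i1; have Txy := cT _ _ Uz j1.
    have Tyx := cT _ _ Uz k1; have Tyy := cT _ _ Uz l1.
    have Tx := cT _ _ Uz cux; have Ty := cT _ _ Uz cuy.
    have cs : cont_at (fun _ : R * R => s) z by exact: cvg_cst.
    have cms : cont_at (fun _ : R * R => - s) z by exact: cvg_cst.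
    split; match goal with |- {for _, continuous ?f} => change (cont_at f z) end;
      repeat match goal with
       | |- cont_at (fun x => @?f x + @?g x) _ => apply (@cont_atD f g)
       | |- cont_at (fun x => @?f x * @?g x) _ => apply (@cont_atM f g)
       | H : ?A |- ?A => exact H end.
  split.
  + exact: dT.
  + exact: dT.
  + split.
    * exact: (is_derive_add (is_derive_mul (dT _ _ _ _ _ _ _ Uz Dux i1 j1 p1 p3) r1)
        (is_derive_mul (dT _ _ _ _ _ _ _ Uz Duy k1 l1 p1 p3) r3)).
    * exact: (is_derive_add (is_derive_mul (dT _ _ _ _ _ _ _ Uz Dux i1 j1 p2 p4) r2)
        (is_derive_mul (dT _ _ _ _ _ _ _ Uz Duy k1 l1 p2 p4) r4)).
    * exact: (is_derive_add
        (is_derive_mul (dT _ _ _ _ _ _ _ Uz Dux i1 j1 p1 p3) (is_derive_scl (- s) r3))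
        (is_derive_mul (dT _ _ _ _ _ _ _ Uz Duy k1 l1 p1 p3) (is_derive_scl s r1))).
    * exact: (is_derive_add
        (is_derive_mul (dT _ _ _ _ _ _ _ Uz Dux i1 j1 p2 p4) (is_derive_scl (- s) r4))
        (is_derive_mul (dT _ _ _ _ _ _ _ Uz Duy k1 l1 p2 p4) (is_derive_scl s r2))).
- move=> z Uz; have := L _ (UW z Uz); rewrite -!TE => Lz.
  (* The first-order terms and the mixed derivatives are collected behind the factor [1 - s^2],
     which is zero. *)
  transitivity ((1 - s ^+ 2) * (T ux z * c z + T uy z * d z + a z * b z * (T uxy z + T uyx z))
    + a z ^+ 2 * (T uxx z + s ^+ 2 * T uyy z) + b z ^+ 2 * (T uyy z + s ^+ 2 * T uxx z)).
    by ring.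
  by rewrite s2 subrr mul0r add0r !mul1r [T uyy z + _]addrC Lz !mulr0 addr0.
Qed.

End Harmonic.

(** * Conformal changes of variable *)

Section Conformal.
Context {R : realType}.
Implicit Types (h u f g : R * R -> R) (z w v : R * R) (U W : set (R * R)).

Lemma is_derive_fst z v : is_derive z v (fun w => w.1) v.1.
Proof.
apply/is_derive_epsP => e e0; near=> h.
rewrite /= addrK subrr normr0 mulr_ge0 //; exact: ltW.
Unshelve. all: by end_near. Qed.

Lemma is_derive_snd z v : is_derive z v (fun w => w.2) v.2.
Proof.
apply/is_derive_epsP => e e0; near=> h.
rewrite /= addrK subrr normr0 mulr_ge0 //; exact: ltW.
Unshelve. all: by end_near. Qed.

Lemma is_derive_const z v (k : R) : is_derive z v (fun=> k) 0.
Proof. exact: is_derive_cst. Qed.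

Lemma is_derive_outer (F : R -> R) f z v (m l : R) :
  is_derive (f z) (1 : R) F m -> is_derive z v f l ->
  is_derive z v (fun w => F (f w)) (m * l).
Proof.
move=> dF df.
have E (G : R * R -> R) (k : R) : is_derive z v G k <->
    is_derive (0 : R) (1 : R) (fun t : R => G (t *: v + z)) k.
  by rewrite -is_derive_slice scale0r add0r.
apply/E; move/E: df => df.
have e0 : (fun t : R => f (t *: v + z)) 0 = f z by rewrite scale0r add0r.
by rewrite -e0 in dF; exact: (@is_derive1_comp _ F (fun t : R => f (t *: v + z)) 0 m l).
Qed.

Lemma is_derive_inv f z v (l : R) : f z != 0 -> is_derive z v f l ->
  is_derive z v (fun w => (f w)^-1) (- (f z) ^- 2 * l).
Proof.
move=> fz df.
split; first by apply: derivableV => //; exact: is_derive_ex df.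
by rewrite deriveV ?(is_derive_val df) //; exact: is_derive_ex df.
Qed.

Lemma cont_fst z : cont_at (fun w => w.1) z.
Proof. exact: cvg_fst. Qed.

Lemma cont_snd z : cont_at (fun w => w.2) z.
Proof. exact: cvg_snd. Qed.

Lemma cont_const z (k : R) : cont_at (fun=> k) z.
Proof. exact: cvg_cst. Qed.

Lemma cont_atV f z : f z != 0 -> cont_at f z -> cont_at (fun w => (f w)^-1) z.
Proof. by move=> fz cf; exact: (@cvgV R _ _ _ f (f z)). Qed.

Lemma is_derive_oppr f z v (l : R) : is_derive z v f l ->
  is_derive z v (fun w => - f w) (- l).
Proof. by move=> df; exact: is_deriveN. Qed.

Lemma is_derive_expr f z v (l : R) n : is_derive z v f l ->
  is_derive z v (fun w => f w ^+ n.+1) (n.+1%:R * f z ^+ n * l).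
Proof.
move=> df; elim: n => [|n IH].
  have -> : (fun w => f w ^+ 1) = f by apply/funext => w; rewrite expr1.
  by rewrite expr0 mulr1 mul1r.
have -> : (fun w => f w ^+ n.+2) = (fun w => f w * f w ^+ n.+1).
  by apply/funext => w; rewrite exprS.
apply: is_derive_eq (is_derive_mul df IH) _.
by rewrite -[n.+2]addn1 natrD !exprS; ring.
Qed.

Lemma cont_atN f z : cont_at f z -> cont_at (fun w => - f w) z.
Proof. by move=> cf; exact: continuousN. Qed.

Lemma cont_atX f z n : cont_at f z -> cont_at (fun w => f w ^+ n) z.
Proof.
elim: n => [|n IH] cf; first exact: cont_const.
have -> : (fun w => f w ^+ n.+1) = (fun w => f w * f w ^+ n) by apply/funext => w; rewrite exprS.
by apply: cont_atM => //; exact: IH.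
Qed.

End Conformal.

(** Differentiation by recursion on the syntax of the function: the derivative is built in an
    existential variable, and [deriv] leaves its equality with the expected value to [ring] or
    [field]. An inverse also leaves the goal that its denominator is nonzero. *)
Ltac deriv_step :=
  lazymatch goal with
  | |- is_derive _ _ (fun _ => ?k) _ => exact (is_derive_const _ _ k)
  | |- is_derive _ _ (fun x => fst x) _ => exact (is_derive_fst _ _)
  | |- is_derive _ _ (fun x => snd x) _ => exact (is_derive_snd _ _)
  | |- is_derive _ _ (fun x => (@?f x + @?g x)%R) _ =>
      simple notypeclasses refine (@is_derive_add _ f g _ _ _ _ _ _); deriv_step
  | |- is_derive _ _ (fun x => (- (@?f x))%R) _ =>
      simple notypeclasses refine (@is_derive_oppr _ f _ _ _ _); deriv_step

  | |- is_derive _ _ (fun x => (@?f x * @?g x)%R) _ =>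
      simple notypeclasses refine (@is_derive_mul _ f g _ _ _ _ _ _); deriv_step
  | |- is_derive _ _ (fun x => ((@?f x) ^+ (S ?n))%R) _ =>
      simple notypeclasses refine (@is_derive_expr _ f _ _ _ n _); deriv_step
  | |- is_derive _ _ (fun x => ((@?f x)^-1)%R) _ =>
      simple notypeclasses refine (@is_derive_inv _ f _ _ _ _ _); deriv_step
  | |- is_derive _ _ (fun x => ?h x) _ =>
      match goal with H : is_derive _ _ h _ |- _ => exact H end
  | |- is_derive _ _ ?f ?l =>
      match goal with H : is_derive _ _ f _ |- _ => exact H end
  | |- _ => idtac
  end.
Ltac deriv := simple notypeclasses refine (@is_derive_eq _ _ _ _ _ _ _ _ _ _);
  [| deriv_step | rewrite /dirx /diry /=].
Ltac cont_step :=
  lazymatch goal with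
  | |- {for ?z, continuous ?f} => change (cont_at f z); cont_step
  | |- cont_at (fun _ => ?k) _ => exact (@cont_const _ _ k)
  | |- cont_at (fun x => fst x) _ => exact (@cont_fst _ _)
  | |- cont_at (fun x => snd x) _ => exact (@cont_snd _ _)
  | |- cont_at (fun x => (@?f x + @?g x)%R) _ =>
      refine (@cont_atD _ f g _ _ _); cont_step
  | |- cont_at (fun x => (- (@?f x))%R) _ =>
      refine (@cont_atN _ f _ _); cont_step
  | |- cont_at (fun x => (@?f x * @?g x)%R) _ =>
      refine (@cont_atM _ f g _ _ _); cont_step
  | |- cont_at (fun x => ((@?f x) ^+ ?n)%R) _ =>
      refine (@cont_atX _ f _ n _); cont_step
  | |- cont_at (fun x => ((@?f x)^-1)%R) _ =>
      refine (@cont_atV _ f _ _ _); [| cont_step]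
  | |- cont_at (fun x => ?h x) ?z =>
      match goal with H : cont_at h z |- _ => exact H end
  | |- cont_at ?f _ => match goal with H : ?A |- ?A => exact H end
  end.

Section ConformalMaps.
Context {R : realType}.
Implicit Types (h u f g : R * R -> R) (z w v : R * R) (U W : set (R * R)).

(** In complex notation the map is [z -> (a + i b) z + (e + i f)] for [s = 1], and the same with the
    conjugate of [z] for [s = -1]. Translations, rotations, dilations and reflections are all
    obtained from it. *)
Lemma harmonic_affine (s a b e f : R) U W u : s ^+ 2 = 1 ->
  open U -> open W -> harmonic_on W u ->
  (forall z, U z -> W (a * z.1 - s * b * z.2 + e, b * z.1 + s * a * z.2 + f)) ->
  harmonic_on U (fun z => u (a * z.1 - s * b * z.2 + e, b * z.1 + s * a * z.2 + f)).
Proof.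
move=> s2 oU oW hu UW.
apply: (@harmonic_comp R s U W (fun z => a * z.1 - s * b * z.2 + e)
  (fun z => b * z.1 + s * a * z.2 + f) (fun=> a) (fun=> b) (fun=> 0) (fun=> 0) _ s2 oU oW hu _ _ _ UW).
- move=> z _; split; deriv; ring.
- move=> z _; split; deriv; ring.
- by move=> z _; split; exact: cvg_cst.
Qed.

Lemma harmonic_quadratic (c : R) U W u : open U -> open W -> harmonic_on W u ->
  (forall z, U z -> W (c * (z.1 ^+ 2 - z.2 ^+ 2 - 1) + 1, c * (2 * z.1 * z.2))) ->
  harmonic_on U (fun z => u (c * (z.1 ^+ 2 - z.2 ^+ 2 - 1) + 1, c * (2 * z.1 * z.2))).
Proof.
move=> oU oW hu UW.
apply: (@harmonic_comp R 1 U W (fun z => c * (z.1 ^+ 2 - z.2 ^+ 2 - 1) + 1)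
  (fun z => c * (2 * z.1 * z.2)) (fun z => c * 2 * z.1) (fun z => c * 2 * z.2)
   (fun=> c * 2) (fun=> 0) _ _ oU oW hu _ _ _ UW).
- by rewrite expr1n.
- move=> z _; split; deriv; ring.
- move=> z _; split; deriv; ring.
- by move=> z _; split; exact: cvg_cst.
Qed.

Definition nrm2 z : R := z.1 ^+ 2 + z.2 ^+ 2.

Lemma nrm2_ge0 z : 0 <= nrm2 z.
Proof. by rewrite addr_ge0 // sqr_ge0. Qed.

Lemma nrm2_eq0 z : (nrm2 z == 0) = (z == 0).
Proof.
by rewrite /nrm2 paddr_eq0 ?sqr_ge0 // !sqrf_eq0; case: z => x y.
Qed.

Lemma nrm2_gt0 z : (0 < nrm2 z) = (z != 0).
Proof. by rewrite lt_def nrm2_ge0 andbT nrm2_eq0. Qed.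

(** The map is [z -> 1 / z]; the four functions given to [harmonic_comp] are the real and imaginary
    parts of its derivatives [- z^-2] and [2 z^-3]. *)
Lemma harmonic_inversion U W u : open U -> open W -> harmonic_on W u ->
  ~ U 0 -> (forall z, U z -> W (z.1 * (nrm2 z)^-1, - z.2 * (nrm2 z)^-1)) ->
  harmonic_on U (fun z => u (z.1 * (nrm2 z)^-1, - z.2 * (nrm2 z)^-1)).
Proof.
move=> oU oW hu U0 UW.
have N0 z : U z -> nrm2 z != 0.
  by move=> Uz; rewrite nrm2_eq0; apply: contra_notN U0 => /eqP <-.
apply: (@harmonic_comp R 1 U W (fun z => z.1 * (nrm2 z)^-1) (fun z => - z.2 * (nrm2 z)^-1)
 (fun z => - (z.1 ^+ 2 - z.2 ^+ 2) * ((nrm2 z)^-1) ^+ 2) (fun z => 2 * z.1 * z.2 * ((nrm2 z)^-1) ^+ 2)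
 (fun z => 2 * (z.1 ^+ 3 - 3 * z.1 * z.2 ^+ 2) * ((nrm2 z)^-1) ^+ 3)
 (fun z => - 2 * (3 * z.1 ^+ 2 * z.2 - z.2 ^+ 3) * ((nrm2 z)^-1) ^+ 3) _ _ oU oW hu _ _ _ UW).
- by rewrite expr1n.
- move=> z Uz; have := N0 _ Uz; rewrite /nrm2 => Nz; split; deriv => //; field => //.
- move=> z Uz; have := N0 _ Uz; rewrite /nrm2 => Nz; split; deriv => //; field => //.
- move=> z Uz; have := N0 _ Uz; rewrite /nrm2 => Nz; split; cont_step; exact: Nz.
Qed.

Lemma is_derive_ln_nrm2 z v : z != 0 ->
  is_derive z v (fun w => 2^-1 * ln (nrm2 w)) ((nrm2 z)^-1 * (z.1 * v.1 + z.2 * v.2)).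
Proof.
move=> z0; have N0 : 0 < nrm2 z by rewrite nrm2_gt0.
have dN : is_derive z v nrm2 (2 * (z.1 * v.1 + z.2 * v.2)).
  rewrite /nrm2; deriv; ring.
apply: is_derive_eq.
  apply: is_derive_scl; apply: is_derive_outer dN; exact: is_derive1_ln.
by rewrite mulrCA [2^-1 * _]mulrA mulVf // mul1r.
Qed.

Lemma harmonic_ln_nrm2 U : open U -> ~ U 0 -> harmonic_on U (fun w => 2^-1 * ln (nrm2 w)).
Proof.
move=> oU U0; apply/(harmonic_onP _ oU).
have N0 z : U z -> nrm2 z != 0.
  by move=> Uz; rewrite nrm2_eq0; apply: contra_notN U0 => /eqP <-.
exists (fun z => (nrm2 z)^-1 * z.1), (fun z => (nrm2 z)^-1 * z.2),
 (fun z => (nrm2 z)^-1 - 2 * z.1 ^+ 2 * (nrm2 z)^-1 ^+ 2),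
 (fun z => - 2 * z.1 * z.2 * (nrm2 z)^-1 ^+ 2),
 (fun z => - 2 * z.1 * z.2 * (nrm2 z)^-1 ^+ 2),
 (fun z => (nrm2 z)^-1 - 2 * z.2 ^+ 2 * (nrm2 z)^-1 ^+ 2); split; last first.
  by move=> z /N0; rewrite /nrm2 => Nz; field.
move=> z Uz; have Nz := N0 _ Uz.
have z0 : z != 0 by rewrite -nrm2_eq0.
split; [split; [| |split]|split].
- by have := is_derive_ln_nrm2 (dirx R) z0; rewrite /dirx /= mulr1 mulr0 addr0.
- by have := is_derive_ln_nrm2 (diry R) z0; rewrite /diry /= mulr1 mulr0 add0r.
- rewrite /nrm2 in Nz *; deriv => //; field => //.
- rewrite /nrm2 in Nz *; deriv => //; field => //.
- rewrite /nrm2 in Nz *; deriv => //; field => //.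
- rewrite /nrm2 in Nz *; deriv => //; field => //.
- rewrite /nrm2 in Nz *; cont_step; exact: Nz.
- rewrite /nrm2 in Nz *; cont_step; exact: Nz.
- rewrite /nrm2 in Nz *; cont_step; exact: Nz.
- rewrite /nrm2 in Nz *; cont_step; exact: Nz.
Qed.

End ConformalMaps.

(** * Maximum principle and gradient estimate *)

Section MaximumPrinciple.
Context {R : realType}.
Implicit Types (h u : R * R -> R) (z w : R * R) (U B : set (R * R)).

Lemma is_derive_opp_direction (f : R * R -> R) z (v : R * R) (l : R) :
  is_derive z v f l -> is_derive z (- v) f (- l).
Proof.
move=> /is_derive_epsP H; apply/is_derive_epsP => e e0.
have /nbhs_ballP [d /= d0 Hd] := H _ e0.
apply/nbhs_ballP; exists d => // h.
rewrite -ball_normE /= sub0r normrN => hd.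
have /Hd : ball (0 : R) d (- h) by rewrite -ball_normE /= sub0r opprK.
have -> : h *: - v = - h *: v by rewrite scalerN scaleNr.
by have -> : h * - l = - h * l by [rewrite mulrN mulNr]; rewrite normrN.
Qed.

(** Symmetrisation: [f (z + s v) + f (z - s v)] has derivative [f' (z + s v) - f' (z - s v)], about
    [2 l s]. If [l > 0], this sum increases for small [s > 0], against the maximum at [z]. *)
Lemma local_max_second_derivative (f f' : R * R -> R) z (v : R * R) (l : R) :
  (\forall w \near z, is_derive w v f (f' w)) -> is_derive z v f' l ->
  (\forall w \near z, f w <= f z) -> l <= 0.
Proof.
move=> Df Df' Hmax; rewrite leNgt; apply/negP => l0.
have cvl : (fun h : R => h *: v + z) @ (0 : R) --> z.

  rewrite -[X in _ --> X](add0r z) -(scale0r v).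
  by apply: cvgD; [apply: cvgZl; exact: cvg_id | exact: cvg_cst].
have l2 : 0 < l / 2 by rewrite divr_gt0.
move/is_derive_epsP : Df' => /(_ _ l2) /nbhs_ballP [d1 /= d10 H1].
have /nbhs_ballP [d2 /= d20 H2] := cvl _ Df.
have /nbhs_ballP [d3 /= d30 H3] := cvl _ Hmax.
pose t := Num.min d1 (Num.min d2 d3) / 2.
have t0 : 0 < t by rewrite divr_gt0 // !lt_min d10 d20.
have tl : t < Num.min d1 (Num.min d2 d3).
  by rewrite ltr_pdivrMr // ltr_pMr ?ltr1n // !lt_min d10 d20.
have tin (s : R) : `|s| <= t -> [/\ ball (0 : R) d1 s, ball (0 : R) d2 s & ball (0 : R) d3 s].
  move=> st; rewrite /ball /= sub0r normrN.
  have := le_lt_trans st tl; rewrite !lt_min => /and3P[? ? ?]; split => //.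
pose g (s : R) := f (s *: v + z) + f (s *: - v + z).
pose dg (s : R) := f' (s *: v + z) - f' ((- s) *: v + z).
have Dg (s : R) : `|s| <= t -> is_derive s (1 : R) g (dg s).
  move=> st; rewrite /g /dg.
  have [_ b2 _] := tin s st.
  have [_ b2' _] := tin (- s) (eq_ind_r (fun x => x <= t) st (normrN s)).
  apply: is_deriveD.
    exact: (proj1 (is_derive_slice z v f s _) (H2 _ b2)).
  apply: (proj1 (is_derive_slice z (- v) f s _)).
  apply: is_derive_opp_direction.
  by rewrite scalerN -scaleNr; exact: (H2 _ b2').
have [c cin E] := @MVT _ g dg 0 t t0
  (fun s sin => Dg s (ltac:(by move: sin; rewrite in_itv /= => /andP[s0 st]; rewrite gtr0_norm // ltW)))
  (ltac:(apply: derivable_within_continuous => s; rewrite in_itv /= => /andP[s0 st];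
         apply: ex_derive; apply: Dg; by rewrite ger0_norm)).
move: cin; rewrite in_itv /= => /andP[c0 ct].
have [a1 _ _] := tin c (ltac:(by rewrite gtr0_norm // ltW)).
have [a1' _ _] := tin (- c) (ltac:(by rewrite normrN gtr0_norm // ltW)).
have [_ _ a3] := tin t (ltac:(by rewrite gtr0_norm)).
have [_ _ a3'] := tin (- t) (ltac:(by rewrite normrN gtr0_norm)).
have := H1 _ a1; have := H1 _ a1'; rewrite /= normrN (gtr0_norm c0) !ler_norml => /andP[p1 p2] /andP[p3 p4].
have := H3 _ a3; have := H3 _ a3'; rewrite /= => p5 p6.
have dgc : 0 < dg c.
  rewrite /dg.
  have lc0 : 0 < l * c by rewrite mulr_gt0.
  have E1 : l / 2 * c = (l * c) / 2 by rewrite mulrAC.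
  move: p2 p3; rewrite E1; nra.
have : 0 < g t - g 0 by rewrite E mulr_gt0 // subr0.
have -> : g 0 = f z + f z by rewrite /g !scale0r add0r.
rewrite /g scalerN -scaleNr; lra.
Qed.

(* Viscosity-type subharmonicity, tested against [h - eta |z|^2] with [h] harmonic. *)
Definition vsub U (v : R * R -> R) : Prop :=
  forall z0 B h (eta : R), U z0 -> open B -> B z0 -> harmonic_on B h -> 0 < eta ->
  ~ (\forall z \near z0, v z - h z + eta * nrm2 z <= v z0 - h z0 + eta * nrm2 z0).

(** At a local maximum both pure second derivatives are nonpositive, yet here they sum to
    [4 eta]. *)
Lemma harmonic_no_local_max B h z0 (eta : R) : open B -> B z0 -> harmonic_on B h ->
  0 < eta -> ~ (\forall z \near z0, h z + eta * nrm2 z <= h z0 + eta * nrm2 z0).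
Proof.
move=> oB Bz0 /(harmonic_onP _ oB) [hx [hy [hxx [hxy [hyx [hyy [D L]]]]]]] eta0 Hm.
have [[_ _ [d1 _ _ d2]] _] := D _ Bz0.
have A1 : hxx z0 + 2 * eta <= 0.
  apply: (@local_max_second_derivative (fun z => h z + eta * nrm2 z)
    (fun z => hx z + 2 * eta * z.1) z0 (dirx R)) => //.
    apply: open_nearW oB Bz0 _ => w /D[[a _ _] _]; rewrite /nrm2; deriv; ring.
  deriv; ring.
have A2 : hyy z0 + 2 * eta <= 0.
  apply: (@local_max_second_derivative (fun z => h z + eta * nrm2 z)
    (fun z => hy z + 2 * eta * z.2) z0 (diry R)) => //.
    apply: open_nearW oB Bz0 _ => w /D[[_ a _] _]; rewrite /nrm2; deriv; ring.
  deriv; ring.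
by have := L _ Bz0; lra.
Qed.

Lemma harmonic_vsub U h : open U -> harmonic_on U h -> vsub U h.
Proof.
move=> oU hh z0 B h' eta Uz0 oB Bz0 hh' eta0.
have oI : open (U `&` B) by exact: openI.
apply: (@harmonic_no_local_max (U `&` B) (fun z => h z - h' z) z0 eta oI) => //.
apply: (harmonicB oI); [exact: harmonic_sub hh|exact: harmonic_sub hh'].
Qed.

(** The test functions of [vsub] contain all local harmonic functions, so [h] is absorbed into the
    test. *)
Lemma vsubB U v h : open U -> vsub U v -> harmonic_on U h -> vsub U (fun z => v z - h z).
Proof.
move=> oU vv hh z0 B h' eta Uz0 oB Bz0 hh' eta0 Hm.
have oI : open (U `&` B) by exact: openI.
apply: (vv z0 (U `&` B) (fun z => h z + h' z) eta) => //.
  by apply: (harmonicD oI); [exact: harmonic_sub hh|exact: harmonic_sub hh'].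
by apply: filterS Hm => z; rewrite !opprD !addrA.
Qed.

Lemma vsub_subset U U' v : U' `<=` U -> vsub U v -> vsub U' v.
Proof. by move=> UU' vv z0 B h eta /UU'; exact: vv. Qed.

Lemma compact_square (a : R) : compact [set z : R * R | `|z.1| <= a /\ `|z.2| <= a].
Proof.
have := compact_setX (@segment_compact R (- a) a) (@segment_compact R (- a) a).
by congr compact; apply/seteqP; split => z /=; rewrite !in_itv /= !ler_norml.
Qed.

Lemma nrm2_bounds z (r : R) : nrm2 z <= r -> `|z.1| <= r + 1 /\ `|z.2| <= r + 1.
Proof.
rewrite /nrm2 => Hz; have := sqr_ge0 z.1; have := sqr_ge0 z.2 => h1 h2.
by rewrite !ler_norml; split; apply/andP; split; nra.
Qed.

Lemma nrm2_cont z : cont_at nrm2 z.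
Proof. rewrite /nrm2; cont_step. Qed.

(** If [u z0 > M], the points where [u] exceeds [M] by half of the excess form a compact subset [A]
    of [U]. A maximum of [u + eta |z|^2] on [A] lies where [u > M + d / 2], hence is a local maximum
    in the plane, which [vsub] tested with [h = 0] forbids. *)
Theorem max_principle U u (M : R) : open U ->
  (forall z, U z -> {for z, continuous u}) -> vsub U u ->
  (forall e : R, 0 < e -> forall zeta, ~ U zeta ->
     \forall z \near zeta, U z -> u z <= M + e) ->
  (forall e : R, 0 < e -> exists r : R, forall z, U z -> r < nrm2 z -> u z <= M + e) ->
  forall z, U z -> u z <= M.
Proof.
move=> oU cu vu Hb Hoo z0 Uz0; rewrite leNgt; apply/negP => Mu.
pose d := u z0 - M; have d0 : 0 < d by rewrite subr_gt0.
have d4 : 0 < d / 4 by rewrite divr_gt0.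
have [r Hr] := Hoo _ d4.
pose A := [set z | [/\ U z, nrm2 z <= r & M + d / 2 <= u z]].
have Az0 : A z0.
  split => //; last by rewrite /d; lra.
  by rewrite leNgt; apply/negP => /(Hr _ Uz0); rewrite /d; lra.
have r0 : 0 <= r by apply: le_trans (nrm2_ge0 z0) _; case: Az0.
have clA : closed A.
  move=> z clz.
  have Uz : U z.
    apply: contrapT => nUz.
    have /clz [w [[Uw _ w2] w3]] := Hb _ d4 _ nUz.
    by have := w3 Uw; lra.
  split => //.
  - rewrite leNgt; apply/negP => rz.
    have : nbhs z [set w | r < nrm2 w].
      by apply: (@nrm2_cont z [set x | r < x]); exact: lt_nbhsr.
    by move=> /clz [w [[_ w1 _] /= w2]]; move: w1; rewrite leNgt w2.
  - rewrite leNgt; apply/negP => rz.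
    have : nbhs z [set w | u w < M + d / 2].
      by apply: (cu z Uz [set x | x < M + d / 2]); exact: lt_nbhsl.
    by move=> /clz [w [[_ _ w1] /= w2]]; move: w1; rewrite leNgt w2.
have cA : compact A.
  refine (@subclosed_compact (R * R)%type A _ clA (@compact_square (r + 1)) _).
  by move=> z [_ /nrm2_bounds ? _].
(* On [A] the perturbation is at most [d / 4], too little to push the maximum down to the level
   [M + d / 2]. *)
pose eta := d / (4 * (r + 1)).
have eta0 : 0 < eta by rewrite divr_gt0 // mulr_gt0 // ltr_wpDl.
have etar : eta * r <= d / 4.
  rewrite /eta mulrAC ler_pdivrMr; last by rewrite mulr_gt0 // ltr_wpDl.
  by nra.
have [z1 /set_mem Az1 Hz1] : exists2 c, c \in A & forall t, t \in A ->
    u t + eta * nrm2 t <= u c + eta * nrm2 c.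
  apply: compact_EVT_max => //; first by exists z0.
  apply: continuous_in_subspaceT => z /set_mem [Uz _ _].
  apply: cont_atD; first exact: cu.
  by apply: cont_atM; [exact: cont_const|exact: nrm2_cont].
have [Uz1 z1r z1M] := Az1.
have u1 : M + d / 2 < u z1.
  have := Hz1 z0 (mem_set Az0); have := nrm2_ge0 z0; have := nrm2_ge0 z1 => h1 h2.
  have : eta * nrm2 z1 <= eta * r by rewrite ler_pM2l.
  have : 0 <= eta * nrm2 z0 by rewrite mulr_ge0 // ltW.
  rewrite /d in etar d4 *; lra.
apply: (vu z1 setT (fun=> 0) eta Uz1 openT I _ eta0); first exact: harmonic_cst openT.
have n1 : \forall z \near z1, U z by apply: open_nbhs_nbhs.
have n2 : \forall z \near z1, M + d / 2 < u z.
  by apply: (cu z1 Uz1 [set x | M + d / 2 < x]); exact: lt_nbhsr.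
apply: filterS2 n1 n2 => z Uz uz; rewrite !subr0.
apply: Hz1; apply/mem_set; split => //; last exact: ltW.
by rewrite leNgt; apply/negP => /(Hr _ Uz); lra.
Qed.

Lemma max_principle_bounded U (C : set (R * R)) u (M : R) : open U -> closed C -> U `<=` C ->
  (exists r : R, forall z, U z -> nrm2 z <= r) ->
  (forall z, C z -> {for z, continuous u}) -> vsub U u ->
  (forall z, C z -> ~ U z -> u z <= M) ->
  forall z, U z -> u z <= M.
Proof.
move=> oU cC UC [r Hr] cu vu Hb; apply: max_principle => //.
- by move=> z /UC /cu.
- move=> e e0 z nUz; have [Cz|nCz] := pselect (C z).
    have : nbhs z [set w | u w < M + e].
      apply: (cu z Cz [set x | x < M + e]); apply: lt_nbhsl.
      by apply: le_lt_trans (Hb z Cz nUz) _; rewrite ltrDl.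
    by apply: filterS => w /= /ltW.
  have : nbhs z (~` C) by apply: open_nbhs_nbhs; split => //; exact: closed_openC.
  by apply: filterS => w nCw /UC.
- by move=> e e0; exists r => z /Hr; rewrite leNgt => /negP.
Qed.

End MaximumPrinciple.

(** * Gradient estimate by reflection *)

Section GradientEstimate.
Context {R : realType}.
Implicit Types (h u : R * R -> R) (z w : R * R) (U B : set (R * R)).

Lemma closed_le_cont (f : R * R -> R) (a : R) :
  (forall z, cont_at f z) -> closed [set z | f z <= a].
Proof.
move=> cf; have := (continuous_closedP f).1 cf [set x | x <= a].
by apply; exact: closed_le.
Qed.

Lemma open_lt_cont (f : R * R -> R) (a : R) :
  (forall z, cont_at f z) -> open [set z | f z < a].
Proof.
move=> cf; have := (continuousP f).1 cf [set x | x < a].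
by apply; exact: open_lt.
Qed.

Lemma open_ball_plane z (d : R) : open (ball z d).
Proof. exact: ball_open. Qed.

(** The difference of [u] and its mirror image in the vertical line through [z0] vanishes on that
    line and is at most [2 M]. On the right half [Q] of the square it is compared with the harmonic
    quadratic [psi], which is nonnegative on the line and at least [2 M] on the other three sides.
    At distance [t] from [z0] on the horizontal axis [psi] is at most [4 M t / r]. *)
Lemma reflection_vanishing_bound u z0 (d r M : R) : 0 < r -> r < d ->
  harmonic_on (ball z0 d) u -> (forall z, ball z0 d z -> `|u z| <= M) ->
  forall t, 0 < t -> t < r ->
  u (z0.1 + t, z0.2) - u (z0.1 - t, z0.2) <= 4 * M * t / r.
Proof.
move=> r0 rd hu uM t t0 tr.
pose Q := [set z : R * R | [/\ - (z.1 - z0.1) < 0, z.1 - z0.1 < r, z.2 - z0.2 < r & - (z.2 - z0.2) < r]].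
pose C := [set z : R * R | [/\ - (z.1 - z0.1) <= 0, z.1 - z0.1 <= r, z.2 - z0.2 <= r & - (z.2 - z0.2) <= r]].
have oQ : open Q.
  have -> : Q = [set z : R * R | - (z.1 - z0.1) < 0] `&` [set z : R * R | z.1 - z0.1 < r] `&`
     [set z : R * R | z.2 - z0.2 < r] `&` [set z : R * R | - (z.2 - z0.2) < r].
    by apply/seteqP; split=> z /=; [move=> [*]|move=> [[[*]]]].
  by repeat apply: openI; apply: open_lt_cont => z; cont_step.
have cC : closed C.
  have -> : C = [set z : R * R | - (z.1 - z0.1) <= 0] `&` [set z : R * R | z.1 - z0.1 <= r] `&`
     [set z : R * R | z.2 - z0.2 <= r] `&` [set z : R * R | - (z.2 - z0.2) <= r].
    by apply/seteqP; split=> z /=; [move=> [*]|move=> [[[*]]]].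
  by repeat apply: closedI; apply: closed_le_cont => z; cont_step.
have QC : Q `<=` C by move=> z [/ltW a /ltW b /ltW c /ltW e].
have CB z : C z -> ball z0 d z.
  move=> [a b c e]; apply/plane_ballP; rewrite !ltr_norml; split; apply/andP; split; lra.
pose s (z : R * R) : R * R := (- 1 * z.1 - (-1) * 0 * z.2 + 2 * z0.1, 0 * z.1 + (-1) * (- 1) * z.2 + 0).
have sE z : s z = (2 * z0.1 - z.1, z.2) by rewrite /s; congr pair; ring.
have BB z : ball z0 d z -> ball z0 d (s z).
  move=> /plane_ballP [a b]; apply/plane_ballP; rewrite sE /=; split => //.
  by have -> : z0.1 - (2 * z0.1 - z.1) = - (z0.1 - z.1) by [ring]; rewrite normrN.
have hus : harmonic_on (ball z0 d) (fun z => u (s z)).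
  have s2 : (-1) ^+ 2 = 1 :> R by rewrite sqrrN expr1n.
  have oB := @open_ball_plane z0 d.
  exact: (@harmonic_affine R (-1) _ _ _ _ (ball z0 d) (ball z0 d) u s2 oB oB hu BB).
have oB := @open_ball_plane z0 d.
pose psi (z : R * R) := 2 * M / r ^+ 2 * ((z.2 - z0.2) ^+ 2 - (z.1 - z0.1) ^+ 2 + 2 * r * (z.1 - z0.1)).
have hpsi : harmonic_on (ball z0 d) psi.
  apply/(harmonic_onP _ oB).
  exists (fun z => 2 * M / r ^+ 2 * (- 2 * (z.1 - z0.1) + 2 * r)),
    (fun z => 2 * M / r ^+ 2 * (2 * (z.2 - z0.2))), (fun=> 2 * M / r ^+ 2 * (- 2)), (fun=> 0),
    (fun=> 0), (fun=> 2 * M / r ^+ 2 * 2); split; last by move=> z _; ring.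
  move=> z _; split; [split; [| |split]|split]; try (cont_step); rewrite /psi; deriv; ring.
have hw : harmonic_on (ball z0 d) (fun z => u z - u (s z) - psi z).
  apply: (harmonicB oB _ hpsi); exact: harmonicB.
have M0 : 0 <= M.
  by apply: le_trans (normr_ge0 _) (uM z0 _); exact: ballxx (lt_trans r0 rd).
have r2 : 0 < r ^+ 2 by rewrite exprn_gt0.
have key z : C z -> ~ Q z -> u z - u (s z) - psi z <= 0.
  move=> Cz nQz; have [a b c e] := Cz.
  have := uM _ (CB _ Cz); have := uM _ (BB _ (CB _ Cz)); rewrite !ler_norml => /andP[m1 m2] /andP[m3 m4].
  have psiE (k : R) : r ^+ 2 <= k -> 2 * M <= 2 * M / r ^+ 2 * k.
    by move=> rk; rewrite mulrAC ler_pdivlMr //; apply: ler_wpM2l => //; rewrite mulr_ge0.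
  have [x0|x0] := leP (z.1 - z0.1) 0.
    have E : z.1 = z0.1 by lra.
    have -> : s z = z by rewrite sE E [RHS]surjective_pairing E; congr pair; ring.
    rewrite subrr sub0r oppr_le0 /psi E subrr expr0n mulr0 addr0 subr0.
    by apply: mulr_ge0; [rewrite divr_ge0 ?mulr_ge0 // ltW|exact: sqr_ge0].
  have X0 : 0 <= (z.1 - z0.1) * (2 * r - (z.1 - z0.1)) by apply: mulr_ge0; lra.
  have r2M : r ^+ 2 <= (z.2 - z0.2) ^+ 2 - (z.1 - z0.1) ^+ 2 + 2 * r * (z.1 - z0.1) ->
      u z - u (s z) - psi z <= 0.
    by move=> /psiE; rewrite -/(psi z); lra.
  have psi' (k : R) : r ^+ 2 <= k ^+ 2 -> k ^+ 2 = (z.2 - z0.2) ^+ 2 -> u z - u (s z) - psi z <= 0.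
    move=> rk kE; apply: r2M; rewrite -kE.
    have -> : k ^+ 2 - (z.1 - z0.1) ^+ 2 + 2 * r * (z.1 - z0.1) =
      k ^+ 2 + (z.1 - z0.1) * (2 * r - (z.1 - z0.1)) by ring.
    by apply: le_trans rk _; rewrite lerDl.
  have sq (k : R) : r <= k -> r ^+ 2 <= k ^+ 2.
    by move=> rk; rewrite lerXn2r // nnegrE; [exact: ltW|exact: le_trans (ltW r0) rk].
  have [x1|x1] := leP r (z.1 - z0.1).
    apply: r2M; have -> : z.1 - z0.1 = r by apply/eqP; rewrite eq_le b x1.
    have -> : (z.2 - z0.2) ^+ 2 - r ^+ 2 + 2 * r * r = (z.2 - z0.2) ^+ 2 + r ^+ 2 by ring.
    by rewrite lerDr sqr_ge0.
  have [/sq x2|x2] := leP r (z.2 - z0.2); first exact: psi' x2 _.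
  have [/sq x3|x3] := leP r (- (z.2 - z0.2)); first by apply: psi' x3 _; rewrite sqrrN.
  by exfalso; apply: nQz; split; lra.
have := @max_principle_bounded R Q C (fun z => u z - u (s z) - psi z) 0 oQ cC QC _ _ _ key (z0.1 + t, z0.2).
have -> : s (z0.1 + t, z0.2) = (z0.1 - t, z0.2) by rewrite sE /=; congr pair; ring.
rewrite /psi /= subrr => K.
have {K} : u (z0.1 + t, z0.2) - u (z0.1 - t, z0.2) -
  2 * M / r ^+ 2 * (0 ^+ 2 - (z0.1 + t - z0.1) ^+ 2 + 2 * r * (z0.1 + t - z0.1)) <= 0.
  apply: K.
  - exists ((`|z0.1| + r) ^+ 2 + (`|z0.2| + r) ^+ 2) => z [a b c e].
    have q (x y : R) : `|x| <= y -> x ^+ 2 <= y ^+ 2.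
      by move=> xy; rewrite -(ger0_norm (sqr_ge0 x)) normrX lerXn2r // nnegrE (le_trans _ xy).
    apply: lerD; apply: q.
      have -> : z.1 = z0.1 + (z.1 - z0.1) by ring.
      by apply: le_trans (ler_normD _ _) _; rewrite lerD2l ler_norml; apply/andP; split; lra.
    have -> : z.2 = z0.2 + (z.2 - z0.2) by ring.
    by apply: le_trans (ler_normD _ _) _; rewrite lerD2l ler_norml; apply/andP; split; lra.
  - by move=> z /CB Bz; exact: harmonic_continuous oB Bz hw.
  - apply: harmonic_vsub oQ _; apply: harmonic_sub hw => z /QC; exact: CB.
  - by split => /=; lra.
have -> : z0.1 + t - z0.1 = t by ring.
move=> K; have : 2 * M / r ^+ 2 * (0 ^+ 2 - t ^+ 2 + 2 * r * t) <= 4 * M * t / r.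
  rewrite -subr_ge0.
  have -> : 4 * M * t / r - 2 * M / r ^+ 2 * (0 ^+ 2 - t ^+ 2 + 2 * r * t) = 2 * M / r ^+ 2 * t ^+ 2.
    by field; rewrite gt_eqF.
  by apply: mulr_ge0; [rewrite divr_ge0 ?mulr_ge0 // ltW|exact: sqr_ge0].
lra.
Qed.

(** The reflection bound with [r = d / 2], for [u] and for [- u], bounds the central difference over
    [2 t] by [4 M / d]; then [t] tends to 0. *)
Lemma gradient_estimate_x u z0 (d M : R) : 0 < d ->
  harmonic_on (ball z0 d) u -> (forall z, ball z0 d z -> `|u z| <= M) ->
  `|'D_(dirx R) u z0| <= 4 * M / d.
Proof.
move=> d0 hu uM.
have Bz0 : ball z0 d z0 by exact: ballxx.
have oB := @open_ball_plane z0 d.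
have [Dx _ _ _] := harmonic_derive oB hu Bz0.
set l := 'D_(dirx R) u z0 in Dx *.
have d2 : 0 < d / 2 by rewrite divr_gt0.
have dd : d / 2 < d by lra.
have hNu : harmonic_on (ball z0 d) (fun z => - u z) by exact: harmonicN.
have NuM z : ball z0 d z -> `|- u z| <= M by move=> /uM; rewrite normrN.
apply/ler_addgt0Pr => e e0.
move/is_derive_epsP : Dx => /(_ _ e0) /nbhs_ballP [a /= a0 Ha].
pose t := Num.min a (d / 2) / 2.
have m0 : 0 < Num.min a (d / 2) by rewrite lt_min a0 d2.
have t0 : 0 < t by rewrite divr_gt0.
have ta : t < a /\ t < d / 2.
  have : t < Num.min a (d / 2) by rewrite /t; lra.
  by rewrite lt_min => /andP.
have B1 := @reflection_vanishing_bound u z0 d (d / 2) M d2 dd hu uM t t0 ta.2.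
have B2 := @reflection_vanishing_bound (fun z => - u z) z0 d (d / 2) M d2 dd hNu NuM t t0 ta.2.
have /Ha : ball (0 : R) a t by rewrite -ball_normE /= sub0r normrN gtr0_norm // ta.1.
have /Ha : ball (0 : R) a (- t) by rewrite -ball_normE /= sub0r opprK gtr0_norm // ta.1.
rewrite /= !shift_dirx normrN (gtr0_norm t0) ![_ + z0.1]addrC !ler_norml => /andP[p1 p2] /andP[p3 p4].
have E : 4 * M * t / (d / 2) = 2 * t * (4 * M / d) by field; rewrite gt_eqF.
rewrite E in B1 B2.
have q1 : 2 * t * l <= 2 * t * (4 * M / d + e) by lra.
have q2 : - (2 * t * l) <= 2 * t * (4 * M / d + e) by lra.
have tt0 : 0 < 2 * t by rewrite mulr_gt0.
suff : - (4 * M / d + e) <= l <= 4 * M / d + e by rewrite -ler_norml.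
apply/andP; split; last by rewrite -(ler_pM2l tt0).
by rewrite lerNl -(ler_pM2l tt0) mulrN.
Qed.

Lemma gradient_estimate u z0 (d M : R) (v : R * R) : v = dirx R \/ v = diry R -> 0 < d ->
  harmonic_on (ball z0 d) u -> (forall z, ball z0 d z -> `|u z| <= M) ->
  `|'D_v u z0| <= 4 * M / d.
Proof.
move=> [->|->] d0 hu uM; first exact: gradient_estimate_x.
(* A quarter turn about [z0], which preserves the square balls and carries the first axis direction
   to the second. *)
pose s (z : R * R) : R * R := (0 * z.1 - 1 * 1 * z.2 + (z0.1 + z0.2), 1 * z.1 + 1 * 0 * z.2 + (z0.2 - z0.1)).
have sE z : s z = (z0.1 + z0.2 - z.2, z.1 + z0.2 - z0.1) by rewrite /s; congr pair; ring.
have BB z : ball z0 d z -> ball z0 d (s z).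
  move=> /plane_ballP [a b]; apply/plane_ballP; rewrite sE /=; split.
    by have -> : z0.1 - (z0.1 + z0.2 - z.2) = - (z0.2 - z.2) by [ring]; rewrite normrN.
  by have -> : z0.2 - (z.1 + z0.2 - z0.1) = z0.1 - z.1 by ring.
have oB := @open_ball_plane z0 d.
have hus : harmonic_on (ball z0 d) (fun z => u (s z)).
  have s2 : 1 ^+ 2 = 1 :> R by rewrite expr1n.
  exact: (@harmonic_affine R 1 _ _ _ _ (ball z0 d) (ball z0 d) u s2 oB oB hu BB).
have := @gradient_estimate_x (fun z => u (s z)) z0 d M d0 hus.
suff -> : 'D_(dirx R) (fun z => u (s z)) z0 = 'D_(diry R) u z0.
  by apply => z /BB; exact: uM.
have [_ /is_derive_epsP D _ _] := harmonic_derive oB hu (ballxx z0 d0).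
apply: is_derive_val; apply/is_derive_epsP => e /D; apply: filterS => h.
rewrite shift_dirx shift_diry !sE /=.
have -> : (z0.1 + z0.2 - z0.2, h + z0.1 + z0.2 - z0.1) = (z0.1, h + z0.2) by congr pair; ring.
have -> // : (z0.1 + z0.2 - z0.2, z0.1 + z0.2 - z0.1) = z0.
by rewrite [RHS]surjective_pairing; congr pair; ring.
Qed.

End GradientEstimate.

(** * Limits of harmonic functions *)

Section UniformLimits.
Context {R : realType}.
Implicit Types (h u w f g : R * R -> R) (z y : R * R) (U B : set (R * R)).

Definition axis_dir (v : R * R) : Prop := v = dirx R \/ v = diry R.

Lemma ball_shift_axis (z y : R * R) (v : R * R) (a b t : R) : axis_dir v ->
  ball z a y -> `|t| <= b -> ball z (a + b) (t *: v + y).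
Proof.
move=> vd /plane_ballP [y1 y2] tb; apply/plane_ballP.
have b0 : 0 <= b by apply: le_trans tb.
by case: vd => ->; rewrite ?shift_dirx ?shift_diry /=; split;
  rewrite ?opprD ?addrA ?[_ - t - _]addrAC; (try exact: (lt_le_trans _ (ler_wpDr b0 (lexx a))));
  apply: le_lt_trans (ler_normB _ _) _; exact: ltr_leD.
Qed.

Lemma ball_center_le (z y x : R * R) (a b : R) : ball z a y -> ball y b x -> ball z (a + b) x.
Proof. exact: ball_triangle. Qed.

Lemma harmonic_derivable B w v : axis_dir v -> open B -> harmonic_on B w ->
  forall z, B z -> is_derive z v w ('D_v w z).
Proof. by move=> [->|->] oB hw z Bz; have [] := harmonic_derive oB hw Bz. Qed.

Lemma harmonic_derivable2 B w v v' : axis_dir v -> axis_dir v' -> open B -> harmonic_on B w ->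
  forall z, B z -> is_derive z v ('D_v' w) ('D_v ('D_v' w) z) /\
    {for z, continuous ('D_v ('D_v' w))}.
Proof.
move=> vd vd' oB [[_ Cx Cy] _] z Bz.
have [x1 x2 x3 x4] := Cx z Bz; have [y1 y2 y3 y4] := Cy z Bz.
case: vd => ->; case: vd' => ->.
- by split; [exact: (derivableP x1)|exact: x3].
- by split; [exact: (derivableP y1)|exact: y3].
- by split; [exact: (derivableP x2)|exact: x4].
- by split; [exact: (derivableP y2)|exact: y4].
Qed.

Lemma harmonic_translate B B' w (c : R * R) : open B -> open B' -> harmonic_on B w ->
  (forall z, B' z -> B (c + z)) -> harmonic_on B' (fun z => w (c + z)).
Proof.
move=> oB oB' hw BB.
have E z : (1 * z.1 - 1 * 0 * z.2 + c.1, 0 * z.1 + 1 * 1 * z.2 + c.2) = c + z.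
  case: c {BB} z => a b [x y] /=; have -> : ((a, b) : R * R) + (x, y) = (a + x, b + y) by [].
  by congr pair; ring.
have s2 : 1 ^+ 2 = 1 :> R by rewrite expr1n.
have := @harmonic_affine R 1 1 0 c.1 c.2 B' B w s2 oB' oB hw.
by under eq_fun do rewrite E; apply => z /BB; rewrite E.
Qed.

(* The bound on the second derivatives comes from the gradient estimate applied
   to the difference quotients, which are harmonic. *)
Lemma second_derivative_estimate w z0 (d M : R) v v' : axis_dir v -> axis_dir v' -> 0 < d ->
  harmonic_on (ball z0 d) w -> (forall z, ball z0 d z -> `|w z| <= M) ->
  `|'D_v ('D_v' w) z0| <= 128 * M / d ^+ 2.
Proof.
move=> vd vd' d0 hw wM.
have oB := @open_ball_plane R z0 d.
have d4 : 0 < d / 4 by rewrite divr_gt0.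
have d2 : 0 < d / 2 by rewrite divr_gt0.
have Dg z : ball z0 (d / 2) z -> `|'D_v w z| <= 8 * M / d.
  move=> Bz; have sub y : ball z (d / 2) y -> ball z0 d y.
    by move=> By; have := ball_center_le Bz By; rewrite -splitr.
  have -> : 8 * M / d = 4 * M / (d / 2) by field; rewrite gt_eqF.
  exact: (gradient_estimate vd d2 (harmonic_sub sub hw) (fun y By => wM y (sub y By))).
have Dq (t : R) : t != 0 -> `|t| <= d / 4 ->
    `|t^-1 * ('D_v' w (t *: v + z0) - 'D_v' w z0)| <= 128 * M / d ^+ 2.
  move=> t0 td.
  pose q (z : R * R) := t^-1 * (w (t *: v + z) - w z).
  have oB4 := @open_ball_plane R z0 (d / 4).
  have inB y : ball z0 (d / 4) y -> ball z0 (d / 2) (t *: v + y).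
    move=> By; have := ball_shift_axis vd By td.
    by have -> : d / 4 + d / 4 = d / 2 by field.
  have B24 y : ball z0 (d / 4) y -> ball z0 d y.
    by apply: le_ball; lra.
  have B2 y : ball z0 (d / 2) y -> ball z0 d y by apply: le_ball; lra.
  have ht : harmonic_on (ball z0 (d / 4)) (fun z => w (t *: v + z)).
    by apply: harmonic_translate oB oB4 hw _ => z /inB /B2.
  have hq : harmonic_on (ball z0 (d / 4)) q.
    exact: (harmonicZ t^-1 oB4 (harmonicB oB4 ht (harmonic_sub B24 hw))).
  have -> : t^-1 * ('D_v' w (t *: v + z0) - 'D_v' w z0) = 'D_v' q z0.
    apply/esym/is_derive_val; apply: is_derive_scl.
    have Bz0 : ball z0 (d / 4) z0 by exact: ballxx.
    have D1 := harmonic_derivable vd' oB hw (B24 _ Bz0).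
    have D2 := harmonic_derivable vd' oB hw (B2 _ (inB _ Bz0)).
    refine (is_derive_add _ (is_derive_oppr D1)).
    apply/is_derive_epsP => e e0; move/is_derive_epsP : D2 => /(_ _ e0).
    by apply: filterS => h; rewrite addrCA.
  have -> : 128 * M / d ^+ 2 = 4 * (8 * M / d) / (d / 4) by field; rewrite gt_eqF.
  apply: gradient_estimate => // z Bz.
  have [s st E] : exists2 s : R, `|s| <= `|t| & w (t *: v + z) - w z = t * 'D_v w (s *: v + z).
    apply: (@mean_value_direction R (R * R)%type w ('D_v w) z v t) => s st.
    apply: (harmonic_derivable vd oB hw).
    apply: B2; have := ball_shift_axis vd Bz (le_trans st td).
    by have -> : d / 4 + d / 4 = d / 2 by field.
  rewrite /q E mulKf //; apply: Dg.
  have := ball_shift_axis vd Bz (le_trans st td).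
  by have -> : d / 4 + d / 4 = d / 2 by field.
have [D _] := harmonic_derivable2 vd vd' oB hw (ballxx z0 d0).
apply/ler_addgt0Pr => e e0.
move/is_derive_epsP : D => /(_ _ e0) /nbhs_ballP [a /= a0 Ha].
pose t := Num.min a (d / 4) / 2.
have m0 : 0 < Num.min a (d / 4) by rewrite lt_min a0 d4.
have t0 : 0 < t by rewrite divr_gt0.
have [ta td] : t < a /\ t < d / 4.
  have : t < Num.min a (d / 4) by rewrite /t; lra.
  by rewrite lt_min => /andP.
have /Ha /= : ball (0 : R) a t by rewrite -ball_normE /= sub0r normrN gtr0_norm.
set X := 'D_v' w (t *: v + z0) - 'D_v' w z0; set l := 'D_v _ _ => H.
have := Dq t (lt0r_neq0 t0) (ltac:(by rewrite gtr0_norm // ltW)); rewrite -/X => H2.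
have -> : l = t^-1 * X - t^-1 * (X - t * l) by field; rewrite gt_eqF.
apply: le_trans (ler_normB _ _) _; apply: lerD => //.
rewrite (gtr0_norm t0) in H.
by rewrite normrM normfV (gtr0_norm t0) ler_pdivrMl // (mulrC t e).
Qed.

(** For a fixed good index [n], the oscillation of [f - fn n] along the segment must be [O(e |t|)].
    It is that of [fm - fn n] up to an error that is arbitrarily small with [m], and the mean value
    theorem bounds the latter by [gn m - gn n]. *)
Lemma uniform_limit_derive B f g (fn gn : nat -> R * R -> R) (en : nat -> R) v z :
  open B -> B z -> axis_dir v ->
  (forall n y, B y -> is_derive y v (fn n) (gn n y)) ->
  (forall n y, B y -> `|f y - fn n y| <= en n) ->
  (forall n y, B y -> `|g y - gn n y| <= en n) ->
  (forall e : R, 0 < e -> exists n, en n <= e) ->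
  is_derive z v f (g z).
Proof.
move=> oB Bz vd Dn fE gE e0; apply/is_derive_epsP => e ep.
have e4 : 0 < e / 4 by rewrite divr_gt0.
have [n en4] := e0 _ e4.
have /nbhs_ballP [r /= r0 Br] : nbhs z B by exact: open_nbhs_nbhs.
have r2 : 0 < r / 2 by rewrite divr_gt0.
have rin (t : R) : `|t| <= r / 2 -> B (t *: v + z).
  move=> tr; apply: Br; have := ball_shift_axis vd (ballxx z r2) tr.
  by rewrite -splitr.
have /is_derive_epsP /(_ _ e4) /nbhs_ballP [a /= a0 Ha] := Dn n z Bz.
apply/nbhs_ballP; exists (Num.min a (r / 2)) => /=; first by rewrite lt_min a0.
move=> t; rewrite -ball_normE /= sub0r normrN lt_min => /andP[ta tr].
have tB s : `|s| <= `|t| -> B (s *: v + z) by move=> st; apply: rin; apply: le_trans st (ltW tr).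
(* The auxiliary index [m] depends on [t] and on the slack [x], while the bound does not. *)
have osc : `|(f (t *: v + z) - fn n (t *: v + z)) - (f z - fn n z)| <= 2 * (e / 4) * `|t|.
  apply/ler_addgt0Pr => x x0.
  have x2 : 0 < Num.min (e / 4) (x / 2) by rewrite lt_min e4 divr_gt0.
  have [m em] := e0 _ x2; move: em; rewrite le_min => /andP[em4 emx].
  have [s st E] : exists2 s : R, `|s| <= `|t| &
     (fn m (t *: v + z) - fn n (t *: v + z)) - (fn m z - fn n z) = t * (gn m (s *: v + z) - gn n (s *: v + z)).
    apply: (@mean_value_direction R (R * R)%type (fun y => fn m y - fn n y) (fun y => gn m y - gn n y)).
    move=> s st; apply: is_derive_add; first exact: Dn (tB _ st).
    by apply: is_derive_oppr; exact: Dn (tB _ st).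
  have -> : f (t *: v + z) - fn n (t *: v + z) - (f z - fn n z) =
    (f (t *: v + z) - fn m (t *: v + z)) - (f z - fn m z) +
     ((fn m (t *: v + z) - fn n (t *: v + z)) - (fn m z - fn n z)) by ring.
  rewrite E; apply: le_trans (ler_normD _ _) _; rewrite addrC; apply: lerD.
    rewrite normrM mulrC ler_wpM2r //.
    have -> : gn m (s *: v + z) - gn n (s *: v + z) =
      (g (s *: v + z) - gn n (s *: v + z)) - (g (s *: v + z) - gn m (s *: v + z)) by ring.
    apply: le_trans (ler_normB _ _) _; have -> : 2 * (e / 4) = e / 4 + e / 4 by ring.
    apply: lerD; [apply: le_trans en4|apply: le_trans em4]; exact: gE (tB _ st).
  apply: le_trans (ler_normB _ _) _; rewrite (splitr x); apply: lerD;
    apply: le_trans emx; apply: fE => //; exact: tB.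
have tin : ball (0 : R) a t by rewrite -ball_normE /= sub0r normrN.
have H := Ha t tin.
have -> : f (t *: v + z) - f z - t * g z =
  ((f (t *: v + z) - fn n (t *: v + z)) - (f z - fn n z)) +
  ((fn n (t *: v + z) - fn n z - t * gn n z) - t * (g z - gn n z)) by ring.
apply: le_trans (ler_normD _ _) _.
have -> : e * `|t| = 2 * (e / 4) * `|t| + (e / 4 * `|t| + `|t| * (e / 4)) by field.
apply: lerD => //; apply: le_trans (ler_normB _ _) _; apply: lerD => //.
rewrite normrM ler_wpM2l //; apply: le_trans en4; exact: gE.
Qed.

Lemma uniform_limit_continuous B f (fn : nat -> R * R -> R) (en : nat -> R) z :
  open B -> B z -> (forall n, {for z, continuous (fn n)}) ->
  (forall n y, B y -> `|f y - fn n y| <= en n) ->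
  (forall e : R, 0 < e -> exists n, en n <= e) -> {for z, continuous f}.
Proof.
move=> oB Bz cn fE e0; apply/cvgrPdist_le => e ep.
have e4 : 0 < e / 4 by rewrite divr_gt0.
have [n en4] := e0 _ e4.
have nB : \forall y \near z, B y by apply: open_nbhs_nbhs.
have /cvgrPdist_le /(_ _ e4) nc := cn n.
apply: filterS2 nB nc => y By yn.
have -> : f z - f y = (f z - fn n z) + (fn n z - fn n y) - (f y - fn n y) by ring.
apply: le_trans (ler_normB _ _) _.
have -> : e = (e / 4 + e / 4) + 2 * (e / 4) by field.
apply: lerD.
  apply: le_trans (ler_normD _ _) _; apply: lerD => //.
  by apply: le_trans en4; exact: fE.
apply: le_trans (fE n y By) _; lra.
Qed.

(** The limit is the supremum of the lower bounds [a n - C / (n + 1)]; taken this way it comes with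
    its rate. *)
Lemma cauchy_limit (a : nat -> R) (C : R) :
  (forall n m, `|a n - a m| <= C / n.+1%:R + C / m.+1%:R) ->
  exists l, forall n, `|l - a n| <= C / n.+1%:R.
Proof.
move=> H.
pose E := [set a n - C / n.+1%:R | n in setT].
have ub m : ubound E (a m + C / m.+1%:R).
  move=> _ [n _ <-]; have := H n m; rewrite ler_norml => /andP[_].
  move: (C / n.+1%:R) (C / m.+1%:R) (a n) (a m) => x y p q.
  by rewrite lerBlDr lerBlDl addrA addrAC.
have E0 : E !=set0 by exists (a 0%N - C / 1%:R); exists 0%N.
exists (sup E) => n; rewrite ler_norml; apply/andP; split.
  have : a n - C / n.+1%:R <= sup E.
    by apply: ub_le_sup; [exists (a 0%N + C / 1%:R); exact: ub|exists n].
  by rewrite lerBrDr addrC.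
by have := ge_sup E0 (ub n); rewrite lerBlDl.
Qed.

Lemma cauchy_limit_fun (T : Type) (A : set T) (a : nat -> T -> R) (C : R) :
  (forall n m (t : T), A t -> `|a n t - a m t| <= C / n.+1%:R + C / m.+1%:R) ->
  exists l : T -> R, forall n (t : T), A t -> `|l t - a n t| <= C / n.+1%:R.
Proof.
move=> H.
have : forall y : T, exists l, A y -> forall n, `|l - a n y| <= C / n.+1%:R.
  move=> y; have [Ay|nAy] := pselect (A y); last by exists 0.
  by have [l Hl] := cauchy_limit (fun n m => H n m y Ay); exists l.
by move=> /choice [l Hl]; exists l => n y Ay; exact: Hl.
Qed.

Lemma small_inv (C e : R) : 0 < e -> exists n : nat, C / n.+1%:R <= e.
Proof.
move=> e0; pose n := Num.truncn (`|C| / e); exists n.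
rewrite ler_pdivrMr ?ltr0Sn // mulrC -ler_pdivrMr //.
apply: le_trans (_ : `|C| / e <= _); first by rewrite ler_pM2r ?invr_gt0 // ler_norm.
by apply: ltW; rewrite truncnS_gt.
Qed.

(** The gradient and second derivative estimates, applied to differences of approximants, make all
    derivatives up to order two uniformly Cauchy on the half ball. Their limits are the derivatives
    of [u], and the Laplace equation passes to the limit. [C] dominates the constants of the three
    orders. *)
Theorem harmonic_uniform_limit U u : open U ->
  (forall z, U z -> exists2 r : R, 0 < r & forall e : R, 0 < e ->
     exists2 v, harmonic_on (ball z r) v & forall y, ball z r y -> `|u y - v y| <= e) ->
  harmonic_on U u.
Proof.
move=> oU H; apply: harmonic_local => // z0 Uz0.
have [r r0 Hr] := H _ Uz0.
have r2 : 0 < r / 2 by rewrite divr_gt0.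
have oB := @open_ball_plane R z0 r; have oB2 := @open_ball_plane R z0 (r / 2).
exists (ball z0 (r / 2)); first exact: nbhsx_ballx.
have -> : (ball z0 (r / 2))° = ball z0 (r / 2) by apply/interior_id.
exists u => //.
have : forall n : nat, exists v, harmonic_on (ball z0 r) v /\
    forall y, ball z0 r y -> `|u y - v y| <= 1 / n.+1%:R.
  by move=> n; have [|v hv vE] := Hr (1 / n.+1%:R); [rewrite divr_gt0|exists v].
move=> /choice [w Hw].
have hw n : harmonic_on (ball z0 r) (w n) by have [] := Hw n.
have wE n y : ball z0 r y -> `|u y - w n y| <= 1 / n.+1%:R by have [_] := Hw n; apply.
have sub y : ball z0 (r / 2) y -> ball y (r / 2) `<=` ball z0 r.
  by move=> By x Bx; have := ball_center_le By Bx; rewrite -splitr.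
have Bs y : ball z0 (r / 2) y -> ball z0 r y by apply: le_ball; lra.
have hnm n m : harmonic_on (ball z0 r) (fun y => w n y - w m y) by exact: harmonicB.
have wnm n m y : ball z0 r y -> `|w n y - w m y| <= 1 / n.+1%:R + 1 / m.+1%:R.
  move=> By; have -> : w n y - w m y = (u y - w m y) - (u y - w n y) by ring.
  by apply: le_trans (ler_normB _ _) _; rewrite addrC; apply: lerD; exact: wE.
pose C := 4 / (r / 2) + 128 / (r / 2) ^+ 2 + 1.
have C1 : 4 / (r / 2) <= C.
  by rewrite /C -addrA lerDl addr_ge0 // divr_ge0 // exprn_ge0 // ltW.
have C2 : 128 / (r / 2) ^+ 2 <= C.
  by rewrite /C addrAC lerDr addr_ge0 // divr_ge0 // ltW.
have C3 : 1 <= C by rewrite /C lerDr addr_ge0 // divr_ge0 ?exprn_ge0 // ltW.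
have CE (k : R) n m : k <= C -> k * (1 / n.+1%:R + 1 / m.+1%:R) <= C / n.+1%:R + C / m.+1%:R.
  move=> kC; have -> : C / n.+1%:R + C / m.+1%:R = C * (1 / n.+1%:R + 1 / m.+1%:R).
    by rewrite !mul1r mulrDr.
  by apply: ler_wpM2r => //; rewrite addr_ge0 // divr_ge0.
have D1 v : axis_dir v -> exists g : R * R -> R, forall n y, ball z0 (r / 2) y ->
    `|g y - 'D_v (w n) y| <= C / n.+1%:R.
  move=> vd; apply: (@cauchy_limit_fun _ (ball z0 (r / 2)) (fun n y => 'D_v (w n) y)).
  move=> n m y By; have By' := Bs _ By.
  have -> : 'D_v (w n) y - 'D_v (w m) y = 'D_v (fun y => w n y - w m y) y.
    by apply/esym/is_derive_val; exact: (is_derive_add (harmonic_derivable vd oB (hw n) By')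
      (is_derive_oppr (harmonic_derivable vd oB (hw m) By'))).
  apply: (@le_trans _ _ (4 * (1 / n.+1%:R + 1 / m.+1%:R) / (r / 2))); last first.
    by rewrite mulrAC; exact: CE.
  exact: (gradient_estimate vd r2 (harmonic_sub (sub y By) (hnm n m))
    (fun x Bx => wnm n m x (sub y By x Bx))).
have D2 v v' : axis_dir v -> axis_dir v' -> exists g : R * R -> R, forall n y, ball z0 (r / 2) y ->
    `|g y - 'D_v ('D_v' (w n)) y| <= C / n.+1%:R.
  move=> vd vd'; apply: (@cauchy_limit_fun _ (ball z0 (r / 2)) (fun n y => 'D_v ('D_v' (w n)) y)).
  move=> n m y By; have By' := Bs _ By.
  have -> : 'D_v ('D_v' (w n)) y - 'D_v ('D_v' (w m)) y = 'D_v ('D_v' (fun y => w n y - w m y)) y.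
    apply/esym/is_derive_val.
    apply: (near_eq_is_derive (f := fun y => 'D_v' (w n) y - 'D_v' (w m) y)).
      apply: (open_nearW oB By') => x Bx; apply/esym/is_derive_val.
      exact: (is_derive_add (harmonic_derivable vd' oB (hw n) Bx)
        (is_derive_oppr (harmonic_derivable vd' oB (hw m) Bx))).
    exact: (is_derive_add (harmonic_derivable2 vd vd' oB (hw n) By').1
      (is_derive_oppr (harmonic_derivable2 vd vd' oB (hw m) By').1)).
  apply: (@le_trans _ _ (128 * (1 / n.+1%:R + 1 / m.+1%:R) / (r / 2) ^+ 2)); last first.
    by rewrite mulrAC; exact: CE.
  exact: (second_derivative_estimate vd vd' r2 (harmonic_sub (sub y By) (hnm n m))
    (fun x Bx => wnm n m x (sub y By x Bx))).
have dx : axis_dir (dirx R) by left. have dy : axis_dir (diry R) by right.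
have [hx Hx] := D1 _ dx; have [hy Hy] := D1 _ dy.
have [hxx Hxx] := D2 _ _ dx dx; have [hxy Hxy] := D2 _ _ dy dx.
have [hyx Hyx] := D2 _ _ dx dy; have [hyy Hyy] := D2 _ _ dy dy.
have uE n y : ball z0 (r / 2) y -> `|u y - w n y| <= C / n.+1%:R.
  by move=> /Bs /wE => /(_ n) K; apply: le_trans K _; rewrite ler_pM2r ?invr_gt0.
have sm e : 0 < e -> exists n, C / n.+1%:R <= e by exact: small_inv.
apply/(harmonic_onP _ oB2); exists hx, hy, hxx, hxy, hyx, hyy; split.
- move=> z Bz; have Dn v : axis_dir v -> forall n y, ball z0 (r / 2) y -> is_derive y v (w n) ('D_v (w n) y).
    by move=> vd n y /Bs By; exact: harmonic_derivable oB (hw n) _ By.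
  have Dn2 v v' : axis_dir v -> axis_dir v' -> forall n y, ball z0 (r / 2) y ->
      is_derive y v ('D_v' (w n)) ('D_v ('D_v' (w n)) y).
    by move=> vd vd' n y /Bs By; have [] := harmonic_derivable2 vd vd' oB (hw n) By.
  have Cn v v' : axis_dir v -> axis_dir v' -> forall n, {for z, continuous ('D_v ('D_v' (w n)))}.
    by move=> vd vd' n; have [] := harmonic_derivable2 vd vd' oB (hw n) (Bs _ Bz).
  split; [split; [| |split]|split].
  + exact: uniform_limit_derive oB2 Bz dx (Dn _ dx) uE Hx sm.
  + exact: uniform_limit_derive oB2 Bz dy (Dn _ dy) uE Hy sm.
  + exact: uniform_limit_derive oB2 Bz dx (Dn2 _ _ dx dx) Hx Hxx sm.
  + exact: uniform_limit_derive oB2 Bz dy (Dn2 _ _ dy dx) Hx Hxy sm.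
  + exact: uniform_limit_derive oB2 Bz dx (Dn2 _ _ dx dy) Hy Hyx sm.
  + exact: uniform_limit_derive oB2 Bz dy (Dn2 _ _ dy dy) Hy Hyy sm.
  + exact: uniform_limit_continuous oB2 Bz (Cn _ _ dx dx) Hxx sm.
  + exact: uniform_limit_continuous oB2 Bz (Cn _ _ dy dx) Hxy sm.
  + exact: uniform_limit_continuous oB2 Bz (Cn _ _ dx dy) Hyx sm.
  + exact: uniform_limit_continuous oB2 Bz (Cn _ _ dy dy) Hyy sm.
- move=> z Bz; apply/eqP; rewrite -normr_le0; apply/ler_addgt0Pr => e e0; rewrite add0r.
  have e2 : 0 < e / 2 by rewrite divr_gt0.
  have [n en] := sm _ e2.
  have L : 'D_(dirx R) ('D_(dirx R) (w n)) z + 'D_(diry R) ('D_(diry R) (w n)) z = 0.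
    by have [_] := hw n; apply; exact: Bs.
  have -> : hxx z + hyy z = (hxx z - 'D_(dirx R) ('D_(dirx R) (w n)) z) +
      (hyy z - 'D_(diry R) ('D_(diry R) (w n)) z).
    by rewrite addrACA -opprD L subr0.
  apply: le_trans (ler_normD _ _) _; rewrite (splitr e).
  by apply: lerD; apply: le_trans en; [exact: Hxx|exact: Hyy].
Qed.

End UniformLimits.

(** * The Dirichlet problem in a disc, and Perron's method *)

Section DiscDirichlet.
Context {R : realType}.
Implicit Types (h u f g p q : R * R -> R) (z w : R * R).

Fixpoint zpow (n : nat) z : R * R :=
  if n is m.+1 then
    (z.1 * (zpow m z).1 - z.2 * (zpow m z).2, z.1 * (zpow m z).2 + z.2 * (zpow m z).1)
  else (1, 0).

Lemma zpow_cauchy_riemann n (k : R) : cauchy_riemann 1 setT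
  (fun z => k * (zpow n z).1) (fun z => k * (zpow n z).2)
  (fun z => k * n%:R * (zpow n.-1 z).1) (fun z => k * n%:R * (zpow n.-1 z).2).
Proof.
suff H : cauchy_riemann 1 setT (fun z => (zpow n z).1) (fun z => (zpow n z).2)
  (fun z => n%:R * (zpow n.-1 z).1) (fun z => n%:R * (zpow n.-1 z).2).
  move=> z _; have [a b c d] := H z I.
  split; [have e := is_derive_scl k a|have e := is_derive_scl k b|
    have e := is_derive_scl k c|have e := is_derive_scl k d];
    apply: is_derive_eq e _; ring.
elim: n => [|n IH] z _.
  by rewrite /=; split; deriv; ring.
have [a b c d] := IH z I.
have E : (n%:R * (zpow n.-1 z).1) * z.1 - (n%:R * (zpow n.-1 z).2) * z.2 = n%:R * (zpow n z).1 /\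
   (n%:R * (zpow n.-1 z).2) * z.1 + (n%:R * (zpow n.-1 z).1) * z.2 = n%:R * (zpow n z).2.
  case: n {IH a b c d} => [|n] /=; first by split; ring.
  by split; ring.
have [E1 E2] := E.
have En : n.+1%:R = 1 + n%:R :> R by rewrite -natr1 addrC.
rewrite /= En; split; deriv; rewrite ?mulrDl ?mul1r; move: E1 E2;
  set A := (zpow n z).1; set B := (zpow n z).2;
  set A' := n%:R * (zpow n.-1 z).1; set B' := n%:R * (zpow n.-1 z).2 => E1 E2.
- by rewrite -E1; ring.
- by rewrite -E2; ring.
- by rewrite -E2; ring.
- by rewrite -E1; ring.
Qed.

Lemma zpow_cont n z : cont_at (fun z => (zpow n z).1) z /\ cont_at (fun z => (zpow n z).2) z.
Proof.
elim: n => [|n [a b]] /=; first by split; exact: cont_const.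
by split; cont_step.
Qed.

Lemma harmonic_fst : harmonic_on setT (fun z : R * R => z.1).
Proof.
apply/(harmonic_onP _ openT); exists (cst 1), (cst 0), (cst 0), (cst 0), (cst 0), (cst 0).
split; last by move=> z _; rewrite addr0.
move=> z _; split; [split; [| |split]|split]; try exact: cst_continuous; try exact: is_derive_cst.
- by apply: is_derive_eq (is_derive_fst _ _) _.
- by apply: is_derive_eq (is_derive_fst _ _) _.
Qed.

Lemma harmonic_snd : harmonic_on setT (fun z : R * R => z.2).
Proof.
apply/(harmonic_onP _ openT); exists (cst 0), (cst 1), (cst 0), (cst 0), (cst 0), (cst 0).
split; last by move=> z _; rewrite addr0.
move=> z _; split; [split; [| |split]|split]; try exact: cst_continuous; try exact: is_derive_cst.
- by apply: is_derive_eq (is_derive_snd _ _) _.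
- by apply: is_derive_eq (is_derive_snd _ _) _.
Qed.

Lemma zpow_harmonic n : harmonic_on setT (fun z => (zpow n z).1) /\ harmonic_on setT (fun z => (zpow n z).2).
Proof.
have s2 : 1 ^+ 2 = 1 :> R by rewrite expr1n.
have C1 := zpow_cauchy_riemann n 1.
have C2 := zpow_cauchy_riemann n.-1 (1 * n%:R).
have cc z : setT z -> {for z, continuous (fun z => 1 * n%:R * n.-1%:R * (zpow n.-1.-1 z).1)} /\
   {for z, continuous (fun z => 1 * n%:R * n.-1%:R * (zpow n.-1.-1 z).2)}.
  by move=> _; have [a b] := zpow_cont n.-1.-1 z; split; cont_step.
have := @harmonic_comp R 1 setT setT _ _ _ _ _ _ _ s2 openT openT harmonic_fst C1 C2 cc (fun _ _ => I).
have := @harmonic_comp R 1 setT setT _ _ _ _ _ _ _ s2 openT openT harmonic_snd C1 C2 cc (fun _ _ => I).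
move=> H1 H2; split.
  by apply: harmonic_ext openT _ H2 => z _ /=; rewrite mul1r.
by apply: harmonic_ext openT _ H1 => z _ /=; rewrite mul1r.
Qed.

(** [zpow n z] is the complex power [z^n], so on the unit circle these are the trigonometric
    polynomials, already extended to harmonic functions on the plane. *)
Inductive trig_poly : (R * R -> R) -> Prop :=
| trig_re n : trig_poly (fun z => (zpow n z).1)
| trig_im n : trig_poly (fun z => (zpow n z).2)
| trig_add f g : trig_poly f -> trig_poly g -> trig_poly (fun z => f z + g z)
| trig_scale (k : R) f : trig_poly f -> trig_poly (fun z => k * f z).

Inductive plane_poly : (R * R -> R) -> Prop :=
| pp_const (k : R) : plane_poly (fun=> k)
| pp_fst : plane_poly (fun z => z.1)
| pp_snd : plane_poly (fun z => z.2)
| pp_add f g : plane_poly f -> plane_poly g -> plane_poly (fun z => f z + g z)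
| pp_mul f g : plane_poly f -> plane_poly g -> plane_poly (fun z => f z * g z).

Lemma trig_poly_harmonic f : trig_poly f -> harmonic_on setT f.
Proof.
elim=> [n|n|f1 g1 _ hf _ hg|k f1 _ hf].
- exact: (zpow_harmonic n).1.
- exact: (zpow_harmonic n).2.
- exact: (harmonicD openT hf hg).
- exact: (harmonicZ k openT hf).
Qed.

(** The product formulas [2 cos t cos n t = cos (n+1) t + cos (n-1) t] and their companions, as
    polynomial identities modulo [|z|^2 = 1]. *)
Lemma trig_poly_mul_coord f : trig_poly f ->
  (exists2 g, trig_poly g & forall z, nrm2 z = 1 -> z.1 * f z = g z) /\
  (exists2 g, trig_poly g & forall z, nrm2 z = 1 -> z.2 * f z = g z).
Proof.
elim=> {f} [n|n|f g _ [[f1 tf1 E1] [f2 tf2 E2]] _ [[g1 tg1 D1] [g2 tg2 D2]]|k f _ [[f1 tf1 E1] [f2 tf2 E2]]].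
- case: n => [|n]; split.
  + by exists (fun z => (zpow 1 z).1); [exact: trig_re|move=> z _ /=; ring].
  + by exists (fun z => (zpow 1 z).2); [exact: trig_im|move=> z _ /=; ring].
  + exists (fun z => 2^-1 * ((zpow n.+2 z).1 + (zpow n z).1)).
      by apply: trig_scale; apply: trig_add; exact: trig_re.
    move=> z; rewrite /nrm2 /= => z1.
    apply/eqP; rewrite -subr_eq0; apply/eqP.
    transitivity (2^-1 * (z.1 ^+ 2 + z.2 ^+ 2 - 1) * (zpow n z).1); first by field.
    by rewrite z1 subrr mulr0 mul0r ?oppr0.
  + exists (fun z => 2^-1 * ((zpow n.+2 z).2 + -1 * (zpow n z).2)).
      apply: trig_scale; apply: trig_add; first exact: trig_im.
      by apply: trig_scale; exact: trig_im.
    move=> z; rewrite /nrm2 /= => z1.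
    apply/eqP; rewrite -subr_eq0; apply/eqP.
    transitivity (- (2^-1 * (z.1 ^+ 2 + z.2 ^+ 2 - 1) * (zpow n z).2)); first by field.
    by rewrite z1 subrr mulr0 mul0r ?oppr0.
- case: n => [|n]; split.
  + exists (fun z => 0 * (zpow 0 z).1); first by apply: trig_scale; exact: trig_re.
    by move=> z _ /=; ring.
  + exists (fun z => 0 * (zpow 0 z).1); first by apply: trig_scale; exact: trig_re.
    by move=> z _ /=; ring.
  + exists (fun z => 2^-1 * ((zpow n.+2 z).2 + (zpow n z).2)).
      by apply: trig_scale; apply: trig_add; exact: trig_im.
    move=> z; rewrite /nrm2 /= => z1.
    apply/eqP; rewrite -subr_eq0; apply/eqP.
    transitivity (2^-1 * (z.1 ^+ 2 + z.2 ^+ 2 - 1) * (zpow n z).2); first by field.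
    by rewrite z1 subrr mulr0 mul0r ?oppr0.
  + exists (fun z => 2^-1 * ((zpow n z).1 + -1 * (zpow n.+2 z).1)).
      apply: trig_scale; apply: trig_add; first exact: trig_re.
      by apply: trig_scale; exact: trig_re.
    move=> z; rewrite /nrm2 /= => z1.
    apply/eqP; rewrite -subr_eq0; apply/eqP.
    transitivity (2^-1 * (z.1 ^+ 2 + z.2 ^+ 2 - 1) * (zpow n z).1); first by field.
    by rewrite z1 subrr mulr0 mul0r ?oppr0.
- split.
  + exists (fun z => f1 z + g1 z); first exact: trig_add.
    by move=> z z1; rewrite mulrDr E1 // D1.
  + exists (fun z => f2 z + g2 z); first exact: trig_add.
    by move=> z z1; rewrite mulrDr E2 // D2.
- split.
  + exists (fun z => k * f1 z); first exact: trig_scale.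
    by move=> z z1; rewrite mulrCA E1.
  + exists (fun z => k * f2 z); first exact: trig_scale.
    by move=> z z1; rewrite mulrCA E2.
Qed.

(** The claim is strengthened to multiplication by [p] preserving trigonometric polynomials on the
    circle, a form that passes through products in the induction on [p]. *)
Lemma plane_poly_trig p : plane_poly p ->
  exists2 u, harmonic_on setT u & forall z, nrm2 z = 1 -> p z = u z.
Proof.
move=> pp; suff H f : trig_poly f -> exists2 g, trig_poly g & forall z, nrm2 z = 1 -> p z * f z = g z.
  have [g tg E] := H _ (trig_re 0).
  by exists g; [exact: trig_poly_harmonic|move=> z /E <-; rewrite /= mulr1].
elim: pp f => {p} [k|||p q _ Hp _ Hq|p q _ Hp _ Hq] f tf.
- by exists (fun z => k * f z); [exact: trig_scale|].
- exact: (trig_poly_mul_coord tf).1.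
- exact: (trig_poly_mul_coord tf).2.
- have [g1 t1 E1] := Hp f tf; have [g2 t2 E2] := Hq f tf.
  exists (fun z => g1 z + g2 z); first exact: trig_add.
  by move=> z z1; rewrite mulrDl E1 // E2.
- have [g1 t1 E1] := Hq f tf; have [g2 t2 E2] := Hp g1 t1.
  by exists g2 => // z z1; rewrite -mulrA E1 // E2.
Qed.

Lemma circle_bounds z : nrm2 z = 1 -> `|z.1| <= 1 /\ `|z.2| <= 1.
Proof.
rewrite /nrm2 => Hz; have := sqr_ge0 z.1; have := sqr_ge0 z.2 => h1 h2.
by rewrite -[`|z.1| <= 1]ler_sqr ?nnegrE // -[`|z.2| <= 1]ler_sqr ?nnegrE // !real_normK ?num_real // expr1n; split; lra.
Qed.

Lemma plane_poly_bounded p : plane_poly p ->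
  exists2 B : R, 0 < B & forall z, nrm2 z = 1 -> `|p z| <= B.
Proof.
elim=> {p} [k|||p q _ [B B0 HB] _ [C C0 HC]|p q _ [B B0 HB] _ [C C0 HC]].
- by exists (`|k| + 1); [rewrite ltr_wpDl|move=> z _; rewrite lerDl].
- by exists 1 => // z /circle_bounds[].
- by exists 1 => // z /circle_bounds[].
- exists (B + C); first exact: addr_gt0.
  by move=> z z1; apply: le_trans (ler_normD _ _) _; apply: lerD; [exact: HB|exact: HC].
- exists (B * C); first exact: mulr_gt0.
  by move=> z z1; rewrite normrM; apply: ler_pM => //; [exact: HB|exact: HC].
Qed.

(* The classical iteration [a <- a + (t^2 - a^2) / 2], converging to [|t|]. *)
Fixpoint abs_iter (n : nat) (t : R) : R :=
  if n is m.+1 then abs_iter m t + 2^-1 * (t * t + -1 * (abs_iter m t * abs_iter m t)) else 0.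

Lemma abs_iter_bounds n (t : R) : `|t| <= 1 ->
  [/\ 0 <= abs_iter n t, abs_iter n t <= `|t| & `|t| - abs_iter n t <= `|t| * (1 - `|t| / 2) ^+ n].
Proof.
move=> t1; have tt : t * t = `|t| * `|t| by rewrite -normrM ger0_norm // -expr2 sqr_ge0.
elim: n => [|n [a b c]] /=; first by rewrite expr0 mulr1 subr0.
rewrite tt; set x := `|t| in t1 a b c *; set y := abs_iter n t in a b c *.
have x0 : 0 <= x by rewrite /x.
have E : x - (y + 2^-1 * (x * x + -1 * (y * y))) = (x - y) * (1 - (x + y) / 2) by field.
have xy : 0 <= x - y by rewrite subr_ge0.
have h : 0 <= 1 - (x + y) / 2 by lra.
split.
- by have : 0 <= x * x - y * y by [nra]; lra.
- by rewrite -subr_ge0 E mulr_ge0.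
- rewrite E exprSr mulrA; apply: ler_pM => //; lra.
Qed.

Lemma abs_iter_approx (e : R) : 0 < e ->
  exists n, forall t, `|t| <= 1 -> `| `|t| - abs_iter n t| <= e.
Proof.
move=> e0; have [n Hn] := small_inv 2 e0; exists n.+1 => t t1.
have [a b c] := abs_iter_bounds n.+1 t1.
rewrite ger0_norm ?subr_ge0 //; apply: le_trans c _; apply: le_trans Hn.
set x := `|t| in t1 *; have x0 : 0 <= x by rewrite /x.
(* With [u = x / 2] this bounds the error [x (1 - x / 2)^m] by [2 / m] uniformly in [x], also near 0
   where the geometric decay is lost. *)
have key (u : R) m : 0 <= u -> u <= 1 -> (1 - u) ^+ m * (1 + m%:R * u) <= 1.
  move=> u0 u1; elim: m => [|m IH]; first by rewrite expr0 mul1r mul0r addr0.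
  apply: le_trans IH; rewrite exprSr -mulrA; apply: ler_wpM2l.
    by apply: exprn_ge0; lra.
  rewrite -natr1; have m0 : 0 <= m%:R :> R by [].
  have : 0 <= (m%:R + 1) * (u * u) by rewrite mulr_ge0 ?mulr_ge0 // addr_ge0.
  lra.
have x2 : 0 <= x / 2 by rewrite divr_ge0.
have := key (x / 2) n.+1 x2 (ltac:(lra)).
set A := (1 - x / 2) ^+ n.+1 => HA.
have A0 : 0 <= A by apply: exprn_ge0; lra.
rewrite ler_pdivlMr ?ltr0Sn //.
have : A * (n.+1%:R * (x / 2)) <= 1.
  by apply: le_trans HA; apply: ler_wpM2l => //; rewrite lerDr.
have -> : A * (n.+1%:R * (x / 2)) = x * A * n.+1%:R / 2 by field.
by rewrite ler_pdivrMr // mul1r.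
Qed.

Definition circle_approx (f : R * R -> R) : Prop := forall e : R, 0 < e ->
  exists2 p, plane_poly p & forall z, nrm2 z = 1 -> `|f z - p z| <= e.

Lemma abs_iter_poly p n : plane_poly p -> plane_poly (fun z => abs_iter n (p z)).
Proof.
move=> pp; elim: n => [|n IH] /=; first exact: pp_const.
apply: pp_add => //; apply: pp_mul; first exact: pp_const.
apply: pp_add; first exact: pp_mul.
by apply: pp_mul; [exact: pp_const|exact: pp_mul].
Qed.

Lemma circle_approx_abs p : plane_poly p -> circle_approx (fun z => `|p z|).
Proof.
move=> pp e e0; have [B B0 HB] := plane_poly_bounded pp.
have [n Hn] := abs_iter_approx (divr_gt0 e0 B0).
exists (fun z => B * abs_iter n (B^-1 * p z)).
  by apply: pp_mul; [exact: pp_const|apply: abs_iter_poly; apply: pp_mul; [exact: pp_const|]].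
move=> z z1.
have h : `|B^-1 * p z| <= 1.
  by rewrite normrM gtr0_norm ?invr_gt0 // ler_pdivrMl // mulr1; exact: HB.
have -> : `|p z| = B * `|B^-1 * p z|.
  by rewrite normrM gtr0_norm ?invr_gt0 // mulrA divff ?gt_eqF // mul1r.
rewrite -mulrBr normrM (gtr0_norm B0).
by rewrite -ler_pdivlMl // (mulrC _ e); exact: Hn.
Qed.

Lemma min_lipschitz (a b c d e : R) : `|a - c| <= e -> `|b - d| <= e ->
  `|Num.min a b - Num.min c d| <= e.
Proof.
rewrite !ler_norml => /andP[h1 h2] /andP[h3 h4].
by rewrite /Num.min; case: ltP => ab; case: ltP => cd; apply/andP; split; lra.
Qed.

(** [min (p, q) = (p + q - |p - q|) / 2], and the absolute value of a polynomial is approximable;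
    the minimum is 1-Lipschitz in its arguments. *)
Lemma circle_approx_min f g : circle_approx f -> circle_approx g ->
  circle_approx (fun z => Num.min (f z) (g z)).
Proof.
move=> af ag e e0; have e2 : 0 < e / 2 by rewrite divr_gt0.
have [p pp Hp] := af _ e2; have [q pq Hq] := ag _ e2.
have pm : plane_poly (fun z => p z + -1 * q z).
  by apply: pp_add => //; apply: pp_mul => //; exact: pp_const.
have [r pr Hr] := circle_approx_abs pm e2.
exists (fun z => 2^-1 * ((p z + q z) + -1 * r z)).
  by repeat first [apply: pp_mul|apply: pp_add|exact: pp_const|exact: pr|exact: pp|exact: pq].
move=> z z1.
have h1 := min_lipschitz (Hp z z1) (Hq z z1).
have -> : Num.min (f z) (g z) - 2^-1 * (p z + q z + -1 * r z) =
  (Num.min (f z) (g z) - Num.min (p z) (q z)) + - (2^-1 * (`|p z + -1 * q z| - r z)).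
  have -> : Num.min (p z) (q z) = 2^-1 * ((p z + q z) - `|p z + -1 * q z|).
    rewrite mulN1r /Num.min; case: ltP => pq'.
      by rewrite ltr0_norm ?subr_lt0 //; field.
    by rewrite ger0_norm ?subr_ge0 //; field.
  by field.
apply: le_trans (ler_normD _ _) _; rewrite normrN normrM gtr0_norm ?invr_gt0 //.
have := Hr z z1; lra.
Qed.

Lemma compact_circle : compact [set z : R * R | nrm2 z = 1].
Proof.
have cl : closed [set z : R * R | nrm2 z = 1].
  have := (continuous_closedP (nrm2 : R * R -> R)).1 (@nrm2_cont R) [set x | x = 1].
  by apply; exact: closed_eq.
apply: (subclosed_compact cl (@compact_square R 1)) => z /= z1.
exact: circle_bounds.
Qed.

(* Dini's argument for families directed downwards. *)
Lemma compact_directed_inf (A : set (R * R)) (Fam : (R * R -> R) -> Prop) (b : R * R -> R) :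
  compact A -> (exists g, Fam g) ->
  (forall g1 g2, Fam g1 -> Fam g2 ->
     exists2 g, Fam g & forall z, A z -> g z <= g1 z /\ g z <= g2 z) ->
  (forall z, A z -> exists2 g, Fam g & \forall w \near z, g w <= b w) ->
  exists2 g, Fam g & forall z, A z -> g z <= b z.
Proof.
move=> cA [g0 Fg0] dir loc.
pose F := filter_from Fam (fun g => [set g' | Fam g' /\ forall z, A z -> g' z <= g z]).
have FF : ProperFilter F.
  apply: filter_from_proper; last by move=> g Fg; exists g; split.
  apply: filter_from_filter; first by exists g0.
  move=> g1 g2 F1 F2; have [g Fg Hg] := dir _ _ F1 F2; exists g => //.
  move=> g' [Fg' Hg']; split; split => // z Az;
    apply: le_trans (Hg' z Az) _; by have [] := Hg z Az.
have := (@compact_near_coveringP _ A).1 cA _ F (fun g z => A z -> g z <= b z) FF.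
case.
- move=> z Az; have [g Fg Hg] := loc z Az.
  exists ([set w | g w <= b w], [set g' | Fam g' /\ forall z, A z -> g' z <= g z]) => /=.
    by split => //; exists g.
  move=> [w g'] /= [gb [_ gg]] Aw; exact: le_trans (gg w Aw) gb.
move=> g Fg H.
have [g' [Fg' _]] : [set g' | Fam g' /\ forall z, A z -> g' z <= g z] !=set0 by exists g; split.
exists g => // z Az; apply: (H g) => //.
Qed.

(** The lattice argument of Stone and Weierstrass. Majorants of [f] that are uniform limits of
    polynomials are stable under minima. The paraboloid [F z] is one of them and stays below
    [f + 3 e / 4] near [z], so the Dini argument yields one majorant uniformly close to [f]. *)
Lemma circle_approx_continuous f :
  (forall z, nrm2 z = 1 -> {for z, continuous f}) -> circle_approx f.
Proof.
move=> cf e e0; have e4 : 0 < e / 4 by rewrite divr_gt0.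
pose S := [set z : R * R | nrm2 z = 1].
have S0 : S !=set0 by exists (1, 0); rewrite /S /nrm2 /= expr1n expr0n addr0.
have cS : compact S by exact: compact_circle.
have [M HM] : exists M : R, forall z, S z -> `|f z| <= M.
  have [c cA Hc] : exists2 c, c \in S & forall t, t \in S -> `|f t| <= `|f c|.
    apply: compact_EVT_max => //; apply: continuous_in_subspaceT => z /set_mem Sz.
    by apply: continuous_comp (cf z Sz) _; exact: norm_continuous.
  by exists `|f c| => z Sz; apply: Hc; exact: mem_set.
have M0 : 0 <= M by case: S0 => z /HM; apply: le_trans.
pose N (z w : R * R) := nrm2 (w.1 - z.1, w.2 - z.2).
have Npp (z : R * R) : plane_poly (N z).
  have E : N z = (fun w => (w.1 + - z.1) * (w.1 + - z.1) + (w.2 + - z.2) * (w.2 + - z.2)).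
    by apply/funext => w; rewrite /N /nrm2 /= !expr2.
  rewrite E; repeat first [apply: pp_add | apply: pp_mul | exact: pp_const | exact: pp_fst | exact: pp_snd].
have Ncont (z w : R * R) : cont_at (N z) w.
  rewrite /N /nrm2 /=; cont_step.
have loc z : exists d : R, S z -> 0 < d /\ forall w, N z w < d -> `|f z - f w| <= e / 4.
  have [Sz|nSz] := pselect (S z); last by exists 0.
  have /cvgrPdist_le /(_ _ e4) /nbhs_ballP [d /= d0 Hd] := cf z Sz.
  (* [N z w] is a squared distance, hence the square of the radius of continuity. *)
  exists (d ^+ 2) => _; split; first by rewrite exprn_gt0.
  move=> w; rewrite /N /nrm2 /= => Hw; apply: Hd; apply/plane_ballP.
  have h1 := sqr_ge0 (w.1 - z.1); have h2 := sqr_ge0 (w.2 - z.2).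
  have sq (x : R) : x ^+ 2 < d ^+ 2 -> `|x| < d.
    by move=> xd; rewrite -ltr_sqr ?nnegrE ?(ltW d0) // real_normK ?num_real.
  by rewrite distrC (distrC z.2); split; apply: sq; lra.
move/choice : loc => [d Hd].
pose F z w := f z + e / 4 + 2 * M / d z * N z w.
have FP z : plane_poly (F z).
  by apply: pp_add; [apply: pp_add; exact: pp_const|apply: pp_mul => //; exact: pp_const].
have Fge z w : S z -> S w -> f w <= F z w.
  move=> Sz Sw; have [dz0 dz] := Hd z Sz.
  have N0 : 0 <= N z w by exact: nrm2_ge0.
  rewrite /F; have [Nd|Nd] := ltP (N z w) (d z).
    have := dz w Nd; rewrite ler_norml => /andP[h1 h2].
    have : 0 <= 2 * M / d z * N z w by rewrite mulr_ge0 // divr_ge0 ?mulr_ge0 // ltW.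
    lra.
  have := HM z Sz; have := HM w Sw; rewrite !ler_norml => /andP[h1 h2] /andP[h3 h4].
  have : 2 * M <= 2 * M / d z * N z w.
    by rewrite mulrAC ler_pdivlMr //; apply: ler_wpM2l => //; rewrite mulr_ge0.
  lra.
pose V z := [set w | S z /\ F z w < f z + e / 2 /\ N z w < d z].
have Vnear z : S z -> nbhs z (V z).
  move=> Sz; have [dz0 dz] := Hd z Sz.
  have Nzz : N z z = 0 by rewrite /N /nrm2 /= !subrr !expr0n addr0.
  have cF : cont_at (F z) z.
    rewrite /F; apply: cont_atD; first exact: cont_const.
    by apply: cont_atM; [exact: cont_const|exact: Ncont].
  have n1 : nbhs z [set w | F z w < f z + e / 2].
    by apply: (cF [set x | x < f z + e / 2]); apply: lt_nbhsl; rewrite /F Nzz mulr0; lra.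
  have n2 : nbhs z [set w | N z w < d z].
    by apply: (@Ncont z z [set x | x < d z]); apply: lt_nbhsl; rewrite Nzz.
  by apply: filterS2 n1 n2 => w.
pose Fam (g : R * R -> R) := circle_approx g /\ forall w, S w -> f w <= g w.
have triv p : plane_poly p -> circle_approx p.
  by move=> pp x x0; exists p => // w _; rewrite subrr normr0 ltW.
have [|g1 g2 [a1 b1] [a2 b2]|z Sz|g [ga gb] gS] :=
  @compact_directed_inf S Fam (fun w => f w + 3 * (e / 4)) cS.
- exists (fun=> M); split; first by apply: triv; exact: pp_const.
  by move=> w /HM; rewrite ler_norml => /andP[].
- exists (fun w => Num.min (g1 w) (g2 w)); last first.
    by move=> w _; rewrite !ge_min !lexx orbT.
  split; first exact: circle_approx_min.
  by move=> w Sw; rewrite le_min b1 // b2.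
- exists (F z); first by split; [exact: triv|move=> w; exact: Fge].
  have [dz0 dz] := Hd z Sz.
  apply: filterS (Vnear z Sz) => w [_ [Fz Nz]].
  by have := dz w Nz; rewrite ler_norml => /andP[h1 h2]; lra.
have [p pp Hp] := ga _ e4; exists p => // w w1.
have := Hp w w1; have := gb w w1; have := gS w w1; rewrite !ler_norml => h1 h2 /andP[h3 h4].
by apply/andP; split; lra.
Qed.

Lemma cvg_le_near (f : R * R -> R) z (e : R) : {for z, continuous f} -> 0 < e ->
  \forall w \near z, `|f w - f z| <= e.
Proof.
move=> /cvgrPdist_le cf e0; have := cf _ e0.
by apply: filterS => w; rewrite distrC.
Qed.

Lemma near_continuousP (f : R * R -> R) z :
  (forall e : R, 0 < e -> \forall w \near z, `|f w - f z| <= e) -> {for z, continuous f}.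
Proof.
move=> H; apply/cvgrPdist_le => e e0; have := H _ e0.
by apply: filterS => w; rewrite distrC.
Qed.

Lemma open_unit_disc : open [set z : R * R | nrm2 z < 1].
Proof. by apply: open_lt_cont => z; exact: nrm2_cont. Qed.

(** Polynomial data have explicit solutions, and the maximum principle makes these Cauchy on the
    closed disc. The solution is continued by [f] outside, so that continuity at the circle is
    two-sided and the function can be glued into a larger domain. *)
Lemma unit_disc_dirichlet (f : R * R -> R) :
  (forall z, nrm2 z = 1 -> {for z, continuous f}) ->
  exists u, [/\ harmonic_on [set z | nrm2 z < 1] u,
    (forall z, 1 <= nrm2 z -> u z = f z) &
    (forall z, nrm2 z <= 1 -> {for z, continuous u})].
Proof.
move=> cf.
pose D := [set z : R * R | nrm2 z < 1]; have oD : open D := open_unit_disc.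
have : forall n : nat, exists v, harmonic_on setT v /\
    forall z, nrm2 z = 1 -> `|f z - v z| <= 1 / n.+1%:R.
  move=> n; have [|p pp Hp] := circle_approx_continuous cf (e := 1 / n.+1%:R); first by rewrite divr_gt0.
  have [v hv E] := plane_poly_trig pp; exists v; split => // z z1.
  by rewrite -E //; exact: Hp.
move=> /choice [v Hv].
have hv n : harmonic_on setT (v n) by case: (Hv n).
have vE n z : nrm2 z = 1 -> `|f z - v n z| <= 1 / n.+1%:R by case: (Hv n) => _; apply.
have vc n z : {for z, continuous (v n)} by exact: harmonic_continuous openT I (hv n).
have one n m z : nrm2 z <= 1 -> v n z - v m z <= 1 / n.+1%:R + 1 / m.+1%:R.
  move=> z1.
  have bd w : nrm2 w = 1 -> v n w - v m w <= 1 / n.+1%:R + 1 / m.+1%:R.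
    move=> w1; have -> : v n w - v m w = (f w - v m w) - (f w - v n w) by ring.
    apply: le_trans (ler_norm _) _; apply: le_trans (ler_normB _ _) _.
    by rewrite addrC; apply: lerD; exact: vE.
  have [Dz|] := ltP (nrm2 z) 1; last first.
    by move=> z1'; apply: bd; apply/eqP; rewrite eq_le z1.
  have hB : harmonic_on setT (fun z => v n z - v m z) by exact: (harmonicB openT (hv n) (hv m)).
  apply: (@max_principle_bounded R D [set z | nrm2 z <= 1] (fun z => v n z - v m z) _ oD) => //.
  - by apply: closed_le_cont => w; exact: nrm2_cont.
  - by move=> w /ltW.
  - by exists 1 => w /ltW.
  - by move=> w _; exact: harmonic_continuous openT I hB.
  - by apply: (harmonic_vsub oD); exact: harmonic_sub hB.
  - by move=> w /= w1 /negP; rewrite -leNgt => w1'; apply: bd; apply/eqP; rewrite eq_le w1.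
have [u0 Hu0] : exists l : R * R -> R, forall n z, nrm2 z <= 1 -> `|l z - v n z| <= 1 / n.+1%:R.
  apply: (@cauchy_limit_fun R (R * R)%type [set z | nrm2 z <= 1] v 1) => n m z z1.
  rewrite ler_norml; apply/andP; split; last exact: one.
  by rewrite lerNl opprB; have := one m n z z1; rewrite (addrC (1 / m.+1%:R)).
have u0f z : nrm2 z = 1 -> u0 z = f z.
  move=> z1; apply/eqP; rewrite -subr_eq0 -normr_le0; apply/ler_addgt0Pr => e e0; rewrite add0r.
  have [n Hn] := small_inv 1 (divr_gt0 e0 (ltr0Sn R 1)).
  have -> : u0 z - f z = (u0 z - v n z) - (f z - v n z) by ring.
  apply: le_trans (ler_normB _ _) _; rewrite (splitr e); apply: lerD; apply: le_trans Hn.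
    by apply: Hu0; rewrite z1.
  exact: vE.
pose u z := if nrm2 z < 1 then u0 z else f z.
have uD z : nrm2 z <= 1 -> u z = u0 z.
  by move=> z1; rewrite /u; case: ltP => // z1'; rewrite u0f //; apply/eqP; rewrite eq_le z1.
have hu : harmonic_on D u.
  apply: (harmonic_uniform_limit oD) => z Dz.
  have /nbhs_ballP [r /= r0 Hr] : nbhs z D by exact: open_nbhs_nbhs.
  exists r => // e e0; have [n Hn] := small_inv 1 e0.
  exists (v n); first exact: harmonic_sub (hv n).
  move=> y /Hr /ltW y1; rewrite uD //; apply: le_trans Hn; exact: Hu0.
exists u; split => //.
  by move=> z z1; rewrite /u ltNge z1.
move=> z z1; have [Dz|z1'] := ltP (nrm2 z) 1.
  exact: harmonic_continuous oD Dz hu.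
have {}z1' : nrm2 z = 1 by apply/eqP; rewrite eq_le z1.
apply: near_continuousP => e e0.
have e3 : 0 < e / 3 by rewrite divr_gt0.
have [n Hn] := small_inv 1 e3.
have n1 := cvg_le_near (vc n z) e3.
have n2 := cvg_le_near (cf z z1') e3.
apply: filterS2 n1 n2 => w w1 w2; rewrite (uD z) // (u0f z) //.
rewrite /u; case: ltP => wD; last by apply: le_trans w2 _; lra.
have -> : u0 w - f z = (u0 w - v n w) + (v n w - v n z) - (f z - v n z) by ring.
have h1 : `|u0 w - v n w| <= e / 3 by apply: le_trans Hn; apply: Hu0; exact: ltW.
have h2 : `|f z - v n z| <= e / 3 by apply: le_trans Hn; exact: vE.
apply: le_trans (ler_normB _ _) _; have := ler_normD (u0 w - v n w) (v n w - v n z); lra.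
Qed.

Lemma cont_at_comp_plane (f : R * R -> R) (p q : R * R -> R) z :
  {for (p z, q z), continuous f} -> cont_at p z -> cont_at q z ->
  {for z, continuous (fun w => f (p w, q w))}.
Proof.
move=> cf cp cq; apply: (@continuous_comp _ _ _ (fun w => (p w, q w)) f) => //.
exact: (@cvg_plane R _ _ _ p q (p z) (q z) cp cq).
Qed.

Theorem disc_dirichlet (c : R * R) (r : R) (f : R * R -> R) : 0 < r ->
  (forall z, nrm2 (z - c) = r ^+ 2 -> {for z, continuous f}) ->
  exists u, [/\ harmonic_on [set z | nrm2 (z - c) < r ^+ 2] u,
    (forall z, r ^+ 2 <= nrm2 (z - c) -> u z = f z) &
    (forall z, nrm2 (z - c) <= r ^+ 2 -> {for z, continuous u})].
Proof.
move=> r0 cf.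
pose s (z : R * R) : R * R := (r * z.1 - 1 * 0 * z.2 + c.1, 0 * z.1 + 1 * r * z.2 + c.2).
pose t (z : R * R) : R * R := (r^-1 * z.1 - 1 * 0 * z.2 + - (r^-1 * c.1), 0 * z.1 + 1 * r^-1 * z.2 + - (r^-1 * c.2)).
have rn0 : r != 0 by rewrite gt_eqF.
have st z : s (t z) = z.
  by rewrite [RHS]surjective_pairing /s /t /=; congr pair; field.
have ts z : t (s z) = z.
  by rewrite [RHS]surjective_pairing /s /t /=; congr pair; field.
have N1 z : nrm2 (s z - c) = r ^+ 2 * nrm2 z.
  by rewrite /nrm2 /s /=; ring.
have N2 z : nrm2 (t z) = r ^- 2 * nrm2 (z - c).
  by rewrite -[X in nrm2 (X - c)]st N1 mulrA mulVf ?mul1r // expf_neq0.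
have r2 : 0 < r ^+ 2 by rewrite exprn_gt0.
have [z z1|u [hu uf cu]] := @unit_disc_dirichlet (f \o s).
  apply: (@cont_at_comp_plane f (fun z => (s z).1) (fun z => (s z).2)).
  - by apply: cf; rewrite -surjective_pairing N1 z1 mulr1.
  - rewrite /s /=; cont_step.
  - rewrite /s /=; cont_step.
have oD : open [set z : R * R | nrm2 (z - c) < r ^+ 2].
  by apply: open_lt_cont => z; rewrite /nrm2 /=; cont_step.
have s2 : 1 ^+ 2 = 1 :> R by rewrite expr1n.
exists (u \o t); split.
- apply: (@harmonic_affine R 1 r^-1 0 (- (r^-1 * c.1)) (- (r^-1 * c.2)) _ _ u s2 oD open_unit_disc hu).
  by move=> z /= zD; rewrite -/(t z) N2 mulrC ltr_pdivrMr // mul1r.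
- move=> z /= zD; rewrite uf /= ?st // N2 mulrC ler_pdivlMr // mul1r //.
- move=> z /= zD.
  apply: (@cont_at_comp_plane u (fun z => (t z).1) (fun z => (t z).2)).
  - by apply: cu; rewrite -surjective_pairing N2 mulrC ler_pdivrMr // mul1r.
  - rewrite /t /=; cont_step.
  - rewrite /t /=; cont_step.
Qed.

End DiscDirichlet.

(** * Removable singularities and Lipschitz bounds *)

Section Removable.
Context {R : realType}.
Implicit Types (h u v w : R * R -> R) (z y : R * R).

Definition disc (c : R * R) (r : R) : set (R * R) := [set z | nrm2 (z - c) < r ^+ 2].

Lemma open_disc c r : open (disc c r).
Proof. by apply: open_lt_cont => z; rewrite /nrm2 /=; cont_step. Qed.

Lemma nrm2B_cont c z : cont_at (fun z => nrm2 (z - c)) z.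
Proof. by rewrite /nrm2 /=; cont_step. Qed.

Lemma gt_open (f : R * R -> R) (a : R) : (forall z, cont_at f z) -> open [set z | a < f z].
Proof.
move=> cf; have := (continuousP f).1 cf [set x | a < x].
by apply; exact: open_gt.
Qed.

Lemma ln_nrm2_cont z : z != 0 -> cont_at (fun z => 2^-1 * ln (nrm2 z)) z.
Proof.
move=> z0.
have oP : open [set z : R * R | 0 < nrm2 z] by apply: gt_open => y; exact: nrm2_cont.
have nP : ~ [set z : R * R | 0 < nrm2 z] 0 by rewrite /= nrm2_gt0 eqxx.
have Pz : [set z : R * R | 0 < nrm2 z] z by rewrite /= nrm2_gt0.
exact: harmonic_continuous oP Pz (harmonic_ln_nrm2 oP nP).
Qed.

Lemma ler_gt0_lim (a b c : R) : (forall d : R, 0 < d -> a <= b + d * c) -> a <= b.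
Proof.
move=> H; apply/ler_addgt0Pr => e e0.
have c0 : 0 < `|c| + 1 by rewrite ltr_wpDl.
apply: le_trans (H (e / (`|c| + 1)) _) _; first by rewrite divr_gt0.
rewrite lerD2l mulrAC ler_pdivrMr // ler_pM2l //.
by apply: le_trans (ler_norm _) _; rewrite lerDl.
Qed.

(** The barrier [d (ln r - ln |z|)] vanishes on the circle and is infinite at the puncture, so it
    dominates the bounded [w] for every [d > 0]; then [d] tends to 0. *)
Lemma punctured_disc_max (r M : R) w : 0 < r ->
  harmonic_on [set z | z != 0 /\ nrm2 z < r ^+ 2] w ->
  (forall z, z != 0 -> nrm2 z < r ^+ 2 -> w z <= M) ->
  (forall z, nrm2 z = r ^+ 2 -> {for z, continuous w} /\ w z <= 0) ->
  forall z, z != 0 -> nrm2 z < r ^+ 2 -> w z <= 0.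
Proof.
move=> r0 hw wM wb z z0 zr.
pose U := [set z : R * R | z != 0 /\ nrm2 z < r ^+ 2].
have oU : open U.
  have -> : U = [set z | 0 < nrm2 z] `&` [set z | nrm2 z < r ^+ 2].
    by apply/seteqP; split => y /=; rewrite nrm2_gt0.
  by apply: openI; [apply: gt_open|apply: open_lt_cont] => y; exact: nrm2_cont.
pose l (z : R * R) := 2^-1 * ln (nrm2 z).
have hl : harmonic_on U l by apply: harmonic_ln_nrm2 => // -[]; rewrite eqxx.
apply: (@ler_gt0_lim _ _ (ln r - l z)) => d d0; rewrite add0r -subr_le0.
pose W := fun z : R * R => w z - d * (ln r - l z).
have hW : harmonic_on U W.
  by apply: (harmonicB oU hw); apply: (harmonicZ d oU); apply: (harmonicB oU (harmonic_cst _ oU) hl).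
have lr y : nrm2 y = r ^+ 2 -> l y = ln r.
  by move=> yr; rewrite /l yr lnXn // -[ln r *+ 2]mulr_natl mulrA mulVf ?mul1r // pnatr_eq0.
apply: (@max_principle R U W 0 oU) => //.
- by move=> y Uy; exact: harmonic_continuous oU Uy hW.
- exact: harmonic_vsub oU hW.
- move=> e e0 y nUy; rewrite add0r.
  have [y0|y0] := eqVneq y 0.
    pose K := expR (2 * (ln r - (`|M| + 1) / d)).
    have : nbhs y [set y | nrm2 y < K].
      apply: (@nrm2_cont _ y [set x | x < K]); apply: lt_nbhsl.
      by rewrite y0 /nrm2 /= !expr0n addr0 expR_gt0.
    apply: filterS => x /= xK [x0 xr].
    have : l x <= ln r - (`|M| + 1) / d.
      rewrite /l -(ler_pM2l (ltr0Sn R 1)) mulrA mulfV ?mul1r //.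
      by rewrite -ler_expR lnK ?posrE ?nrm2_gt0 //; exact: ltW.
    have := wM x x0 xr; have := ler_norm M => h1 h2 h3.
    have : (`|M| + 1) <= d * (ln r - l x).
      by rewrite mulrC -ler_pdivrMr //; lra.
    by rewrite /W; lra.
  have [yr|yr] := eqVneq (nrm2 y) (r ^+ 2).
    have [cw w0] := wb y yr.
    have cl : cont_at l y.
      exact: ln_nrm2_cont.
    have cW : cont_at W y.
      rewrite /W; apply: cont_atD; first exact: cw.
      apply: cont_atN; apply: cont_atM; first exact: cont_const.
      by apply: cont_atD; [exact: cont_const|exact: cont_atN].
    have : nbhs y [set x | W x < e].
      apply: (cW [set x | x < e]); apply: lt_nbhsl.
      by rewrite /W lr // subrr mulr0 subr0; exact: le_lt_trans e0.
    by apply: filterS => x /= /ltW.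
  have yr' : r ^+ 2 < nrm2 y.
    rewrite lt_neqAle eq_sym yr /= leNgt; apply/negP => yr'; apply: nUy; split => //.
  have : nbhs y [set x | r ^+ 2 < nrm2 x].
    by apply: (@nrm2_cont _ y [set x | r ^+ 2 < x]); exact: lt_nbhsr.
  by apply: filterS => x /= h [_]; rewrite ltNge (ltW h).
- move=> e e0; exists (r ^+ 2) => y [_ h]; by rewrite ltNge (ltW h).
Qed.

(** The radius [2 r] makes [u] continuous on the circle of radius [r]. The Dirichlet solution there
    with data [u] differs from [u] by a bounded function vanishing on the circle, and
    [punctured_disc_max] with both signs makes it zero. *)
Theorem removable_singularity (r M : R) u : 0 < r ->
  harmonic_on [set z | z != 0 /\ nrm2 z < (2 * r) ^+ 2] u ->
  (forall z, z != 0 -> nrm2 z < (2 * r) ^+ 2 -> `|u z| <= M) ->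
  exists v, [/\ harmonic_on [set z | nrm2 z < r ^+ 2] v,
     (forall z, z != 0 -> nrm2 z < r ^+ 2 -> v z = u z) &
     forall z, nrm2 z < r ^+ 2 -> `|v z| <= M].
Proof.
move=> r0 hu uM.
pose U2 := [set z : R * R | z != 0 /\ nrm2 z < (2 * r) ^+ 2].
have oU2 : open U2.
  have -> : U2 = [set z | 0 < nrm2 z] `&` [set z | nrm2 z < (2 * r) ^+ 2].
    by apply/seteqP; split => y /=; rewrite nrm2_gt0.
  by apply: openI; [apply: gt_open|apply: open_lt_cont] => y; exact: nrm2_cont.
have r2 : 0 < r ^+ 2 by rewrite exprn_gt0.
have rr : r ^+ 2 < (2 * r) ^+ 2 by rewrite exprMn; lra.
have U2S z : nrm2 z = r ^+ 2 -> U2 z.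
  by move=> zr; split; [rewrite -nrm2_gt0 zr|rewrite zr].
have cu z : nrm2 z = r ^+ 2 -> {for z, continuous u}.
  by move=> /U2S Uz; exact: harmonic_continuous oU2 Uz hu.
have [|v [hv vf cv]] := @disc_dirichlet R 0 r u r0.
  by move=> z; rewrite subr0; exact: cu.
have E0 : [set z : R * R | nrm2 (z - 0) < r ^+ 2] = [set z | nrm2 z < r ^+ 2].
  by apply/seteqP; split => z /=; rewrite subr0.
rewrite E0 in hv.
have oD : open [set z : R * R | nrm2 z < r ^+ 2] by apply: open_lt_cont => z; exact: nrm2_cont.
pose U := [set z : R * R | z != 0 /\ nrm2 z < r ^+ 2].
have UU2 : U `<=` U2 by move=> z [a b]; split => //; exact: lt_trans rr.
have UD : U `<=` [set z | nrm2 z < r ^+ 2] by move=> z [].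
have vb z : nrm2 z < r ^+ 2 -> `|v z| <= M.
  have one w : harmonic_on [set z | nrm2 z < r ^+ 2] w ->
      (forall z, nrm2 z <= r ^+ 2 -> {for z, continuous w}) ->
      (forall z, nrm2 z = r ^+ 2 -> w z <= M) -> forall z, nrm2 z < r ^+ 2 -> w z <= M.
    move=> hw cw wM; apply: (@max_principle_bounded R _ [set z | nrm2 z <= r ^+ 2] w M oD).
    - by apply: closed_le_cont => y; exact: nrm2_cont.
    - by move=> y /ltW.
    - by exists (r ^+ 2) => y /ltW.
    - exact: cw.
    - exact: harmonic_vsub oD hw.
    - by move=> y /= y1 /negP; rewrite -leNgt => y2; apply: wM; apply/eqP; rewrite eq_le y1.
  have vE y : nrm2 y = r ^+ 2 -> v y = u y by move=> yr; rewrite vf // subr0 yr.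
  have uMr y : nrm2 y = r ^+ 2 -> `|u y| <= M by move=> /U2S [a b]; exact: uM.
  have cv' y : nrm2 y <= r ^+ 2 -> {for y, continuous v} by move=> yr; apply: cv; rewrite subr0.
  move=> zr; rewrite ler_norml; apply/andP; split; last first.
    apply: (one v hv cv') => // y yr; rewrite vE //.
    by apply: le_trans (ler_norm _) _; exact: uMr.
  have cN y : nrm2 y <= r ^+ 2 -> {for y, continuous (fun z => - v z)}.
    by move=> /cv' cy; exact: cont_atN.
  have bN y : nrm2 y = r ^+ 2 -> - v y <= M.
    by move=> yr; rewrite vE //; apply: le_trans (ler_norm _) _; rewrite normrN; exact: uMr.
  by rewrite lerNl; exact: (one (fun z => - v z) (harmonicN oD hv) cN bN z zr).
exists v; split => // z z0 zr.
have oU : open U.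
  have -> : U = [set z | 0 < nrm2 z] `&` [set z | nrm2 z < r ^+ 2].
    by apply/seteqP; split => y /=; rewrite nrm2_gt0.
  by apply: openI; [apply: gt_open|apply: open_lt_cont] => y; exact: nrm2_cont.
have hu' : harmonic_on U u by exact: harmonic_sub hu.
have hv' : harmonic_on U v by exact: harmonic_sub hv.
apply/eqP; rewrite eq_le; apply/andP; split; rewrite -subr_le0.
- refine (@punctured_disc_max r (M + M) (fun z => v z - u z) r0 (harmonicB oU hv' hu') _ _ z z0 zr).
  + move=> y y0 yr; have := vb y yr; have := uM y y0 (lt_trans yr rr).
    rewrite !ler_norml => /andP[h1 h2] /andP[h3 h4]; lra.
  + move=> y yr; split; last by rewrite vf ?subr0 ?yr // subrr.
    by apply: cont_atD; [apply: cv; rewrite subr0 yr|apply: cont_atN; exact: cu].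
- refine (@punctured_disc_max r (M + M) (fun z => u z - v z) r0 (harmonicB oU hu' hv') _ _ z z0 zr).
  + move=> y y0 yr; have := vb y yr; have := uM y y0 (lt_trans yr rr).
    rewrite !ler_norml => /andP[h1 h2] /andP[h3 h4]; lra.
  + move=> y yr; split; last by rewrite vf ?subr0 ?yr // subrr.
    by apply: cont_atD; [exact: cu|apply: cont_atN; apply: cv; rewrite subr0 yr].
Qed.

(** Points of the ball of radius [d / 8] are joined by two axis-parallel legs of length at most
    [d / 4]. These stay in the ball of radius [d / 2], where the gradient estimate gives
    [8 M / d]. *)
Lemma harmonic_lipschitz (z0 : R * R) (d M : R) w : 0 < d ->
  harmonic_on (ball z0 d) w -> (forall z, ball z0 d z -> `|w z| <= M) ->
  forall y z, ball z0 (d / 8) y -> ball z0 (d / 8) z ->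
  `|w y - w z| <= 8 * M / d * (`|y.1 - z.1| + `|y.2 - z.2|).
Proof.
move=> d0 hw wM y z By Bz.
have d2 : 0 < d / 2 by rewrite divr_gt0.
have oB := @open_ball_plane R z0 d.
have sub x : ball z0 (d / 2) x -> ball x (d / 2) `<=` ball z0 d.
  by move=> Bx x' Bx'; have := ball_center_le Bx Bx'; rewrite -splitr.
have Bs x : ball z0 (d / 2) x -> ball z0 d x by apply: le_ball; lra.
have Dg (v x : R * R) : axis_dir v -> ball z0 (d / 2) x -> `|'D_v w x| <= 8 * M / d.
  move=> vd Bx; have -> : 8 * M / d = 4 * M / (d / 2) by field; rewrite gt_eqF.
  exact: (gradient_estimate vd d2 (harmonic_sub (sub x Bx) hw) (fun x' B' => wM x' (sub x Bx x' B'))).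
have dx : axis_dir (dirx R) by left. have dy : axis_dir (diry R) by right.
move/plane_ballP : By => [y1 y2]; move/plane_ballP : Bz => [z1 z2].
have t1 : `|y.1 - z.1| <= d / 4.
  have -> : y.1 - z.1 = (z0.1 - z.1) - (z0.1 - y.1) by ring.
  by apply: le_trans (ler_normB _ _) _; lra.
have t2 : `|y.2 - z.2| <= d / 4.
  have -> : y.2 - z.2 = (z0.2 - z.2) - (z0.2 - y.2) by ring.
  by apply: le_trans (ler_normB _ _) _; lra.
have leg (v x : R * R) (t : R) : axis_dir v -> ball z0 (d / 8) x -> `|t| <= d / 4 ->
    `|w (t *: v + x) - w x| <= `|t| * (8 * M / d).
  move=> vd Bx td.
  have inB s : `|s| <= `|t| -> ball z0 (d / 2) (s *: v + x).
    move=> st; have := ball_shift_axis vd Bx (le_trans st td).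
    by apply: le_ball; lra.
  have [s st ->] := @mean_value_direction R (R * R)%type w ('D_v w) x v t
    (fun s st => harmonic_derivable vd oB hw (Bs _ (inB s st))).
  by rewrite normrM ler_wpM2l //; exact: Dg vd (inB s st).
have B1 : ball z0 (d / 8) z by apply/plane_ballP.
have B2 : ball z0 (d / 8) (y.1, z.2) by apply/plane_ballP.
have := leg _ z (y.1 - z.1) dx B1 t1; have := leg _ (y.1, z.2) (y.2 - z.2) dy B2 t2.
rewrite shift_diry shift_dirx /= !subrK -!surjective_pairing => L2 L1.
have -> : w y - w z = (w y - w (y.1, z.2)) + (w (y.1, z.2) - w z) by ring.
apply: le_trans (ler_normD _ _) _; rewrite mulrDr addrC.
by apply: lerD; rewrite mulrC; [exact: L1|exact: L2].
Qed.

End Removable.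

(** * Perron's method between a subsolution and a supersolution *)

Section Perron.
Context {R : realType}.
Implicit Types (h u v w : R * R -> R) (z y c : R * R) (U : set (R * R)).

Definition sub_between U v0 v1 v : Prop :=
  [/\ forall z, U z -> {for z, continuous v}, vsub U v &
      forall z, U z -> v0 z <= v z <= v1 z].

(** A test function for [v'] at a point where [v] touches [v'] from below is also one for [v]. This
    covers maxima and Poisson modifications. *)
Lemma vsub_near U v v' z0 B h (eta : R) :
  vsub U v -> U z0 -> open B -> B z0 -> harmonic_on B h -> 0 < eta ->
  (\forall z \near z0, v z <= v' z) -> v z0 = v' z0 ->
  ~ (\forall z \near z0, v' z - h z + eta * nrm2 z <= v' z0 - h z0 + eta * nrm2 z0).
Proof.
move=> vv Uz oB Bz hh e0 le eq H; apply: (vv z0 B h eta Uz oB Bz hh e0).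
by apply: filterS2 le H => z vz; rewrite eq; apply: le_trans; rewrite !lerD2r.
Qed.

(** Poisson modification: [v] is replaced in the disc by the harmonic function with the same values
    on the circle. The maximum principle in the disc for [v - w] and [w - v1] gives the order; off
    the open disc [w] is touched from below by [v]. *)
Lemma perron_sweep U v0 v1 v c (r : R) : open U -> 0 < r ->
  [set z | nrm2 (z - c) <= r ^+ 2] `<=` U ->
  (forall z, U z -> {for z, continuous v1}) -> vsub U (fun z => - v1 z) ->
  sub_between U v0 v1 v ->
  exists w, [/\ sub_between U v0 v1 w, forall z, v z <= w z & harmonic_on (disc c r) w].
Proof.
move=> oU r0 DU cv1 v1s [cv vs vb].
have [|w [hw wv cw]] := @disc_dirichlet R c r v r0.
  by move=> z zr; apply: cv; apply: DU; rewrite /= zr.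
have oD := @open_disc R c r.
have DU' : disc c r `<=` U by move=> z /ltW; exact: DU.
have clD : closed [set z : R * R | nrm2 (z - c) <= r ^+ 2].
  by apply: closed_le_cont => z; exact: nrm2B_cont.
have bdD : exists a : R, forall z, disc c r z -> nrm2 z <= a.
  exists (2 * r ^+ 2 + 2 * nrm2 c) => z; rewrite /disc /nrm2 /= => H.
  have := sqr_ge0 (z.1 - 2 * c.1); have := sqr_ge0 (z.2 - 2 * c.2); nra.
have sE z : nrm2 (z - c) <= r ^+ 2 -> ~ disc c r z -> nrm2 (z - c) = r ^+ 2.
  by move=> z1 /negP; rewrite -leNgt => z2; apply/eqP; rewrite eq_le z1.
have le1 z : v z <= w z.
  have [Dz|Dz] := ltP (nrm2 (z - c)) (r ^+ 2); last by rewrite wv.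
  rewrite -subr_le0.
  apply: (@max_principle_bounded R (disc c r) _ (fun z => v z - w z) 0 oD clD) => //.
  - by move=> y /ltW.
  - move=> y /= yr; apply: cont_atD; first by apply: cv; apply: DU.
    by apply: cont_atN; exact: cw.
  - by apply: vsubB oD _ hw; exact: vsub_subset vs.
  - by move=> y yr /(sE y yr) E; rewrite wv ?E // subrr.
exists w; split => //; split.
- move=> z Uz; have [Dz|Dz] := leP (nrm2 (z - c)) (r ^+ 2); first exact: cw.
  have : nbhs z [set y | r ^+ 2 < nrm2 (y - c)].
    by apply: (@nrm2B_cont R c z [set x | r ^+ 2 < x]); exact: lt_nbhsr.
  move=> H; apply: near_continuous (cv z Uz).
  by apply: filterS H => y /= /ltW yr; rewrite wv.
- move=> z0 B h eta Uz0 oB Bz0 hh eta0.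
  have [Dz|Dz] := ltP (nrm2 (z0 - c)) (r ^+ 2).
    exact: (@harmonic_vsub R (disc c r) w oD hw z0 B h eta Dz oB Bz0 hh eta0).
  apply: (vsub_near vs Uz0 oB Bz0 hh eta0); last by rewrite wv.
  by near=> z; exact: le1.
- move=> z Uz; have /andP[b1 b2] := vb z Uz; apply/andP; split.
    exact: le_trans b1 (le1 z).
  have [Dz|Dz] := ltP (nrm2 (z - c)) (r ^+ 2); last by rewrite wv.
  rewrite -subr_le0.
  have E : (fun z => w z - v1 z) = (fun z => - v1 z - - w z) by apply/funext => y; ring.
  apply: (@max_principle_bounded R (disc c r) _ (fun z => w z - v1 z) 0 oD clD) => //.
  + by move=> y /ltW.
  + move=> y /= yr; apply: cont_atD; first exact: cw.
    by apply: cont_atN; apply: cv1; exact: DU.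
  + rewrite E; refine (vsubB oD (vsub_subset DU' v1s) (harmonicN oD hw)).
  + move=> y yr /(sE y yr) Ey; rewrite wv ?Ey // subr_le0.
    by have /andP[] := vb y (DU y yr).
Unshelve. all: by end_near. Qed.

Lemma sub_between_max U v0 v1 v w : sub_between U v0 v1 v -> sub_between U v0 v1 w ->
  sub_between U v0 v1 (fun z => Num.max (v z) (w z)).
Proof.
move=> [cv vv bv] [cw vw bw]; split.
- move=> z Uz; have := cv z Uz; have := cw z Uz => c1 c2.
  exact: (@continuous_max _ _ v w z c2 c1).
- move=> z0 B h eta Uz0 oB Bz0 hh eta0.
  case/orP: (le_total (v z0) (w z0)) => vw0.
    apply: (vsub_near vw Uz0 oB Bz0 hh eta0); last by rewrite max_r.
    by near=> z; rewrite le_max lexx orbT.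
  apply: (vsub_near vv Uz0 oB Bz0 hh eta0); last by rewrite max_l.
  by near=> z; rewrite le_max lexx.
- move=> z Uz; have /andP[a b] := bv z Uz; have /andP[c d] := bw z Uz.
  by rewrite le_max a /= ge_max b d.
Unshelve. all: by end_near. Qed.

Lemma compact_box c (a : R) : compact [set z : R * R | `|z.1 - c.1| <= a /\ `|z.2 - c.2| <= a].
Proof.
have := compact_setX (@segment_compact R (c.1 - a) (c.1 + a)) (@segment_compact R (c.2 - a) (c.2 + a)).
by congr compact; apply/seteqP; split => z /=; rewrite !in_itv /= !ler_distl.
Qed.

(** [u] is the supremum of the subsolutions between [v0] and [v1]. Swept ones are harmonic in a disc
    and uniformly bounded near its centre, hence equi-Lipschitz there, and so is [u]. The family is
    directed, so the Dini argument finds one swept function within [e] of [u] on a smaller ball, and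
    [u] is locally a uniform limit of harmonic functions. *)
Theorem perron U v0 v1 : open U ->
  (forall z, U z -> {for z, continuous v0}) -> (forall z, U z -> {for z, continuous v1}) ->
  vsub U v0 -> vsub U (fun z => - v1 z) -> (forall z, U z -> v0 z <= v1 z) ->
  exists2 u, harmonic_on U u & forall z, U z -> v0 z <= u z <= v1 z.
Proof.
move=> oU c0 c1 s0 s1 le01.
pose S := sub_between U v0 v1.
have S0 : S v0 by split => // z Uz; rewrite lexx le01.
pose u z := sup [set v z | v in S].
have hs z : U z -> has_ubound [set v z | v in S].
  by move=> Uz; exists (v1 z) => _ [v [_ _ vb] <-]; have /andP[] := vb z Uz.
have leu v z : S v -> U z -> v z <= u z.
  by move=> Sv Uz; apply: ub_le_sup; [exact: hs|exists v].
have ule z (b : R) : U z -> (forall v, S v -> v z <= b) -> u z <= b.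
  move=> Uz H; apply: ge_sup; first by exists (v0 z); exists v0.
  by move=> _ [v Sv <-]; exact: H.
exists u; last first.
  move=> z Uz; rewrite leu //=; apply: ule => // v [_ _ vb].
  by have /andP[] := vb z Uz.
apply: (harmonic_uniform_limit oU) => z0 Uz0.
have /nbhs_ballP [q /= q0 Hq] : nbhs z0 U by exact: open_nbhs_nbhs.
pose r := q / 2; have r0 : 0 < r by rewrite divr_gt0.
have DU : [set z | nrm2 (z - z0) <= r ^+ 2] `<=` U.
  move=> z; rewrite /nrm2 /= => H; apply: Hq; apply/plane_ballP.
  have h1 := sqr_ge0 (z.1 - z0.1); have h2 := sqr_ge0 (z.2 - z0.2).
  have sq (x : R) : x ^+ 2 <= r ^+ 2 -> `|x| < q.
    move=> xd; apply: (@le_lt_trans _ _ r); last by rewrite /r; lra.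
    by rewrite -ler_sqr ?nnegrE ?(ltW r0) // real_normK ?num_real.
  by rewrite distrC (distrC z0.2); split; apply: sq; lra.
pose d := r / 2; have d0 : 0 < d by rewrite divr_gt0.
have BD : ball z0 d `<=` disc z0 r.
  move=> z /plane_ballP; rewrite distrC (distrC z0.2) /disc /nrm2 /= => -[h1 h2].
  have sq (x : R) : `|x| < d -> x ^+ 2 < d ^+ 2.
    by move=> xd; rewrite -[x ^+ 2]real_normK ?num_real // ltr_sqr ?nnegrE // ltW.
  have := sq _ h1; have := sq _ h2 => h3 h4.
  have -> : r ^+ 2 = 4 * d ^+ 2 by rewrite /d; field.
  by have := sqr_ge0 d; lra.
have BU : ball z0 d `<=` U by move=> z /BD /ltW; exact: DU.
have [M HM] : exists M : R, forall v z, S v -> ball z0 d z -> `|v z| <= M.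
  have cB := @compact_box z0 d.
  have BB : [set z : R * R | `|z.1 - z0.1| <= d /\ `|z.2 - z0.2| <= d] `<=` U.
    move=> z [h1 h2]; apply: Hq; apply/plane_ballP.
    by rewrite distrC (distrC z0.2); split; apply: le_lt_trans (_ : d < q) => //; rewrite /d /r; lra.
  have bd (f : R * R -> R) : (forall z, U z -> {for z, continuous f}) ->
     exists M : R, forall z, ball z0 d z -> `|f z| <= M.
    move=> cf.
    have [c cA Hc] : exists2 c, c \in [set z : R * R | `|z.1 - z0.1| <= d /\ `|z.2 - z0.2| <= d] &
       forall t, t \in [set z : R * R | `|z.1 - z0.1| <= d /\ `|z.2 - z0.2| <= d] -> `|f t| <= `|f c|.
      apply: compact_EVT_max => //; first by exists z0 => /=; rewrite !subrr normr0 ltW.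
      apply: continuous_in_subspaceT => z /set_mem Sz.
      by apply: continuous_comp (cf z (BB z Sz)) _; exact: norm_continuous.
    exists `|f c| => z /plane_ballP [h1 h2]; apply: Hc; apply/mem_set => /=.
    by rewrite distrC (distrC z.2); split; exact: ltW.
  have [M0 H0] := bd _ c0; have [M1 H1] := bd _ c1.
  exists (M0 + M1) => v z [_ _ vb] Bz.
  have /andP[b1 b2] := vb z (BU z Bz); have := H0 z Bz; have := H1 z Bz.
  by rewrite !ler_norml => /andP[h1 h2] /andP[h3 h4]; apply/andP; split; lra.
have M0 : 0 <= M by apply: le_trans (normr_ge0 _) (HM v0 z0 S0 (ballxx z0 d0)).
have Lip w : S w -> harmonic_on (disc z0 r) w -> forall y z, ball z0 (d / 8) y -> ball z0 (d / 8) z ->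
   `|w y - w z| <= 8 * M / d * (`|y.1 - z.1| + `|y.2 - z.2|).
  move=> Sw hw; exact: (harmonic_lipschitz d0 (harmonic_sub BD hw) (fun z Bz => HM w z Sw Bz)).
have sw v : S v -> exists w, [/\ S w, forall z, v z <= w z & harmonic_on (disc z0 r) w].
  by move=> Sv; exact: perron_sweep.
have B8U z : ball z0 (d / 8) z -> U z by move=> /(@le_ball _ _ z0 (d / 8) d (ltac:(lra))); exact: BU.
have uLip y z : ball z0 (d / 8) y -> ball z0 (d / 8) z ->
   u y <= u z + 8 * M / d * (`|y.1 - z.1| + `|y.2 - z.2|).
  move=> By Bz; apply: ule; first exact: B8U.
  move=> v Sv; have [w [Sw vw hw]] := sw v Sv.
  apply: le_trans (vw y) _.
  have := Lip w Sw hw y z By Bz; rewrite ler_norml => /andP[_ h].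
  have := leu w z Sw (B8U z Bz); lra.
have L0 : 0 <= 8 * M / d by rewrite divr_ge0 ?mulr_ge0 // ltW.
exists (d / 16); first by rewrite divr_gt0.
move=> e e0.
pose A := [set z : R * R | `|z.1 - z0.1| <= d / 16 /\ `|z.2 - z0.2| <= d / 16].
have AB z : A z -> ball z0 (d / 8) z.
  move=> [h1 h2]; apply/plane_ballP; rewrite distrC (distrC z0.2); split;
   (apply: le_lt_trans (_ : d / 16 < _); [assumption|lra]).
pose Fam g := exists w, [/\ S w, harmonic_on (disc z0 r) w & g = (fun z => - w z)].
have [||z Az|g [w [Sw hw ->]] Hg] := @compact_directed_inf R A Fam (fun z => - u z + e) (@compact_box z0 _).
- by have [w [Sw _ hw]] := sw v0 S0; exists (fun z => - w z); exists w.
- move=> _ _ [w1 [S1 h1 ->]] [w2 [S2 h2 ->]].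
  have [w [Sw ww hw]] := sw _ (sub_between_max S1 S2).
  exists (fun z => - w z); first by exists w.
  by move=> z _; rewrite !lerN2; have := ww z; rewrite ge_max => /andP.
- have Bz := AB z Az.
  have e3 : 0 < e / 3 by rewrite divr_gt0.
  have [v Sv vz] : exists2 v, S v & u z - e / 3 < v z.
    apply: contrapT => H; have : u z <= u z - e / 3.
      apply: ule; first exact: B8U.
      by move=> v Sv; rewrite leNgt; apply/negP => h; apply: H; exists v.
    lra.
  have [w [Sw vw hw]] := sw v Sv.
  exists (fun z => - w z); first by exists w.
  pose L := 8 * M / d.
  have L1 : 0 < L + 1 by rewrite ltr_wpDl.
  have x0 : 0 < e / 3 / (2 * (L + 1)) by rewrite divr_gt0 // mulr_gt0.
  have nb : \forall y \near z, ball z0 (d / 8) y.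
    by apply: open_nbhs_nbhs; split => //; exact: open_ball_plane.
  have nb2 : \forall y \near z, ball z (e / 3 / (2 * (L + 1))) y by exact: nbhsx_ballx.
  apply: filterS2 nb nb2 => y By /plane_ballP [k1 k2].
  have K : L * (`|y.1 - z.1| + `|y.2 - z.2|) <= e / 3.
    rewrite distrC (distrC y.2).
    apply: (@le_trans _ _ ((L + 1) * (e / 3 / (2 * (L + 1)) + e / 3 / (2 * (L + 1))))).
      apply: ler_pM; [exact: L0|exact: addr_ge0|by rewrite lerDl|by apply: lerD; exact: ltW].
    by rewrite le_eqVlt; apply/orP; left; apply/eqP; field; rewrite gt_eqF.
  have := Lip w Sw hw y z By Bz; rewrite ler_norml -/L => /andP[h1 h2].
  have := uLip y z By Bz; rewrite -/L; have := vw z; lra.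
have le16 : d / 16 <= d by rewrite ler_pdivrMr // ler_peMr ?ler1n // ltW.
exists w; first by apply: harmonic_sub hw => z /(@le_ball _ _ z0 (d / 16) d le16); exact: BD.
move=> y By.
have Ay : A y by move/plane_ballP : By => [h1 h2]; split; rewrite distrC ltW.
have := Hg y Ay; have := leu w y Sw (B8U y (AB y Ay)) => h1 h2.
by rewrite ger0_norm ?subr_ge0 //; lra.
Qed.

End Perron.

(** * The maps f_n and the Green function *)

Section Modulus.
Context {R : realType}.
Implicit Types (z w : R * R).

Lemma cmod_ge0 z : 0 <= cmod z.
Proof. exact: sqrtr_ge0. Qed.

Lemma cmod_sqr z : cmod z ^+ 2 = nrm2 z.
Proof. by rewrite sqr_sqrtr // nrm2_ge0. Qed.

Lemma cmod_le z (a : R) : 0 <= a -> (cmod z <= a) = (nrm2 z <= a ^+ 2).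
Proof. by move=> a0; rewrite -cmod_sqr ler_sqr // nnegrE cmod_ge0. Qed.

Lemma cmod_gt0 z : (0 < cmod z) = (z != 0).
Proof. by rewrite /cmod sqrtr_gt0 -nrm2_gt0. Qed.

Lemma cmod_triangle (a b c d : R) : cmod (a + c, b + d) <= cmod (a, b) + cmod (c, d).
Proof.
have h1 := cmod_ge0 (a, b); have h2 := cmod_ge0 (c, d).
rewrite cmod_le ?addr_ge0 // sqrrD !cmod_sqr /nrm2 /=.
have : a * c + b * d <= cmod (a, b) * cmod (c, d).
  rewrite /cmod -sqrtrM ?nrm2_ge0 //=.
  apply: le_trans (ler_norm _) _.
  rewrite -sqrtr_sqr ler_wsqrtr //.
  have := sqr_ge0 (a * d - b * c); rewrite !expr2; nra.
rewrite -[_ *+ 2]mulr_natl; lra.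
Qed.

Lemma cmod_real_shift z (k : R) : 0 <= k -> cmod z - k <= cmod (z.1 - k, z.2).
Proof.
move=> k0; have := cmod_triangle (z.1 - k) z.2 k 0.
rewrite subrK addr0 -surjective_pairing.
have -> : cmod (k, 0) = k by rewrite /cmod /= expr0n addr0 sqrtr_sqr ger0_norm.
by rewrite lerBlDr.
Qed.

Lemma cmod_real_shift_le z (k : R) : 0 <= k -> cmod (z.1 - k, z.2) <= cmod z + k.
Proof.
move=> k0; have := cmod_triangle z.1 z.2 (- k) 0; rewrite addr0 -surjective_pairing.
by have -> : cmod (- k, 0) = k by rewrite /cmod /= expr0n addr0 sqrrN sqrtr_sqr ger0_norm.
Qed.

Lemma cmod_cont z : cont_at (@cmod R) z.
Proof.
apply: (@continuous_comp _ _ _ (@nrm2 R) Num.sqrt); first exact: nrm2_cont.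
exact: sqrt_continuous.
Qed.

Lemma cmod_eq_ln z : z != 0 -> ln (cmod z) = 2^-1 * ln (nrm2 z).
Proof.
move=> z0; have c0 : 0 < cmod z by rewrite cmod_gt0.
by rewrite -cmod_sqr lnXn // -[ln _ *+ 2]mulr_natl mulrA mulVf ?mul1r // pnatr_eq0.
Qed.

(* The ellipses with foci [-1] and [1] are the level curves of [ell]; the Green function
   of the complement of the interval [-1, 1] is [acosh (ell z)]. *)
Definition ell z : R := 2^-1 * (cmod (z.1 - 1, z.2) + cmod (z.1 + 1, z.2)).

Definition sqm1 z : R * R := (z.1 ^+ 2 - z.2 ^+ 2 - 1, 2 * z.1 * z.2).

Lemma cmod_sqm1 z : cmod (sqm1 z) = cmod (z.1 - 1, z.2) * cmod (z.1 + 1, z.2).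
Proof.
rewrite /cmod -sqrtrM ?nrm2_ge0 //=.
congr Num.sqrt; ring.
Qed.

(** The parallelogram law for [z - 1] and [z + 1], whose product is [z^2 - 1]. *)
Lemma ell_sqr z : 2 * ell z ^+ 2 = nrm2 z + 1 + cmod (sqm1 z).
Proof.
rewrite cmod_sqm1 /ell.
have := cmod_sqr (z.1 - 1, z.2); have := cmod_sqr (z.1 + 1, z.2); rewrite /nrm2 /=.
set a := cmod _; set b := cmod _ => h1 h2.
have -> : 2 * (2^-1 * (b + a)) ^+ 2 = 2^-1 * (b ^+ 2 + a ^+ 2) + b * a by field.
by rewrite h1 h2; field.
Qed.

Lemma sqm1_sqr z : cmod (sqm1 z) ^+ 2 = (1 - nrm2 z) ^+ 2 + 4 * z.2 ^+ 2.
Proof. by rewrite cmod_sqr /nrm2 /sqm1 /=; ring. Qed.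

Lemma sqm1_ge z : `|1 - nrm2 z| <= cmod (sqm1 z).
Proof.
rewrite -sqrtr_sqr -[cmod _](ger0_norm (cmod_ge0 _)) -[X in _ <= X]sqrtr_sqr.
by rewrite ler_wsqrtr // sqm1_sqr lerDl mulr_ge0 // sqr_ge0.
Qed.

Lemma ell_ge0 z : 0 <= ell z.
Proof. by rewrite mulr_ge0 ?addr_ge0 ?cmod_ge0 // invr_ge0. Qed.

Lemma ell_ge1 z : 1 <= ell z.
Proof.
rewrite -ler_sqr ?nnegrE ?ell_ge0 // expr1n.
have := ell_sqr z; have := sqm1_ge z; rewrite ler_norml => /andP[h1 h2] h3; lra.
Qed.

Lemma ell_ge_cmod z : cmod z <= ell z.
Proof.
rewrite cmod_le ?ell_ge0 //.
have := ell_sqr z; have := sqm1_ge z; rewrite ler_norml => /andP[h1 h2] h3; lra.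
Qed.

Lemma ell_le_cmod z : ell z <= cmod z + 1.
Proof.
have h1 := cmod_real_shift_le z (ler01).
have h2 := cmod_triangle z.1 z.2 1 0; rewrite addr0 -surjective_pairing in h2.
have h3 : cmod (1, 0) = 1 :> R by rewrite /cmod /= expr0n addr0 expr1n sqrtr1.
rewrite /ell; lra.
Qed.

Lemma ell_le1P z : ell z <= 1 <-> z.2 = 0 /\ `|z.1| <= 1.
Proof.
split.
- move=> e1; have e2 : ell z ^+ 2 = 1.
    by apply/eqP; rewrite sqrp_eq1 ?ell_ge0 //; rewrite eq_le e1 ell_ge1.
  have h1 := ell_sqr z; have h2 := sqm1_sqr z; rewrite e2 in h1.
  have h3 : cmod (sqm1 z) = 1 - nrm2 z by lra.
  have z2 : z.2 = 0.
    apply/eqP; rewrite -sqrf_eq0; apply/eqP; rewrite h3 in h2; lra.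
  split=> //; rewrite -ler_sqr ?nnegrE // expr1n real_normK ?num_real //.
  have := cmod_ge0 (sqm1 z); rewrite h3 /nrm2 z2 expr0n /=; lra.
- move=> [z2 z1]; rewrite /ell z2 /cmod /= !expr0n !addr0 !sqrtr_sqr.
  move: z1; rewrite ler_norml => /andP[h1 h2].
  rewrite ler0_norm ?subr_le0 // ger0_norm; last by lra.
  lra.
Qed.

Lemma ell_cont z : cont_at ell z.
Proof.
rewrite /ell; apply: cont_atM; first exact: cont_const.
apply: cont_atD.
- apply: (@cont_at_comp_plane R (@cmod R) (fun z => z.1 - 1) (fun z => z.2)); [exact: cmod_cont|cont_step|cont_step].
- apply: (@cont_at_comp_plane R (@cmod R) (fun z => z.1 + 1) (fun z => z.2)); [exact: cmod_cont|cont_step|cont_step].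
Qed.

Lemma ell_real (x : R) : 1 <= `|x| -> ell (x, 0) = `|x|.
Proof.
move=> x1; rewrite /ell /cmod /= !expr0n !addr0 !sqrtr_sqr.
have [x0|x0] := leP 0 x.
  rewrite (ger0_norm x0) in x1 *.
  by rewrite !ger0_norm ?subr_ge0 //; [field|lra].
rewrite (ltr0_norm x0) in x1 *.
by rewrite !ler0_norm; [field|lra|lra].
Qed.

(* The map [f_n] with [c = gamma_n], in real coordinates. *)
Definition quad (c : R) z : R * R :=
  ((2 * c)^-1 * (z.1 ^+ 2 - z.2 ^+ 2 - 1) + 1, (2 * c)^-1 * (2 * z.1 * z.2)).

Lemma quad_cont (c : R) z : cont_at (fun z => (quad c z).1) z /\ cont_at (fun z => (quad c z).2) z.
Proof. by rewrite /quad /=; split; cont_step. Qed.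

(** [quad c z] has distances [|z^2 - 1| / (2 c)] and [|z^2 - (1 - 4 c)| / (2 c)] from the foci 1 and
    -1. Since [1 - 4 c > 0], the second modulus is within [1 - 4 c] of [|z|^2], and [ell_sqr] does
    the rest. *)
Lemma ell_quad (c : R) z : 0 < c < 1 / 4 ->
  1 + (ell z ^+ 2 - 1) / (2 * c) <= ell (quad c z) <= ell z ^+ 2 / (2 * c).
Proof.
move=> /andP[c0 c4].
have cn : c != 0 by rewrite gt_eqF.
have p0 : 0 < (2 * c)^-1 by rewrite invr_gt0 mulr_gt0.
have hom (a b : R) : cmod ((2 * c)^-1 * a, (2 * c)^-1 * b) = (2 * c)^-1 * cmod (a, b).
  rewrite /cmod /= !exprMn -mulrDr sqrtrM ?sqr_ge0 // sqrtr_sqr ger0_norm //; exact: ltW.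
have E : ell (quad c z) = (4 * c)^-1 * (cmod (sqm1 z) + cmod (z.1 ^+ 2 - z.2 ^+ 2 - (1 - 4 * c), 2 * z.1 * z.2)).
  rewrite /ell /quad /= addrK.
  have -> : (2 * c)^-1 * (z.1 ^+ 2 - z.2 ^+ 2 - 1) + 1 + 1 = (2 * c)^-1 * (z.1 ^+ 2 - z.2 ^+ 2 - (1 - 4 * c)).
    by field.
  by rewrite !hom; field.
have k0 : 0 <= 1 - 4 * c by lra.
have sq : cmod (z.1 ^+ 2 - z.2 ^+ 2, 2 * z.1 * z.2) = nrm2 z.
  rewrite /cmod /= -[RHS](ger0_norm (nrm2_ge0 z)) -sqrtr_sqr; congr Num.sqrt; rewrite /nrm2; ring.
have lo := @cmod_real_shift (z.1 ^+ 2 - z.2 ^+ 2, 2 * z.1 * z.2) _ k0.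
have hi := @cmod_real_shift_le (z.1 ^+ 2 - z.2 ^+ 2, 2 * z.1 * z.2) _ k0.
rewrite sq /= in lo hi.
have e2 := ell_sqr z.
have q0 : 0 < (4 * c)^-1 by rewrite invr_gt0 mulr_gt0.
rewrite E; apply/andP; split.
- have -> : 1 + (ell z ^+ 2 - 1) / (2 * c) = (4 * c)^-1 * (4 * c + (2 * ell z ^+ 2 - 2)) by field.
  by rewrite ler_pM2l //; lra.
- have -> : ell z ^+ 2 / (2 * c) = (4 * c)^-1 * (2 * ell z ^+ 2) by field.
  by rewrite ler_pM2l //; lra.
Qed.

Definition acosh (e : R) : R := ln (e + Num.sqrt (e ^+ 2 - 1)).

Lemma acosh_arg (e : R) : 1 <= e -> e <= e + Num.sqrt (e ^+ 2 - 1) <= 2 * e.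
Proof.
move=> e1; rewrite lerDl sqrtr_ge0 /=.
have : Num.sqrt (e ^+ 2 - 1) <= e.
  rewrite -[X in _ <= X]ger0_norm; last by lra.
  by rewrite -sqrtr_sqr ler_wsqrtr //; lra.
lra.
Qed.

Lemma acosh_ge (e : R) : 1 <= e -> ln e <= acosh e.
Proof.
move=> e1; have /andP[h _] := acosh_arg e1.
by rewrite ler_ln // posrE; lra.
Qed.

Lemma acosh_le (e : R) : 1 <= e -> acosh e <= ln 2 + ln e.
Proof.
move=> e1; have /andP[h1 h2] := acosh_arg e1.
by rewrite -lnM ?posrE //; [rewrite ler_ln // posrE; lra|lra].
Qed.

Lemma acosh_mono (e e' : R) : 1 <= e -> e <= e' -> acosh e <= acosh e'.
Proof.
move=> e1 ee; have /andP[h _] := acosh_arg e1.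
have /andP[h' _] := acosh_arg (le_trans e1 ee).
rewrite ler_ln ?posrE; try lra.
apply: lerD => //; apply: ler_wsqrtr; rewrite lerD2r lerXn2r // nnegrE; lra.
Qed.

Lemma acosh_ge0 (e : R) : 1 <= e -> 0 <= acosh e.
Proof. by move=> e1; apply: le_trans (acosh_ge e1); rewrite ln_ge0. Qed.

Lemma acosh_gt0 (e : R) : 1 < e -> 0 < acosh e.
Proof. by move=> e1; apply: lt_le_trans (acosh_ge (ltW e1)); rewrite ln_gt0. Qed.

Lemma acosh_double (e : R) : 1 <= e -> acosh (2 * e ^+ 2 - 1) = 2 * acosh e.
Proof.
move=> e1; have /andP[h _] := acosh_arg e1.
have e2 : 0 <= e ^+ 2 - 1 by rewrite subr_ge0 -[1](expr1n _ 2) lerXn2r // nnegrE; lra.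
rewrite /acosh [RHS]mulr_natl -lnXn; last by lra.
congr ln; rewrite [RHS]sqrrD sqr_sqrtr //.
have -> : (2 * e ^+ 2 - 1) ^+ 2 - 1 = (2 * e) ^+ 2 * (e ^+ 2 - 1) by ring.
rewrite sqrtrM ?sqr_ge0 // sqrtr_sqr ger0_norm; last by lra.
rewrite -mulr_natl; ring.
Qed.

Lemma acosh_le_sqrt (x : R) : 0 <= x -> acosh (1 + x) <= x + Num.sqrt (x ^+ 2 + 2 * x).
Proof.
move=> x0; rewrite /acosh.
have -> : (1 + x) ^+ 2 - 1 = x ^+ 2 + 2 * x by ring.
rewrite -addrA; set y := x + _.
have y0 : 0 <= y by rewrite addr_ge0 // sqrtr_ge0.
have := @le_ln1Dx R y; apply; lra.
Qed.

Lemma acosh_ge_sqrt (x : R) : 0 <= x -> ln (1 + Num.sqrt (2 * x)) <= acosh (1 + x).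
Proof.
move=> x0; rewrite /acosh.
have -> : (1 + x) ^+ 2 - 1 = x ^+ 2 + 2 * x by ring.
have s0 := sqrtr_ge0 (2 * x).
have s1 : Num.sqrt (2 * x) <= Num.sqrt (x ^+ 2 + 2 * x) by rewrite ler_wsqrtr // lerDr sqr_ge0.
rewrite ler_ln ?posrE; lra.
Qed.

End Modulus.

(** * Iteration of the quadratic maps and the set K *)

Section Dynamics.
Context {R : realType}.
Implicit Types (g : nat -> R) (z w : R * R) (n m k : nat).

Definition quarter g : Prop := forall n, 0 < g n < 1 / 4.

Definition sh k g : nat -> R := fun j => g (k + j)%N.

(* The iterate [F_n] with [gamma_n = g (n - 1)], in real coordinates. *)
Fixpoint Phi g n z : R * R := if n is m.+1 then quad (g m) (Phi g m z) else z.

(** By [ell_le1P] the condition says that [F_n z] lies in [-1, 1]. Written with [ell], it is a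
    sublevel condition on a quantity monotone in [n]. *)
Definition Kset g : set (R * R) := [set z | forall n, ell (Phi g n z) <= 1].

(* [2^-n] times the logarithm of the leading coefficient of [F_n]. *)
Fixpoint cap g n : R := if n is m.+1 then cap g m + 2^- m.+1 * ln ((2 * g m)^-1) else 0.

Lemma quarter_sh k g : quarter g -> quarter (sh k g).
Proof. by move=> qg n; exact: qg. Qed.

Lemma sh_sh k m g : sh m (sh k g) = sh (k + m) g.
Proof. by apply/funext => j; rewrite /sh addnA. Qed.

Lemma Phi_add g k m z : Phi g (k + m) z = Phi (sh k g) m (Phi g k z).
Proof. by elim: m => [|m IH]; rewrite ?addn0 // addnS /= IH. Qed.

Lemma Phi_shS g n z : Phi g n.+1 z = Phi (sh 1 g) n (quad (g 0%N) z).
Proof. by rewrite -add1n Phi_add. Qed.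

Lemma quad_opp (c : R) z : quad c (- z) = quad c z.
Proof. by rewrite /quad /= !sqrrN; congr pair; ring. Qed.

Lemma pow2_gt0 n : 0 < 2 ^- n :> R.
Proof. by rewrite invr_gt0 exprn_gt0. Qed.

Lemma pow2S n : 2 ^- n.+1 = 2^-1 * 2 ^- n :> R.
Proof. by rewrite exprS invfM. Qed.

Lemma pow2_le1 n : 2 ^- n <= 1 :> R.
Proof. by rewrite invf_le1 ?exprn_gt0 // exprn_ege1 // ler1n. Qed.

Lemma lnV_gt0 g n : quarter g -> 0 < ln ((2 * g n)^-1).
Proof.
move=> qg; have /andP[g0 g4] := qg n.
by rewrite ln_gt0 // invf_gt1 ?mulr_gt0 //; lra.
Qed.

Lemma cap_mono g n m : quarter g -> (n <= m)%N -> cap g n <= cap g m.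
Proof.
move=> qg /subnK <-; elim: (m - n)%N => [|k IH]; rewrite ?addSn //=.
by rewrite ler_wpDr // mulr_ge0 ?ltW ?pow2_gt0 // lnV_gt0.
Qed.

Lemma cap_ge0 g n : quarter g -> 0 <= cap g n.
Proof. by move=> qg; exact: (@cap_mono g 0%N n qg). Qed.

Lemma cap_sh g k n : cap g (k + n) = cap g k + 2 ^- k * cap (sh k g) n.
Proof.
elim: n => [|n IH] /=; first by rewrite addn0 mulr0 addr0.
rewrite addnS /= IH mulrDr addrA; congr (_ + _).
by rewrite mulrA -invfM -exprD addnS.
Qed.

(** The lower half of [ell_quad], with [e + 1 >= 2] and [8 g n < 2]. A point off K therefore escapes
    at rate [4^k]. *)
Lemma ell_step g n z : quarter g ->
  4 * (ell (Phi g n z) - 1) <= ell (Phi g n.+1 z) - 1.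
Proof.
move=> qg; have /andP[g0 g4] := qg n.
have /andP[h _] := ell_quad (Phi g n z) (qg n).
have e1 := ell_ge1 (Phi g n z); rewrite /= lerBrDl; apply: le_trans h.
rewrite lerD2l ler_pdivlMr ?mulr_gt0 //.
set e := ell _ in e1 *.
have : 0 <= (e - 1) * (e + 1 - 8 * g n) by rewrite mulr_ge0 //; lra.
by lra.
Qed.

Lemma ell_iter g n k z : quarter g ->
  4 ^+ k * (ell (Phi g n z) - 1) <= ell (Phi g (n + k) z) - 1.
Proof.
move=> qg; elim: k => [|k IH]; first by rewrite addn0 mul1r.
rewrite addnS exprS -mulrA; apply: le_trans (ell_step _ _ qg).
by rewrite ler_pM2l.
Qed.

Lemma ell_nondecreasing g n m z : quarter g -> (n <= m)%N ->
  ell (Phi g n z) <= ell (Phi g m z).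
Proof.
move=> qg /subnKC <-; have := @ell_iter g n (m - n) z qg.
have e1 := ell_ge1 (Phi g n z).
have : 1 <= 4 ^+ (m - n) :> R by rewrite exprn_ege1 // ler1n.
nra.
Qed.

Lemma ell_escape g z (a : R) : quarter g -> ~ Kset g z ->
  exists n, a < ell (Phi g n z).
Proof.
move=> qg /existsNP[n /negP]; rewrite -ltNge => en.
have d0 : 0 < ell (Phi g n z) - 1 by rewrite subr_gt0.
have [k hk] : exists k, a / (ell (Phi g n z) - 1) < 4 ^+ k.
  exists (Num.truncn `|a / (ell (Phi g n z) - 1)|).+1.
  apply: le_lt_trans (ler_norm _) _; apply: lt_trans (truncnS_gt _) _.
  by rewrite -natrX ltr_nat ltn_expl.
exists (n + k)%N; have := @ell_iter g n k z qg.
by rewrite ltr_pdivrMr // in hk; lra.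
Qed.

Lemma Kset_ell g n z : Kset g z -> ell (Phi g n z) = 1.
Proof. by move=> Kz; apply/eqP; rewrite eq_le ell_ge1 Kz. Qed.

(** [ell] does not decrease along orbits, so late iterates control the early ones. *)
Lemma Kset_sh g k z : quarter g -> Kset (sh k g) (Phi g k z) <-> Kset g z.
Proof.
move=> qg; split=> Kz n; last by rewrite -Phi_add.
apply: le_trans (@ell_nondecreasing g n (k + n) z qg (leq_addl _ _)) _.
by rewrite Phi_add.
Qed.

Lemma Kset_shS g z : quarter g -> Kset (sh 1 g) (quad (g 0%N) z) <-> Kset g z.
Proof. exact: (@Kset_sh g 1 z). Qed.

Lemma Kset_real g z : Kset g z -> z.2 = 0 /\ `|z.1| <= 1.
Proof. by move=> Kz; apply/ell_le1P; exact: (Kz 0%N). Qed.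

Lemma Kset_opp g z : quarter g -> Kset g z -> Kset g (- z).
Proof.
move=> qg Kz; apply: (Kset_shS (- z) qg).1.
by rewrite quad_opp; exact: (Kset_shS z qg).2 Kz.
Qed.

Lemma quad_continuous (c : R) z : {for z, continuous (quad c : R * R -> R * R)}.
Proof. by have [h1 h2] := quad_cont c z; exact: (cvg_plane h1 h2). Qed.

Lemma Phi_continuous g n z : {for z, continuous (Phi g n : R * R -> R * R)}.
Proof.
elim: n => [|n IH]; first exact: cvg_id.
by apply: (@continuous_comp _ _ _ (Phi g n) (quad (g n))) => //; exact: quad_continuous.
Qed.

Lemma ell_Phi_cont g n z : cont_at (fun z => ell (Phi g n z)) z.
Proof.
apply: (@continuous_comp _ _ _ (Phi g n) (@ell R)); first exact: Phi_continuous.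
exact: ell_cont.
Qed.

Lemma Kset_closed g : closed (Kset g).
Proof.
have -> : Kset g = \bigcap_n [set z | ell (Phi g n z) <= 1].
  by apply/seteqP; split => z Kz n => [_|]; exact: Kz.
by apply: closed_bigI => n _; apply: closed_le_cont => z; exact: ell_Phi_cont.
Qed.

Lemma Kset_compact g : compact (Kset g).
Proof.
apply: (subclosed_compact (@Kset_closed g) (@compact_square R 1)) => z /Kset_real[z2 z1].
by rewrite /= z2 normr0.
Qed.

Lemma Kset_one g : quarter g -> Kset g (1, 0).
Proof.
move=> qg n; have -> : Phi g n (1, 0) = (1, 0).
  elim: n => [//|n /= ->]; rewrite /quad /= expr1n expr0n /=; congr pair; ring.
by apply/ell_le1P; rewrite /= normr1.
Qed.

Lemma open_Kset g : open (~` Kset g).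
Proof. by apply: closed_openC; exact: Kset_closed. Qed.

End Dynamics.

(** * The Green function of the complement of K *)

Section GreenFunction.
Context {R : realType}.
Implicit Types (g : nat -> R) (z w : R * R) (n m k : nat).

(** The Green function of the complement of the preimage of [-1, 1] under [F_n]. These preimages
    decrease to K, which is why [green] is a supremum. *)
Definition Gn g n z : R := 2 ^- n * acosh (ell (Phi g n z)).

Definition green g z : R := sup [set Gn g n z | n in setT].

Definition fincap g : Prop := exists B, forall n, cap g n <= B.

(** The Robin constant of K: by [green_asymptotics], [green] is [ln |z| + capoo + O(|z|^-2)]. *)
Definition capoo g : R := sup [set cap g n | n in setT].

Lemma le_capoo g n : fincap g -> cap g n <= capoo g.
Proof.
move=> [B Hb]; apply: ub_le_sup; last by exists n.
by exists B => _ [m _ <-].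
Qed.

Lemma capoo_ge0 g : quarter g -> fincap g -> 0 <= capoo g.
Proof. by move=> qg fc; apply: le_trans (cap_ge0 0%N qg) (le_capoo 0%N fc). Qed.

Lemma fincap_sh g k : quarter g -> fincap g -> fincap (sh k g).
Proof.
move=> qg [B Hb]; exists (2 ^+ k * B) => n.
have := Hb (k + n)%N; rewrite cap_sh => H.
have h0 := cap_ge0 k qg.
rewrite -ler_pdivrMl ?exprn_gt0 //; lra.
Qed.

Lemma cap_tail g (C e : R) : quarter g -> fincap g -> 0 <= C -> 0 < e ->
  exists N, forall n, (N <= n)%N -> 2 ^- n * C + C * (capoo g - cap g n) <= e.
Proof.
move=> qg fc C0 e0.
have C1 : 0 < 2 * (C + 1) by lra.
have e1 : 0 < e / (2 * (C + 1)) by rewrite divr_gt0.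
have [_ [N1 _ <-] h1] := sup_adherent e1 (ltac:(split; [exists (cap g 0); by exists 0%N|
  case: fc => B Hb; exists B => _ [n _ <-]; exact: Hb]) : has_sup [set cap g n | n in setT]).
have [N2 h2] := small_inv C (divr_gt0 e0 (ltr0Sn R 1)).
exists (maxn N1 N2) => n; rewrite geq_max => /andP[n1 n2].
have A1 : 2 ^- n * C <= e / 2.
  apply: le_trans h2; rewrite mulrC; apply: ler_wpM2l => //.
  rewrite lef_pV2 ?posrE ?exprn_gt0 ?ltr0Sn // -natrX ler_nat.
  by apply: leq_ltn_trans n2 _; rewrite ltn_expl.
have h3 : capoo g - cap g n <= e / (2 * (C + 1)).
  have := @cap_mono _ g N1 n qg n1; rewrite /capoo; lra.
have A2 : C * (capoo g - cap g n) <= e / 2.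
  apply: le_trans (_ : (C + 1) * (capoo g - cap g n) <= _).
    by apply: ler_wpM2r; [rewrite subr_ge0 le_capoo|lra].
  have -> : e / 2 = (C + 1) * (e / (2 * (C + 1))) by field; lra.
  by apply: ler_wpM2l => //; lra.
by rewrite [e]splitr lerD.
Qed.

(** By the lower half of [ell_quad] and [2 g n < 1/2], the next value of [ell] is at least
    [2 e^2 - 1], and [acosh] doubles under [e -> 2 e^2 - 1]. *)
Lemma Gn_step g n z : quarter g -> Gn g n z <= Gn g n.+1 z.
Proof.
move=> qg; rewrite /Gn pow2S -mulrA [X in _ <= X]mulrCA.
rewrite ler_pM2l ?pow2_gt0 // mulrC ler_pdivlMr // mulrC.
rewrite -acosh_double ?ell_ge1 //; apply: acosh_mono.
  have := ell_ge1 (Phi g n z); nra.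
have /andP[g0 g4] := qg n.
have /andP[h _] := ell_quad (Phi g n z) (qg n); apply: le_trans h.
have e1 := ell_ge1 (Phi g n z); set e := ell _ in e1 *.
suff : 2 * (e ^+ 2 - 1) <= (e ^+ 2 - 1) / (2 * g n) by lra.
rewrite ler_pdivlMr ?mulr_gt0 //.
have : 0 <= (e ^+ 2 - 1) * (1 - 4 * g n) by rewrite mulr_ge0 //; [nra|lra].
by lra.
Qed.

Lemma Gn_mono g n m z : quarter g -> (n <= m)%N -> Gn g n z <= Gn g m z.
Proof.
move=> qg /subnK <-; elim: (m - n)%N => [//|k IH].
by apply: le_trans IH _; rewrite addSn Gn_step.
Qed.

(** The upper half of [ell_quad]: a decreasing companion of the increasing [Gn]. As [acosh e] lies
    between [ln e] and [ln 2 + ln e], the two enclose the limit. *)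
Lemma ln_ell_step g n m z : quarter g -> (n <= m)%N ->
  2 ^- m * ln (ell (Phi g m z)) - cap g m <= 2 ^- n * ln (ell (Phi g n z)) - cap g n.
Proof.
move=> qg /subnK <-; elim: (m - n)%N => [//|k IH]; apply: le_trans IH.
rewrite addSn; move: (k + n)%N => {k}m.
have /andP[g0 g4] := qg m.
have /andP[_ h] := ell_quad (Phi g m z) (qg m).
have e1 := ell_ge1 (Phi g m z).
have e1' := ell_ge1 (Phi g m.+1 z).
suff H : ln (ell (Phi g m.+1 z)) <= 2 * ln (ell (Phi g m z)) + ln (2 * g m)^-1.
  have := ler_wpM2l (ltW (@pow2_gt0 R m.+1)) H; rewrite /= pow2S.
  set a := 2 ^- m; set x := ln _; set y := ln _; set t := ln _ => H'.
  rewrite (_ : 2^-1 * a * (2 * y + t) = a * y + 2^-1 * a * t) in H'; last by field.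
  by lra.
rewrite mulr_natl -lnXn; last by lra.
have p0 : 0 < ell (Phi g m z) ^+ 2 by rewrite exprn_gt0 //; lra.
have q0 : 0 < (2 * g m)^-1 by rewrite invr_gt0 mulr_gt0.
have b0 : 0 < ell (Phi g m z) ^+ 2 / (2 * g m) by apply: mulr_gt0.
have a0 : 0 < ell (Phi g m.+1 z) by apply: lt_le_trans e1'.
by rewrite -lnM ?posrE //; rewrite ler_ln ?posrE.
Qed.

Lemma Gn_le g n m z : quarter g -> fincap g ->
  Gn g m z <= 2 ^- n * (ln 2 + ln (ell (Phi g n z))) + (capoo g - cap g n).
Proof.
move=> qg fc.
have bound k : Gn g k z <= 2 ^- k * ln 2 + 2 ^- k * ln (ell (Phi g k z)).
  by rewrite -mulrDr ler_pM2l ?pow2_gt0 // acosh_le // ell_ge1.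
have [nm|/ltnW mn] := leqP n m.
- apply: le_trans (bound m) _.
  have h1 := @ln_ell_step g n m z qg nm.
  have h2 := le_capoo m fc.
  have h3 : 2 ^- m * ln 2 <= 2 ^- n * ln 2 :> R.
    rewrite ler_pM2r ?ln_gt0 ?ltr1n // lef_pV2 ?posrE ?exprn_gt0 //.
    by rewrite ler_weXn2l // ler1n.
  rewrite mulrDr; lra.
- apply: le_trans (Gn_mono z qg mn) _; apply: le_trans (bound n) _.
  rewrite mulrDr; have := le_capoo n fc; lra.
Qed.

Lemma Gn_le_green g n z : quarter g -> fincap g -> Gn g n z <= green g z.
Proof.
move=> qg fc; apply: ub_le_sup; last by exists n.
by eexists => _ [m _ <-]; exact: (@Gn_le g 0 m z qg fc).
Qed.

Lemma green_le g n z : quarter g -> fincap g ->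
  green g z <= 2 ^- n * (ln 2 + ln (ell (Phi g n z))) + (capoo g - cap g n).
Proof.
move=> qg fc; apply: ge_sup; first by exists (Gn g 0 z); exists 0%N.
by move=> _ [m _ <-]; exact: Gn_le.
Qed.

Lemma green_ge0 g z : quarter g -> fincap g -> 0 <= green g z.
Proof.
move=> qg fc; apply: le_trans (Gn_le_green 0 z qg fc).
by rewrite /Gn mulr_ge0 // ?acosh_ge0 // ?ell_ge1 // ltW // pow2_gt0.
Qed.

Lemma green_gt0 g z : quarter g -> fincap g -> ~ Kset g z -> 0 < green g z.
Proof.
move=> qg fc Kz; have [n en] := ell_escape 1 qg Kz.
apply: lt_le_trans (Gn_le_green n z qg fc).
by rewrite mulr_gt0 ?pow2_gt0 // acosh_gt0.
Qed.

Lemma green_sh g k z : quarter g -> fincap g ->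
  green g z = 2 ^- k * green (sh k g) (Phi g k z).
Proof.
move=> qg fc; have fk := fincap_sh k qg fc; have qk := quarter_sh k qg.
have E n : Gn g (k + n) z = 2 ^- k * Gn (sh k g) n (Phi g k z).
  by rewrite /Gn Phi_add mulrA -invfM -exprD.
apply/eqP; rewrite eq_le; apply/andP; split.
- apply: ge_sup; first by exists (Gn g 0 z); exists 0%N.
  move=> _ [n _ <-]; apply: le_trans (@Gn_mono g n (k + n) z qg (leq_addl _ _)) _.
  by rewrite E ler_pM2l ?pow2_gt0 // Gn_le_green.
- rewrite -ler_pdivlMl ?pow2_gt0 //.
  apply: ge_sup; first by exists (Gn (sh k g) 0 (Phi g k z)); exists 0%N.
  by move=> _ [n _ <-]; rewrite ler_pdivlMl ?pow2_gt0 // -E Gn_le_green.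
Qed.

(** At a point of K the iterate [N] has [ell = 1], so [green_le] leaves only [2^-N ln 2] and a tail
    of S. Continuity of this single iterate spreads the bound to a neighbourhood. *)
Lemma green_near_Kset g zeta (e : R) : quarter g -> fincap g -> Kset g zeta -> 0 < e ->
  \forall z \near zeta, `|green g z| <= e.
Proof.
move=> qg fc Kz e0.
have l2 : 0 < ln 2 :> R by rewrite ln_gt0 // ltr1n.
have e2 : 0 < e / 2 by rewrite divr_gt0.
have C0 : 0 <= ln 2 + 2 :> R by lra.
have [N HN] := cap_tail qg fc C0 e2; have := HN N (leqnn N) => {}HN.
have := le_capoo N fc => hN.
have p0 := @pow2_gt0 R N; have p1 := @pow2_le1 R N.
have b0 : 1 < 1 + e / 2 by lra.
have : nbhs zeta [set z | ell (Phi g N z) < 1 + e / 2].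
  apply: (@ell_Phi_cont R g N zeta [set x | x < 1 + e / 2]).
  by apply: lt_nbhsl; rewrite (Kset_ell N Kz).
apply: filterS => z /= ez.
rewrite ger0_norm ?green_ge0 //; apply: le_trans (green_le N z qg fc) _.
have e1 := ell_ge1 (Phi g N z).
have : ln (ell (Phi g N z)) <= e / 2.
  by have := @le_ln1Dx R (ell (Phi g N z) - 1); rewrite addrCA subrr addr0; lra.
have : 0 <= ln (ell (Phi g N z)) by rewrite ln_ge0.
set y := ln (ell _); nra.
Qed.

Lemma green_ge_ln g z : quarter g -> fincap g -> z != 0 -> ln (cmod z) <= green g z.
Proof.
move=> qg fc z0; apply: le_trans (Gn_le_green 0 z qg fc).
rewrite /Gn /= expr0 invr1 mul1r; apply: le_trans (acosh_ge (ell_ge1 z)).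
by rewrite ler_ln ?posrE ?cmod_gt0 // ?ell_ge_cmod // (lt_le_trans _ (ell_ge1 z)).
Qed.

Lemma green_le_ln g z : quarter g -> fincap g ->
  green g z <= ln 2 + ln (cmod z + 1) + capoo g.
Proof.
move=> qg fc; apply: le_trans (green_le 0 z qg fc) _.
rewrite expr0 invr1 mul1r /= subr0 lerD2r lerD2l ler_ln ?posrE.
- exact: ell_le_cmod.
- by apply: lt_le_trans (ell_ge1 z).
- by have := cmod_ge0 z; lra.
Qed.

(** The harmonic approximant of [green]: its harmonicity follows from that of [ln |z|] by
    composition, and where [ell] of the iterate is at least 3 it differs from [green] by [O(2^-n)]
    plus a tail of S. *)
Definition logPhi g n z : R := 2 ^- n * (2^-1 * ln (nrm2 (Phi g n z))).

Lemma green_logPhi g n z : quarter g -> fincap g -> 3 <= ell (Phi g n z) ->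
  0 <= green g z - logPhi g n z <= 2 ^- n * (2 * ln 2) + (capoo g - cap g n).
Proof.
move=> qg fc e3.
have c1 := ell_le_cmod (Phi g n z); have c2 := ell_ge_cmod (Phi g n z).
have P0 : Phi g n z != 0 by rewrite -cmod_gt0; lra.
have c0 : 0 < cmod (Phi g n z) by lra.
have -> : logPhi g n z = 2 ^- n * ln (cmod (Phi g n z)) by rewrite /logPhi cmod_eq_ln.
apply/andP; split.
- rewrite subr_ge0; apply: le_trans (Gn_le_green n z qg fc).
  rewrite ler_pM2l ?pow2_gt0 //; apply: le_trans (acosh_ge _); last by lra.
  by rewrite ler_ln ?posrE //; lra.
- have h := green_le n z qg fc.
  suff : ln (ell (Phi g n z)) <= ln 2 + ln (cmod (Phi g n z)).
    move/(ler_wpM2l (ltW (@pow2_gt0 R n))); rewrite mulrDr in h *; lra.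
  have e0 : 0 < ell (Phi g n z) by lra.
  have cc : 0 < 2 * cmod (Phi g n z) by lra.
  by rewrite -lnM ?posrE //; rewrite ler_ln ?posrE //; lra.
Qed.

Lemma harmonic_quad (c : R) W (u : R * R -> R) : open W -> harmonic_on W u ->
  harmonic_on (quad c @^-1` W) (u \o quad c).
Proof.
move=> oW hu; have oU : open (quad c @^-1` W).
  by apply: (continuousP _).1 oW => z; exact: quad_continuous.
exact: (@harmonic_quadratic R _ (quad c @^-1` W) W u oU oW hu (fun z Wz => Wz)).
Qed.

Lemma Phi_open g n (W : set (R * R)) : open W -> open (Phi g n @^-1` W).
Proof. by apply: (continuousP _).1 => z; exact: Phi_continuous. Qed.

Lemma harmonic_Phi g n W (u : R * R -> R) : open W -> harmonic_on W u ->
  harmonic_on (Phi g n @^-1` W) (u \o Phi g n).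
Proof.
elim: n W u => [//|n IH] W u oW hu.
apply: (IH (quad (g n) @^-1` W) (u \o quad (g n))).
  by apply: (continuousP _).1 oW => z; exact: quad_continuous.
exact: harmonic_quad.
Qed.

Lemma harmonic_logPhi g n : harmonic_on [set z | 1 < ell (Phi g n z)] (logPhi g n).
Proof.
have oW : open [set z : R * R | 1 < ell z] by apply: gt_open => z; exact: ell_cont.
have W0 : ~ [set z : R * R | 1 < ell z] 0.
  by rewrite /= ltNge; have /ell_le1P -> : (0 : R * R).2 = 0 /\ `|(0 : R * R).1| <= 1 by rewrite /= normr0.
have h := harmonicZ (2 ^- n) oW (harmonic_ln_nrm2 oW W0).
exact: (harmonic_Phi g n oW h).
Qed.

Lemma harmonic_green g : quarter g -> fincap g -> harmonic_on (~` Kset g) (green g).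
Proof.
move=> qg fc; apply: harmonic_uniform_limit; first exact: open_Kset.
move=> z Kz; have [N eN] := ell_escape 2 qg Kz.
have : nbhs z [set w | 2 < ell (Phi g N w)].
  by apply: (@ell_Phi_cont R g N z [set x | 2 < x]); exact: lt_nbhsr.
move=> /nbhs_ballP[r /= r0 Hr]; exists r => // e e0.
have l2 : 0 < ln 2 :> R by rewrite ln_gt0 // ltr1n.
have C0 : 0 <= 2 * ln 2 + 1 :> R by lra.
have [n0 Hn] := cap_tail qg fc C0 e0.
pose n := maxn n0 N.+1.
have en w : ball z r w -> 3 <= ell (Phi g n w).
  move=> Bw; have /= h := Hr w Bw.
  apply: le_trans (ell_nondecreasing w qg (leq_maxr n0 N.+1)).
  have := ell_step N w qg; lra.
exists (logPhi g n).
  apply: (harmonic_sub _ (harmonic_logPhi g n)) => w Bw /=.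
  by apply: lt_le_trans (en w Bw); lra.
move=> w Bw; have /andP[h1 h2] := green_logPhi qg fc (en w Bw).
rewrite ger0_norm //; apply: le_trans h2 _; apply: le_trans (Hn n (leq_maxl _ _)).
have := le_capoo n fc; have := @pow2_gt0 R n.
set a := 2 ^- n; nra.
Qed.

(* [h = 1 / |w|^2] bounds the distance from [2^-n ln|F_n|] to its limit since the
   [F_n] grow. *)
Lemma logPhi_step g n z : quarter g -> 3 <= cmod z ->
  cmod z <= cmod (Phi g n z) /\
  `|logPhi g n z - cap g n - ln (cmod z)| <= (1 - 2 ^- n) * (2 / nrm2 z).
Proof.
move=> qg z3; elim: n => [|n [IH1 IH2]].
  split=> //; have z0 : z != 0 by rewrite -cmod_gt0; lra.
  by rewrite /logPhi /= expr0 invr1 mul1r subr0 -cmod_eq_ln // !subrr normr0 mul0r.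
have /andP[g0 g4] := qg n.
set w := Phi g n z in IH1 IH2 *.
have w0 : w != 0 by rewrite -cmod_gt0; lra.
have nz : 9 <= nrm2 z by rewrite -cmod_sqr; nra.
have nw : nrm2 z <= nrm2 w by rewrite -!cmod_sqr; have := cmod_ge0 z; nra.
(* [y = 2 g n * quad (g n) w = w^2 - (1 - 2 g n)], so [|y| / |w|^2] differs from 1 by at most
   [1 / |w|^2]. *)
pose y := (w.1 ^+ 2 - w.2 ^+ 2 - (1 - 2 * g n), 2 * w.1 * w.2).
have yE : cmod (quad (g n) w) = (2 * g n)^-1 * cmod y.
  have p0 : 0 < (2 * g n)^-1 by rewrite invr_gt0 mulr_gt0.
  rewrite /quad /y /cmod /=.
  have -> : (2 * g n)^-1 * (w.1 ^+ 2 - w.2 ^+ 2 - 1) + 1 = (2 * g n)^-1 * (w.1 ^+ 2 - w.2 ^+ 2 - (1 - 2 * g n)).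
    by field; rewrite gt_eqF.
  by rewrite !exprMn -mulrDr sqrtrM ?sqr_ge0 // sqrtr_sqr (ger0_norm (ltW p0)) -!exprMn.
have k0 : 0 <= 1 - 2 * g n by lra.
have sq : cmod (w.1 ^+ 2 - w.2 ^+ 2, 2 * w.1 * w.2) = nrm2 w.
  rewrite /cmod /= -[RHS](ger0_norm (nrm2_ge0 w)) -sqrtr_sqr; congr Num.sqrt; rewrite /nrm2; ring.
have lo := @cmod_real_shift R (w.1 ^+ 2 - w.2 ^+ 2, 2 * w.1 * w.2) _ k0.
have hi := @cmod_real_shift_le R (w.1 ^+ 2 - w.2 ^+ 2, 2 * w.1 * w.2) _ k0.
rewrite sq /= -/y in lo hi.
have y0 : 0 < cmod y by lra.
have V0 : 0 < (2 * g n)^-1 by rewrite invr_gt0 mulr_gt0.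
have V2 : 2 <= (2 * g n)^-1 by rewrite -[2]invrK lef_pV2 ?posrE ?mulr_gt0 ?invr_gt0 //; lra.
have big : cmod w <= cmod (quad (g n) w).
  rewrite yE; have := cmod_sqr w; nra.
split; first by apply: le_trans IH1 big.
have q0 : quad (g n) w != 0 by rewrite -cmod_gt0; apply: lt_le_trans big; lra.
have E : logPhi g n.+1 z - cap g n.+1 = logPhi g n z - cap g n + 2 ^- n.+1 * (ln (cmod y) - ln (nrm2 w)).
  rewrite /logPhi /= -/w -!cmod_eq_ln // yE lnM ?posrE // -[nrm2 w]cmod_sqr lnXn ?cmod_gt0 //.
  rewrite pow2S -mulr_natl; field.
  by rewrite expf_neq0.
have D : `|ln (cmod y) - ln (nrm2 w)| <= 2 / nrm2 z.
  have w9 : 0 < nrm2 w by lra.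
  have z9 : 0 < nrm2 z by lra.
  have t1 : ln (cmod y) - ln (nrm2 w) = ln (cmod y / nrm2 w) by rewrite ln_div ?posrE.
  have t2 : ln (nrm2 w) - ln (cmod y) = ln (nrm2 w / cmod y) by rewrite ln_div ?posrE.
  have u1 : ln (cmod y / nrm2 w) <= cmod y / nrm2 w - 1.
    by have := @le_ln1Dx R (cmod y / nrm2 w - 1); rewrite addrCA subrr addr0; apply; rewrite ltrBrDl subrr divr_gt0.
  have u2 : ln (nrm2 w / cmod y) <= nrm2 w / cmod y - 1.
    by have := @le_ln1Dx R (nrm2 w / cmod y - 1); rewrite addrCA subrr addr0; apply; rewrite ltrBrDl subrr divr_gt0.
  have u3 : cmod y / nrm2 w - 1 <= 2 / nrm2 z.
    rewrite lerBlDr ler_pdivrMr // mulrDl mul1r mulrAC.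
    have : 2 <= 2 * nrm2 w / nrm2 z by rewrite ler_pdivlMr //; lra.
    lra.
  have u4 : nrm2 w / cmod y - 1 <= 2 / nrm2 z.
    rewrite lerBlDr ler_pdivrMr // mulrDl mul1r mulrAC.
    have : 1 <= 2 * cmod y / nrm2 z by rewrite ler_pdivlMr //; lra.
    lra.
  rewrite ler_norml; lra.
rewrite E (_ : _ + _ - ln (cmod z) = logPhi g n z - cap g n - ln (cmod z) + 2 ^- n.+1 * (ln (cmod y) - ln (nrm2 w))); last by ring.
apply: le_trans (ler_normD _ _) _.
rewrite [X in _ + X]normrM (ger0_norm (ltW (@pow2_gt0 R n.+1))).
have := ler_wpM2l (ltW (@pow2_gt0 R n.+1)) D; rewrite pow2S => D'.
apply: le_trans (lerD IH2 D') _.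
by rewrite -mulrDl; apply: ler_wpM2r; [rewrite divr_ge0 ?nrm2_ge0|lra].
Qed.

Lemma green_asymptotics g z : quarter g -> fincap g -> 3 <= cmod z ->
  `|green g z - ln (cmod z) - capoo g| <= 2 / nrm2 z.
Proof.
move=> qg fc z3; apply/ler_addgt0Pr => e e0.
have l2 : 0 < ln 2 :> R by rewrite ln_gt0 // ltr1n.
have C0 : 0 <= 2 * ln 2 + 2 :> R by lra.
have [n /(_ n (leqnn n)) Hn] := cap_tail qg fc C0 e0.
have [c1 c2] := logPhi_step n qg z3.
have e3 : 3 <= ell (Phi g n z) by apply: le_trans (ell_ge_cmod _); exact: le_trans c1.
have /andP[h1 h2] := green_logPhi qg fc e3.
have h3 := le_capoo n fc; have p0 := @pow2_gt0 R n.
have n0 : 0 <= 2 / nrm2 z by rewrite divr_ge0 ?nrm2_ge0.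
have c3 : `|logPhi g n z - cap g n - ln (cmod z)| <= 2 / nrm2 z.
  by apply: le_trans c2 _; nra.
move: c3; rewrite ler_norml => /andP[c3 c4].
suff : - (2 / nrm2 z + e) <= green g z - ln (cmod z) - capoo g <= 2 / nrm2 z + e by rewrite -ler_norml.
move: Hn h2; set a := 2 ^- n in p0 *; set l := ln 2 in l2 *; set s := capoo g in h3 * => Hn h2.
have : a * (2 * l) + 2 * (s - cap g n) <= e.
  apply: le_trans Hn; have : 0 <= l * (s - cap g n) by rewrite mulr_ge0 //; lra.
  lra.
move=> HH; apply/andP; split; lra.
Qed.

End GreenFunction.

(** * Itineraries *)

Section InverseBranches.
Context {R : realType}.
Implicit Types (g : nat -> R) (z w : R * R) (n m k : nat) (s : seq bool).

Definition branch (c y : R) : R := Num.sqrt (1 - 2 * c * (1 - y)).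

(* [(pt g tau s, 0)] is the preimage of [(tau, 0)] under [Phi g (size s)] whose
   itinerary is [s]; the letter [true] stands for the right half plane. *)
Fixpoint pt g (tau : R) s : R :=
  if s is b :: s' then (if b then 1 else -1) * branch (g 0%N) (pt (sh 1 g) tau s') else tau.

Definition itinerary g n z : seq bool := mkseq (fun k => 0 < (Phi g k z).1) n.

Lemma branch_arg (c y : R) : 0 < c < 1 / 4 -> `|y| <= 1 -> 0 < 1 - 2 * c * (1 - y) <= 1.
Proof. by move=> /andP[c0 c4]; rewrite ler_norml => /andP[y1 y2]; apply/andP; split; nra. Qed.

Lemma branch_bounds (c y : R) : 0 < c < 1 / 4 -> `|y| <= 1 -> 0 < branch c y <= 1.
Proof.
move=> hc hy; have /andP[h1 h2] := branch_arg hc hy.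
by rewrite /branch sqrtr_gt0 h1 /= -[X in _ <= X]sqrtr1 ler_wsqrtr.
Qed.

Lemma branch_sqr (c y : R) : 0 < c < 1 / 4 -> `|y| <= 1 ->
  branch c y ^+ 2 = 1 - 2 * c * (1 - y).
Proof. by move=> hc hy; have /andP[/ltW h1 _] := branch_arg hc hy; rewrite sqr_sqrtr. Qed.

Lemma pt_bound g (tau : R) s : quarter g -> `|tau| <= 1 -> `|pt g tau s| <= 1.
Proof.
move=> qg t1; elim: s g qg => [//|b s IH] g qg /=.
have /andP[h1 h2] := branch_bounds (qg 0%N) (IH _ (quarter_sh 1 qg)).
have h3 : `|if b then 1 else -1 : R| = 1 by case: b; rewrite ?normrN normr1.
by rewrite normrM h3 mul1r ger0_norm ?(ltW h1).
Qed.

Lemma quad_branch (c y e : R) : 0 < c < 1 / 4 -> `|y| <= 1 -> e ^+ 2 = 1 ->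
  quad c (e * branch c y, 0) = (y, 0).
Proof.
move=> hc hy he; rewrite /quad /= exprMn he branch_sqr // expr0n /=.
have c0 : c != 0 by case/andP: hc => c0 _; rewrite gt_eqF.
by congr pair; field.
Qed.

Lemma sign_sqr (b : bool) : (if b then 1 else -1 : R) ^+ 2 = 1.
Proof. by case: b; rewrite ?sqrrN expr1n. Qed.

Lemma Phi_pt g (tau : R) s : quarter g -> `|tau| <= 1 ->
  Phi g (size s) (pt g tau s, 0) = (tau, 0).
Proof.
move=> qg t1; elim: s g qg => [//|b s IH] g qg; have q1 := quarter_sh 1 qg.
rewrite [size _]/= Phi_shS [pt _ _ _]/= quad_branch ?sign_sqr ?IH //.
exact: pt_bound.
Qed.

Lemma itineraryS g n z : itinerary g n.+1 z = (0 < z.1) :: itinerary (sh 1 g) n (quad (g 0%N) z).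
Proof.
rewrite /itinerary /mkseq /=; have -> : iota 1 n = [seq (1 + i)%N | i <- iota 0 n] := iotaDl 1 0 n.
rewrite -map_comp; congr cons; apply: eq_map => k.
exact: (congr1 (fun w : R * R => 0 < w.1) (Phi_shS g k z)).
Qed.

Lemma itinerary_rcons g n z : itinerary g n.+1 z = rcons (itinerary g n z) (0 < (Phi g n z).1).
Proof. by rewrite /itinerary mkseqS. Qed.

Lemma size_itinerary g n z : size (itinerary g n z) = n.
Proof. exact: size_mkseq. Qed.

Lemma itinerary_pt g (tau : R) s : quarter g -> `|tau| <= 1 ->
  itinerary g (size s) (pt g tau s, 0) = s.
Proof.
move=> qg t1; elim: s g qg => [//|b s IH] g qg; have q1 := quarter_sh 1 qg.
have hp := pt_bound s q1 t1; have /andP[h1 _] := branch_bounds (qg 0%N) hp.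
rewrite [size _]/= itineraryS [pt _ _ _]/= quad_branch ?sign_sqr // IH //; congr cons => /=.
by case: b; rewrite ?mul1r // mulN1r oppr_gt0; apply/negbTE; rewrite -leNgt ltW.
Qed.

Lemma quad_real_eq (c y : R) z : 0 < c < 1 / 4 -> `|y| <= 1 -> quad c z = (y, 0) ->
  z = ((if 0 < z.1 then 1 else -1) * branch c y, 0).
Proof.
move=> hc hy; have /andP[c0 c4] := hc; rewrite /quad => -[e1 e2].
have cn : c != 0 by rewrite gt_eqF.
have V0 : (2 * c)^-1 != 0 by rewrite invr_eq0 mulf_neq0.
have e3 : z.1 ^+ 2 - z.2 ^+ 2 = 1 - 2 * c * (1 - y) by rewrite -e1; field.
have /andP[p0 _] := branch_arg hc hy.
have /eqP := e2; rewrite mulf_eq0 (negbTE V0) /= -mulrA !mulf_eq0 pnatr_eq0 /= => /orP[/eqP z1|/eqP z2].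
  by move: p0; rewrite -e3 z1 expr0n add0r oppr_gt0 ltNge sqr_ge0.
rewrite z2 expr0n subr0 in e3.
rewrite [LHS]surjective_pairing z2 /branch -e3 sqrtr_sqr; congr pair.
by case: ltP => h; [rewrite mul1r gtr0_norm|rewrite mulN1r ler0_norm // opprK].
Qed.

Lemma pt_itinerary g (tau : R) n z : quarter g -> `|tau| <= 1 -> Phi g n z = (tau, 0) ->
  z = (pt g tau (itinerary g n z), 0).
Proof.
move=> qg t1; elim: n g z qg => [|n IH] g z qg; first by move=> /= ->.
rewrite Phi_shS => /(IH _ _ (quarter_sh 1 qg)) E.
rewrite itineraryS [pt _ _ _]/=; apply: quad_real_eq => //.
by apply: pt_bound => //; exact: quarter_sh.
Qed.

Lemma Kset_itinerary g n z : quarter g -> Kset g z ->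
  z = (pt g (Phi g n z).1 (itinerary g n z), 0).
Proof.
move=> qg Kz; have /ell_le1P[h2 h1] := Kz n.
by apply: pt_itinerary => //; rewrite [LHS]surjective_pairing h2.
Qed.

(* With [a = cos (2 s)] one has [sin (acos (branch c a)) = 2 sqrt c * sin s], and
   [2 sqrt c < 1]. *)
Lemma acos_branch (c a b : R) : 0 < c < 1 / 4 -> `|a| <= 1 -> `|b| <= 1 ->
  acos b <= acos a -> acos (branch c a) - acos (branch c b) <= (acos a - acos b) / 2.
Proof.
move=> hc; have /andP[c0 c4] := hc.
pose k := Num.sqrt (4 * c).
have k0 : 0 <= k by exact: sqrtr_ge0.
have k1 : k <= 1 by rewrite -[X in _ <= X]sqrtr1 ler_wsqrtr //; lra.
have pi0 := pi_gt0 R.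
have half (y : R) : `|y| <= 1 -> let s := acos y / 2 in let t := acos (branch c y) in
    [/\ 0 <= s <= pi / 2, 0 <= t <= pi / 2, sin t = k * sin s & t <= s].
  move=> y1 s t.
  have y1' : -1 <= y <= 1 by rewrite -ler_norml.
  have /andP[r0 r1] := branch_bounds hc y1.
  have r1' : -1 <= branch c y <= 1 by apply/andP; split; lra.
  have [/andP[u0 u1] cu] := acos_def y1'; have [/andP[v0 v1] cv] := acos_def r1'.
  have s0 : 0 <= s <= pi / 2 by apply/andP; split; rewrite /s; lra.
  have t0 : 0 <= t <= pi / 2.
    rewrite v0 /= leNgt; apply/negP => h.
    have := @ltr_cos R (pi / 2) t; rewrite !in_itv /= cos_pihalf cv h => /(_ _ _).
    by rewrite ltNge (ltW r0) => E; have := E ltac:(apply/andP; split; lra) ltac:(apply/andP; split => //; lra).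
  have ss : 0 <= sin s by apply: sin_ge0_pi; move: s0 => /andP[? ?]; apply/andP; split; lra.
  have st : 0 <= sin t by apply: sin_ge0_pi; rewrite v0.
  have E : sin t = k * sin s.
    rewrite -[LHS]ger0_norm // -[RHS]ger0_norm ?mulr_ge0 // -!sqrtr_sqr; congr Num.sqrt.
    rewrite exprMn sqr_sqrtr ?mulr_ge0 ?(ltW c0) // sin2cos2 cv branch_sqr // sin2cos2.
    have := cos_mulr2n s; have -> : s *+ 2 = acos y by rewrite /s -mulr_natr divfK.
    rewrite cu -mulr_natl => E2; have -> : cos s ^+ 2 = (y + 1) / 2 by lra.
    by field.
  suff ts : t <= s by split.
  rewrite leNgt; apply/negP => h.
  have : sin s < sin t.
    by rewrite ltr_sin ?in_itv /= //; move: s0 t0 => /andP[? ?] /andP[? ?]; apply/andP; split; lra.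
  by rewrite E ltNge ler_piMl.
move=> a1 b1 ab.
have [/andP[s0 s1] /andP[al0 al1] Ea las] := half a a1.
have [/andP[t0 t1] /andP[be0 be1] Eb lbt] := half b b1.
set s := acos a / 2 in s0 s1 Ea las; set t := acos b / 2 in t0 t1 Eb lbt.
set al := acos (branch c a) in al0 al1 Ea las *; set be := acos (branch c b) in be0 be1 Eb lbt *.
have -> : (acos a - acos b) / 2 = s - t by rewrite /s /t; field.
have st : t <= s by rewrite /s /t; lra.
rewrite leNgt; apply/negP => h.
(* From [al <= s] and [be <= t] the midpoint cosine is larger for [(al, be)] than for [(s, t)]. If
   [al - be] exceeded [s - t], the difference of the sines would be too large for the factor
   [k <= 1]. *)
have sumd (x y : R) : sin x - sin y = 2 * (cos ((x + y) / 2) * sin ((x - y) / 2)).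
  have E1 : x = (x + y) / 2 + (x - y) / 2 by field.
  have E2 : y = (x + y) / 2 - (x - y) / 2 by field.
  rewrite [X in sin X - _]E1 [X in _ - sin X]E2 sinD sinB; ring.
have cp : cos ((s + t) / 2) <= cos ((al + be) / 2).
  by rewrite leNgt ltr_cos ?in_itv /= -?leNgt; try (apply/andP; split); lra.
have cp0 : 0 < cos ((al + be) / 2) by apply: cos_gt0_pihalf; apply/andP; split; lra.
have sd0 : 0 <= sin ((s - t) / 2) by apply: sin_ge0_pi; apply/andP; split; lra.
have sd : sin ((s - t) / 2) < sin ((al - be) / 2).
  by rewrite ltr_sin ?in_itv /=; [lra|apply/andP; split; lra|apply/andP; split; lra].
have H : sin al - sin be = k * (sin s - sin t) by rewrite Ea Eb; ring.
rewrite !sumd in H.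
have h1 : cos ((s + t) / 2) * sin ((s - t) / 2) <= cos ((al + be) / 2) * sin ((s - t) / 2).
  exact: ler_wpM2r.
have h2 : cos ((al + be) / 2) * sin ((s - t) / 2) < cos ((al + be) / 2) * sin ((al - be) / 2).
  by rewrite ltr_pM2l.
have h3 : 0 <= cos ((s + t) / 2) * sin ((s - t) / 2).
  by rewrite mulr_ge0 // cos_ge0_pihalf //; apply/andP; split; lra.
have h4 : k * (cos ((s + t) / 2) * sin ((s - t) / 2)) <= cos ((s + t) / 2) * sin ((s - t) / 2).
  exact: ler_piMl.
nra.
Qed.

Lemma acos_branch_abs (c a b : R) : 0 < c < 1 / 4 -> `|a| <= 1 -> `|b| <= 1 ->
  `|acos (branch c a) - acos (branch c b)| <= `|acos a - acos b| / 2.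
Proof.
move=> hc a1 b1.
wlog ab : a b a1 b1 / acos b <= acos a.
  move=> H; case/orP: (le_total (acos b) (acos a)) => h; first exact: H.
  by rewrite distrC [X in X / 2]distrC; exact: H.
have h1 := acos_branch hc a1 b1 ab.
have mono : acos (branch c b) <= acos (branch c a).
  have a1' : -1 <= a <= 1 by rewrite -ler_norml.
  have b1' : -1 <= b <= 1 by rewrite -ler_norml.
  have /andP[ra0 ra1] := branch_bounds hc a1; have /andP[rb0 rb1] := branch_bounds hc b1.
  have A : -1 <= branch c a <= 1 by apply/andP; split; lra.
  have B : -1 <= branch c b <= 1 by apply/andP; split; lra.
  have [/andP[u0 u1] cu] := acos_def a1'; have [/andP[v0 v1] cv] := acos_def b1'.
  have [/andP[x0 x1] cx] := acos_def A; have [/andP[y0 y1] cy] := acos_def B.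
  have : a <= b.
    rewrite -cu -cv; move: ab; rewrite le_eqVlt => /orP[/eqP -> //|ab].
    by apply/ltW; rewrite ltr_cos ?in_itv /= ?u0 ?v0.
  move=> le_ab.
  have rr : branch c a <= branch c b.
    by rewrite /branch ler_wsqrtr //; case/andP: hc => c0 c4; nra.
  rewrite leNgt; apply/negP => h.
  have : branch c b < branch c a by rewrite -cx -cy ltr_cos ?in_itv /= ?x0 ?y0.
  by rewrite ltNge rr.
by rewrite !ger0_norm ?subr_ge0.
Qed.

(** Each letter halves the distance in the angle, uniformly in [g]. In the Euclidean distance the
    derivative of [branch c] at -1 is [c / sqrt (1 - 4 c)], unbounded as [c] tends to 1/4. *)
Lemma acos_pt g (tau tau' : R) s : quarter g -> `|tau| <= 1 -> `|tau'| <= 1 ->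
  `|acos (pt g tau s) - acos (pt g tau' s)| <= pi * 2 ^- size s.
Proof.
move=> qg t1 t1'; elim: s g qg => [|b s IH] g qg /=.
  have /acos_def[/andP[u0 u1] _] : -1 <= tau <= 1 by rewrite -ler_norml.
  have /acos_def[/andP[v0 v1] _] : -1 <= tau' <= 1 by rewrite -ler_norml.
  rewrite expr0 invr1 mulr1 ler_norml; lra.
have q1 := quarter_sh 1 qg.
have p1 := pt_bound s q1 t1; have p1' := pt_bound s q1 t1'.
have H : `|acos (branch (g 0%N) (pt (sh 1 g) tau s)) - acos (branch (g 0%N) (pt (sh 1 g) tau' s))|
   <= pi * 2 ^- (size s).+1.
  apply: le_trans (acos_branch_abs (qg 0%N) p1 p1') _.
  by rewrite pow2S mulrCA mulrC ler_pM2l ?invr_gt0 // IH.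
case: b; first by rewrite !mul1r.
have /andP[ra0 ra1] := branch_bounds (qg 0%N) p1; have /andP[rb0 rb1] := branch_bounds (qg 0%N) p1'.
rewrite !mulN1r !acosN; [|lra|lra].
by rewrite opprB addrC addrA subrK distrC.
Qed.

Lemma cos_lipschitz (x y : R) : `|cos x - cos y| <= `|x - y|.
Proof.
wlog xy : x y / y < x.
  move=> H; have [->|xy] := eqVneq x y; first by rewrite !subrr.
  move: xy; rewrite neq_lt => /orP[h|h]; last exact: H.
  by rewrite distrC [X in _ <= X]distrC; exact: H.
have [t _ ->] := @MVT R cos (fun t => - sin t) y x xy
  (fun t _ => is_derive_cos t) (continuous_subspaceT (@continuous_cos R)).
by rewrite normrM normrN ler_piMl // ler_norml sin_geN1 sin_le1.
Qed.

Lemma pt_diameter g (tau tau' : R) s : quarter g -> `|tau| <= 1 -> `|tau'| <= 1 ->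
  `|pt g tau s - pt g tau' s| <= pi * 2 ^- size s.
Proof.
move=> qg t1 t1'; apply: le_trans (acos_pt s qg t1 t1').
have p1 := pt_bound s qg t1; have p1' := pt_bound s qg t1'.
rewrite -{1}[pt g tau s]acosK ?in_itv /= -?ler_norml //.
rewrite -{1}[pt g tau' s]acosK ?in_itv /= -?ler_norml //.
exact: cos_lipschitz.
Qed.

End InverseBranches.

(** * Critical points and the Parreau-Widom sum *)

Section CriticalPoints.
Context {R : realType}.
Implicit Types (g : nat -> R) (z w : R * R) (n m k : nat) (s : seq bool) (u : R * R -> R).

Definition grad2 u z : R := ('D_(dirx R) u z) ^+ 2 + ('D_(diry R) u z) ^+ 2.

Lemma grad2_eq0 u z : grad2 u z = 0 <-> 'D_(dirx R) u z = 0 /\ 'D_(diry R) u z = 0.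
Proof.
rewrite /grad2; split=> [/eqP|[-> ->]]; last by rewrite expr0n addr0.
by rewrite paddr_eq0 ?sqr_ge0 // !sqrf_eq0 => /andP[/eqP -> /eqP ->].
Qed.

Lemma grad2_quad (c : R) W u z : c != 0 -> open W -> harmonic_on W u -> W (quad c z) ->
  grad2 (u \o quad c) z = grad2 u (quad c z) * (nrm2 z / c ^+ 2).
Proof.
move=> c0 oW hu Wz.
have CR : cauchy_riemann 1 setT (fun z : R * R => (2 * c)^-1 * (z.1 ^+ 2 - z.2 ^+ 2 - 1) + 1)
    (fun z => (2 * c)^-1 * (2 * z.1 * z.2)) (fun z => (2 * c)^-1 * 2 * z.1) (fun z => (2 * c)^-1 * 2 * z.2).
  by move=> y _; split; deriv; ring.
have [d1 d2] := derive_comp_conformal oW hu CR (I : setT z) Wz.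
pose ux := 'D_(dirx R) u (quad c z); pose uy := 'D_(diry R) u (quad c z).
have E1 : 'D_(dirx R) (u \o quad c) z = ux * ((2 * c)^-1 * 2 * z.1) + uy * ((2 * c)^-1 * 2 * z.2).
  exact: (is_derive_val d1).
have E2 : 'D_(diry R) (u \o quad c) z =
    ux * (- 1 * ((2 * c)^-1 * 2 * z.2)) + uy * (1 * ((2 * c)^-1 * 2 * z.1)).
  exact: (is_derive_val d2).
rewrite /grad2 E1 E2 -/ux -/uy /nrm2; field.
by rewrite c0.
Qed.

(** The product is the squared modulus of the derivative of [F_n], each factor being that of
    [f'(w) = w / gamma] at an iterate. A critical point of the composition is thus a critical image
    point or a zero of an earlier iterate. *)
Lemma grad2_Phi g n W u z : quarter g -> open W -> harmonic_on W u -> W (Phi g n z) ->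
  grad2 (u \o Phi g n) z = grad2 u (Phi g n z) * \prod_(k < n) (nrm2 (Phi g k z) / g k ^+ 2).
Proof.
move=> qg; elim: n W u => [|n IH] W u oW hu Wz; first by rewrite big_ord0 mulr1.
have gn0 : g n != 0 by case/andP: (qg n) => ? _; rewrite gt_eqF.
have oU : open (quad (g n) @^-1` W).
  by apply: (continuousP _).1 oW => y; exact: quad_continuous.
have := IH (quad (g n) @^-1` W) (u \o quad (g n)) oU (harmonic_quad (g n) oW hu) Wz.
rewrite (grad2_quad gn0 oW hu Wz) big_ord_recr /= -mulrA [X in _ * X]mulrC => <-.
by [].
Qed.

Lemma grad2_scale U u z (k : R) : open U -> harmonic_on U u -> U z ->
  grad2 (fun w => k * u w) z = k ^+ 2 * grad2 u z.
Proof.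
move=> oU hu Uz; have [d1 d2 _ _] := harmonic_derive oU hu Uz.
have E1 := is_derive_val (is_derive_scl k d1); have E2 := is_derive_val (is_derive_scl k d2).
by rewrite /grad2 [X in X ^+ 2 + _ = _]E1 [X in _ + X ^+ 2 = _]E2 !exprMn mulrDr.
Qed.

Lemma cmod_le_sum (a b : R) : cmod (a, b) <= `|a| + `|b|.
Proof.
rewrite cmod_le ?addr_ge0 // /nrm2 /= sqrrD !real_normK ?num_real //.
by rewrite addrAC lerDl mulrn_wge0 // mulr_ge0.
Qed.

Lemma cmod_sup_ball z w (d : R) : ball z d w -> cmod z - 2 * d <= cmod w.
Proof.
move/plane_ballP => [h1 h2]; have := cmod_triangle w.1 w.2 (z.1 - w.1) (z.2 - w.2).
have -> : (w.1 + (z.1 - w.1), w.2 + (z.2 - w.2)) = z.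
  by rewrite [RHS]surjective_pairing; congr pair; ring.
rewrite -surjective_pairing => h.
have := cmod_le_sum (z.1 - w.1) (z.2 - w.2); lra.
Qed.

(** On the ball of radius [r / 4] about [z], with [r = |z|], [green] differs from [ln |w| + capoo]
    by at most [8 / r^2], so each partial derivative differs by at most [128 / r^3]. The gradient of
    [ln |w|] has length [1 / r], which is larger once [r >= 32]. *)
Lemma grad2_green_infty g z : quarter g -> fincap g -> 32 <= cmod z -> grad2 (green g) z != 0.
Proof.
move=> qg fc z32.
have oK := @open_Kset R g.
set r := cmod z in z32.
have r0 : 0 < r by lra.
have z0 : z != 0 by rewrite -cmod_gt0.
pose d := r / 4.
have d0 : 0 < d by rewrite divr_gt0.
have far w : ball z d w -> r / 2 <= cmod w by move/cmod_sup_ball; rewrite -/r /d; lra.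
have oB := @open_ball_plane R z d.
have BK : ball z d `<=` ~` Kset g.
  move=> w Bw Kw; have := far w Bw.
  by have := Kw 0%N; have := ell_ge_cmod w; rewrite /=; lra.
have B0 : ~ ball z d (0 : R * R).
  by move/far; rewrite /cmod /= expr0n addr0 sqrtr0; lra.
have hL := harmonic_ln_nrm2 oB B0.
have hk := harmonicB oB (harmonicB oB (harmonic_sub BK (harmonic_green qg fc)) hL) (harmonic_cst (capoo g) oB).
have kM w : ball z d w -> `|green g w - 2^-1 * ln (nrm2 w) - capoo g| <= 8 / r ^+ 2.
  move=> Bw; have c1 := far w Bw; have c3 : 3 <= cmod w by lra.
  rewrite -cmod_eq_ln; last by rewrite -cmod_gt0; lra.
  apply: le_trans (green_asymptotics qg fc c3) _.
  have c4 : r ^+ 2 / 4 <= nrm2 w by rewrite -cmod_sqr; nra.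
  have r2 : 0 < r ^+ 2 by rewrite exprn_gt0.
  rewrite ler_pdivlMr // mulrAC ler_pdivrMr; lra.
have Bz : ball z d z by exact: ballxx.
have comp (v : R * R) : v = dirx R \/ v = diry R -> 'D_v (green g) z = 0 ->
    `|z.1 * v.1 + z.2 * v.2| <= 128 / r.
  move=> vd D0; have vd' : axis_dir v by [].
  have g1 := gradient_estimate vd d0 hk kM.
  have dk : is_derive z v (fun w => green g w - 2^-1 * ln (nrm2 w) - capoo g)
     (0 - (nrm2 z)^-1 * (z.1 * v.1 + z.2 * v.2) - 0).
    have dg : is_derive z v (green g) 0.
      by rewrite -D0; exact: (harmonic_derivable vd' oK (harmonic_green qg fc) (BK z Bz)).
    exact: (is_derive_add (is_derive_add dg (is_derive_oppr (is_derive_ln_nrm2 v z0)))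
      (is_derive_oppr (is_derive_const z v (capoo g)))).
  rewrite (is_derive_val dk) sub0r subr0 normrN normrM -cmod_sqr -/r in g1.
  rewrite ger0_norm ?invr_ge0 ?sqr_ge0 // ler_pdivrMl ?exprn_gt0 // in g1.
  apply: le_trans g1 _; rewrite /d le_eqVlt; apply/orP; left; apply/eqP; field.
  by rewrite gt_eqF.
apply/negP => /eqP/grad2_eq0[X0 Y0].
have := comp _ (or_introl erefl) X0; have := comp _ (or_intror erefl) Y0.
move=> {X0 Y0 comp}; rewrite /dirx /diry /= !mulr0 !mulr1 add0r addr0 => h2 h1.
have q : 128 / r <= 4 by rewrite ler_pdivrMr //; lra.
have : nrm2 z <= 32.
  rewrite /nrm2 -(real_normK (num_real z.1)) -(real_normK (num_real z.2)).
  have := normr_ge0 z.1; have := normr_ge0 z.2; nra.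
rewrite -cmod_sqr -/r; nra.
Qed.

(** [quad c 0 = 1 - 1 / (2 c)] is below -1 because [c < 1/4], and [ell] never decreases
    afterwards. *)
Lemma Phi_zero_ell g k n z : quarter g -> Phi g k z = 0 -> (k < n)%N -> 1 < ell (Phi g n z).
Proof.
move=> qg z0 kn; apply: lt_le_trans (ell_nondecreasing z qg kn).
rewrite ltNge /= z0 /quad /= !expr0n /= subrr sub0r !mulr0; apply/negP => /ell_le1P[_].
have /andP[g0 g4] := qg k; rewrite ler_norml => /andP[/=].
have : 2 < (2 * g k)^-1 by rewrite -[2]invrK ltf_pV2 ?posrE ?mulr_gt0 ?invr_gt0 //; lra.
lra.
Qed.

Lemma Phi_zero_off_Kset g k z : quarter g -> Phi g k z = 0 -> ~ Kset g z.
Proof.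
by move=> qg z0 /(_ k.+1); apply/negP; rewrite -ltNge; exact: (Phi_zero_ell qg z0).
Qed.

(** With [N] so large that [|F_N z| >= 32], the shifted Green function has no critical point at
    [F_N z]. By [grad2_Phi] the gradient can only vanish through a factor with [F_k z = 0],
    [k < N]. *)
Lemma critical_green g z : quarter g -> fincap g -> ~ Kset g z ->
  grad2 (green g) z = 0 <-> exists k, Phi g k z = 0.
Proof.
move=> qg fc Kz.
have E N : grad2 (green g) z = (2 ^- N) ^+ 2 * (grad2 (green (sh N g)) (Phi g N z) *
    \prod_(k < N) (nrm2 (Phi g k z) / g k ^+ 2)).
  have qN := quarter_sh N qg; have fN := fincap_sh N qg fc.
  have oN := @open_Kset R (sh N g); have hN := harmonic_green qN fN.
  have KN : (~` Kset (sh N g)) (Phi g N z) by move/Kset_sh => /(_ qg).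
  have -> : green g = (fun w => 2 ^- N * (green (sh N g) \o Phi g N) w).
    by apply/funext => w; exact: green_sh.
  have oU := @Phi_open R g N _ oN; have hU := @harmonic_Phi R g N _ _ oN hN.
  by rewrite (grad2_scale (2 ^- N) oU hU KN) (grad2_Phi qg oN hN KN).
split; last first.
  move=> [k Pk]; rewrite (E k.+1) big_ord_recr /= Pk /nrm2 expr0n addr0 mul0r !mulr0 //.
move=> G0; apply: contrapT => /forallNP N0.
have [N eN] := ell_escape 33 qg Kz.
have c32 : 32 <= cmod (Phi g N z) by have := ell_le_cmod (Phi g N z); lra.
have := grad2_green_infty (quarter_sh N qg) (fincap_sh N qg fc) c32.
move/eqP; apply; move/eqP: G0; rewrite (E N) mulf_eq0 (negbTE (expf_neq0 2 (lt0r_neq0 (@pow2_gt0 R N)))) /= mulf_eq0.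
move=> /orP[/eqP //|/prodf_eq0[k _]].
have /andP[gk _] := qg k.
have gk0 : (g k ^+ 2)^-1 != 0 by rewrite invr_neq0 // expf_neq0 // lt0r_neq0.
rewrite mulf_eq0 (negbTE gk0) orbF nrm2_eq0 => /eqP Pk.
by case: (N0 k Pk).
Qed.

End CriticalPoints.

(** * Critical values and the convergence of their sum *)

Section ParreauWidomSum.
Context {R : realType}.
Implicit Types (g : nat -> R) (z w : R * R) (n m k : nat) (s : seq bool) (u : R * R -> R).

Definition crit_point g s : R * R := (pt g 0 s, 0).

Lemma Phi_crit_point g s : quarter g -> Phi g (size s) (crit_point g s) = 0.
Proof. by move=> qg; rewrite /crit_point Phi_pt // normr0. Qed.

Lemma crit_point_green g s : quarter g -> fincap g ->
  green g (crit_point g s) = 2 ^- size s * green (sh (size s) g) 0.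
Proof. by move=> qg fc; rewrite (green_sh (size s) _ qg fc) Phi_crit_point. Qed.

Lemma ell0 : ell (0 : R * R) = 1.
Proof.
by apply/eqP; rewrite eq_le ell_ge1 andbT; apply/ell_le1P; rewrite /= normr0.
Qed.

(** The length of the word is recovered because a zero of [F_k] has [ell > 1] at all later times,
    while [ell 0 = 1]; the letters are then the itinerary. *)
Lemma crit_point_inj g : quarter g -> injective (crit_point g).
Proof.
move=> qg s s' E; have P := Phi_crit_point s qg; have P' := Phi_crit_point s' qg.
have S : size s = size s'.
  case: (ltngtP (size s) (size s')) => // h.
    have := Phi_zero_ell qg P h; by rewrite E P' ell0 ltxx.
  have := Phi_zero_ell qg P' h; by rewrite -E P ell0 ltxx.
have t0 : `|0 : R| <= 1 by rewrite normr0.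
by rewrite -[s](itinerary_pt s qg t0) -[RHS](itinerary_pt s' qg t0) S -/(crit_point g s) E.
Qed.

Lemma critical_set_green g : quarter g -> fincap g ->
  [set c | ~ Kset g c /\ grad2 (green g) c = 0] = crit_point g @` [set: seq bool].
Proof.
move=> qg fc; apply/seteqP; split => z.
  move=> [Kz /(critical_green qg fc Kz)[k Pk]]; exists (itinerary g k z) => //.
  by rewrite /crit_point -pt_itinerary // normr0.
move=> [s _ <-]; have P := Phi_crit_point s qg; have Ks := Phi_zero_off_Kset qg P.
by split=> //; apply/(critical_green qg fc Ks); exists (size s).
Qed.

Definition words n : seq (seq bool) := [seq val t | t : n.-tuple bool].

Lemma wordsP n : [set` words n] = [set s | size s = n].
Proof.
apply/seteqP; split => s /=; first by move=> /mapP[t _ ->]; exact: size_tuple.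
by move=> /eqP h; apply/mapP; exists (Tuple h) => //; rewrite mem_enum.
Qed.

Lemma words_uniq n : uniq (words n).
Proof. by rewrite map_inj_uniq ?enum_uniq //; exact: val_inj. Qed.

Lemma size_words n : size (words n) = (2 ^ n)%N.
Proof. by rewrite size_map -cardE card_tuple card_bool. Qed.

Lemma esum_critical_green g : quarter g -> fincap g ->
  (\esum_(c in [set c | ~ Kset g c /\ grad2 (green g) c = 0%R]) (green g c)%:E =
   \sum_(k <oo) (green (sh k g) 0%R)%:E)%E.
Proof.
move=> qg fc; rewrite critical_set_green // esum_image; last first.
  by move=> s s' _ _; exact: crit_point_inj.
have -> : [set: seq bool] = \bigcup_(k in [set: nat]) [set s | size s = k].
  by apply/seteqP; split => s // _; exists (size s).
rewrite esum_bigcupT; first last.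
- by move=> s; rewrite lee_fin green_ge0.
- by move=> i j _ _ [s [/= <- <-]].
rewrite nneseries_esumT; last first.
  by move=> k; rewrite lee_fin green_ge0 //; [exact: quarter_sh|exact: fincap_sh].
apply: eq_esum => k _; rewrite -wordsP esum_fset; [|exact: finite_seq|].
  rewrite -fsbig_seq ?words_uniq //.
  rewrite (eq_big_seq (fun _ => (2 ^- k * green (sh k g) 0)%:E)).
    rewrite sumEFin big_const_seq count_predT size_words iter_addr addr0 -[(_ * _) *+ _]mulr_natl natrX.
    by rewrite mulVKf // expf_neq0.
  move=> s; have := wordsP k => /seteqP[/(_ s) h _] /h /= <-.
  by rewrite crit_point_green.
by move=> s _; rewrite lee_fin green_ge0.
Qed.

Lemma green0 g : quarter g -> fincap g ->
  green g 0 = 2^-1 * green (sh 1 g) (- (1 + (1 - 4 * g 0%N) / (2 * g 0%N)), 0).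
Proof.
move=> qg fc; have /andP[g0 _] := qg 0%N; rewrite (green_sh 1 _ qg fc) expr1; congr (_ * green _ _).
rewrite /= /quad /= !expr0n /= !mulr0 subrr sub0r; congr pair; field.
by rewrite gt_eqF.
Qed.

Lemma crit_value_ge0 g : quarter g -> 8 * (1 / 4 - g 0%N) <= (1 - 4 * g 0%N) / (2 * g 0%N).
Proof.
move=> qg; have /andP[g0 g4] := qg 0%N.
rewrite ler_pdivlMr ?mulr_gt0 //; nra.
Qed.

(** Put [t = sqrt eps <= 1/2]. The critical value is [-(1 + x)] with [x >= 8 eps], so [acosh (1 + x)
    >= ln (1 + 4 t) >= 4 t / (1 + 4 t) >= 4 t / 3]; the factor 1/2 of [green0] leaves 2/3. *)
Lemma green0_ge g : quarter g -> fincap g ->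
  2 / 3 * Num.sqrt (1 / 4 - g 0%N) <= green g 0.
Proof.
move=> qg fc; have /andP[g0 g4] := qg 0%N; rewrite green0 //.
have := crit_value_ge0 qg; set x := (1 - _) / _ => hx.
have e0 : 0 <= 1 / 4 - g 0%N by lra.
have x0 : 0 <= x by lra.
have := Gn_le_green 0 (- (1 + x), 0) (quarter_sh 1 qg) (fincap_sh 1 qg fc).
have n1 : `|- (1 + x)| = 1 + x by rewrite normrN ger0_norm //; lra.
rewrite /Gn expr0 invr1 mul1r [Phi _ _ _]/= ell_real n1 ?lerDl // => hG.
have h1 := acosh_ge_sqrt x0.
set e := 1 / 4 - g 0%N in e0 hx *; set t := Num.sqrt e.
have t0 : 0 <= t by exact: sqrtr_ge0.
have t2 : t ^+ 2 = e by rewrite sqr_sqrtr.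
have t12 : t <= 1 / 2 by have : e <= 1 / 4 by [rewrite /e; lra]; nra.
have h2 : 4 * t <= Num.sqrt (2 * x).
  rewrite -[X in X <= _]ger0_norm ?mulr_ge0 // -sqrtr_sqr ler_wsqrtr // exprMn t2; lra.
have h3 : ln (1 + 4 * t) <= ln (1 + Num.sqrt (2 * x)) by rewrite ler_ln ?posrE; lra.
have p0 : 0 < (1 + 4 * t)^-1 by rewrite invr_gt0; lra.
have h4 : 1 - (1 + 4 * t)^-1 <= ln (1 + 4 * t).
  have := @le_ln1Dx R ((1 + 4 * t)^-1 - 1); rewrite addrCA subrr addr0 lnV ?posrE; last by lra.
  by move=> /(_ ltac:(lra)); lra.
have h5 : 4 / 3 * t <= 1 - (1 + 4 * t)^-1.
  rewrite lerBrDl -lerBrDr -[X in X <= _]mul1r ler_pdivrMr; last by lra.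
  nra.
lra.
Qed.

(** Convexity of the exponential along chords through 0; it is used with both signs of [x]. *)
Lemma expR_secant (mu x : R) : 1 <= mu -> mu * (expR x - 1) <= expR (mu * x) - 1.
Proof.
move=> mu1; have -> : mu * x = x + (mu - 1) * x by ring.
rewrite expRD; have e0 := expR_gt0 x.
have h1 : expR x * (1 + (mu - 1) * x) <= expR x * expR ((mu - 1) * x).
  by rewrite ler_pM2l // expR_ge1Dx.
have h2 : expR x * (1 - x) <= 1.
  rewrite -[X in _ <= X](@expRxMexpNx_1 R x) ler_pM2l //; exact: expR_ge1Dx.
have : 0 <= (mu - 1) * (1 - expR x * (1 - x)) by rewrite mulr_ge0; lra.
lra.
Qed.

(** Averaging [expR_secant] at [a] and [- a], with [cosh a = 1 + v], gives
    [cosh (mu a) >= 1 + mu v]. *)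
Lemma acosh_scale (mu v : R) : 1 <= mu -> 0 <= v -> acosh (1 + mu * v) <= mu * acosh (1 + v).
Proof.
move=> mu1 v0; set a := acosh (1 + v).
have a0 : 0 <= a by apply: acosh_ge0; lra.
have e1 : 1 <= 1 + v by lra.
have s0 : 0 <= (1 + v) ^+ 2 - 1 by nra.
have Ea : expR a = 1 + v + Num.sqrt ((1 + v) ^+ 2 - 1).
  by rewrite /a /acosh lnK // posrE; have := sqrtr_ge0 ((1 + v) ^+ 2 - 1); lra.
have EV : expR (- a) = 1 + v - Num.sqrt ((1 + v) ^+ 2 - 1).
  apply: (mulfI (lt0r_neq0 (expR_gt0 a))); rewrite expRxMexpNx_1 Ea.
  have := sqr_sqrtr s0; set r := Num.sqrt _ => r2; nra.
have h1 := expR_secant a mu1; have h2 := expR_secant (- a) mu1.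
rewrite mulrN Ea EV in h1 h2.
set B := expR (mu * a) in h1; set C := expR (- (mu * a)) in h2.
have BC : B * C = 1 by exact: expRxMexpNx_1.
have B1 : 1 <= B by rewrite -expR0 ler_expR mulr_ge0 //; lra.
have B0 : 0 < B by lra.
have CB : C <= B.
  have : C <= 1 by rewrite -expR0 ler_expR oppr_le0 mulr_ge0 //; lra.
  lra.
have big : 1 + mu * v <= (B + C) / 2 by lra.
have m0 : 0 <= mu * v by rewrite mulr_ge0; lra.
apply: le_trans (acosh_mono _ big) _; first by lra.
rewrite /acosh.
(* [B] and [C] are the exponentials of [mu a] and [- mu a]: this is [cosh^2 - 1 = sinh^2]. *)
have -> : ((B + C) / 2) ^+ 2 - 1 = ((B - C) / 2) ^+ 2 + (B * C - 1) by field.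
rewrite BC subrr addr0.
rewrite sqrtr_sqr ger0_norm; last by lra.
by rewrite (_ : (B + C) / 2 + (B - C) / 2 = B) ?expRK //; field.
Qed.

(** With [v = 2 y^2 - 2], the next iterate is [1 + v / (4 g n)], whereas [1 + v] is the Chebyshev
    image of [y], for which [acosh] exactly doubles. [acosh_scale] pays for the difference with the
    factor [1 / (4 g n)]. *)
Lemma Gn_real_step g n z : quarter g -> (Phi g n z).2 = 0 -> 1 <= `|(Phi g n z).1| ->
  [/\ (Phi g n.+1 z).2 = 0, 1 <= `|(Phi g n.+1 z).1| & Gn g n.+1 z <= (4 * g n)^-1 * Gn g n z].
Proof.
move=> qg P2 P1; have /andP[g0 g4] := qg n.
set y := (Phi g n z).1 in P1.
have Py : Phi g n z = (y, 0) by rewrite [LHS]surjective_pairing P2.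
have y1 : 1 <= y ^+ 2 by rewrite -(real_normK (num_real y)); nra.
pose v := 2 * y ^+ 2 - 2.
have v0 : 0 <= v by rewrite /v; lra.
pose mu := (4 * g n)^-1.
have mu1 : 1 <= mu by rewrite /mu -[1]invr1 lef_pV2 ?posrE ?mulr_gt0 //; lra.
have Q : Phi g n.+1 z = (1 + mu * v, 0).
  by rewrite /= Py /quad /= expr0n /= mulr0 mulr0; congr pair; rewrite /mu /v; field; rewrite gt_eqF.
have m0 : 0 <= mu * v by rewrite mulr_ge0; lra.
have N1 : 1 <= `|1 + mu * v| by rewrite ger0_norm; lra.
rewrite Q /=; split => //.
rewrite /Gn Q Py !ell_real // ger0_norm; last by lra.
rewrite pow2S -mulrA mulrCA [X in _ <= X]mulrCA ler_pM2l ?pow2_gt0 //.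
have h := acosh_scale mu1 v0.
have E : 1 + v = 2 * `|y| ^+ 2 - 1 by rewrite (real_normK (num_real y)) /v; ring.
rewrite E acosh_double // in h; rewrite -/mu; lra.
Qed.

Lemma Gn_real_le g n (y : R) : quarter g -> 1 <= `|y| ->
  Gn g n (y, 0) <= \prod_(k < n) (4 * g k)^-1 * acosh `|y|.
Proof.
move=> qg y1.
have : [/\ (Phi g n (y, 0)).2 = 0, 1 <= `|(Phi g n (y, 0)).1|
   & Gn g n (y, 0) <= \prod_(k < n) (4 * g k)^-1 * acosh `|y|].
  elim: n => [|n [IH1 IH2 IH3]].
    by split=> //=; rewrite /Gn expr0 invr1 /= big_ord0 ell_real.
  have [h1 h2 h3] := Gn_real_step qg IH1 IH2; split=> //.
  apply: le_trans h3 _; have /andP[g0 _] := qg n.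
  rewrite big_ord_recr /= [X in _ <= X * _]mulrC -mulrA ler_pM2l //.
  by rewrite invr_gt0 mulr_gt0.
by case.
Qed.

Definition sqrt_summable g : Prop :=
  exists B, forall n, \sum_(k < n) Num.sqrt (1 / 4 - g k) <= B.

Lemma sqrt_summable_large g : sqrt_summable g -> exists N, forall n, (N <= n)%N -> 1 / 8 <= g n.
Proof.
move=> [B Hb]; pose u : R^nat := fun k => Num.sqrt (1 / 4 - g k).
have cu : cvgn (series u).
  apply: nondecreasing_is_cvgn.
    by apply/nondecreasing_seqP => n; rewrite /series /= big_nat_recr //= lerDl sqrtr_ge0.
  by exists B => _ [n _ <-]; rewrite /series /= big_mkord.
(* [sqrt eps < 1/3] gives [eps < 1/9 < 1/8]. *)
have /cvgrPdist_lt/(_ (1 / 3)) := cvg_series_cvg_0 cu.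
move=> /(_ ltac:(lra))[N _ HN]; exists N => n /HN /=.
rewrite sub0r normrN ger0_norm ?sqrtr_ge0 // => h.
rewrite leNgt; apply/negP => hg.
have p0 : 0 <= 1 / 4 - g n by lra.
by have := sqr_sqrtr p0; have := sqrtr_ge0 (1 / 4 - g n); rewrite /u in h; nra.
Qed.

Lemma fincap_of_sh g N : fincap (sh N g) -> quarter g -> fincap g.
Proof.
move=> [B Hb] qg; exists (cap g N + 2 ^- N * B) => n.
apply: le_trans (@cap_mono R g n (N + n) qg (leq_addl _ _)) _.
by rewrite cap_sh lerD2l ler_pM2l ?pow2_gt0.
Qed.

Lemma fincap_large g : quarter g -> (forall n, 1 / 8 <= g n) -> fincap g.
Proof.
move=> qg gl; exists (ln 4) => n.
have l4 : 0 < ln 4 :> R by rewrite ln_gt0 // ltr1n.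
suff : cap g n <= (1 - 2 ^- n) * ln 4.
  by move=> h; apply: le_trans h _; have := @pow2_gt0 R n; nra.
elim: n => [|n IH]; first by rewrite /= expr0 invr1 subrr mul0r.
have /andP[g0 g4] := qg n; have gn := gl n.
have : ln (2 * g n)^-1 <= ln 4.
  rewrite ler_ln ?posrE ?invr_gt0 ?mulr_gt0 // -[4]invrK lef_pV2 ?posrE ?invr_gt0 ?mulr_gt0 //; lra.
rewrite /= pow2S; set x := ln (_)^-1 => hx.
have := ler_wpM2l (ltW (@pow2_gt0 R n)) hx; lra.
Qed.

Lemma sqrt_summable_fincap g : quarter g -> sqrt_summable g -> fincap g.
Proof.
move=> qg /sqrt_summable_large[N HN]; apply: (@fincap_of_sh g N) => //.
by apply: fincap_large; [exact: quarter_sh|move=> n; apply: HN; exact: leq_addr].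
Qed.

(** From [g >= 1/8] follow [x <= 16 eps <= 8 t] and [acosh (1 + x) <= 8 t + 10 t], half of which is
    [9 t]. The growth along the real axis is at most the product of the [1 / (4 g k) = 1 / (1 - 4
    s^2) <= 1 + 8 s <= exp (8 s)], where [s] is the square root of [1/4 - g k]. *)
Lemma green0_le g (B : R) : quarter g -> fincap g -> (forall n, 1 / 8 <= g n) ->
  (forall n, \sum_(k < n) Num.sqrt (1 / 4 - g k.+1) <= B) ->
  green g 0 <= expR (8 * B) * 9 * Num.sqrt (1 / 4 - g 0%N).
Proof.
move=> qg fc gl Hb; have /andP[g0 g4] := qg 0%N; have gl0 := gl 0%N; rewrite green0 //.
have := crit_value_ge0 qg; set x := (1 - _) / _ => hx.
set e := 1 / 4 - g 0%N in hx *.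
have e0 : 0 <= e by rewrite /e; lra.
have x0 : 0 <= x by lra.
have xe : x <= 16 * e by rewrite /x /e ler_pdivrMr ?mulr_gt0 //; nra.
set t := Num.sqrt e.
have t0 : 0 <= t by exact: sqrtr_ge0.
have t2 : t ^+ 2 = e by rewrite sqr_sqrtr.
have t12 : t <= 1 / 2 by have : e <= 1 / 4 by [rewrite /e; lra]; nra.
have n1 : `|- (1 + x)| = 1 + x by rewrite normrN ger0_norm //; lra.
have A : acosh (1 + x) <= 18 * t.
  apply: le_trans (acosh_le_sqrt x0) _.
  have x8 : x <= 8 * t by nra.
  suff : Num.sqrt (x ^+ 2 + 2 * x) <= 10 * t by lra.
  have xx : x * x <= 8 * t * (8 * t) by apply: ler_pM.
  rewrite -[X in _ <= X]ger0_norm ?mulr_ge0 // -sqrtr_sqr ler_wsqrtr //.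
  rewrite !expr2; rewrite expr2 in t2; lra.
have P n : \prod_(k < n) (4 * sh 1 g k)^-1 <= expR (8 * B).
  apply: le_trans (_ : expR (8 * \sum_(k < n) Num.sqrt (1 / 4 - g k.+1)) <= _); last first.
    by rewrite ler_expR ler_pM2l // Hb.
  elim: n => [|n IH]; first by rewrite !big_ord0 mulr0 expR0.
  rewrite !big_ord_recr /= mulrDr expRD; apply: ler_pM => //.
  - by apply: prodr_ge0 => k _; have /andP[h _] := qg k.+1; rewrite /sh invr_ge0 mulr_ge0 // ltW.
  - by have /andP[h _] := qg n.+1; rewrite /sh invr_ge0 mulr_ge0 // ltW.
  - rewrite /sh add1n; have /andP[h0 h4] := qg n.+1; have hl := gl n.+1.
    set s := Num.sqrt _; have s0 : 0 <= s by exact: sqrtr_ge0.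
    have s2 : s ^+ 2 = 1 / 4 - g n.+1 by rewrite sqr_sqrtr //; lra.
    apply: le_trans (_ : 1 + 8 * s <= _); last exact: expR_ge1Dx.
    rewrite -[X in X <= _]mul1r ler_pdivrMr ?mulr_gt0 //.
    have -> : g n.+1 = 1 / 4 - s ^+ 2 by lra.
    have : s <= 1 / 2 by nra.
    nra.
have y1 : 1 <= `|- (1 + x)| by rewrite n1; lra.
have E0 := expR_gt0 (8 * B).
have : green (sh 1 g) (- (1 + x), 0) <= expR (8 * B) * (18 * t).
  apply: ge_sup; first by exists (Gn (sh 1 g) 0 (- (1 + x), 0)); exists 0%N.
  move=> _ [n _ <-]; apply: le_trans (Gn_real_le n (quarter_sh 1 qg) y1) _; rewrite n1.
  apply: ler_pM => //; last by apply: acosh_ge0; lra.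
  by apply: prodr_ge0 => k _; have /andP[h _] := quarter_sh 1 qg k; rewrite invr_ge0 mulr_ge0 // ltW.
lra.
Qed.

Lemma PW_green_finite g : quarter g -> fincap g ->
  (\sum_(k <oo) (green (sh k g) 0%R)%:E < +oo)%E <-> sqrt_summable g.
Proof.
move=> qg fc; pose v k := green (sh k g) 0.
have v0 k : 0 <= v k by apply: green_ge0; [exact: quarter_sh|exact: fincap_sh].
split=> [|sg].
- set S := (\sum_(k <oo) _)%E => S1.
  have S0 : (0 <= S)%E by apply: nneseries_ge0 => k _ _; rewrite lee_fin v0.
  exists (3 / 2 * fine S) => n.
  suff : \sum_(k < n) v k <= fine S.
    move=> h; apply: le_trans (ler_wpM2l _ h); last by lra.
    rewrite mulr_sumr ler_sum // => k _.
    have := green0_ge (quarter_sh k qg) (fincap_sh k qg fc); rewrite /sh addn0 -/(v k); lra.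
  rewrite -lee_fin fineK ?ge0_fin_numE // -sumEFin -(big_mkord xpredT (fun k => (v k)%:E)).
  by apply: (@nneseries_lim_ge R (fun k => (v k)%:E) xpredT 0%N n) => k _; rewrite lee_fin v0.
- have [N HN] := sqrt_summable_large sg.
  have [B Hb] := sg.
  (* The first [N] values are merely finite; from [N] on, every shift satisfies the hypotheses of
     [green0_le] with the same [B]. *)
  pose M := \sum_(k < N) v k + expR (8 * B) * 9 * B.
  apply: (@le_lt_trans _ _ M%:E); last by rewrite ltry.
  apply: lime_le; first by apply: is_cvg_nneseries => k _ _; rewrite lee_fin v0.
  apply: nearW => n; rewrite sumEFin big_mkord lee_fin.
  apply: le_trans (_ : \sum_(k < N + n) v k <= _).
    rewrite (addnC N) big_split_ord /= lerDl sumr_ge0 //.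
  rewrite big_split_ord /= lerD2l.
  apply: le_trans (_ : expR (8 * B) * 9 * \sum_(k < n) Num.sqrt (1 / 4 - g (N + k)%N) <= _).
    rewrite mulr_sumr ler_sum // => k _.
    have := @green0_le (sh (N + k) g) B (quarter_sh _ qg) (fincap_sh _ qg fc).
    rewrite /sh addn0; apply.
      by move=> j; apply: HN; rewrite -addnA leq_addr.
    move=> j; apply: le_trans (Hb ((N + k).+1 + j)%N).
    rewrite big_split_ord /= (eq_bigr (fun i : 'I_j => Num.sqrt (1 / 4 - g ((N + k).+1 + i)%N))).
      by rewrite lerDr sumr_ge0 // => i _; exact: sqrtr_ge0.
    by move=> i _; rewrite addSnnS.
  apply: ler_wpM2l; first by rewrite mulr_ge0 ?expR_ge0.
  by have := Hb (N + n)%N; rewrite big_split_ord /=; apply: le_trans; rewrite lerDr sumr_ge0 // => k _; exact: sqrtr_ge0.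
Qed.

End ParreauWidomSum.

(** * The Dirichlet problem off K *)

Section DirichletProblem.
Context {R : realType}.
Implicit Types (g : nat -> R) (z w zeta : R * R) (n m k : nat) (s : seq bool) (u phi : R * R -> R).

Definition bvals g phi u : Prop := forall zeta, Kset g zeta -> forall e : R, 0 < e ->
  \forall z \near zeta, ~ Kset g z -> `|u z - phi zeta| <= e.

(** Phragmen-Lindelof: subtracting [eta * green], which grows like [eta ln |z|], supplies the
    control at infinity for a function bounded above; then [eta] tends to 0. *)
Lemma green_vsub_max g u (C M : R) : quarter g -> fincap g ->
  (forall z, ~ Kset g z -> {for z, continuous u}) -> vsub (~` Kset g) u ->
  (forall z, ~ Kset g z -> u z <= C) ->
  (forall zeta, Kset g zeta -> forall e : R, 0 < e ->
     \forall z \near zeta, ~ Kset g z -> u z <= M + e) ->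
  forall z, ~ Kset g z -> u z <= M.
Proof.
move=> qg fc cu vu uC ub z Kz; have oK := @open_Kset R g.
have hG := harmonic_green qg fc.
have H (eta : R) : 0 < eta -> forall y, ~ Kset g y -> u y - eta * green g y <= M.
  move=> eta0; apply: (@max_principle R (~` Kset g) (fun y => u y - eta * green g y) M oK).
  - move=> y Ky; have cG : cont_at (green g) y := harmonic_continuous oK Ky hG.
    have cy : cont_at u y := cu y Ky.
    by cont_step.
  - exact: (vsubB oK vu (harmonicZ eta oK hG)).
  - move=> e e0 zeta /contrapT Kzeta; apply: filterS (ub zeta Kzeta e e0) => y h Ky.
    have := h Ky; have := mulr_ge0 (ltW eta0) (green_ge0 y qg fc); lra.
  (* Beyond this radius [eta ln |y|] exceeds [C - M], since [ln |y|] is half of [ln (nrm2 y)]. *)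
  - move=> e e0; exists (Num.max 1 (expR (2 * ((C - M) / eta)))) => y Ky.
    rewrite gt_max => /andP[y1 y2].
    have y0 : y != 0 by rewrite -nrm2_gt0; lra.
    have := uC y Ky; have := green_ge_ln qg fc y0; rewrite cmod_eq_ln //.
    have : 2 * ((C - M) / eta) < ln (nrm2 y).
      by rewrite -ltr_expR lnK // posrE; lra.
    move=> h1 h2 h3.
    have : (C - M) / eta * eta <= green g y * eta by rewrite ler_pM2r //; lra.
    by rewrite divfK ?lt0r_neq0 //; lra.
by apply: ler_gt0_lim => eta /H /(_ z Kz); rewrite lerBlDr; exact.
Qed.

Lemma green_max g u (C M : R) : quarter g -> fincap g -> harmonic_on (~` Kset g) u ->
  (forall z, ~ Kset g z -> u z <= C) ->
  (forall zeta, Kset g zeta -> forall e : R, 0 < e ->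
     \forall z \near zeta, ~ Kset g z -> u z <= M + e) ->
  forall z, ~ Kset g z -> u z <= M.
Proof.
move=> qg fc hu; have oK := @open_Kset R g.
apply: green_vsub_max qg fc _ (harmonic_vsub oK hu) => z Kz.
exact: harmonic_continuous oK Kz hu.
Qed.

Lemma green_max_abs g u (C M : R) : quarter g -> fincap g -> harmonic_on (~` Kset g) u ->
  (forall z, ~ Kset g z -> `|u z| <= C) ->
  (forall zeta, Kset g zeta -> forall e : R, 0 < e ->
     \forall z \near zeta, ~ Kset g z -> `|u z| <= M + e) ->
  forall z, ~ Kset g z -> `|u z| <= M.
Proof.
move=> qg fc hu uC ub z Kz; have oK := @open_Kset R g.
have h1 : u z <= M.
  apply: (green_max qg fc hu (C := C)) => // [y Ky|zeta Kzeta e e0].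
    by apply: le_trans (uC y Ky); exact: ler_norm.
  by apply: filterS (ub zeta Kzeta e e0) => y h /h; apply: le_trans; exact: ler_norm.
have h2 : - u z <= M.
  apply: (green_max qg fc (harmonicN oK hu) (C := C)) => // [y Ky|zeta Kzeta e e0].
    by apply: le_trans (uC y Ky); rewrite -normrN; exact: ler_norm.
  by apply: filterS (ub zeta Kzeta e e0) => y h /h; apply: le_trans; rewrite -normrN; exact: ler_norm.
by rewrite ler_norml; lra.
Qed.

(** In a box a positive continuous function has a positive minimum on a compact set; outside the box
    [ln 3] is a lower bound by [green_ge_ln]. *)
Lemma green_lower_bound g (C : set (R * R)) : quarter g -> fincap g -> closed C ->
  C `<=` ~` Kset g -> exists2 d : R, 0 < d & forall z, C z -> d <= green g z.
Proof.
move=> qg fc cC CK; have oK := @open_Kset R g; have hG := harmonic_green qg fc.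
have far z : ~ (`|z.1| <= 3 /\ `|z.2| <= 3) -> ln 3 <= green g z.
  move=> h; have c3 : 3 <= cmod z.
    rewrite leNgt; apply/negP => c3; apply: h.
    have := cmod_sqr z; rewrite /nrm2; have := cmod_ge0 z.
    have := sqr_ge0 z.1; have := sqr_ge0 z.2.
    by move=> h1 h2 h3 h4; split; rewrite -ler_sqr ?nnegrE // real_normK ?num_real //; nra.
  have z0 : z != 0 by rewrite -cmod_gt0; lra.
  by apply: le_trans (green_ge_ln qg fc z0); rewrite ler_ln ?posrE //; lra.
have l3 : 0 < ln 3 :> R by rewrite ln_gt0 // ltr1n.
pose S := C `&` [set z | `|z.1| <= 3 /\ `|z.2| <= 3].
have [S0|/nonemptyPn S0] := pselect (S !=set0); last first.
  exists (ln 3) => // z Cz; apply: far => h; have : S z by split.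
  by rewrite S0.
have cS : compact S.
  by apply: (subclosed_compact _ (@compact_square R 3)) => [|z []//]; apply: closedI => //; exact: compact_closed (@compact_square R 3).
have cG : {within S, continuous (green g)}.
  apply: continuous_in_subspaceT => z /set_mem[Cz _].
  exact: harmonic_continuous oK (CK z Cz) hG.
have [c /set_mem[Cc _] Hc] := @compact_EVT_min _ R (green g) S S0 cS cG.
exists (Num.min (ln 3) (green g c)).
  by rewrite lt_min l3 /= green_gt0 //; exact: CK.
move=> z Cz; rewrite ge_min; have [h|h] := pselect (`|z.1| <= 3 /\ `|z.2| <= 3).
  by apply/orP; right; apply: Hc; apply/mem_set.
by rewrite far.
Qed.

(** A barrier tending to 1 at the points of K in [A]. When [green >= d] off [A] and the
    complementary open set [B], the truncated expression vanishes at the edge of [A], so the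
    extension by 0 is continuous; being a maximum with 0 it stays subharmonic. *)
Definition dent g (d : R) (A : set (R * R)) z : R :=
  if `[< A z >] then Num.max 0 (1 - green g z / d) else 0.

Lemma dent_bounds g (d : R) A z : quarter g -> fincap g -> 0 < d -> 0 <= dent g d A z <= 1.
Proof.
move=> qg fc d0; rewrite /dent; case: asboolP => _; last by rewrite lexx ler01.
rewrite le_max lexx /= ge_max ler01 /= lerBlDr lerDl divr_ge0 ?green_ge0 //; exact: ltW.
Qed.

Lemma dent_ge g (d : R) A z : A z -> 1 - green g z / d <= dent g d A z.
Proof. by move=> Az; rewrite /dent asboolT // le_max lexx orbT. Qed.

Section Dent.
Variables (g : nat -> R) (d : R) (A B : set (R * R)).
Hypotheses (qg : quarter g) (fc : fincap g) (d0 : 0 < d).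
Hypotheses (oA : open A) (oB : open B) (AB : A `&` B = set0).
Hypothesis (Gd : forall z, ~ A z -> ~ B z -> d <= green g z).

Let cG z : ~ Kset g z -> cont_at (fun z => 1 - green g z / d) z.
Proof.
move=> Kz; have c : cont_at (green g) z := harmonic_continuous (@open_Kset R g) Kz (harmonic_green qg fc).
by cont_step.
Qed.

Let cM z : ~ Kset g z -> cont_at (fun z => Num.max 0 (1 - green g z / d)) z.
Proof.
move=> Kz; have c1 := @cont_const R z 0; have c2 := cG Kz.
exact: (@continuous_max _ _ (fun=> 0 : R) _ z c1 c2).
Qed.

Lemma dent_cont z : ~ Kset g z -> {for z, continuous (dent g d A)}.
Proof.
move=> Kz; have [Az|nA] := pselect (A z).
  apply: near_continuous (cM Kz); apply: (open_nearW oA Az) => w Aw.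
  by rewrite /dent asboolT.
have [Bz|nB] := pselect (B z).
  apply: (@near_continuous R (fun=> 0) (dent g d A) z _ (@cont_const R z 0)).
  apply: (open_nearW oB Bz) => w Bw.
  by rewrite /dent asboolF // => Aw; have : (A `&` B) w by []; rewrite AB.
apply: near_continuousP => e e0.
have E0 : Num.max 0 (1 - green g z / d) = 0.
  by rewrite max_l // subr_le0 ler_pdivlMr // mul1r Gd.
have -> : dent g d A z = 0 by rewrite /dent asboolF.
have : nbhs z [set w | Num.max 0 (1 - green g w / d) < e].
  have := cM Kz; rewrite /cont_at /prop_for /continuous_at E0 => /(_ [set x | x < e]); apply.
  exact: lt_nbhsl.
apply: filterS => w /= h; rewrite subr0 ger0_norm; last by have /andP[] := dent_bounds A w qg fc d0.
by rewrite /dent; case: asboolP => _; exact: ltW.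
Qed.

Lemma dent_vsub : vsub (~` Kset g) (dent g d A).
Proof.
have oK := @open_Kset R g.
move=> z0 V h eta Kz oV Vz hh eta0.

have [E|N] := eqVneq (dent g d A z0) 0.
  apply: (@vsub_near R _ (fun=> 0) _ _ _ _ _ (harmonic_vsub oK (harmonic_cst 0 oK)) Kz oV Vz hh eta0 _ (esym E)).
  by near=> w; have /andP[] := dent_bounds A w qg fc d0.
have Az : A z0 by apply: contra_neqP N; rewrite /dent => ?; rewrite asboolF.
have hs : harmonic_on (~` Kset g) (fun z => 1 - d^-1 * green g z).
  exact: (harmonicB oK (harmonic_cst 1 oK) (harmonicZ d^-1 oK (harmonic_green qg fc))).
apply: (@vsub_near R _ _ (dent g d A) _ _ _ _ (harmonic_vsub oK hs) Kz oV Vz hh eta0).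
  by apply: (open_nearW oA Az) => w Aw; rewrite mulrC; exact: dent_ge.
move: N; rewrite /dent asboolT // mulrC; case: leP => //; by rewrite eqxx.
Unshelve. all: by end_near. Qed.

End Dent.

(** Perron's method between [dent] of [A] and [1 - dent] of [B]. Both have the desired boundary
    values because [green] tends to 0 at K. *)
Lemma dirichlet_separated g A B : quarter g -> fincap g -> open A -> open B ->
  A `&` B = set0 -> Kset g `<=` A `|` B ->
  exists u, [/\ harmonic_on (~` Kset g) u, forall z, ~ Kset g z -> 0 <= u z <= 1 &
    bvals g (fun z => `[< A z >]%:R) u].
Proof.
move=> qg fc oA oB AB KAB; have oK := @open_Kset R g.
have [d d0 Hd] := @green_lower_bound g (~` (A `|` B)) qg fc (open_closedC (openU oA oB))
  (fun z nAB Kz => nAB (KAB z Kz)).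
have Gd z : ~ A z -> ~ B z -> d <= green g z by move=> nA nB; apply: Hd => -[].
have BA : B `&` A = set0 by rewrite setIC.
have Gd' z : ~ B z -> ~ A z -> d <= green g z by move=> nB nA; exact: Gd.
have cA z : ~ Kset g z -> {for z, continuous (dent g d A)} by exact: (dent_cont qg fc d0 oA oB AB Gd).
have cB z : ~ Kset g z -> {for z, continuous (dent g d B)} by exact: (dent_cont qg fc d0 oB oA BA Gd').
have s1 : vsub (~` Kset g) (fun z => - (1 - dent g d B z)).
  have -> : (fun z => - (1 - dent g d B z)) = (fun z => dent g d B z - 1) by apply/funext => z; ring.
  exact: (vsubB oK (dent_vsub qg fc d0 oB) (harmonic_cst 1 oK)).
have le01 z : ~ Kset g z -> dent g d A z <= 1 - dent g d B z.
  move=> _; have /andP[a1 a2] := dent_bounds A z qg fc d0.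
  have /andP[b1 b2] := dent_bounds B z qg fc d0.
  have [Az|nA] := pselect (A z).
    have -> : dent g d B z = 0.
      by rewrite /dent asboolF // => Bz; have : (A `&` B) z by []; rewrite AB.
    lra.
  have -> : dent g d A z = 0 by rewrite /dent asboolF.
  lra.
have [u hu Hu] := @perron R (~` Kset g) (dent g d A) (fun z => 1 - dent g d B z) oK cA
  (fun z Kz => cont_atD (@cont_const R z 1) (cont_atN (cB z Kz)))
  (dent_vsub qg fc d0 oA) s1 le01.
have ub z : ~ Kset g z -> 0 <= u z <= 1.
  move=> Kz; have /andP[h1 h2] := Hu z Kz.
  have /andP[a1 a2] := dent_bounds A z qg fc d0; have /andP[b1 b2] := dent_bounds B z qg fc d0.
  by apply/andP; split; lra.
exists u; split=> // zeta Kz e e0.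
have de0 : 0 < d * e by exact: mulr_gt0.
have nG := green_near_Kset qg fc Kz de0.
have small z : `|green g z| <= d * e -> green g z / d <= e.
  by rewrite ger0_norm ?green_ge0 // ler_pdivrMr // mulrC.
have [Az|Bz] := KAB zeta Kz.
  rewrite asboolT //; have nA := open_nearW oA Az (fun w (Aw : A w) => Aw).
  apply: filterS2 nG nA => z /small hG Aw nK.
  have /andP[h1 _] := Hu z nK; have /andP[_ h2] := ub z nK; have h3 := @dent_ge g d A z Aw.
  by rewrite (_ : true%:R = 1 :> R) // ler_norml; apply/andP; split; lra.
rewrite asboolF; last by move=> Az; have : (A `&` B) zeta by []; rewrite AB.
have nB := open_nearW oB Bz (fun w (Bw : B w) => Bw).
apply: filterS2 nG nB => z /small hG Bw nK; rewrite subr0.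
have /andP[_ h1] := Hu z nK; have /andP[h2 _] := ub z nK; have h3 := @dent_ge g d B z Bw.
by rewrite ger0_norm //; lra.
Qed.

Lemma Kset_Phi_neq0 g n z : quarter g -> Kset g z -> (Phi g n z).1 != 0.
Proof.
move=> qg Kz; apply/eqP => P1; have /ell_le1P[P2 _] := Kz n.
by apply: (@Phi_zero_off_Kset R g n z qg _ Kz); rewrite [LHS]surjective_pairing P1 P2.
Qed.

(** On K no [F_k] vanishes and all are real, so each letter is decided by which of two disjoint open
    half planes contains [F_k z]. *)
Lemma itinerary_separated g s : quarter g -> exists A B,
  [/\ open A, open B, A `&` B = set0, Kset g `<=` A `|` B &
    forall z, Kset g z -> A z <-> itinerary g (size s) z = s].
Proof.
move=> qg; elim/last_ind: s => [|s b [A [B [oA oB AB KAB HA]]]].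
  exists setT, set0; split; [exact: openT|exact: open0|exact: setI0|by move=> z _; left|by []].
pose f z := (if b then 1 else -1) * (Phi g (size s) z).1.
have cf z : cont_at f z.
  apply: cont_atM; first exact: cont_const.
  by apply: (@continuous_comp _ _ _ (Phi g (size s)) fst); [exact: Phi_continuous|exact: cvg_fst].
exists (A `&` [set z | 0 < f z]), (B `|` [set z | f z < 0]); split.
- by apply: openI => //; exact: gt_open.
- by apply: openU => //; exact: open_lt_cont.
- apply/seteqP; split=> // z [[Az /= fz] [Bz|/= fz']].
    by have : (A `&` B) z by []; rewrite AB.
  by move: (lt_trans fz fz'); rewrite ltxx.
- move=> z Kz; case: (KAB z Kz) => [Az|]; last by right; left.
  have : f z != 0 by rewrite mulf_neq0 ?Kset_Phi_neq0 //; case: b @f cf; rewrite ?oppr_eq0 oner_eq0.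
  by rewrite neq_lt => /orP[h|h]; [right; right|left].
- move=> z Kz; rewrite size_rcons itinerary_rcons; split.
    move=> [/(HA z Kz) -> /=]; rewrite /f; case: b @f cf => _ _; first by rewrite mul1r => ->.
    by rewrite mulN1r oppr_gt0 => h; rewrite ltNge (ltW h).
  move/eqP; rewrite eqseq_rcons => /andP[/eqP h1 /eqP h2]; split; first exact/HA.
  rewrite /= /f -h2; case: (ltP 0 (Phi g (size s) z).1) => h; first by rewrite mul1r.
  by rewrite mulN1r oppr_gt0 lt_neqAle h Kset_Phi_neq0.
Qed.

Lemma dirichlet_word_sum g n (L : seq (seq bool)) (chi : seq bool -> R) : quarter g -> fincap g ->
  (forall s, s \in L -> size s = n) ->
  exists u, [/\ harmonic_on (~` Kset g) u,
    exists C : R, forall z, ~ Kset g z -> `|u z| <= C &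
    bvals g (fun z => \sum_(s <- L) chi s * (itinerary g n z == s)%:R) u].
Proof.
move=> qg fc; have oK := @open_Kset R g; elim: L => [|s L IH] HL.
  exists (fun=> 0); split; [exact: harmonic_cst|by exists 0 => z _; rewrite normr0|].
  by move=> zeta _ e e0; near=> z => _; rewrite big_nil subrr normr0 ltW.
have [u [hu [C uC] ub]] := IH (fun s' h => HL s' (ltac:(by rewrite inE h orbT))).
have [A [B [oA oB AB KAB HA]]] := itinerary_separated s qg.
have [v [hv v01 vb]] := dirichlet_separated qg fc oA oB AB KAB.
exists (fun z => chi s * v z + u z); split.
- exact: (harmonicD oK (harmonicZ (chi s) oK hv) hu).
- exists (`|chi s| + C) => z Kz; apply: le_trans (ler_normD _ _) _; apply: lerD; last exact: uC.
  rewrite normrM ler_piMr //; have /andP[h1 h2] := v01 z Kz; by rewrite ger0_norm.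
- move=> zeta Kz e e0; rewrite big_cons.
  have c0 : 0 < `|chi s| + 1 by rewrite ltr_wpDl.
  have e1 : 0 < e / 2 by rewrite divr_gt0.
  have e2 : 0 < e / 2 / (`|chi s| + 1) by rewrite divr_gt0.
  apply: filterS2 (vb zeta Kz _ e2) (ub zeta Kz _ e1) => z h1 h2 nK.
  have {}h1 := h1 nK; have {}h2 := h2 nK.
  have E : `[< A zeta >] = (itinerary g n zeta == s).
    by rewrite -(HL s (mem_head _ _)); apply/asboolP/eqP => /(HA zeta Kz).
  rewrite E in h1; set t := (_ == s)%:R in h1 *; set S := \sum_(_ <- _) _ in h2 *.
  have -> : chi s * v z + u z - (chi s * t + S) = chi s * (v z - t) + (u z - S) by ring.
  apply: le_trans (ler_normD _ _) _; rewrite [e]splitr; apply: lerD => //.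
  rewrite normrM; apply: le_trans (_ : (`|chi s| + 1) * (e / 2 / (`|chi s| + 1)) <= _).
    by apply: ler_pM => //; rewrite lerDl.
  by rewrite mulrC divfK // lt0r_neq0.
Unshelve. all: by end_near. Qed.

Lemma dirichlet_word g n (chi : seq bool -> R) : quarter g -> fincap g ->
  exists u, [/\ harmonic_on (~` Kset g) u,
    exists C : R, forall z, ~ Kset g z -> `|u z| <= C &
    bvals g (fun z => chi (itinerary g n z)) u].
Proof.
move=> qg fc; have HL s : s \in words n -> size s = n.
  by have := wordsP n => /seteqP[/(_ s)].
have [u [hu uC ub]] := dirichlet_word_sum chi qg fc HL; exists u; split=> //.
move=> zeta Kz e e0; apply: filterS (ub zeta Kz e e0) => z.
rewrite (bigD1_seq (itinerary g n zeta)) ?words_uniq //=; last first.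
  by have := wordsP n => /seteqP[_ /(_ (itinerary g n zeta))]; apply; rewrite /= size_itinerary.
rewrite eqxx mulr1 big1 ?addr0 // => s /negbTE h.
by rewrite eq_sym h mulr0.
Qed.

Lemma Kset_pt1 g s : quarter g -> Kset g (pt g 1 s, 0).
Proof.
move=> qg; apply: ((@Kset_sh R g (size s) _ qg).1 _).
by rewrite Phi_pt ?normr1 //; apply: Kset_one; exact: quarter_sh.
Qed.

(** Uniform continuity on the compact K. A point and the representative [pt g 1] of its word of
    length [n] are at distance at most [pi 2^-n]. *)
Lemma word_approximation g phi (e : R) : quarter g -> 0 < e ->
  (forall zeta, Kset g zeta -> forall e : R, 0 < e ->
     \forall z \near zeta, Kset g z -> `|phi z - phi zeta| <= e) ->
  exists n, forall z, Kset g z -> `|phi z - phi (pt g 1 (itinerary g n z), 0)| <= e.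
Proof.
move=> qg e0 cphi.
have /compact_near_coveringP cK := @Kset_compact R g.
pose P n (z : R * R) := Kset g z -> forall w, Kset g w -> w.2 = z.2 ->
  `|z.1 - w.1| <= pi * 2 ^- n -> `|phi z - phi w| <= e.
have [N _ HN] : \forall n \near \oo, Kset g `<=` P n.
  apply: cK => z Kz.
  have e2 : 0 < e / 2 by rewrite divr_gt0.
  have /nbhs_ballP[r /= r0 Hr] := cphi z Kz _ e2.
  have r2 : 0 < r / 2 by rewrite divr_gt0.
  have [N HN] := small_inv pi (ltac:(rewrite divr_gt0 //) : 0 < r / 4).
  exists (ball z (r / 2), [set n | (N <= n)%N]); first split.
  - exact: nbhsx_ballx.
  - by exists N.
  move=> [z' n] [/= Bz' Nn] Kz' w Kw w2 wz.
  have Bw : ball z r w.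
    move/plane_ballP : Bz' => [b1 b2]; apply/plane_ballP; rewrite w2; split; last by lra.
    have : pi * 2 ^- n <= r / 4 :> R.
      apply: le_trans HN; rewrite ler_pM2l ?pi_gt0 // lef_pV2 ?posrE ?exprn_gt0 ?ltr0Sn //.
      by rewrite -natrX ler_nat; apply: leq_ltn_trans Nn _; rewrite ltn_expl.
    have := ler_normD (z.1 - z'.1) (z'.1 - w.1); rewrite addrA subrK; lra.
  have Bz'' : ball z r z' by apply: le_ball Bz'; lra.
  have h1 := Hr w Bw Kw; have h2 := Hr z' Bz'' Kz'.
  have := ler_normB (phi z' - phi z) (phi w - phi z).
  rewrite (_ : phi z' - phi z - (phi w - phi z) = phi z' - phi w); last by ring.
  by lra.
exists N => z Kz; have := HN N (leqnn N) z Kz Kz (pt g 1 (itinerary g N z), 0) (Kset_pt1 _ qg).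
have [z2 _] := Kset_real Kz; have /ell_le1P[_ p1] := Kz N.
apply=> //=; rewrite {1}(Kset_itinerary N qg Kz) /= -[X in 2 ^- X](size_itinerary g N z).
by apply: pt_diameter => //; rewrite normr1.
Qed.

Theorem dirichlet_Kset g phi : quarter g -> fincap g ->
  (forall zeta, Kset g zeta -> forall e : R, 0 < e ->
     \forall z \near zeta, Kset g z -> `|phi z - phi zeta| <= e) ->
  exists u, [/\ harmonic_on (~` Kset g) u,
    exists C : R, forall z, ~ Kset g z -> `|u z| <= C & bvals g phi u].
Proof.
move=> qg fc cphi; have oK := @open_Kset R g.
have step (k : nat) : exists u, [/\ harmonic_on (~` Kset g) u,
    exists C : R, forall z, ~ Kset g z -> `|u z| <= C &
    forall zeta, Kset g zeta -> forall e : R, 0 < e ->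
      \forall z \near zeta, ~ Kset g z -> `|u z - phi zeta| <= k.+1%:R^-1 + e].
  have k0 : 0 < k.+1%:R^-1 :> R by rewrite invr_gt0.
  have [n Hn] := word_approximation qg k0 cphi.
  have [u [hu uC ub]] := @dirichlet_word g n (fun s => phi (pt g 1 s, 0)) qg fc.
  exists u; split=> // zeta Kz e e0; apply: filterS (ub zeta Kz e e0) => z h /h {}h.
  have := Hn zeta Kz; set p := phi (_, 0) in h * => h'.
  have -> : u z - phi zeta = (u z - p) - (phi zeta - p) by ring.
  by apply: le_trans (ler_normB _ _) _; rewrite addrC lerD.
have [U HU] := choice step.
have UU n m z : ~ Kset g z -> `|U n z - U m z| <= n.+1%:R^-1 + m.+1%:R^-1.
  have [hn [Cn un] bn] := HU n; have [hm [Cm um] bm] := HU m.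
  move: z; apply: (@green_max_abs g (fun z => U n z - U m z) (Cn + Cm) _ qg fc (harmonicB oK hn hm)).
    by move=> z Kz; apply: le_trans (ler_normB _ _) _; rewrite lerD ?un ?um.
  move=> zeta Kz e e0; have e2 : 0 < e / 2 by rewrite divr_gt0.
  apply: filterS2 (bn zeta Kz _ e2) (bm zeta Kz _ e2) => z h1 h2 nK.
  have := h1 nK; have := h2 nK.
  have -> : U n z - U m z = (U n z - phi zeta) - (U m z - phi zeta) by ring.
  move=> h3 h4; apply: le_trans (ler_normB _ _) _.
  by rewrite (splitr e) addrACA; exact: lerD.
have UU' n m z : (~` Kset g) z -> `|U n z - U m z| <= 1 / n.+1%:R + 1 / m.+1%:R.
  by move=> Kz; rewrite !div1r; exact: UU.
have [u Hu] := cauchy_limit_fun UU'.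
exists u; split.
- apply: harmonic_uniform_limit => // z Kz.
  have /nbhs_ballP[r /= r0 Hr] : nbhs z (~` Kset g) by exact: open_nbhs_nbhs.
  exists r => // e e0; have [n hn] := small_inv 1 e0.
  have [hn' _ _] := HU n; exists (U n); first exact: harmonic_sub Hr hn'.
  by move=> y By; apply: le_trans (Hu n y (Hr y By)) hn.
- have [_ [C HC] _] := HU 0%N; exists (C + 1) => z Kz.
  have := Hu 0%N z Kz; rewrite divr1 => h; have := HC z Kz.
  by have := ler_normD (u z - U 0%N z) (U 0%N z); rewrite subrK; lra.
- move=> zeta Kz e e0; have e2 : 0 < e / 2 by rewrite divr_gt0.
  have [n hn] := small_inv 2 e2.
  have [_ _ bn] := HU n; apply: filterS (bn zeta Kz _ e2) => z h nK.
  have h1 := h nK; have h2 := Hu n z nK.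
  have := ler_normD (u z - U n z) (U n z - phi zeta); rewrite addrA subrK.
  move: hn h1 h2; rewrite mul1r; move: n.+1%:R^-1 => x hn; lra.
Qed.

End DirichletProblem.

(** * Values at infinity *)

Section LimitAtInfinity.
Context {R : realType}.
Implicit Types (z w : R * R) (u : R * R -> R).

Definition cinv z : R * R := (z.1 * (nrm2 z)^-1, - z.2 * (nrm2 z)^-1).

Lemma nrm2_cinv z : nrm2 (cinv z) = (nrm2 z)^-1.
Proof.
have [->|z0] := eqVneq z 0; first by rewrite /cinv /nrm2 /= !mul0r oppr0 !expr0n /= addr0 mul0r expr0n addr0 invr0.
have n0 : nrm2 z != 0 by rewrite nrm2_eq0.
rewrite {1}/nrm2 /cinv /= !exprMn sqrrN -mulrDl -/(nrm2 z) expr2 mulrA divff ?mul1r //.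
Qed.

Lemma cinvK z : cinv (cinv z) = z.
Proof.
have [->|z0] := eqVneq z 0; first by rewrite /cinv /= !(mul0r, oppr0).
have n0 : nrm2 z != 0 by rewrite nrm2_eq0.
rewrite [RHS]surjective_pairing /cinv -/(cinv z) nrm2_cinv invrK /=.
by rewrite !mulNr opprK !divfK.
Qed.

Lemma cinv_neq0 z : z != 0 -> cinv z != 0.
Proof. by rewrite -!nrm2_gt0 nrm2_cinv invr_gt0. Qed.

Lemma open_outside (a : R) : open [set z : R * R | a < nrm2 z].
Proof. by apply: gt_open => z; exact: nrm2_cont. Qed.

(** After inversion the singularity at 0 is removable, and the Lipschitz bound on the ball of radius
    [1/4 / 8 = 1/32] becomes the rate [64 M / |z|]. *)
Lemma limit_at_infinity u (M : R) : harmonic_on [set z | 1 < nrm2 z] u ->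
  (forall z, 1 < nrm2 z -> `|u z| <= M) ->
  exists v, [/\ harmonic_on [set z | nrm2 z < (1 / 2) ^+ 2] v,
    forall z, z != 0 -> nrm2 z < (1 / 2) ^+ 2 -> v z = u (cinv z),
    `|v 0| <= M &
    forall z, 32 <= cmod z -> `|u z - v 0| <= 64 * M / cmod z].
Proof.
move=> hu uM.
pose P := [set z : R * R | z != 0 /\ nrm2 z < (2 * (1 / 2)) ^+ 2].
have r1 : 2 * (1 / 2) = 1 :> R by field.
have oP : open P.
  have -> : P = [set z | 0 < nrm2 z] `&` [set z | nrm2 z < (2 * (1 / 2)) ^+ 2].
    by apply/seteqP; split => z /=; rewrite nrm2_gt0.
  by apply: openI; [exact: open_outside|apply: open_lt_cont => z; exact: nrm2_cont].
have PW z : P z -> 1 < nrm2 (cinv z).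
  by rewrite /P /= r1 expr1n nrm2_cinv -nrm2_gt0 => -[z0 z1]; rewrite invf_gt1.
have P0 : ~ P 0 by rewrite /P /= eqxx => -[].
have hw : harmonic_on P (u \o cinv).
  exact: (harmonic_inversion oP (@open_outside 1) hu P0 PW).
have h0 : 0 < 1 / 2 :> R by lra.
have [v [hv vE vM]] := @removable_singularity R (1 / 2) M (u \o cinv) h0 hw
  (fun z hz hz' => uM _ (PW z (conj hz hz'))).
have v0M : `|v 0| <= M by apply: vM; rewrite /nrm2 /= expr0n addr0 exprn_gt0.
exists v; split=> //.
move=> z z32.
have c0 : 0 < cmod z by lra.
have z0 : z != 0 by rewrite -cmod_gt0.
have sz : 32 <= nrm2 z by rewrite -cmod_sqr; nra.
have i4 : nrm2 (cinv z) < (1 / 2) ^+ 2.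
  rewrite nrm2_cinv; apply: le_lt_trans (_ : 32^-1 < _); last by lra.
  rewrite lef_pV2 ?posrE //; exact: lt_le_trans sz.
have E : u z = v (cinv z) by rewrite vE ?cinv_neq0 //= cinvK.
have sub : ball (0 : R * R) (1 / 4) `<=` [set z | nrm2 z < (1 / 2) ^+ 2].
  move=> y /plane_ballP; rewrite /= !sub0r !normrN => -[y1 y2].
  rewrite /nrm2 -(real_normK (num_real y.1)) -(real_normK (num_real y.2)).
  have := normr_ge0 y.1; have := normr_ge0 y.2; nra.
have d4 : 0 < 1 / 4 :> R by lra.
have a1 : `|(cinv z).1| <= (cmod z)^-1.
  rewrite /cinv /= -cmod_sqr normrM (ger0_norm (_ : 0 <= (cmod z ^+ 2)^-1)) ?invr_ge0 ?sqr_ge0 //.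
  rewrite ler_pdivrMr ?exprn_gt0 // expr2 mulrA mulVf ?gt_eqF // mul1r.
  by rewrite -sqrtr_sqr ler_wsqrtr // lerDl sqr_ge0.
have a2 : `|(cinv z).2| <= (cmod z)^-1.
  rewrite /cinv /= -cmod_sqr normrM normrN (ger0_norm (_ : 0 <= (cmod z ^+ 2)^-1)) ?invr_ge0 ?sqr_ge0 //.
  rewrite ler_pdivrMr ?exprn_gt0 // expr2 mulrA mulVf ?gt_eqF // mul1r.
  by rewrite -sqrtr_sqr ler_wsqrtr // lerDr sqr_ge0.
have s32 : (cmod z)^-1 <= 32^-1 by rewrite lef_pV2 ?posrE.
(* At [|z| = 32] the inverse may fall on the edge of the open ball; there the bound is [2 M] and
   holds trivially. *)
have Bi : ball (0 : R * R) (1 / 4 / 8) (cinv z) \/ cmod z = 32.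
  have [e32|n32] := eqVneq (cmod z) 32; first by right.
  left; apply/plane_ballP; rewrite /= !sub0r !normrN.
  have : (cmod z)^-1 < 32^-1 by rewrite ltf_pV2 ?posrE //; rewrite lt_neqAle eq_sym n32.
  by split; lra.

have viM := vM (cinv z) i4.
rewrite E; case: Bi => [Bi|->].
  have := harmonic_lipschitz d4 (harmonic_sub sub hv) (fun y By => vM y (sub y By)) Bi
    (ballxx _ (ltac:(lra) : 0 < 1 / 4 / 8)).
  rewrite /= !subr0 => h; apply: le_trans h _.
  have M0 : 0 <= M by apply: le_trans v0M.
  have -> : 8 * M / (1 / 4) = 32 * M by field.
  have -> : 64 * M / cmod z = 32 * M * ((cmod z)^-1 + (cmod z)^-1) by field; rewrite gt_eqF.
  by apply: ler_wpM2l; [rewrite mulr_ge0|rewrite lerD].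
apply: le_trans (ler_normB _ _) _; lra.
Qed.

End LimitAtInfinity.

(** * Data depending on finitely many letters: averages and values at infinity *)

Section Transfer.
Context {R : realType}.
Implicit Types (g : nat -> R) (z w zeta : R * R) (n m k : nat) (s : seq bool) (u phi : R * R -> R).

Definition dsol g phi u : Prop := [/\ harmonic_on (~` Kset g) u,
  exists C : R, forall z, ~ Kset g z -> `|u z| <= C & bvals g phi u].

Lemma dsol_unique g phi u u' : quarter g -> fincap g -> dsol g phi u -> dsol g phi u' ->
  forall z, ~ Kset g z -> u z = u' z.
Proof.
move=> qg fc [hu [C uC] ub] [hu' [C' uC'] ub'] z Kz; have oK := @open_Kset R g.
apply/eqP; rewrite -subr_eq0 -normr_le0.
apply: (@green_max_abs R g (fun z => u z - u' z) (C + C') 0 qg fc (harmonicB oK hu hu')) Kz.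
  by move=> y Ky; apply: le_trans (ler_normB _ _) _; rewrite lerD ?uC ?uC'.
move=> zeta Kzeta e e0; have e2 : 0 < e / 2 by rewrite divr_gt0.
apply: filterS2 (ub zeta Kzeta _ e2) (ub' zeta Kzeta _ e2) => y h1 h2 Ky.
have := h1 Ky; have := h2 Ky => h3 h4.
have -> : u y - u' y = (u y - phi zeta) - (u' y - phi zeta) by ring.
by apply: le_trans (ler_normB _ _) _; rewrite add0r [e]splitr lerD.
Qed.

Lemma dsol_range g phi u (a b : R) : quarter g -> fincap g -> dsol g phi u ->
  (forall zeta, Kset g zeta -> a <= phi zeta <= b) -> forall z, ~ Kset g z -> a <= u z <= b.
Proof.
move=> qg fc [hu [C uC] ub] pab z Kz; have oK := @open_Kset R g; apply/andP; split.
  rewrite -lerN2; apply: (green_max qg fc (harmonicN oK hu) (C := C)) Kz => [y Ky|zeta Kzeta e e0].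
    by apply: le_trans (uC y Ky); rewrite -normrN; exact: ler_norm.
  apply: filterS (ub zeta Kzeta e e0) => y h /h; have /andP[h1 _] := pab zeta Kzeta.
  by rewrite ler_norml => /andP[h2 h3]; lra.
apply: (green_max qg fc hu (C := C)) Kz => [y Ky|zeta Kzeta e e0].
  by apply: le_trans (uC y Ky); exact: ler_norm.
apply: filterS (ub zeta Kzeta e e0) => y h /h; have /andP[_ h1] := pab zeta Kzeta.
by rewrite ler_norml => /andP[h2 h3]; lra.
Qed.

Lemma Kset_nrm2 g z : 1 < nrm2 z -> ~ Kset g z.
Proof.
move=> z1 /(_ 0%N) /= e1; have := ell_ge_cmod z; have := cmod_sqr z; have := cmod_ge0 z; nra.
Qed.

(** The mean over all words of length [n], that is, the integral against the equilibrium measure.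
    Its recursion on the first letter matches the passage from K to K'. *)
Fixpoint avg n (chi : seq bool -> R) : R :=
  if n is m.+1 then 2^-1 * (avg m (chi \o cons true) + avg m (chi \o cons false)) else chi [::].

Definition fold1 (chi : seq bool -> R) s : R := 2^-1 * (chi (true :: s) + chi (false :: s)).

Lemma avg_lin n (a b : R) chi chi' :
  avg n (fun s => a * chi s + b * chi' s) = a * avg n chi + b * avg n chi'.
Proof.
elim: n chi chi' => [//|n IH] chi chi' /=.
rewrite (IH (chi \o cons true) (chi' \o cons true)) (IH (chi \o cons false) (chi' \o cons false)).
ring.
Qed.

Lemma avg_fold1 n chi : avg n (fold1 chi) = avg n.+1 chi.
Proof.
rewrite /= mulrDr -avg_lin; congr avg; apply/funext => s.
by rewrite /fold1 mulrDr.
Qed.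

Lemma fold1_range chi (a b : R) : (forall s, a <= chi s <= b) -> forall s, a <= fold1 chi s <= b.
Proof.
move=> h s; have /andP[h1 h2] := h (true :: s); have /andP[h3 h4] := h (false :: s).
by rewrite /fold1; apply/andP; split; lra.
Qed.

Definition wsol g n (chi : seq bool -> R) u : Prop := dsol g (fun z => chi (itinerary g n z)) u.

Lemma wsol_ex g n chi : quarter g -> fincap g -> exists u, wsol g n chi u.
Proof. by move=> qg fc; exact: dirichlet_word. Qed.

(** Both sides solve the same Dirichlet problem: [z] and [- z] have the same image under [quad], and
    on K their itineraries differ exactly in the first letter. *)
Lemma wsol_fold g n chi u u' : quarter g -> fincap g -> wsol g n.+1 chi u ->
  wsol (sh 1 g) n (fold1 chi) u' ->
  forall z, ~ Kset g z -> u' (quad (g 0%N) z) = 2^-1 * (u z + u (- z)).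
Proof.
move=> qg fc [hu [C uC] ub] [hu' [C' uC'] ub']; have oK := @open_Kset R g.
have oK1 := @open_Kset R (sh 1 g).
have KN z : ~ Kset g z -> ~ Kset g (- z).
  by move=> Kz Kz'; apply: Kz; rewrite -[z]opprK; exact: Kset_opp.
have KQ z : ~ Kset g z -> ~ Kset (sh 1 g) (quad (g 0%N) z).
  by move=> Kz Kz'; apply: Kz; exact: (Kset_shS z qg).1.
apply: (@dsol_unique g (fun z => fold1 chi (itinerary (sh 1 g) n (quad (g 0%N) z))) _ _ qg fc); split.
- exact: (harmonic_sub KQ (harmonic_quad (g 0%N) oK1 hu')).
- by exists C' => z Kz; apply: uC'; exact: KQ.
- move=> zeta Kz e e0; have Kq := (Kset_shS zeta qg).2 Kz.
  have H : \forall z \near zeta, ~ Kset (sh 1 g) (quad (g 0%N) z) ->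
      `|u' (quad (g 0%N) z) - fold1 chi (itinerary (sh 1 g) n (quad (g 0%N) zeta))| <= e.
    exact: (@quad_continuous R (g 0%N) zeta _ (ub' _ Kq e e0)).
  by apply: filterS H => z h nK; apply: h; exact: KQ.
- have hN : harmonic_on (~` Kset g) (fun z => u (- z)).
    have E z : (-1 * z.1 - 1 * 0 * z.2 + 0, 0 * z.1 + 1 * -1 * z.2 + 0) = - z.
      by rewrite [RHS]surjective_pairing /=; congr pair; ring.
    have := @harmonic_affine R 1 (-1) 0 0 0 (~` Kset g) (~` Kset g) u (expr1n _ 2) oK oK hu.
    move=> /(_ (ltac:(by move=> z Kz; rewrite E; exact: KN))).
    by apply: (harmonic_ext oK) => z Kz; rewrite E.
  exact: (harmonicZ 2^-1 oK (harmonicD oK hu hN)).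
- exists C => z Kz; rewrite normrM (ger0_norm (_ : 0 <= 2^-1)) ?invr_ge0 //.
  have := uC z Kz; have := uC _ (KN z Kz); have := ler_normD (u z) (u (- z)); lra.
- move=> zeta Kz e e0.
  have H : \forall z \near zeta, ~ Kset g (- z) ->
      `|u (- z) - chi (itinerary g n.+1 (- zeta))| <= e.
    have cN : {for zeta, continuous (fun z : R * R => - z)} by exact: opp_continuous.
    exact: (cN _ (ub _ (Kset_opp qg Kz) e e0)).
  apply: filterS2 H (ub zeta Kz e e0) => z h1 h2 nK.
  have {}h1 := h1 (KN z nK); have {}h2 := h2 nK.
  rewrite !itineraryS quad_opp in h1 h2; set s := itinerary _ _ _ in h1 h2 *.
  have N0 := @Kset_Phi_neq0 R g 0 zeta qg Kz; rewrite /= in N0.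
  have -> : 2^-1 * (u z + u (- z)) - fold1 chi s =
     2^-1 * ((u z - chi ((0 < zeta.1) :: s)) + (u (- z) - chi ((0 < (- zeta).1) :: s))).
    have -> : (0 < (- zeta).1) = ~~ (0 < zeta.1).
      by rewrite /= oppr_gt0 -leNgt lt_neqAle N0.
    by rewrite /fold1; case: (0 < zeta.1) => /=; ring.
  rewrite normrM (ger0_norm (_ : 0 <= 2^-1)) ?invr_ge0 //.
  have := ler_normD (u z - chi ((0 < zeta.1) :: s)) (u (- z) - chi ((0 < (- zeta).1) :: s)); lra.
Qed.

Lemma quad_far (c : R) z : 0 < c < 1 / 4 -> 2 <= cmod z -> cmod z <= cmod (quad c z).
Proof.
move=> hc z2; have /andP[h _] := ell_quad z hc; have /andP[c0 c4] := hc.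
have h1 := ell_ge_cmod z; have h2 := ell_le_cmod (quad c z).
suff : 2 * (ell z ^+ 2 - 1) <= (ell z ^+ 2 - 1) / (2 * c) by nra.
rewrite ler_pdivlMr ?mulr_gt0 //.
have : 0 <= (ell z ^+ 2 - 1) * (1 - 4 * c) by rewrite mulr_ge0 //; [nra|lra].
by lra.
Qed.

(** Some limit [l] with this rate exists by [limit_at_infinity]. Since [z], [- z] and [quad z] tend
    to infinity together, [wsol_fold] shows that averaging over the first letter keeps [l]; after
    [n] steps the data are constant. Harmonic measure at infinity is thus uniform on words. *)
Lemma wsol_limit g n chi u (M : R) : quarter g -> fincap g -> wsol g n chi u ->
  (forall s, `|chi s| <= M) ->
  forall z, 32 <= cmod z -> `|u z - avg n chi| <= 64 * M / cmod z.
Proof.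
move=> qg fc us cM.
have uM g' n' chi' u' : quarter g' -> fincap g' -> wsol g' n' chi' u' -> (forall s, `|chi' s| <= M) ->
    forall z, ~ Kset g' z -> `|u' z| <= M.
  move=> qg' fc' us' cM' z Kz.
  have := @dsol_range g' _ u' (- M) M qg' fc' us'.
  move=> /(_ (fun zeta _ => ltac:(by rewrite -ler_norml; exact: cM')) z Kz).
  by rewrite -ler_norml.
have lim g' n' chi' u' : quarter g' -> fincap g' -> wsol g' n' chi' u' -> (forall s, `|chi' s| <= M) ->
    exists l, forall z, 32 <= cmod z -> `|u' z - l| <= 64 * M / cmod z.
  move=> qg' fc' us' cM'; have [hu _ _] := us'.
  have [v [_ _ _ H]] := limit_at_infinity (harmonic_sub (@Kset_nrm2 g') hu)
    (fun z hz => uM g' n' chi' u' qg' fc' us' cM' z (Kset_nrm2 hz)).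
  by exists (v 0).
have [l Hl] := lim _ _ _ _ qg fc us cM.
suff -> : avg n chi = l by [].
have M0 : 0 <= M by apply: le_trans (cM [::]).
have same (a b : R) : (forall z, 32 <= cmod z -> `|a - b| <= 128 * M / cmod z) -> a = b.
  move=> H; apply/eqP; rewrite -subr_eq0 -normr_le0; apply: (@ler_gt0_lim R _ 0 1) => d d0.
  pose r := Num.max 32 (128 * M / d).
  have r32 : 32 <= r by rewrite le_max lexx.
  have r0 : 0 < r by lra.
  have cr : cmod (r, 0) = r by rewrite /cmod /= expr0n addr0 sqrtr_sqr ger0_norm // ltW.
  have := H (r, 0); rewrite cr => /(_ r32) h; apply: le_trans h _.
  have : 128 * M / d <= r by rewrite /r le_max lexx orbT.
  by rewrite add0r mulr1 !ler_pdivrMr // [d * r]mulrC.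
elim: n g chi u qg fc us cM l Hl => [|n IH] g chi u qg fc us cM l Hl.
  have c0 : dsol g (fun z => chi (itinerary g 0 z)) (fun=> chi [::]).
    split; [exact: (harmonic_cst _ (@open_Kset R g))|by exists M => z _|].
    by move=> zeta _ e e0; apply: filterE => z _; rewrite subrr normr0 ltW.
  apply: same => z z32; have z1 : ~ Kset g z.
    by apply: Kset_nrm2; rewrite -cmod_sqr; nra.
  rewrite /= -(dsol_unique qg fc us c0 z1).
  apply: le_trans (Hl z z32) _; rewrite ler_pM2r ?invr_gt0; [nra|lra].
have q1 := quarter_sh 1 qg; have f1 := fincap_sh 1 qg fc.
have [u' us'] := wsol_ex n (fold1 chi) q1 f1.
have cM' s : `|fold1 chi s| <= M.
  have := @fold1_range chi (- M) M (fun s => ltac:(by rewrite -ler_norml)) s.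
  by rewrite -ler_norml.
have [l' Hl'] := lim _ _ _ _ q1 f1 us' cM'.
rewrite -avg_fold1 (IH _ _ _ q1 f1 us' cM' l' Hl').
apply: same => z z32.
have z1 : ~ Kset g z by apply: Kset_nrm2; rewrite -cmod_sqr; nra.
have far := @quad_far (g 0%N) z (qg 0%N) (ltac:(lra)).
have h1 := Hl z z32.
have cN : cmod (- z) = cmod z by rewrite /cmod /= !sqrrN.
have h2 := Hl (- z); rewrite cN in h2; have {}h2 := h2 z32.
have h3 := Hl' _ (le_trans z32 far).
have z0 : 0 < cmod z by lra.
have h4 : 64 * M / cmod (quad (g 0%N) z) <= 64 * M / cmod z.
  by apply: ler_wpM2l; [rewrite mulr_ge0|rewrite lef_pV2 ?posrE //; lra].
rewrite (wsol_fold qg fc us us' z1) in h3.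
have -> : l' - l = 2^-1 * ((u z - l) + (u (- z) - l)) - (2^-1 * (u z + u (- z)) - l') by field.
have n1 := ler_normB (2^-1 * ((u z - l) + (u (- z) - l))) (2^-1 * (u z + u (- z)) - l').
have n2 : `|2^-1 * ((u z - l) + (u (- z) - l))| <= 64 * M / cmod z.
  rewrite normrM (ger0_norm (_ : 0 <= 2^-1)) ?invr_ge0 //.
  by have := ler_normD (u z - l) (u (- z) - l); lra.
have -> : 128 * M / cmod z = 64 * M / cmod z + 64 * M / cmod z by field; rewrite gt_eqF.
by apply: le_trans n1 _; rewrite lerD //; apply: le_trans h3 h4.
Qed.

(* A nonnegative [u] is at most [2^m] times its average over the fibre of [Phi g m]. *)
Lemma wsol_fiber_bound g m n chi u : quarter g -> fincap g -> (forall s, 0 <= chi s <= 1) ->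
  wsol g (m + n) chi u -> exists chi' u', [/\ wsol (sh m g) n chi' u', forall s, 0 <= chi' s <= 1,
   avg n chi' = avg (m + n) chi & forall z, ~ Kset g z -> u z <= 2 ^+ m * u' (Phi g m z)].
Proof.
elim: m g chi u => [|m IH] g chi u qg fc c01 us.
  by exists chi, u; split=> // z _; rewrite mul1r.
have q1 := quarter_sh 1 qg; have f1 := fincap_sh 1 qg fc.
have [u1 us1] := wsol_ex (m + n) (fold1 chi) q1 f1.
have [chi' [u' [us' c01' E H]]] := IH _ _ _ q1 f1 (fold1_range c01) us1.
exists chi', u'; split; [by move: us'; rewrite sh_sh add1n|by []|by rewrite E avg_fold1|].
move=> z Kz.
have KN : ~ Kset g (- z) by move=> Kz'; apply: Kz; rewrite -[z]opprK; exact: Kset_opp.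
have KQ : ~ Kset (sh 1 g) (quad (g 0%N) z) by move=> Kz'; apply: Kz; exact: (Kset_shS z qg).1.
have := H _ KQ; rewrite -Phi_shS (wsol_fold qg fc us us1 Kz) => h.
have /andP[p _] := dsol_range qg fc us (fun zeta _ => c01 _) KN.
by rewrite exprS -mulrA; lra.
Qed.

(** The loss [2^m] of [wsol_fiber_bound] is beaten by the growth of [|F_m z|] like [4^m]: at so
    distant a point the solution is almost its average. *)
Lemma wsol_small g z (e : R) : quarter g -> fincap g -> ~ Kset g z -> 0 < e ->
  exists m (d : R), 0 < d /\ forall n chi u, (forall s, 0 <= chi s <= 1) -> wsol g (m + n) chi u ->
    avg (m + n) chi <= d -> u z <= e.
Proof.
move=> qg fc Kz e0; have [k ek] := ell_escape 2 qg Kz.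
have [N hN] := small_inv (128 * 4 ^+ k) e0.
(* The extra factor [4^6] puts [F_m z] beyond the radius 32 required by [wsol_limit]. *)
pose m := (k + (N + 6))%N.
exists m, (e / 2 * 2 ^- m); split; first by rewrite mulr_gt0 ?pow2_gt0 ?divr_gt0.
move=> n chi u c01 us ad.
have [chi' [u' [us' c01' E H]]] := wsol_fiber_bound qg fc c01 us.
have qm := quarter_sh m qg; have fm := fincap_sh m qg fc.
have growth : 4 ^+ (N + 6) <= cmod (Phi g m z).
  have := @ell_iter R g k (N + 6) z qg; have := ell_le_cmod (Phi g m z).
  have : 0 < 4 ^+ (N + 6) :> R by rewrite exprn_gt0.
  rewrite -/m; nra.
have p6 : 4 ^+ (N + 6) = 4 ^+ N * 4096 :> R by rewrite exprD; congr (_ * _); ring.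
have p1 : 1 <= 4 ^+ N :> R by rewrite exprn_ege1 // ler1n.
have c32 : 32 <= cmod (Phi g m z) by lra.
have c1 s : `|chi' s| <= 1 by have /andP[a b] := c01' s; rewrite ger0_norm.
have := wsol_limit qm fm us' c1 c32; rewrite mulr1 E => L.
have c0 : 0 < cmod (Phi g m z) by lra.
have P : 2 ^+ m * (64 / cmod (Phi g m z)) <= e / 2.
  have : 64 / cmod (Phi g m z) <= 64 / 4 ^+ (N + 6).
    by rewrite ler_pM2l // lef_pV2 ?posrE // exprn_gt0.
  move/(ler_wpM2l (ltW (exprn_gt0 m (ltr0Sn R 1)))) => h; apply: le_trans h _.
  have -> : 2 ^+ m * (64 / 4 ^+ (N + 6)) = 2^-1 * (128 * 2 ^+ k / 2 ^+ (N + 6)) :> R.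
    have -> : (4 : R) = 2 * 2 by ring.
    rewrite /m exprD exprMn; field.
    by rewrite expf_neq0.
  have : 128 * 2 ^+ k / 2 ^+ (N + 6) <= e.
    apply: le_trans hN; apply: ler_pM.
    - by rewrite mulr_ge0 // exprn_ge0.
    - by rewrite invr_ge0 exprn_ge0.
    - by rewrite ler_pM2l // lerXn2r ?nnegrE // ler_nat.
    - rewrite lef_pV2 ?posrE ?exprn_gt0 ?ltr0Sn // -natrX ler_nat.
      by apply: leq_trans (ltn_expl N (isT : (1 < 2)%N)) _; rewrite leq_exp2l // leq_addr.
  by lra.
apply: le_trans (H z Kz) _.
have L' : u' (Phi g m z) <= avg (m + n) chi + 64 / cmod (Phi g m z).
  by move: L; rewrite ler_distl => /andP[_]; lra.
apply: le_trans (ler_wpM2l (ltW (exprn_gt0 m (ltr0Sn R 1))) L') _.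
rewrite mulrDr.
have Q : 2 ^+ m * avg (m + n) chi <= e / 2.
  apply: le_trans (ler_wpM2l (ltW (exprn_gt0 m (ltr0Sn R 1))) ad) _.
  by rewrite mulrC divfK // expf_neq0.
by rewrite [X in _ <= X]splitr lerD.
Qed.

End Transfer.

(** * Equilibrium measure and polar sets *)

Section MeasureComparison.
Context d (T : measurableType d) (R : realType).
Local Open Scope ereal_scope.
Implicit Types (mu : {measure set T -> \bar R}) (f h : T -> \bar R).

Import HBNNSimple.

(** Both integrals are suprema over the nonnegative simple functions below [f], and the integral of
    each of these grows with the measure. *)
Lemma le_measure_integral mu mu' f : (forall A, measurable A -> mu A <= mu' A) ->
  (forall x, 0 <= f x) -> \int[mu]_x f x <= \int[mu']_x f x.
Proof.
move=> le_mu f0; rewrite !ge0_integralTE //; apply: ge_ereal_sup => _ [k kf <-].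
apply: (@le_trans _ _ (sintegral mu' k)); last by apply: ereal_sup_ubound; exists k.
rewrite !sintegralE; apply: lee_fsum; first by [].
move=> r _; have [r0|r0] := leP 0%R r.
  by apply: lee_wpmul2l; [rewrite lee_fin|exact: le_mu].
have -> : k @^-1` [set r] = set0.
  apply/seteqP; split=> // t /= kt; have : (0 <= k t)%R by [].
  by rewrite kt leNgt r0.
by rewrite !measure0 mule0.
Qed.

Lemma ge0_le_integral_any mu f h : (forall x, 0 <= f x) -> (forall x, f x <= h x) ->
  \int[mu]_x f x <= \int[mu]_x h x.
Proof.
move=> f0 fh; have h0 x : 0 <= h x by apply: le_trans (fh x).
rewrite !ge0_integralTE //; apply: le_ereal_sup => _ [k kf <-]; exists k => // x.
exact: le_trans (kf x) (fh x).
Qed.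

End MeasureComparison.

(** * Binary digits as random words *)

Section Digits.
Context {R : realType}.
Implicit Types (n m k : nat) (s : seq bool) (a h t : R).

(** Binary digits of [t] relative to the interval from [a] to [a + h], with [true] for the left
    half. For [t] uniform on [0, 1], each word of length [n] has probability [2^-n]. *)
Fixpoint dig n a h t : seq bool :=
  if n is m.+1 then
    let b := a + h / 2 in
    if t < b then true :: dig m a (h / 2) t else false :: dig m b (h / 2) t
  else [::].

Lemma size_dig n a h t : size (dig n a h t) = n.
Proof. by elim: n a h => [//|n IH] a h /=; case: ifP => _ /=; rewrite IH. Qed.

Lemma dig_prefix n k a h t : exists s, dig (n + k) a h t = dig n a h t ++ s.
Proof.
elim: n a h => [|n IH] a h; first by exists (dig k a h t).
rewrite addSn /=; case: ifP => _.
  by have [s ->] := IH a (h / 2); exists s.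
by have [s ->] := IH (a + h / 2) (h / 2); exists s.
Qed.

Lemma measurable_dig d (T : measurableType d) n a h (F : seq bool -> T) :
  measurable_fun [set: R] (fun t => F (dig n a h t)).
Proof.
elim: n a h F => [|n IH] a h F; first exact: (@measurable_cst _ _ _ _ setT (F [::])).
rewrite (_ : (fun t => _) = fun t => if t < a + h / 2 then (F \o cons true) (dig n a (h / 2) t)
    else (F \o cons false) (dig n (a + h / 2) (h / 2) t)); last first.
  by apply/funext => t /=; case: ifP.
apply: measurable_fun_ifT; [|exact: IH|exact: IH].
by apply: measurable_fun_ltr; [exact: measurable_id|exact: measurable_cst].
Qed.

(** [bb] says whether the right end is excluded: the uniform law lives on a closed interval, while
    every left half is half-open. *)
Lemma integral_dig n a h (bb : bool) (F : seq bool -> R) : 0 < h -> (forall s, 0 <= F s) ->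
  (\int[lebesgue_measure]_(t in [set` Interval (BLeft a) (BSide bb (a + h)%R)])
     (F (dig n a h t))%:E = (h * avg n F)%:E)%E.
Proof.
elim: n a h bb F => [|n IH] a h bb F h0 F0 /=.
  rewrite integral_cst //= lebesgue_measure_itv /= lte_fin ltrDl h0.
  by rewrite -EFinB -EFinM addrAC subrr add0r mulrC.
have h2 : 0 < h / 2 by rewrite divr_gt0.
pose I1 : set R := [set` Interval (BLeft a) (BLeft (a + h / 2))].
pose I2 : set R := [set` Interval (BLeft (a + h / 2)) (BSide bb (a + h / 2 + h / 2))].
have -> : [set` Interval (BLeft a) (BSide bb (a + h))] = I1 `|` I2.
  rewrite /I1 /I2 -addrA -splitr -itv_bndbnd_setU // bnd_simp; first by rewrite lerDl ltW.
  lra.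
rewrite ge0_integral_setU //; first last.
- apply/disj_setPS => t []; rewrite /I1 /I2 /= !in_itv /= => /andP[_ t1] /andP[t2 _].
  by move: (le_lt_trans t2 t1); rewrite ltxx.
- by move=> t _; rewrite lee_fin.
- apply: measurable_funTS; apply/measurable_EFinP.
  exact: (@measurable_dig _ _ n.+1 a h F).
- exact: measurable_itv.
- exact: measurable_itv.
transitivity ((h / 2 * avg n (F \o cons true))%:E + (h / 2 * avg n (F \o cons false))%:E)%E; last first.
  by rewrite -EFinD; congr EFin; field.
congr (_ + _)%E.
- transitivity (\int[lebesgue_measure]_(t in I1) ((F \o cons true) (dig n a (h / 2) t))%:E)%E.
    by apply: eq_integral => t; rewrite inE /I1 /= in_itv /= => /andP[_ ->].
  exact: (IH a (h / 2) true (F \o cons true) h2 (fun s => F0 _)).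
- transitivity (\int[lebesgue_measure]_(t in I2) ((F \o cons false) (dig n (a + h / 2)%R (h / 2) t))%:E)%E.
    by apply: eq_integral => t; rewrite inE /I2 /= in_itv /= => /andP[t1 _]; rewrite ltNge t1.
  exact: (IH (a + h / 2) (h / 2) bb (F \o cons false) h2 (fun s => F0 _)).
Qed.

Definition unif : probability (measurableTypeR R) R := uniform_prob (@ltr01 R).

Lemma integral_unif_dig n (F : seq bool -> R) : (forall s, 0 <= F s) ->
  (\int[unif]_t (F (dig n 0 1 t))%:E = (avg n F)%:E)%E.
Proof.
move=> F0; rewrite integral_uniform; first last.
- by move=> t; rewrite lee_fin.
- by apply/measurable_EFinP; exact: measurable_dig.
rewrite subr0 invr1 mul1e; have := @integral_dig n 0 1 false F ltr01 F0.
by rewrite add0r mul1r.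
Qed.

Lemma unif_dig n (J : pred (seq bool)) :
  unif [set t | J (dig n 0 1 t)] = (avg n (fun s => (J s)%:R))%:E.
Proof.
rewrite -integral_unif_dig // -[X in unif X]setIT -integral_indic; first last.
- rewrite -[X in measurable X]setTI; apply: (@measurable_dig _ bool n 0 1 J); first exact: measurableT.
  exact: (_ : measurable [set true]).
- exact: measurableT.
apply: eq_integral => t _; congr EFin; rewrite indicE.
by case: (boolP (J (dig n 0 1 t))) => h; [rewrite mem_set|rewrite memNset //; exact/negP].
Qed.

End Digits.

(** * The equilibrium measure and its potential *)

Section Potential.
Context {R : realType}.
Implicit Types (g : nat -> R) (z w : R * R) (n m k : nat) (s : seq bool) (t : R).

Lemma avg_le n (chi chi' : seq bool -> R) : (forall s, size s = n -> chi s <= chi' s) ->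
  avg n chi <= avg n chi'.
Proof.
elim: n chi chi' => [|n IH] chi chi' H /=; first exact: H.
by rewrite ler_pM2l ?invr_gt0 // lerD // IH // => s sn /=; apply: H; rewrite /= sn.
Qed.

Lemma avg_eq n (chi chi' : seq bool -> R) : (forall s, size s = n -> chi s = chi' s) ->
  avg n chi = avg n chi'.
Proof. by move=> H; apply/eqP; rewrite eq_le !avg_le // => s sn; rewrite H. Qed.

Lemma avg_cst n (a : R) : avg n (fun=> a) = a.
Proof. elim: n => [//|n /= IH]; rewrite (_ : (fun=> a) \o cons true = fun=> a) // IH; lra. Qed.

Lemma cmod_quad_branch (c y : R) z : 0 < c < 1 / 4 -> `|y| <= 1 ->
  cmod ((quad c z).1 - y, (quad c z).2) =
  (2 * c)^-1 * (cmod (z.1 - branch c y, z.2) * cmod (z.1 + branch c y, z.2)).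
Proof.
move=> hc hy; have /andP[c0 _] := hc; have cn : c != 0 by rewrite gt_eqF.
have r2 := branch_sqr hc hy; set r := branch c y in r2 *.
have V0 : 0 <= (2 * c)^-1 by rewrite invr_ge0 mulr_ge0 // ltW.
rewrite -[X in _ = X * _]ger0_norm // -sqrtr_sqr /cmod -!sqrtrM ?sqr_ge0 ?nrm2_ge0 //.
congr Num.sqrt; rewrite /quad /=.
have -> : (2 * c)^-1 * (z.1 ^+ 2 - z.2 ^+ 2 - 1) + 1 - y = (2 * c)^-1 * (z.1 ^+ 2 - z.2 ^+ 2 - r ^+ 2).
  by rewrite r2; field.
ring.
Qed.

Lemma Phi_neq_branch g n z (tau : R) s : quarter g -> `|tau| <= 1 -> size s = n ->
  Phi g n z <> (tau, 0) -> z <> (pt g tau s, 0).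
Proof. by move=> qg t1 <- H E; apply: H; rewrite E Phi_pt. Qed.

(** [F_n - tau] is a polynomial with the [2^n] roots [pt g tau s] and leading coefficient
    [exp (2^n cap)]. One level of the factorisation is [cmod_quad_branch], and the average folds the
    two roots together. *)
Lemma avg_ln_pt g n z (tau : R) : quarter g -> `|tau| <= 1 -> Phi g n z <> (tau, 0) ->
  avg n (fun s => ln (cmod (z.1 - pt g tau s, z.2))) =
  2 ^- n * ln (cmod ((Phi g n z).1 - tau, (Phi g n z).2)) - cap g n.
Proof.
move=> qg t1; elim: n g qg z => [|n IH] g qg z Pz; first by rewrite /= expr0 invr1 mul1r subr0.
have q1 := quarter_sh 1 qg; have /andP[g0 _] := qg 0%N.
rewrite Phi_shS in Pz.
have P0 w (y : R) : w <> (y, 0) -> 0 < cmod (w.1 - y, w.2).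
  rewrite cmod_gt0 => H; apply/eqP => -[h1 h2]; apply: H.
  by rewrite [LHS]surjective_pairing h2; congr pair; apply/eqP; rewrite -subr_eq0 h1.
rewrite -avg_fold1 (@avg_eq n _ (fun s => 2^-1 * ln (cmod ((quad (g 0%N) z).1 - pt (sh 1 g) tau s, (quad (g 0%N) z).2))
   + (- 2^-1) * ln (2 * g 0%N)^-1)); last first.
  move=> s sn; have p1 := pt_bound s q1 t1.
  have Q := P0 _ _ (Phi_neq_branch q1 t1 sn Pz).
  have V0 : 0 < (2 * g 0%N)^-1 by rewrite invr_gt0 mulr_gt0.
  rewrite (cmod_quad_branch z (qg 0%N) p1) in Q *.
  rewrite pmulr_rgt0 // in Q; rewrite /fold1 /= mul1r mulN1r opprK.
  set r := branch _ _ in Q *.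
  have c1 : 0 < cmod (z.1 - r, z.2).
    rewrite lt_neqAle cmod_ge0 andbT eq_sym; apply/eqP => E0; move: Q; by rewrite E0 mul0r ltxx.
  have c2 : 0 < cmod (z.1 + r, z.2).
    rewrite lt_neqAle cmod_ge0 andbT eq_sym; apply/eqP => E0; move: Q; by rewrite E0 mulr0 ltxx.
  by rewrite !lnM ?posrE ?mulr_gt0 //; field.
rewrite (avg_lin n 2^-1 (- 2^-1)
  (fun s => ln (cmod ((quad (g 0%N) z).1 - pt (sh 1 g) tau s, (quad (g 0%N) z).2)))
  (fun=> ln (2 * g 0%N)^-1)) avg_cst (IH _ q1 _ Pz) -Phi_shS.
have := cap_sh g 1 n; rewrite add1n [cap g 1]/= expr1 add0r => ->.
rewrite pow2S; ring.
Qed.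

(** Since [ell >= 1], one of the endpoints 1 and -1 is at distance at least 1 from [F_n z]; with it
    as [tau] the logarithm in [avg_ln_pt] is nonnegative. For [|z| <= 3] all distances are at most
    4, so [ln 4 - ln] dominates the negative part; for larger [|z|] that part is zero. *)
Lemma avg_log_neg g n z : quarter g -> fincap g -> exists tau : R,
  [/\ `|tau| <= 1, forall s, size s = n -> 0 < cmod (z.1 - pt g tau s, z.2) &
   avg n (fun s => Num.max 0 (- ln (cmod (z.1 - pt g tau s, z.2)))) <= ln 4 + capoo g].
Proof.
move=> qg fc.
have [tau [t1 P1]] : exists tau : R, `|tau| <= 1 /\ 1 <= cmod ((Phi g n z).1 - tau, (Phi g n z).2).
  have := ell_ge1 (Phi g n z); rewrite /ell => e1.
  have [h|h] := leP 1 (cmod ((Phi g n z).1 - 1, (Phi g n z).2)).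
    by exists 1; rewrite normr1.
  exists (-1); rewrite normrN normr1 opprK; split=> //; lra.
have Pn : Phi g n z <> (tau, 0).
  by move=> E; move: P1; rewrite E /cmod /= subrr expr0n addr0 sqrtr0 ler10.
have c0 s : size s = n -> 0 < cmod (z.1 - pt g tau s, z.2).
  move=> sn; rewrite cmod_gt0; apply/eqP => -[h1 h2].
  apply: (Phi_neq_branch qg t1 sn Pn); rewrite [LHS]surjective_pairing h2.
  by congr pair; apply/eqP; rewrite -subr_eq0 h1.
exists tau; split=> //.
have l4 : 0 <= ln 4 :> R by rewrite ln_ge0 // ler1n.
have S0 := capoo_ge0 qg fc.
have near4 s : `|cmod z - cmod (z.1 - pt g tau s, z.2)| <= 1.
  have p1 := pt_bound s qg t1.
  have h1 := cmod_triangle z.1 z.2 (- pt g tau s) 0.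
  have h2 := cmod_triangle (z.1 - pt g tau s) z.2 (pt g tau s) 0.
  rewrite subrK addr0 -surjective_pairing in h2; rewrite addr0 -surjective_pairing in h1.
  have e1 : cmod (pt g tau s, 0) <= 1 by rewrite /cmod /= expr0n addr0 sqrtr_sqr.
  have e2 : cmod (- pt g tau s, 0) <= 1 by rewrite /cmod /= expr0n addr0 sqrtr_sqr normrN.
  by rewrite ler_norml; apply/andP; split; lra.
have [z3|z3] := leP (cmod z) 3; last first.
  apply: le_trans (_ : avg n (fun=> 0) <= _); last by rewrite avg_cst addr_ge0.
  apply: avg_le => s sn; have := near4 s; rewrite ler_norml => /andP[h1 h2].
  by rewrite ge_max lexx oppr_le0 ln_ge0 //; lra.
apply: le_trans (_ : avg n (fun s => ln 4 * (fun=> 1) s + (-1) * (fun s => ln (cmod (z.1 - pt g tau s, z.2))) s) <= _).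
  apply: avg_le => s sn; have := near4 s; rewrite ler_norml => /andP[h1 h2].
  have : ln (cmod (z.1 - pt g tau s, z.2)) <= ln 4 by rewrite ler_ln ?posrE ?c0 //; lra.
  by move=> h; rewrite ge_max; apply/andP; split; lra.
rewrite avg_lin avg_cst (avg_ln_pt qg t1 Pn).
have : 0 <= 2 ^- n * ln (cmod ((Phi g n z).1 - tau, (Phi g n z).2)).
  by rewrite mulr_ge0 ?ln_ge0 // ltW // pow2_gt0.
have := le_capoo n fc; lra.
Qed.

Lemma pt_cat g (tau : R) s s' : pt g tau (s ++ s') = pt g (pt (sh (size s) g) tau s') s.
Proof. by elim: s g => [//|b s IH] g /=; rewrite IH sh_sh add1n. Qed.

(** [x t] is the point of K whose itinerary is the binary expansion of [t], a pointwise limit of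
    step functions. The estimate is uniform in [tau] because [potential_bound] chooses the endpoint
    anew at each level. *)
Lemma cantor_param g : quarter g -> exists x : R -> R,
  [/\ measurable_fun [set: R] x,
   forall n t (tau : R), `|tau| <= 1 -> `|x t - pt g tau (dig n 0 1 t)| <= pi / n.+1%:R &
   forall t, Kset g (x t, 0)].
Proof.
move=> qg; pose u n t := pt g 1 (dig n 0 1 t).
have pi0 := pi_gt0 R.
have le2 n : pi * 2 ^- n <= pi / n.+1%:R :> R.
  rewrite ler_pM2l // lef_pV2 ?posrE ?exprn_gt0 ?ltr0Sn // -natrX ler_nat.
  exact: ltn_expl.
have close n m t (tau tau' : R) : (n <= m)%N -> `|tau| <= 1 -> `|tau'| <= 1 ->
    `|pt g tau' (dig m 0 1 t) - pt g tau (dig n 0 1 t)| <= pi * 2 ^- n.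
  move=> /subnKC <- t1 t1'; have [s ->] := dig_prefix n (m - n) 0 1 t.
  rewrite pt_cat -[X in 2 ^- X](size_dig n 0 1 t); apply: pt_diameter => //.
  by apply: pt_bound => //; exact: quarter_sh.
have n1 : `|1 : R| <= 1 by rewrite normr1.
have uu n m t : setT t -> `|u n t - u m t| <= pi / n.+1%:R + pi / m.+1%:R.
  move=> _; have p k : 0 <= pi / k.+1%:R :> R by rewrite divr_ge0 // ltW.
  case: (leqP n m) => h.
    rewrite distrC; apply: le_trans (close n m t 1 1 h n1 n1) _.
    by apply: le_trans (le2 n) _; rewrite lerDl.
  apply: le_trans (close m n t 1 1 (ltnW h) n1 n1) _.
  by apply: le_trans (le2 m) _; rewrite lerDr.
have [x Hx] := cauchy_limit_fun uu.
have cx t : u ^~ t @ \oo --> x t.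
  apply/cvgrPdist_le => e e0; have [N hN] := small_inv pi e0.
  exists N => // n /= Nn; apply: le_trans (Hx n t I) _; apply: le_trans hN.
  by rewrite ler_pM2l // lef_pV2 ?posrE ?ltr0Sn // ler_nat.
exists x; split.
- apply: (@measurable_fun_cvg _ _ _ setT u) => [n|t _]; last exact: cx.
  exact: (@measurable_dig _ _ _ n 0 1 (pt g 1)).
- move=> n t tau t1; apply/ler_addgt0Pr => e e0; have [N hN] := small_inv pi e0.
  have h1 := Hx (maxn n N) t I; have h2 := close n (maxn n N) t tau 1 (leq_maxl _ _) t1 n1.
  have h3 : pi / (maxn n N).+1%:R <= pi / N.+1%:R :> R.
    by rewrite ler_pM2l // lef_pV2 ?posrE ?ltr0Sn // ler_nat ltnS leq_maxr.
  have -> : x t - pt g tau (dig n 0 1 t) = (x t - u (maxn n N) t) + (u (maxn n N) t - pt g tau (dig n 0 1 t)).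
    by ring.
  apply: le_trans (ler_normD _ _) _; rewrite addrC; apply: lerD.
    exact: le_trans h2 (le2 n).
  by apply: le_trans h1 _; exact: le_trans h3 hN.
- move=> t; have cK := @Kset_closed R g; apply: cK => B /nbhs_ballP[e /= e0 HB].
  have e2 : 0 < e / 2 by rewrite divr_gt0.
  have [N hN] := small_inv pi e2.
  exists (u N t, 0); split; first exact: Kset_pt1.
  apply: HB; apply/plane_ballP; rewrite /= subrr normr0; split=> //.
  apply: le_lt_trans (Hx N t I) _; apply: le_lt_trans hN _; lra.
Qed.

Lemma measurable_lne_cmod z :
  measurable_fun [set: (R * R)%type] (fun w : (R * R)%type => lne (cmod (z - w))%:E).
Proof.
have mc : measurable_fun [set: (R * R)%type] (fun w : (R * R)%type => cmod (z - w)).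
  apply: (measurableT_comp (continuous_measurable_fun (@sqrt_continuous R))).
  apply: measurable_funD; apply: measurable_funX; apply: measurable_funB.
  - exact: measurable_cst.
  - exact: measurable_fst.
  - exact: measurable_cst.
  - exact: measurable_snd.
rewrite (_ : (fun w => _) = fun w => if 0 < cmod (z - w) then (ln (cmod (z - w)))%:E else -oo%E); last first.
  apply/funext => w; case: ltP => h; first by rewrite lne_EFin.
  by rewrite le0_lneNy // lee_fin.
apply: measurable_fun_ifT.
- by apply: measurable_fun_ltr => //; exact: measurable_cst.
- by apply/measurable_EFinP; apply: (measurableT_comp (@measurable_ln R)).
- exact: measurable_cst.
Qed.

Lemma limn_einf_ge (u : nat -> \bar R) (a : \bar R) : (0 <= a)%E -> (forall n, (0 <= u n)%E) ->
  (forall L : R, (L%:E < a)%E -> exists N, forall n, (N <= n)%N -> (L%:E <= u n)%E) ->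
  (a <= limn_einf u)%E.
Proof.
move=> a0 u0 H; rewrite limn_einf_lim.
have -> : limn (einfs u) = ereal_sup (range (einfs u)) by apply/cvg_lim => //; exact: cvg_einfs_sup.
have ge (L : R) : (L%:E < a)%E -> (L%:E <= ereal_sup (range (einfs u)))%E.
  move=> /H[N HN]; apply: (@le_trans _ _ (einfs u N)); last by apply: ereal_sup_ubound; exists N.
  by apply: le_ereal_inf_tmp => _ [n /= Nn <-]; exact: HN.
case: a a0 H ge => [r| |] // a0 H ge.
  apply/lee_addgt0Pr => e e0; rewrite -leeBlDr //; apply: ge.
  by rewrite lte_fin ltrBlDr ltrDl.
move: ge; case: (ereal_sup _) => [r| |] // ge.
  by have := ge (r + 1) (ltry _); rewrite lee_fin gerDl ler10.
by have := ge 0 (ltry _).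
Qed.

Definition logneg z w : \bar R := (fun w => lne (cmod (z - w))%:E)^\-%E w.

Lemma lognegE z w : logneg z w =
  if 0 < cmod (z - w) then (Num.max 0 (- ln (cmod (z - w))))%:E else +oo%E.
Proof.
rewrite /logneg funenegE; case: ltP => h.
  by rewrite lne_EFin // -EFinN -EFin_max maxC.
by rewrite le0_lneNy ?lee_fin // oppeNy maxye.
Qed.

(** Fatou's lemma: the kernel at [x t] is at most the lower limit of the kernels at the level-[n]
    points, whose averages [avg_log_neg] bounds independently of [n] and [z]. *)
Lemma potential_bound g (x : R -> R) z : quarter g -> fincap g ->
  (forall n t (tau : R), `|tau| <= 1 -> `|x t - pt g tau (dig n 0 1 t)| <= pi / n.+1%:R) ->
  (\int[unif]_t logneg z (x t, 0%R) <= (ln 4 + capoo g)%:E)%E.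
Proof.
move=> qg fc Hx.
have [tau Ht] := choice (fun n => avg_log_neg n z qg fc).
pose F n s := Num.max 0 (- ln (cmod (z.1 - pt g (tau n) s, z.2))).
pose h n t := (F n (dig n 0 1 t))%:E.
have F0 n s : 0 <= F n s by rewrite le_max lexx.
have mh n : measurable_fun [set: measurableTypeR R] (h n).
  by apply/measurable_EFinP; exact: measurable_dig.
have h0 n t : (0 <= h n t)%E by rewrite lee_fin.
have ih n : (\int[unif]_t h n t <= (ln 4 + capoo g)%:E)%E.
  by rewrite integral_unif_dig // lee_fin; have [] := Ht n.
have nn t : (0 <= logneg z (x t, 0%R))%E.
  by rewrite lognegE; case: ifP => _; rewrite ?leey // lee_fin le_max lexx.
have le1 t : (logneg z (x t, 0%R) <= limn_einf (h ^~ t))%E.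
  apply: limn_einf_ge => // L.
  rewrite lognegE => HL.
  have [L0|L0] := ltP L 0; first by exists 0%N => n _; rewrite lee_fin; apply: le_trans (ltW L0) _.
  have rL : cmod (z - (x t, 0)) < expR (- L).
    move: HL; case: (ltP 0 (cmod (z - (x t, 0)))) => h1; last first.
      by move=> _; apply: le_lt_trans h1 _; exact: expR_gt0.
    rewrite lte_fin lt_max ltNge L0 /= => hL.
    by rewrite -[X in X < _]lnK ?posrE // ltr_expR ltrNr.
  have d0 : 0 < expR (- L) - cmod (z - (x t, 0)) by rewrite subr_gt0.
  have [N hN] := small_inv pi (divr_gt0 d0 (ltr0Sn R 1)).
  exists N => n Nn; have [t1 c0 _] := Ht n.
  have hn := Hx n t (tau n) t1.
  have hnN : pi / n.+1%:R <= pi / N.+1%:R :> R.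
    by rewrite ler_pM2l ?pi_gt0 // lef_pV2 ?posrE ?ltr0Sn // ler_nat.
  rewrite lee_fin /F le_max; apply/orP; right.
  have cp := c0 _ (size_dig n 0 1 t).
  rewrite lerNr -[X in _ <= X]expRK ler_ln ?posrE ?expR_gt0 //.
  have := cmod_triangle (z.1 - x t) z.2 (x t - pt g (tau n) (dig n 0 1 t)) 0.
  rewrite addrA subrK addr0.
  have -> : cmod (x t - pt g (tau n) (dig n 0 1 t), 0) = `|x t - pt g (tau n) (dig n 0 1 t)|.
    by rewrite /cmod /= expr0n addr0 sqrtr_sqr.
  have -> : cmod (z.1 - x t, z.2) = cmod (z - (x t, 0)) by rewrite /cmod /= subr0.
  move: hn hnN hN; move: (pi / n.+1%:R) (pi / N.+1%:R) => a b; lra.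
apply: le_trans (@ge0_le_integral_any _ (measurableTypeR R) R unif
  (fun t => logneg z (x t, 0%R)) (fun t => limn_einf (h ^~ t)) nn le1) _.
apply: le_trans (fatou unif measurableT mh (fun n t _ => h0 n t)) _.
rewrite limn_einf_lim; apply: lime_le; first exact: is_cvg_einfs.
apply: nearW => n; apply: le_trans (ih n).
by apply: ereal_inf_lbound; exists n => /=.
Qed.

(** Every inner integral is at least [- C], so the negative part of the outer one is at most [C]
    times the finite total mass. *)
Lemma log_energy_neq (mu : {finite_measure set (R * R)%type -> \bar R}) (C : R) : 0 <= C ->
  (forall z, (\int[mu]_w logneg z w <= C%:E)%E) -> log_energy mu != -oo%E.
Proof.
move=> C0 HC; rewrite /log_energy.
set I1 := fun z => (\int[mu]_w _)%E.
have I1C z : (- C%:E <= I1 z)%E.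
  rewrite /I1 integralE -[X in (X <= _)%E]add0e; apply: leeB; last exact: HC.
  by apply: integral_ge0 => w _; exact: funepos_ge0.
have nC z : (I1^\- z <= C%:E)%E.
  by rewrite funenegE ge_max leeNl I1C lee_fin C0.
have fin : (\int[mu]_z (I1^\- z) < +oo)%E.
  apply: le_lt_trans (ge0_le_integral_any mu (funeneg_ge0 I1) nC) _.
    rewrite integral_cst //=.
  by rewrite lte_mul_pinfty ?lee_fin // ?fin_num_measure // ltey_eq fin_num_measure.
have p0 : (0 <= \int[mu]_z (I1^\+ z))%E by apply: integral_ge0 => w _; exact: funepos_ge0.
have n0 : (0 <= \int[mu]_z (I1^\- z))%E by apply: integral_ge0 => w _; exact: funeneg_ge0.
rewrite integralE; move: fin p0 n0.
by case: (\int[mu]_z (I1^\- z))%E => [b| |] //; case: (\int[mu]_z (I1^\+ z))%E => [a| |].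
Qed.

End Potential.

(** * Polar sets are null, and the Green function is unique *)

Section EquilibriumMeasure.
Context {R : realType}.
Implicit Types (g : nat -> R) (z w : R * R) (n m k : nat) (s : seq bool) (t : R).

Section Pushforward.
Variables (f : R -> R * R) (E : set (R * R)).
Hypothesis mf : measurable_fun [set: R] f.
Hypothesis mE : measurable E.

Let F : measurableTypeR R -> (R * R)%type := f.
Let mF : measurable_fun [set: measurableTypeR R] F := mf.
HB.instance Definition _ := isMeasurableFun.Build _ _ _ _ F mF.

Lemma pushforward_restriction : exists mu : {finite_measure set (R * R)%type -> \bar R},
  (forall A, mu A = unif (f @^-1` (A `&` E))) /\
  forall h : R * R -> \bar R, measurable_fun [set: (R * R)%type] h -> (forall w, (0 <= h w)%E) ->
    (\int[mu]_w h w <= \int[unif]_t h (f t))%E.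
Proof.
exists (mrestr (distribution unif F) mE); split=> // h mh h0.
apply: (@le_trans _ _ (\int[distribution unif F]_w h w)%E).
  apply: le_measure_integral => [A mA|]; last exact: h0.
  by apply: le_measure; [apply/mem_set; exact: measurableI|exact/mem_set|exact: subIsetl].
by rewrite ge0_integral_pushforward.
Qed.

End Pushforward.

(** Such a set is the product of its first projection, compact and hence closed in the line, with
    [[set 0]]. *)
Lemma measurable_real_compact (E : set (R * R)) : compact E -> E `<=` [set z | z.2 = 0] ->
  measurable E.
Proof.
move=> cE E0; have c1 : compact (fst @` E).
  apply: continuous_compact => //; apply: continuous_subspaceT => z; exact: cvg_fst.
have m1 : measurable (fst @` E : set R).
  by apply: closed_measurable; apply: compact_closed.
have -> : E = (fun w : (R * R)%type => w.1) @^-1` (fst @` E) `&` (fun w : (R * R)%type => w.2) @^-1` [set 0].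
  apply/seteqP; split => [w Ew|w [[w' Ew' e1] /= e2]]; first by split; [exists w|exact: E0].
  by rewrite (_ : w = w') // [LHS]surjective_pairing [RHS]surjective_pairing e1 e2 (E0 _ Ew').
apply: measurableI; rewrite -[X in measurable X]setTI.
  exact: measurable_fst.
by apply: measurable_snd.
Qed.

(** The equilibrium measure restricted to [E] has potentials bounded by those of the whole measure.
    If it had positive mass, its energy would exceed [-oo], against polarity. *)
Lemma polar_unif0 g (x : R -> R) (N E : set (R * R)) : quarter g -> fincap g ->
  measurable_fun [set: R] x ->
  (forall n t (tau : R), `|tau| <= 1 -> `|x t - pt g tau (dig n 0 1 t)| <= pi / n.+1%:R) ->
  polar N -> compact E -> E `<=` [set z | z.2 = 0] -> E `<=` N ->
  unif [set t | E (x t, 0)] = 0%E.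
Proof.
move=> qg fc mx Hx pN cE E0 EN.
have mE := measurable_real_compact cE E0.
have mf : measurable_fun [set: R] (fun t => (x t, 0) : R * R).
  by apply: measurable_fun_pair => //; exact: measurable_cst.
have [mu [muE muI]] := pushforward_restriction mf mE.
apply/eqP/negPn/negP => U0.
have C0 : 0 <= ln 4 + capoo g by rewrite addr_ge0 ?ln_ge0 ?ler1n ?capoo_ge0.
have HC z : (\int[mu]_w logneg z w <= (ln 4 + capoo g)%:E)%E.
  apply: le_trans (potential_bound z qg fc Hx).
  apply: muI => [|w]; first exact: (measurable_funeneg (measurable_lne_cmod z)).
  exact: funeneg_ge0.
have /eqP := log_energy_neq C0 HC; apply; apply: pN.
- by rewrite muE setTI.
- by exists E; split=> //; rewrite muE setICl preimage_set0 measure0.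
Qed.

Lemma Kset_nonpolar g : quarter g -> fincap g -> ~ polar (Kset g).
Proof.
move=> qg fc pK; have [x [mx Hx xK]] := cantor_param qg.
have := polar_unif0 qg fc mx Hx pK (@Kset_compact R g) (fun z Kz => (Kset_real Kz).1) (fun z Kz => Kz).
have -> : [set t | Kset g (x t, 0)] = setT by apply/seteqP; split=> t // _; exact: xK.
by rewrite probability_setT => /eqP; rewrite onee_eq0.
Qed.

Definition meets g (E : set (R * R)) n : pred (seq bool) :=
  fun s => `[< exists2 z, E z & itinerary g n z = s >].

(** The sets of [t] whose first [n] digits are the word of some point of [E] decrease, and by
    closedness of [E] their intersection lies in the null set where [x t] is in [E]. Continuity from
    above concludes. *)
Lemma polar_words g (N E : set (R * R)) (d : R) : quarter g -> fincap g ->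
  polar N -> compact E -> E `<=` Kset g -> E `<=` N -> 0 < d ->
  exists n0, forall n, (n0 <= n)%N -> avg n (fun s => (meets g E n s)%:R) <= d.
Proof.
move=> qg fc pN cE EK EN d0; have [x [mx Hx xK]] := cantor_param qg.
have U0 := polar_unif0 qg fc mx Hx pN cE (fun z Ez => (Kset_real (EK z Ez)).1) EN.
pose D n : set R := [set t | meets g E n (dig n 0 1 t)].
have mD n : measurable (D n).
  rewrite -[X in measurable X]setTI.
  by apply: (@measurable_dig _ _ bool n 0 1 (meets g E n) _ [set true]).
have cD : \bigcap_n D n `<=` [set t | E (x t, 0)].
  move=> t Dt; have clE : closed E by exact: compact_closed.
  apply: clE => B /nbhs_ballP[e /= e0 HB].
  have [n hn] := small_inv pi (divr_gt0 e0 (ltr0Sn R 1)).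
  have /asboolP[z Ez zt] := Dt n I; exists z; split=> //.
  apply: HB; apply/plane_ballP; rewrite /= (Kset_real (EK z Ez)).1 subrr normr0; split=> //.
  have Kz := EK z Ez; have /ell_le1P[_ p1] := Kz n.
  rewrite (Kset_itinerary n qg Kz) /= zt.
  by apply: le_lt_trans (Hx n t _ p1) _; apply: le_lt_trans hn _; lra.
have D0 : unif (\bigcap_n D n) = 0%E.
  apply/eqP; rewrite eq_le measure_ge0 andbT -U0; apply: le_measure => //; rewrite inE.
    exact: bigcapT_measurable.
  have mE := measurable_real_compact cE (fun z Ez => (Kset_real (EK z Ez)).1).
  have mf : measurable_fun [set: R] (fun t => (x t, 0) : R * R).
    by apply: measurable_fun_pair => //; exact: measurable_cst.
  rewrite -[X in measurable X]setTI; exact: mf.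
have nD : nonincreasing_seq D.
  apply/nonincreasing_seqP => n; apply/subsetPset => t /asboolP[z Ez zt]; apply/asboolP; exists z => //.
  have [s hs] := dig_prefix n 1 0 1 t; move: zt; rewrite itinerary_rcons -addn1 hs -cats1 => /eqP.
  by rewrite eqseq_cat ?size_itinerary ?size_dig // => /andP[/eqP].
have Doo : (unif (D 0%N) < +oo)%E.
  by apply: le_lt_trans (ltry 1); apply: probability_le1; exact: mD.
have : (unif \o D) k @[k --> \oo] --> (0%E : \bar R).
  by rewrite -D0; exact: (nonincreasing_cvg_mu Doo mD (bigcapT_measurable mD) nD).
move=> /fine_cvgP[_ /cvgrPdist_le/(_ d d0)[n0 _ Hn0]].
exists n0 => n /Hn0 /=; rewrite sub0r normrN unif_dig /= => h.
by apply: le_trans (ler_norm _) h.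
Qed.

Theorem green_unique g (G : R * R -> R) (N : set (R * R)) (r M : R) : quarter g -> fincap g ->
  harmonic_on (~` Kset g) G ->
  (forall r : R, exists M : R, forall z, ~ Kset g z -> cmod z <= r -> `|G z| <= M) ->
  (forall z, ~ Kset g z -> r < cmod z -> `|G z - ln (cmod z)| <= M) ->
  polar N ->
  (forall zeta, Kset g zeta -> ~ N zeta -> forall e : R, 0 < e ->
     \forall z \near zeta, ~ Kset g z -> `|G z| <= e) ->
  forall z, ~ Kset g z -> G z = green g z.
Proof.
move=> qg fc hG locG infG pN bG z0 Kz0; have oK := @open_Kset R g.
have hg := harmonic_green qg fc.
pose h z := G z - green g z.
have hh : harmonic_on (~` Kset g) h := harmonicB oK hG hg.
have [M1 HM1] := locG (Num.max r 1).
pose C := ln 2 + ln 2 + capoo g.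
have l2 : 0 < ln 2 :> R by rewrite ln_gt0 // ltr1n.
have S0 := capoo_ge0 qg fc.
pose M0 : R := `|M1| + `|M| + C + ln 2 + ln (Num.max r 1 + 1).
have rm : 1 <= Num.max r 1 by rewrite le_max lexx orbT.
have lr : 0 <= ln (Num.max r 1 + 1) by rewrite ln_ge0 //; lra.
have M00 : 0 <= M0 by rewrite /M0 /C; have := normr_ge0 M1; have := normr_ge0 M; lra.
have hM z : ~ Kset g z -> `|h z| <= M0.
  move=> Kz; have [zr|zr] := leP (cmod z) (Num.max r 1).
    have h1 := HM1 z Kz zr; have h2 := green_ge0 z qg fc; have h3 := green_le_ln z qg fc.
    have h4 : ln (cmod z + 1) <= ln (Num.max r 1 + 1).
      by rewrite ler_ln ?posrE; have := cmod_ge0 z; lra.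
    apply: le_trans (ler_normB _ _) _; rewrite (ger0_norm h2).
    by have := ler_norm M1; have := normr_ge0 M; rewrite /M0 /C; lra.
  move: (zr); rewrite gt_max => /andP[z1 z2].
  have h1 := infG z Kz z1; have z00 : z != 0 by rewrite -cmod_gt0; lra.
  have h2 := green_ge_ln qg fc z00; have h3 := green_le_ln z qg fc.
  have h4 : ln (cmod z + 1) <= ln 2 + ln (cmod z).
    by rewrite -lnM ?posrE //; [rewrite ler_ln ?posrE; lra|lra].
  have -> : h z = (G z - ln (cmod z)) - (green g z - ln (cmod z)) by rewrite /h; ring.
  apply: le_trans (ler_normB _ _) _; rewrite [X in _ + X]ger0_norm; last by lra.
  by have := ler_norm M; have := normr_ge0 M1; rewrite /M0 /C; lra.
suff key (e : R) : 0 < e -> `|h z0| <= e + e.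
  apply/eqP; rewrite -subr_eq0 -normr_le0 -/(h z0).
  by apply: (@ler_gt0_lim R _ 0 2) => e /key; lra.
(* The points of K near which [|h| <= e] fails. What is removed from K is open, being an interior,
   and [E] lies in [N]: it is a compact set to which [polar_words] applies. *)
move=> e0; pose E : set (R * R) := Kset g `\` [set zeta | \forall z \near zeta, ~ Kset g z -> `|h z| <= e].
have cE : compact E.
  apply: (subclosed_compact _ (@Kset_compact R g)) => [|z []//].
  rewrite /E setDE; apply: closedI; first exact: Kset_closed.
  apply: open_closedC; exact: (@open_interior _ [set z | ~ Kset g z -> `|h z| <= e]).
have EK : E `<=` Kset g by move=> z [].
have EN : E `<=` N.
  move=> zeta [Kz nE]; apply: contrapT => nN; apply: nE.
  have e2 : 0 < e / 2 by rewrite divr_gt0.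
  apply: filterS2 (bG zeta Kz nN _ e2) (green_near_Kset qg fc Kz e2) => z h1 h2 nK.
  by apply: le_trans (ler_normB _ _) _; rewrite [e]splitr lerD // h1.
have e1 : 0 < e / (M0 + 1) by rewrite divr_gt0 //; lra.
(* [m] and [d] depend on [z0] and [e] only, so the word length [m + n0] can still be raised until
   few words meet [E]. *)
have [m [d [d0 small]]] := wsol_small qg fc Kz0 e1.
have [n0 Hn0] := polar_words qg fc pN cE EK EN d0.
pose chi s : R := (meets g E (m + n0) s)%:R.
have c01 s : 0 <= chi s <= 1 by rewrite /chi; case: (meets _ _ _ _); rewrite /= ?lexx ler01.
have [b bs] := wsol_ex (m + n0) chi qg fc.
have bz := small n0 chi b c01 bs (Hn0 _ (leq_addl _ _)).
have b01 z : ~ Kset g z -> 0 <= b z <= 1 by exact: (dsol_range qg fc bs (fun zeta _ => c01 _)).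
have [hb _ bb] := bs.
have side (sg : R) : sg ^+ 2 = 1 -> sg * h z0 <= e + M0 * b z0.
  move=> sg2; have sg1 : `|sg| = 1.
    by apply/eqP; rewrite -sqrp_eq1 // real_normK ?num_real // sg2.
  have hs := harmonicB oK (harmonicZ sg oK hh) (harmonicZ M0 oK hb).
  rewrite -lerBlDr; apply: (@green_max R g (fun z => sg * h z - M0 * b z) M0 e qg fc hs) => //.
    move=> z Kz; have /andP[b0 _] := b01 z Kz; have := hM z Kz.
    have := ler_norm (sg * h z); rewrite normrM sg1 mul1r.
    have := mulr_ge0 M00 b0; lra.
  move=> zeta Kz e' e'0.
  have [Ez|nE] := pselect (E zeta).
    have e2 : 0 < e' / (M0 + 1) by rewrite divr_gt0 //; lra.
    apply: filterS (bb zeta Kz _ e2) => z hz nK.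
    have := hz nK; have -> : chi (itinerary g (m + n0) zeta) = 1.
      by rewrite /chi (_ : meets _ _ _ _) //; apply/asboolP; exists zeta.
    rewrite ler_distl => /andP[h1 _].
    have h2 : M0 * (1 - e' / (M0 + 1)) <= M0 * b z by apply: ler_wpM2l.
    have h3 : M0 * (e' / (M0 + 1)) <= e'.
      by rewrite mulrA ler_pdivrMr; [nra|lra].
    have := hM z nK; have := ler_norm (sg * h z); rewrite normrM sg1 mul1r; lra.
  have nr : \forall z \near zeta, ~ Kset g z -> `|h z| <= e.
    by apply: contrapT => nn; apply: nE.
  apply: filterS nr => z hz nK; have := hz nK; have /andP[b0 _] := b01 z nK.
  have := ler_norm (sg * h z); rewrite normrM sg1 mul1r.
  have := mulr_ge0 M00 b0; lra.
have fin : M0 * b z0 <= e.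
  apply: le_trans (ler_wpM2l M00 bz) _; rewrite mulrA ler_pdivrMr; [nra|lra].
have := side 1 (expr1n _ _); have := side (-1) (ltac:(by rewrite sqrrN expr1n)).
by rewrite ler_norml => h1 h2; apply/andP; split; lra.
Qed.

End EquilibriumMeasure.

(** * The case of infinite S *)

Section InfiniteCapacity.
Context {R : realType}.
Implicit Types (g : nat -> R) (z w : R * R) (n m k : nat).

Lemma cap_unbounded g (A : R) : ~ fincap g -> exists n, A < cap g n.
Proof.
move=> nf; apply: contrapT => /forallNP H; apply: nf; exists A => n.
by rewrite leNgt; apply/negP => h; exact: (H n).
Qed.

Lemma dist_Kset_pos g z : quarter g -> ~ Kset g z ->
  exists2 d : R, 0 < d & forall w, Kset g w -> d <= cmod (z.1 - w.1, z.2 - w.2).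
Proof.
move=> qg Kz; have /nbhs_ballP[d /= d0 Hd] : nbhs z (~` Kset g).
  by apply: open_nbhs_nbhs; split=> //; exact: open_Kset.
exists d => // w Kw; rewrite leNgt; apply/negP => h; apply: (Hd w) => //.
have le (a b : R) : `|a| <= cmod (a, b) /\ `|b| <= cmod (a, b).
  by rewrite /cmod /= -!sqrtr_sqr; split; apply: ler_wsqrtr; rewrite ?lerDl ?lerDr sqr_ge0.
by have [h1 h2] := le (z.1 - w.1) (z.2 - w.2); apply/plane_ballP; split; lra.
Qed.

Lemma logPhi_le g n z : quarter g -> 2 <= cmod (Phi g n z) ->
  logPhi g n z <= ln (cmod z + 1) + cap g n.
Proof.
move=> qg P2; have P0 : Phi g n z != 0 by rewrite -cmod_gt0; lra.
have e1 := ell_ge1 (Phi g n z); have e2 := ell_ge_cmod (Phi g n z).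
rewrite /logPhi -cmod_eq_ln //.
have h1 : 2 ^- n * ln (cmod (Phi g n z)) <= 2 ^- n * ln (ell (Phi g n z)).
  by rewrite ler_pM2l ?pow2_gt0 // ler_ln ?posrE //; lra.
have := @ln_ell_step R g 0 n z qg (leq0n n); rewrite /= expr0 invr1 mul1r subr0.
have h2 : ln (ell z) <= ln (cmod z + 1).
  have := ell_le_cmod z; have := ell_ge1 z; have := cmod_ge0 z => h3 h4 h5.
  by rewrite ler_ln ?posrE //; lra.
lra.
Qed.

(** The zeros of [F_n - 1] lie in K, at distance at least [d] from [z], so [avg_ln_pt] bounds
    [ln |F_n z - 1|] from below. [ln 2] pays for the passage to [ln |F_n z|]. *)
Lemma logPhi_ge g n z (d : R) : quarter g -> 0 < d -> 2 <= cmod (Phi g n z) ->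
  (forall w, Kset g w -> d <= cmod (z.1 - w.1, z.2 - w.2)) ->
  ln d - ln 2 + cap g n <= logPhi g n z.
Proof.
move=> qg d0 P2 Hd; have P0 : Phi g n z != 0 by rewrite -cmod_gt0; lra.
have n1 : `|1 : R| <= 1 by rewrite normr1.
have Pn : Phi g n z <> (1, 0).
  by move=> E; move: P2; rewrite E /cmod /= expr1n expr0n addr0 sqrtr1 lern1.
have E := avg_ln_pt qg n1 Pn.
have : ln d <= avg n (fun s => ln (cmod (z.1 - pt g 1 s, z.2))).
  rewrite -[X in X <= _](avg_cst n); apply: avg_le => s sn.
  have := Hd _ (Kset_pt1 s qg); rewrite /= subr0 => h.
  by rewrite ler_ln ?posrE //; exact: lt_le_trans h.
rewrite E /logPhi -cmod_eq_ln // => h.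
have t1 := cmod_real_shift_le (Phi g n z) (@ler01 R).
have t2 := cmod_real_shift (Phi g n z) (@ler01 R).
have : ln (cmod ((Phi g n z).1 - 1, (Phi g n z).2)) <= ln 2 + ln (cmod (Phi g n z)).
  by rewrite -lnM ?posrE //; [rewrite ler_ln ?posrE|]; lra.
have l2 : 0 < ln 2 :> R by rewrite ln_gt0 // ltr1n.
move/(ler_wpM2l (ltW (pow2_gt0 n))); rewrite mulrDr.
have a2 : 2 ^- n * ln 2 <= ln 2 :> R by rewrite ger_pMl //; exact: pow2_le1.
lra.
Qed.

(** The barrier is [A / Q] times [cap g n + c - logPhi], on the region [|z| < rho], [|F_n| > 2].
    Where [|F_n| = 2] the second factor is at least [Q], so the barrier is at least [A] and absorbs
    the bound on [h] near K; on [|z| = rho] it is nonnegative. At [z0] the second factor stays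
    bounded in [n] by [logPhi_ge], while [Q] tends to infinity with [cap g n]. *)
Lemma infinite_capacity_le g (h : R * R -> R) (L : R) : quarter g -> ~ fincap g ->
  harmonic_on (~` Kset g) h ->
  (forall rho : R, exists M : R, forall z, ~ Kset g z -> cmod z <= rho -> h z <= M) ->
  (forall e : R, 0 < e -> exists rho : R, forall z, rho <= cmod z -> h z <= L + e) ->
  forall z, ~ Kset g z -> h z <= L.
Proof.
move=> qg nf hh hM hL z0 Kz0; have oK := @open_Kset R g.
apply/ler_addgt0Pr => e e0.
have e2 : 0 < e / 2 by rewrite divr_gt0.
have [rho0 Hrho0] := hL _ e2.
pose rho : R := Num.max rho0 (cmod z0 + 1).
have rho1 : rho0 <= rho by rewrite le_max lexx.
have rho2 : cmod z0 + 1 <= rho by rewrite le_max lexx orbT.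
have c0 := cmod_ge0 z0.
have [M HM] := hM rho.
pose A : R := `|M| + `|L|.
have A0 : 0 <= A by rewrite addr_ge0.
have [d d0 Hd] := dist_Kset_pos qg Kz0.
have [N HN] := ell_escape 3 qg Kz0.
pose c : R := ln (rho + 1).
have cc : 0 <= c by rewrite ln_ge0 //; lra.
have l2 : 0 < ln 2 :> R by rewrite ln_gt0 // ltr1n.
(* Makes [Q] positive and at least [2 A |ln 2 - ln d + c| / e], so that the barrier costs at most
   [e / 2] at [z0]. *)
pose B : R := 2 * A * `|ln 2 - ln d + c| / e + ln 2 + 1.
have [n1 Hn1] := cap_unbounded B nf.
pose n := maxn N n1.
have Hn : B < cap g n by apply: lt_le_trans Hn1 (cap_mono qg (leq_maxr _ _)).
have AB : 0 <= 2 * A * `|ln 2 - ln d + c| / e.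
  by rewrite divr_ge0 ?mulr_ge0 // ltW.
pose Q := cap g n - ln 2 + c.
have Q0 : 0 < Q by rewrite /Q; rewrite /B in Hn; lra.
have Pz0 : 2 < cmod (Phi g n z0).
  have := ell_nondecreasing z0 qg (leq_maxl N n1); have := ell_le_cmod (Phi g n z0).
  rewrite -/n; lra.
pose v z := h z - (L + e / 2 + A * (cap g n + c) / Q) + A / Q * logPhi g n z.
have KP z : 1 < ell (Phi g n z) -> ~ Kset g z.
  by move=> h1 /(_ n); rewrite leNgt h1.
have e2K z : 2 <= cmod (Phi g n z) -> 1 < ell (Phi g n z).
  by have := ell_ge_cmod (Phi g n z); lra.
have cP z : cont_at (fun z => cmod (Phi g n z)) z.
  by apply: (@continuous_comp _ _ _ (Phi g n) (@cmod R)); [exact: Phi_continuous|exact: cmod_cont].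
pose U := [set z | cmod z < rho] `&` [set z | 2 < cmod (Phi g n z)].
pose C := [set z | cmod z <= rho] `&` [set z | - cmod (Phi g n z) <= -2].
have oU : open U.
  by apply: openI; [apply: open_lt_cont => z; exact: cmod_cont|exact: gt_open].
have clC : closed C.
  apply: closedI; first by apply: closed_le_cont => z; exact: cmod_cont.
  by apply: closed_le_cont => z; apply: cont_atN; exact: cP.
have hlog := harmonic_logPhi g n.
have oE : open [set z | 1 < ell (Phi g n z)] by apply: gt_open => z; exact: ell_Phi_cont.
have hv : harmonic_on [set z | 1 < ell (Phi g n z)] v.
  apply: (harmonicD oE (harmonicB oE (harmonic_sub KP hh) (harmonic_cst _ oE)) (harmonicZ _ oE hlog)).
have UC : U `<=` C by move=> z [/= h1 h2]; split => /=; lra.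
have CE z : C z -> 1 < ell (Phi g n z) by move=> [_ /= hC]; apply: e2K; lra.
have UE : U `<=` [set z | 1 < ell (Phi g n z)] by move=> z /UC /CE.
have Uz0 : U z0 by split => //=; lra.
have vle : v z0 <= 0.
  apply: (@max_principle_bounded R U C v 0 oU clC UC) => //.
  - exists (rho ^+ 2) => z [/= zr _]; rewrite -cmod_sqr; have := cmod_ge0 z; nra.
  - by move=> z /CE Ez; exact: harmonic_continuous oE Ez hv.
  - by apply: (harmonic_vsub oU); exact: harmonic_sub UE hv.
  - move=> z Cz nU; have [/= zr zP] := Cz.
    have P2 : 2 <= cmod (Phi g n z) by lra.
    have Kz := KP z (e2K z P2).
    have VE : v z = h z - (L + e / 2) - A / Q * (cap g n + c - logPhi g n z) by rewrite /v; field; lra.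
    have aq : 0 <= A / Q by rewrite divr_ge0 // ltW.
    have [rz|rz] := ltP (cmod z) rho.
      have P22 : cmod (Phi g n z) = 2.
        apply/eqP; rewrite eq_le P2 andbT leNgt; apply/negP => h2.
        by apply: nU.
      have P0 : Phi g n z != 0 by rewrite -cmod_gt0 P22.
      have lE : logPhi g n z <= ln 2.
        by rewrite /logPhi -cmod_eq_ln // P22 ger_pMl //; exact: pow2_le1.
      have h1 : h z <= M := HM z Kz zr.
      have h2 : A / Q * Q <= A / Q * (cap g n + c - logPhi g n z).
        by apply: ler_wpM2l => //; rewrite /Q; lra.
      rewrite divfK ?lt0r_neq0 // in h2.
      have := ler_norm M; have := ler_norm (- L); rewrite normrN VE /A in h2 *; lra.
    have h1 := Hrho0 z (le_trans rho1 rz).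
    have h3 := logPhi_le qg P2.
    have h4 : ln (cmod z + 1) <= c by rewrite /c ler_ln ?posrE; have := cmod_ge0 z; lra.
    have h5 : 0 <= A / Q * (cap g n + c - logPhi g n z) by rewrite mulr_ge0 //; lra.
    rewrite VE; lra.
have VE0 : v z0 = h z0 - (L + e / 2) - A / Q * (cap g n + c - logPhi g n z0) by rewrite /v; field; lra.
have lo := logPhi_ge qg d0 (ltW Pz0) Hd.
have aq : 0 <= A / Q by rewrite divr_ge0 // ltW.
have q1 : A / Q * (cap g n + c - logPhi g n z0) <= A / Q * `|ln 2 - ln d + c|.
  by apply: ler_wpM2l => //; have := ler_norm (ln 2 - ln d + c); lra.
have q2 : A / Q * `|ln 2 - ln d + c| <= e / 2.
  rewrite mulrAC ler_pdivrMr //.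
  have : 2 * A * `|ln 2 - ln d + c| / e <= Q by rewrite /Q; rewrite /B in Hn; lra.
  rewrite ler_pdivrMr //; lra.
rewrite VE0 in vle; lra.
Qed.

Lemma infinite_capacity_constant g (h : R * R -> R) (L : R) : quarter g -> ~ fincap g ->
  harmonic_on (~` Kset g) h ->
  (forall rho : R, exists M : R, forall z, ~ Kset g z -> cmod z <= rho -> `|h z| <= M) ->
  (forall e : R, 0 < e -> exists rho : R, forall z, rho <= cmod z -> `|h z - L| <= e) ->
  forall z, ~ Kset g z -> h z = L.
Proof.
move=> qg nf hh hM hL z Kz; have oK := @open_Kset R g; apply/eqP; rewrite eq_le; apply/andP; split.
  apply: (infinite_capacity_le qg nf hh _ _ Kz).
    move=> rho; have [M HM] := hM rho; exists M => y Ky yr.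
    exact: le_trans (ler_norm _) (HM y Ky yr).
  move=> e e0; have [rho H] := hL e e0; exists rho => y /H; rewrite ler_distl; lra.
rewrite -lerN2; apply: (infinite_capacity_le qg nf (harmonicN oK hh) _ _ Kz).
  move=> rho; have [M HM] := hM rho; exists M => y Ky yr.
  by apply: le_trans (HM y Ky yr); rewrite -normrN; exact: ler_norm.
by move=> e e0; have [rho H] := hL e e0; exists rho => y /H; rewrite ler_distl; lra.
Qed.

End InfiniteCapacity.

(** * The Riemann sphere and regularity *)

Section Sphere.
Context {R : realType}.
Implicit Types (g : nat -> R) (z w zeta : R * R).

Lemma ofC_invC z : ofC (toC z)^-1 = cinv z.
Proof.
by rewrite /ofC /toC /cinv /nrm2 /= mulNr.
Qed.

Lemma chartoo0 : chartoo (0 : R * R) = None.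
Proof. by rewrite /chartoo eqxx. Qed.

Lemma chartooE z : z != 0 -> chartoo z = Some (cinv z).
Proof. by move=> z0; rewrite /chartoo (negbTE z0) ofC_invC. Qed.

Lemma nbhs_Some z (P : sphere R -> Prop) :
  (\forall w \near (Some z : sphere R), P w) <-> \forall w \near z, P (Some w).
Proof. by []. Qed.

Lemma nbhs_None (P : sphere R -> Prop) :
  (\forall w \near (None : sphere R), P w) -> P None /\ exists r : R, forall z, r < nrm2 z -> P (Some z).
Proof.
move=> [C [cC _] CP]; split; first by apply: CP; right.
have [r Hr] : exists r : R, forall z, C z -> nrm2 z <= r.
  have [->|/set0P C0] := eqVneq C set0; first by exists 0.
  have cn : {within C, continuous (@nrm2 R)}.
    by apply: continuous_in_subspaceT => z _; exact: nrm2_cont.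
  have [c _ Hc] := @compact_EVT_max _ R (@nrm2 R) C C0 cC cn.
  by exists (nrm2 c) => z Cz; apply: Hc; exact/mem_set.
exists r => z rz; apply: CP; left; exists z => // Cz.
by move: (Hr z Cz); rewrite leNgt rz.
Qed.

Lemma nbhs_None_of (P : sphere R -> Prop) (r : R) : P None -> (forall z, r < nrm2 z -> P (Some z)) ->
  \forall w \near (None : sphere R), P w.
Proof.
move=> P0 Pr; exists [set z | nrm2 z <= r]; first split.
- apply: (subclosed_compact _ (@compact_square R (`|r| + 1))).
    by apply: closed_le_cont => z; exact: nrm2_cont.
  move=> z /= zr; have := ler_norm r; have := normr_ge0 r; rewrite /nrm2 in zr.
  have := sqr_ge0 z.1; have := sqr_ge0 z.2 => h1 h2 h3 h4.
  by split; rewrite -ler_sqr ?nnegrE ?addr_ge0 // real_normK ?num_real //; nra.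
- by apply: closed_le_cont => z; exact: nrm2_cont.
- by move=> w [[z hz <-]|->] //; apply: Pr; move/negP: hz; rewrite -ltNge.
Qed.

(** K lies on the real axis, so from any point off K the vertical ray pointing away from the axis
    avoids K. Its closure is connected and contains infinity. *)
Lemma outer_domain_Kset g : quarter g -> outer_domain (Kset g) = ~` (@chart0 R @` Kset g).
Proof.
move=> qg; apply/seteqP; split; first exact: connected_component_sub.
have N0 : (~` (@chart0 R @` Kset g)) None by move=> [z _].
case=> [z|_]; last exact: connected_component_refl.
move=> Kz; pose sg : R := if 0 <= z.2 then 1 else -1.
pose gam (t : R) : R * R := (z.1, z.2 + sg * t).
pose ray : set (sphere R) := (fun t => Some (gam t)) @` `[0, +oo[%classic.
have sg2 : sg * sg = 1 by rewrite /sg; case: ifP => _; rewrite ?mulrNN mulr1.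
have cg : continuous gam.
  move=> t; apply: cvg_plane; first exact: cvg_cst.
  by apply: cvgD; [exact: cvg_cst|apply: cvgM; [exact: cvg_cst|exact: cvg_id]].
have cr : connected ray.
  apply: connected_continuous_connected.
    by apply/connected_intervalP; exact: interval_is_interval.
  apply: continuous_subspaceT => t.
  exact: (continuous_comp (cg t) (one_point_compactification_some_continuous _)).
have clo : closure ray `<=` ~` (@chart0 R @` Kset g).
  move=> x cx [w Kw E]; move: cx; rewrite -E => cw.
  have w2 := (Kset_real Kw).1.
  have nz : w <> z by move=> wz; apply: Kz; exists z => //; rewrite -wz.
  (* The complement of the ray: horizontal distance to its line plus the depth on the wrong side of
     [z], a continuous quantity. *)
  have oV : open [set y : R * R | `|y.1 - z.1| + Num.max 0 (- (sg * (y.2 - z.2))) > 0].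
    apply: gt_open => y; apply: cont_atD.
      by apply: (@continuous_comp _ _ _ (fun y : R * R => y.1 - z.1) (fun x : R => `|x|)); [cont_step|exact: norm_continuous].
    apply: (@continuous_max _ _ (fun=> 0 : R) (fun y : R * R => - (sg * (y.2 - z.2))) y); first exact: cvg_cst.
    by cont_step.
  have Vw : [set y : R * R | `|y.1 - z.1| + Num.max 0 (- (sg * (y.2 - z.2))) > 0] w.
    rewrite /= w2 sub0r mulrN opprK.
    have [wz1|N] := eqVneq w.1 z.1; last first.
      by apply: ltr_wpDr; [rewrite le_max lexx|rewrite normr_gt0 subr_eq0].
    have z2 : z.2 != 0.
      by apply/eqP => z2; apply: nz; rewrite [LHS]surjective_pairing w2 wz1 -z2 -surjective_pairing.
    apply: ltr_wpDl => //; rewrite lt_max; apply/orP; right.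
    rewrite /sg; have [z20|z20] := leP 0 z.2; last by rewrite mulN1r oppr_gt0.
    by rewrite mul1r lt_neqAle eq_sym z2.
  have := cw (Some @` [set y : R * R | `|y.1 - z.1| + Num.max 0 (- (sg * (y.2 - z.2))) > 0]).
  have nV := open_nbhs_nbhs (conj oV Vw).
  move=> /(_ (one_point_compactification_some_nbhs _ _ nV)) [_ [[t t0 <-] [y Vy [yE]]]].
  move: Vy t0; rewrite yE /gam /= subrr normr0 add0r addrC addKr mulrA sg2 mul1r in_itv /= andbT => Vy t0.
  by move: Vy; rewrite lt_max ltxx /= oppr_gt0 ltNge t0.
have rN : closure ray None.
  move=> B /nbhs_None[_ [r Hr]].
  pose t : R := `|z.2| + `|r| + 1.
  exists (Some (gam t)); split.
    by exists t => //; rewrite /= in_itv /= andbT /t; have := normr_ge0 z.2; have := normr_ge0 r; lra.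
  apply: Hr; rewrite /nrm2 /gam /=.
  have : `|r| + 1 <= sg * (z.2 + sg * t).
    rewrite mulrDr mulrA sg2 mul1r /t.
    have : - `|z.2| <= sg * z.2.
      have : `|sg * z.2| = `|z.2| by rewrite normrM (_ : `|sg| = 1) ?mul1r // /sg; case: ifP; rewrite ?normrN normr1.
      by move=> E; have := ler_norm (- (sg * z.2)); rewrite normrN E; lra.
    lra.
  have : (sg * (z.2 + sg * t)) ^+ 2 = (z.2 + sg * t) ^+ 2 by rewrite exprMn expr2 sg2 mul1r.
  have := sqr_ge0 z.1; have := ler_norm r; have := normr_ge0 r; set q := sg * _; nra.
have rz : closure ray (Some z).
  apply: subset_closure; exists 0; first by rewrite /= in_itv /= lexx.
  by rewrite /gam mulr0 addr0 -surjective_pairing.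
exact: (connected_component_max rN clo (connected_closure cr)) rz.
Qed.

Lemma chart0_outer_domain g : quarter g -> @chart0 R @^-1` outer_domain (Kset g) = ~` Kset g.
Proof.
move=> qg; rewrite outer_domain_Kset //; apply/seteqP; split => z /= H.
  by move=> Kz; apply: H; exists z.
by move=> [w Kw [E]]; apply: H; rewrite -E.
Qed.

Lemma boundary_outer_domain g : quarter g -> boundary (outer_domain (Kset g)) = @chart0 R @` Kset g.
Proof.
move=> qg; rewrite outer_domain_Kset //.
have oD : open (~` (@chart0 R @` Kset g)).
  rewrite openE => -[z|] /= H.
    have Kz : ~ Kset g z by move=> Kz; apply: H; exists z.
    apply/nbhs_Some; apply: (open_nearW (@open_Kset R g) Kz) => w Kw [w' Kw' [E]].
    by apply: Kw; rewrite -E.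
  apply: (@nbhs_None_of _ 1) => // z z1 [w Kw [E]].
  by apply: (@Kset_nrm2 R g z z1); rewrite -E.
rewrite /boundary ((interior_id _).1 oD).
apply/seteqP; split => [x [_ /contrapT]//|_ [z Kz <-]]; split; last by move=> H; apply: H; exists z.
move=> B /nbhs_Some /nbhs_ballP[e /= e0 HB].
exists (Some (z.1, z.2 + e / 2)); split.
  move=> [w Kw [E]]; have := (Kset_real Kw).1; rewrite E /= (Kset_real Kz).1; lra.
apply: HB; apply/plane_ballP; rewrite /= subrr normr0; split => //.
rewrite opprD addrA subrr sub0r normrN ger0_norm; lra.
Qed.

End Sphere.

(** * Regularity is equivalent to finiteness of S *)

Section Regularity.
Context {R : realType}.
Implicit Types (g : nat -> R) (z w zeta : R * R).

Lemma harmonic_union (U V : set (R * R)) (h : R * R -> R) :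
  harmonic_on U h -> harmonic_on V h -> harmonic_on (U `|` V) h.
Proof.
move=> [[a b c] d] [[a' b' c'] d']; split; last by move=> z [/d|/d'].
by split => z [] Uz; [exact: a|exact: a'|exact: b|exact: b'|exact: c|exact: c'].
Qed.

Lemma cinv_continuous z : z != 0 -> {for z, continuous (@cinv R)}.
Proof.
move=> z0; have n0 : nrm2 z != 0 by rewrite nrm2_eq0.
have cn : cont_at (@nrm2 R) z := @nrm2_cont R z.
have c1 : cont_at (fun w => w.1 * (nrm2 w)^-1) z by cont_step.
have c2 : cont_at (fun w => - w.2 * (nrm2 w)^-1) z by cont_step.
by apply: cvg_plane; [exact: c1|exact: c2].
Qed.

Lemma cmod_cinv z : cmod (cinv z) = (cmod z)^-1.
Proof. by rewrite /cmod -!/(nrm2 _) nrm2_cinv sqrtrV // nrm2_ge0. Qed.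

Lemma outer_domain_None g : quarter g -> outer_domain (Kset g) None.
Proof. by move=> qg; rewrite outer_domain_Kset // => -[z _]. Qed.

Lemma outer_domain_Some g z : quarter g -> outer_domain (Kset g) (Some z) <-> ~ Kset g z.
Proof.
move=> qg; have E := chart0_outer_domain qg.
by rewrite -[outer_domain _ _]/((@chart0 R @^-1` outer_domain (Kset g)) z) E.
Qed.

(** The value at infinity is that of the removable extension. In the chart at infinity the domain is
    covered by a disc about 0, where that extension is used, and the punctured part, where the
    function is [u] composed with inversion. *)
Lemma sphere_harmonic_bounded g u (M : R) : quarter g ->
  harmonic_on (~` Kset g) u -> (forall z, ~ Kset g z -> `|u z| <= M) ->
  exists2 H : sphere R -> R, sphere_harmonic_on (outer_domain (Kset g)) H &
    forall z, H (Some z) = u z.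
Proof.
move=> qg hu uM.
have [v [hv vu _ _]] := limit_at_infinity (harmonic_sub (@Kset_nrm2 R g) hu)
  (fun y y1 => uM y (@Kset_nrm2 R g y y1)).
pose H (x : sphere R) : R := if x is Some z then u z else v 0.
exists H => //; split; first by rewrite chart0_outer_domain //; exact: hu.
pose A : set (R * R) := [set z | nrm2 z < (1 / 2) ^+ 2].
pose B : set (R * R) := [set z | z != 0 /\ ~ Kset g (cinv z)].
have oA : open A by apply: open_lt_cont => z; exact: nrm2_cont.
have oB : open B.
  rewrite openE => z [z0 Kz]; rewrite /interior.
  have n1 : \forall w \near z, w != 0.
    have z1 : 0 < nrm2 z by rewrite nrm2_gt0.
    by apply: (open_nearW (@open_outside R 0) z1) => w; rewrite /= nrm2_gt0.
  have n2 : \forall w \near z, ~ Kset g (cinv w).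
    exact: (cinv_continuous z0 (open_nbhs_nbhs (conj (@open_Kset R g) Kz))).
  by near=> w; split; near: w.
have hA : harmonic_on A (H \o @chartoo R).
  apply: (harmonic_ext oA _ hv) => z Az /=.
  have [->|z0] := eqVneq z 0; first by rewrite chartoo0.
  by rewrite chartooE //= vu.
have hB : harmonic_on B (H \o @chartoo R).
  have hi : harmonic_on B (fun z => u (cinv z)).
    apply: (harmonic_inversion oB (@open_Kset R g) hu); last by move=> z [].
    by move=> [/eqP].
  apply: (harmonic_ext oB _ hi) => z [z0 _] /=.
  by rewrite chartooE.
apply: harmonic_sub (harmonic_union hA hB) => z /= Dz.
have [->|z0] := eqVneq z 0; first by left; rewrite /A /= /nrm2 /= expr0n addr0 exprn_gt0 ?divr_gt0.
by right; split => //; apply/(outer_domain_Some _ qg); rewrite -chartooE.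
Unshelve. all: end_near. Qed.

Lemma sphere_harmonic_infinity g h : quarter g ->
  sphere_harmonic_on (outer_domain (Kset g)) h ->
  forall e : R, 0 < e -> exists rho : R, forall z, rho <= cmod z -> `|h (Some z) - h None| <= e.
Proof.
move=> qg [_ hoo] e e0; pose V : set (R * R) := [set z | nrm2 z < 1].
have oV : open V by apply: open_lt_cont => z; exact: nrm2_cont.
have V0 : V 0 by rewrite /V /= /nrm2 /= expr0n addr0.
have VD : V `<=` @chartoo R @^-1` outer_domain (Kset g).
  move=> z Vz /=; have [->|z0] := eqVneq z 0.
    by rewrite chartoo0; exact: outer_domain_None.
  rewrite chartooE //; apply/outer_domain_Some => //; apply: Kset_nrm2.
  by rewrite nrm2_cinv invf_gt1 // nrm2_gt0.
have := harmonic_continuous oV V0 (harmonic_sub VD hoo).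
move/cvgrPdist_le => /(_ e e0) /nbhs_ballP[d /= d0 Hd].
exists (d^-1 + 1) => z zd; have d1 : 0 < d^-1 by rewrite invr_gt0.
have z0 : z != 0 by rewrite -cmod_gt0; lra.
have : `|h (chartoo 0) - h (chartoo (cinv z))| <= e.
  apply: Hd; have : cmod (cinv z) < d by rewrite cmod_cinv invf_plt ?posrE //; lra.
  have := nrm2_ge0 (cinv z); rewrite /cmod => n0 cd.
  apply/plane_ballP; rewrite /= !sub0r !normrN -!sqrtr_sqr.
  by split; apply: le_lt_trans cd; apply: ler_wsqrtr; rewrite ?lerDl ?lerDr sqr_ge0.
by rewrite chartoo0 chartooE ?cinv_neq0 // cinvK distrC.
Qed.

Lemma boundary_limit g (h : sphere R -> R) (a : R) zeta : quarter g ->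
  (h x @[x --> within (outer_domain (Kset g)) (nbhs (Some zeta : sphere R))] --> a) <->
  (forall e : R, 0 < e -> \forall z \near zeta, ~ Kset g z -> `|h (Some z) - a| <= e).
Proof.
move=> qg; split.
  move/cvgrPdist_le => H e e0; have := H e e0; rewrite near_withinE => /nbhs_Some.
  by apply: filterS => z Hz Kz; rewrite distrC; apply: Hz; apply/outer_domain_Some.
move=> H; apply/cvgrPdist_le => e e0; rewrite near_withinE; apply/nbhs_Some.
by have := H e e0; apply: filterS => z Hz /(outer_domain_Some _ qg) /Hz; rewrite distrC.
Qed.

Lemma off_Kset_near g zeta (P : R * R -> Prop) : Kset g zeta ->
  (\forall z \near zeta, P z) -> exists2 z, ~ Kset g z & P z.
Proof.
move=> Kz /nbhs_ballP[e /= e0 HB]; exists (zeta.1, zeta.2 + e / 2).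
  by move=> /Kset_real[/= h _]; move: h; rewrite (Kset_real Kz).1; lra.
apply: HB; apply/plane_ballP; rewrite /= subrr normr0; split => //.
rewrite opprD addrA subrr sub0r normrN ger0_norm; lra.
Qed.

(** Near a point of K the boundary value bounds [u], near other points continuity does; compactness
    of a square makes the bound uniform. *)
Lemma bvals_bounded g phi u : harmonic_on (~` Kset g) u -> bvals g phi u ->
  forall rho : R, exists M : R, forall z, ~ Kset g z -> cmod z <= rho -> `|u z| <= M.
Proof.
move=> hu bu rho; have oK := @open_Kset R g.
pose P (M : R) z := ~ Kset g z -> `|u z| <= M.
have H z : [set z : R * R | `|z.1| <= rho /\ `|z.2| <= rho] z ->
    \forall z' \near z & M \near +oo, P M z'.
  move=> _; have [c Hc] : exists c : R, \forall w \near z, ~ Kset g w -> `|u w| <= c.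
    have [Kz|Kz] := pselect (Kset g z).
      exists (`|phi z| + 1); have := bu z Kz 1 ltr01; apply: filterS => w Hw /Hw.
      by have := ler_normD (u w - phi z) (phi z); rewrite subrK; lra.
    exists (`|u z| + 1); have : {for z, continuous u} := harmonic_continuous oK Kz hu.
    move/cvgrPdist_le => /(_ 1 ltr01); apply: filterS => w Hw _.
    by have := ler_normD (u w - u z) (u z); rewrite subrK distrC; lra.
  exists ([set w | ~ Kset g w -> `|u w| <= c], [set M | c < M]).
    by split => //; exact: nbhs_pinfty_gt (num_real c).
  by move=> [w M] [/= Hw cM] /Hw; lra.
have [M HM] := filter_ex ((compact_near_coveringP _).1 (@compact_square R rho) R +oo P _ H).
exists M => z Kz zr; apply: HM => //=.
by split; apply: le_trans zr; rewrite -sqrtr_sqr; apply: ler_wsqrtr; rewrite ?lerDl ?lerDr sqr_ge0.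
Qed.

(** The boundary data [Re z] take the values 1 and -1 on K, while for infinite S the solution would
    be constant. *)
Lemma regular_fincap g : quarter g -> dirichlet_regular (outer_domain (Kset g)) -> fincap g.
Proof.
move=> qg reg; apply: contrapT => nf.
pose phi (x : sphere R) : R := if x is Some z then z.1 else 0.
have cphi : {within boundary (outer_domain (Kset g)), continuous phi}.
  apply/subspace_continuousP => x; rewrite boundary_outer_domain // => -[z _ <-].
  apply: cvg_within_filter; apply/cvgrPdist_le => e e0; apply/nbhs_Some => /=.
  have c1 : {for z, continuous (fun w : R * R => w.1)} by cont_step.
  by move/cvgrPdist_le: c1 => /(_ e e0).
have [h hh bh] := reg phi cphi.
pose u z := h (Some z).
have hu : harmonic_on (~` Kset g) u by have := hh.1; rewrite chart0_outer_domain.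
have bu : bvals g (fun z => z.1) u.
  move=> zeta Kz; apply/(boundary_limit h _ _ qg); apply: (bh (Some zeta)).
  by rewrite boundary_outer_domain //; exists zeta.
have uL := infinite_capacity_constant qg nf hu (bvals_bounded hu bu) (sphere_harmonic_infinity qg hh).
have bd zeta : Kset g zeta -> `|h None - zeta.1| <= 1 / 2.
  move=> Kz; have e0 : 0 < 1 / 2 :> R by lra.
  by have [z Kz' /(_ Kz')] := off_Kset_near Kz (bu zeta Kz _ e0); rewrite uL.
have K1 := Kset_one qg; have := bd _ K1; have := bd _ (Kset_opp qg K1).
rewrite /= !ler_distl; lra.
Qed.

Lemma fincap_regular g : quarter g -> fincap g -> dirichlet_regular (outer_domain (Kset g)).
Proof.
move=> qg fc phi /subspace_continuousP; rewrite boundary_outer_domain // => cphi.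
have c1 : forall zeta, Kset g zeta -> forall e : R, 0 < e ->
    \forall z \near zeta, Kset g z -> `|phi (Some z) - phi (Some zeta)| <= e.
  move=> zeta Kz e e0.
  have /cvgrPdist_le/(_ e e0) : phi x @[x --> within (@chart0 R @` Kset g) (nbhs (Some zeta : sphere R))] --> phi (Some zeta).
    by apply: cphi; exists zeta.
  rewrite near_withinE => /nbhs_Some; apply: filterS => z Hz Kz'.
  by rewrite distrC; apply: Hz; exists z.
have [u [hu [C uC] bu]] := dirichlet_Kset qg fc c1.
have [H hH HE] := sphere_harmonic_bounded qg hu uC.
exists H => // x [zeta Kz <-]; apply/(boundary_limit _ _ _ qg) => e e0.
by have := bu zeta Kz e e0; apply: filterS => z Hz /Hz; rewrite HE.
Qed.

End Regularity.

(** * The set K_1(gamma) *)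

Section Green.
Context {R : realType}.
Implicit Types (g : nat -> R) (z w zeta : R * R).

Lemma polar0 : polar (set0 : set (R * R)).
Proof.
move=> mu /eqP mu0 [A [_ A0 muA]]; exfalso; apply: mu0.
by move: muA; rewrite (_ : A = set0) ?setC0 //; apply/seteqP; split.
Qed.

Lemma is_green_green g : quarter g -> fincap g -> is_green (Kset g) (green g).
Proof.
move=> qg fc; rewrite /is_green chart0_outer_domain //; split.
- exact: harmonic_green.
- move=> r; exists (ln 2 + ln (`|r| + 1) + capoo g) => z _ zr.
  rewrite ger0_norm ?green_ge0 //; apply: le_trans (green_le_ln z qg fc) _.
  have := cmod_ge0 z; have := ler_norm r => rr c0.
  by rewrite lerD2r lerD2l ler_ln ?posrE; lra.
- exists 1, (2 * ln 2 + capoo g) => z _ z1.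
  have z0 : z != 0 by rewrite -cmod_gt0; lra.
  have lo := green_ge_ln qg fc z0; have hi := green_le_ln z qg fc.
  have : ln (cmod z + 1) <= ln 2 + ln (cmod z).
    by rewrite -lnM ?posrE //; [rewrite ler_ln ?posrE|]; lra.
  have := capoo_ge0 qg fc; have l2 : 0 < ln 2 :> R by rewrite ln_gt0 // ltr1n.
  by move=> c0 h; rewrite ger0_norm; lra.
exists set0; split; [exact: measurable0|exact: polar0|].
move=> zeta; rewrite boundary_outer_domain // => -[w Kw [E]] _.
apply: cvg_within_filter; apply/cvgrPdist_le => e e0.
have := green_near_Kset qg fc Kw e0; rewrite E; apply: filterS => z.
by rewrite sub0r normrN.
Qed.

Lemma is_green_eq g G : quarter g -> fincap g -> is_green (Kset g) G ->
  forall z, ~ Kset g z -> G z = green g z.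
Proof.
move=> qg fc; rewrite /is_green chart0_outer_domain // => -[hG bG [r [M rM]] [N [_ pN bN]]].
apply: (green_unique qg fc hG bG rM pN) => zeta Kz Nz e e0.
have : G z @[z --> within (~` Kset g) (nbhs zeta)] --> (0 : R).
  by apply: bN => //; rewrite boundary_outer_domain //; exists zeta.
move/cvgrPdist_le => /(_ e e0); rewrite near_withinE; apply: filterS => z Hz Kz'.
by have := Hz Kz'; rewrite sub0r normrN.
Qed.

Lemma PW_Kset g G : quarter g -> fincap g -> is_green (Kset g) G ->
  (PW (Kset g) G = \sum_(k <oo) (green (sh k g) 0%R)%:E)%E.
Proof.
move=> qg fc /(is_green_eq qg fc) GE; rewrite -esum_critical_green // /PW chart0_outer_domain //.
have DE c v : ~ Kset g c -> 'D_v G c = 'D_v (green g) c.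
  move=> Kc; apply: near_eq_derive.
  by apply: (open_nearW (@open_Kset R g) Kc) => w; exact: GE.
have -> : critical_points (~` Kset g) G = [set c | ~ Kset g c /\ grad2 (green g) c = 0].
  apply/seteqP; split => c /=.
    by move=> [Kc dx dy]; split => //; apply/grad2_eq0; rewrite -!DE.
  by move=> [Kc /grad2_eq0[dx dy]]; split; rewrite ?DE.
by apply: eq_esum => c [Kc _]; rewrite GE.
Qed.

Lemma parreau_widom_Kset g : quarter g -> parreau_widom (Kset g) <-> sqrt_summable g.
Proof.
move=> qg; split.
  move=> [_ _ _ /(regular_fincap qg) fc [G GG]].
  by rewrite (PW_Kset qg fc GG) => /(PW_green_finite qg fc).
move=> sg; have fc := sqrt_summable_fincap qg sg; split.
- exact: Kset_compact.
- by move=> z /Kset_real[].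
- exact: Kset_nonpolar.
- exact: fincap_regular.
have gg := is_green_green qg fc.
by exists (green g) => //; rewrite (PW_Kset qg fc gg); apply/PW_green_finite.
Qed.

Lemma F_gammaE (gamma : nat -> R) n z :
  F_gamma gamma n (toC z) = toC (Phi (fun n => gamma n.+1) n z).
Proof.
elim: n => [//|n /= ->]; case: (Phi _ n z) => a b.
rewrite /f_gamma /toC /quad expr2; apply/eqP; rewrite eq_complex /=.
by rewrite div1r; apply/andP; split; apply/eqP; ring.
Qed.

Lemma K1E (gamma : nat -> R) : quarter (fun n => gamma n.+1) ->
  K1 gamma = Kset (fun n => gamma n.+1).
Proof.
move=> qg; have E n z : (exists2 t : R, -1 <= t <= 1 & F_gamma gamma n (toC z) = real_complex R t) <->
    ell (Phi (fun n => gamma n.+1) n z) <= 1.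
  rewrite F_gammaE ell_le1P; split.
    by move=> [t t1 [-> ->]]; rewrite ler_norml.
  move=> [z2 z1]; exists (Phi (fun n => gamma n.+1) n z).1; first by rewrite -ler_norml.
  by rewrite /toC z2.
apply/seteqP; split => z Kz n.
  (* The intersection defining [K1] starts at 1; the condition at [n] follows from the one at
     [n + 1] by monotonicity of [ell]. *)
  apply: le_trans (ell_nondecreasing z qg (leqnSn n)) _.
  by apply/E; exact: (Kz n.+1).
by move=> _; apply/E; exact: Kz.
Qed.

Lemma nneseries_lt_ooP (v : nat -> R) : (forall n, 0 <= v n) ->
  (\sum_(k <oo) (v k)%:E < +oo)%E <-> exists B : R, forall n, \sum_(k < n) v k <= B.
Proof.
move=> v0; have v0' k : (0 <= (v k)%:E)%E by rewrite lee_fin.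
split=> [S|[B HB]].
  exists (fine (\sum_(k <oo) (v k)%:E)%E) => n.
  rewrite -lee_fin fineK; last by rewrite ge0_fin_numE // nneseries_ge0.
  by have := @nneseries_lim_ge R (fun k => (v k)%:E) xpredT 0 n (fun k _ _ => v0' k); rewrite sumEFin big_mkord.
apply: (@le_lt_trans _ _ B%:E); last exact: ltry.
apply: lime_le; first by apply: is_cvg_nneseries => k _ _.
by apply: nearW => n; rewrite sumEFin big_mkord lee_fin.
Qed.

End Green.

Theorem theorem7p2 (R : realType) (gamma epsilon : nat -> R)
    (hgamma : forall n : nat, (1 <= n)%N -> 0 < gamma n < 1 / 4)
    (hepsilon : forall n : nat, (1 <= n)%N -> epsilon n = 1 / 4 - gamma n) :
  parreau_widom (K1 gamma) <->
  (\sum_(1 <= k <oo) (Num.sqrt (epsilon k))%:E < +oo)%E.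
Proof.
have qg : quarter (fun n => gamma n.+1) by move=> n; exact: hgamma.
rewrite K1E // parreau_widom_Kset // /sqrt_summable.
(* Passes from summation over [k >= 1] to the indexing from 0 of [sqrt_summable]. *)
rewrite -(@nneseries_addn R (fun k => (Num.sqrt (epsilon k))%:E) 1); last first.
  by move=> k; rewrite lee_fin sqrtr_ge0.
under eq_eseriesr do rewrite addn1 hepsilon //.
by rewrite nneseries_lt_ooP // => n; exact: sqrtr_ge0.
Qed.
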